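(* The Cartan projection $$\delta_{\mathbb{F}}:\mathcal{X}_{\mathbb{F}}\times\mathcal{X}_{\mathbb{F}}\to A^+_{\mathbb{F}},\qquad (x,y)\mapsto a,$$ where $x=g.\operatorname{Id}$, $y=h.\operatorname{Id}$ with $g,h\in G_{\mathbb{F}}$ and $a\in A_{\mathbb{F}}^+$ is the element with $g^{-1}h\in K_{\mathbb{F}}aK_{\mathbb{F}}$, is well-defined and invariant under the (diagonal) action of $G_{\mathbb{F}}$. For all $x,y\in\mathcal{X}_{\mathbb{F}}$, $\delta_{\mathbb{F}}(y,x)$ is in the Weyl group orbit of $\delta_{\mathbb{F}}(x,y)^{-1}$.
   Context: Let $\mathbb{K},\mathbb{F}$ be real closed fields with $\mathbb{K}\subseteq\mathbb{R}\cap\mathbb{F}$. For a semialgebraic set $V$ defined over $\mathbb{K}$, $V_{\mathbb{F}}$ denotes its $\mathbb{F}$-extension (the set defined over $\mathbb{F}$ by the same formula). $G<\operatorname{SL}_n$ is a connected semisimple algebraic group over $\mathbb{K}$, self-adjoint ($g\in G$ implies $g^{\mathsf T}\in G$). $S<G$ is a maximal $\mathbb{K}$-split torus with $s=s^{\mathsf T}$ for all $s\in S$; $A_{\mathbb{F}}$ is the $\mathbb{F}$-extension of the semialgebraic connected component of $S_{\mathbb{K}}$ containing $\operatorname{Id}$; $K_{\mathbb{F}}=G_{\mathbb{F}}\cap\operatorname{SO}_n(\mathbb{F})$. Let $\mathfrak{a}=\operatorname{Lie}(A_{\mathbb{R}})$; $\Sigma\subseteq\mathfrak{a}^\star$ is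 the root system of $\operatorname{Lie}(G_{\mathbb{R}})$ with respect to $\mathfrak{a}$. For $\alpha\in\Sigma$, $\chi_\alpha:A_{\mathbb{F}}\to\mathbb{F}_{>0}$ is the restriction of the algebraic character of $S$ over $\mathbb{K}$ which over $\mathbb{R}$ satisfies $\chi_\alpha(\exp H)=e^{\alpha(H)}$, $H\in\mathfrak{a}$. Fix a basis $\Delta$ of $\Sigma$ and let $A^+_{\mathbb{F}}=\{a\in A_{\mathbb{F}}:\chi_\alpha(a)\ge1\ \forall\alpha\in\Delta\}$. The spherical Weyl group is $W_s=\operatorname{Nor}_{K_{\mathbb{F}}}(A_{\mathbb{F}})/\operatorname{Cen}_{K_{\mathbb{F}}}(A_{\mathbb{F}})$, acting on $A_{\mathbb{F}}$ by conjugation. $G_{\mathbb{F}}$ acts on symmetric positive definite matrices of determinant $1$ over $\mathbb{F}$ by $g.x=gxg^{\mathsf T}$, and $\mathcal{X}_{\mathbb{F}}=G_{\mathbb{F}}.\operatorname{Id}$ is the orbit of the identity matrix. By the Cartan decomposition $G_{\mathbb{F}}=K_{\mathbb{F}}A_{\mathbb{F}}K_{\mathbb{F}}$, every element of $G_{\mathbb{F}}$ lies in $K_{\mathbb{F}}aK_{\mathbb{F}}$ for a unique $a\in A^+_{\mathbb{F}}$. *)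

(* Defs.v *)
From HB Require Import structures.
From mathcomp Require Import all_boot all_order all_algebra.
From mathcomp Require Import all_classical all_reals all_analysis.
From mathcomp Require mpoly complex.
(* The notations of [mpoly] clash with those of MathComp-Analysis; its canonical
   structures are needed. *)
Export -(notations) mpoly.
Export -(notations) complex.
Set Implicit Arguments.
Unset Strict Implicit.
Unset Printing Implicit Defensive.
Import Order.TTheory GRing.Theory Num.Theory numFieldNormedType.Exports.
Local Open Scope classical_set_scope.
Local Open Scope ring_scope.

(* Polynomials over K in the n^2 entries of an n x n matrix; the entry (i, j) is
   the variable of index [mxvec_index i j]. *)
Definition mxpol (K : fieldType) (n : nat) := mpoly (n * n)%N K.

Definition mxeval (K L : fieldType) (iota : {rmorphism K -> L}) (n : nat)
    (p : mxpol K n) (g : 'M[L]_n) : L :=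
  meval (fun k => mxvec g 0 k) (map_mpoly iota p).

(* The L-points of the algebraic set defined over K by a finite family of
   polynomials, for a field extension iota : K -> L. *)
Definition points (K L : fieldType) (iota : {rmorphism K -> L}) (n : nat)
    (V : seq (mxpol K n)) : set 'M[L]_n :=
  [set g | forall p, p \in V -> mxeval iota p g = 0].

(* The algebraic closure of the real closed field K is K[i]; an algebraic group
   over K is identified with its group of K[i]-points. *)
Definition geom (K : rcfType) (n : nat) (V : seq (mxpol K n)) :
    set 'M[complex K]_n :=
  points (@real_complex K) V.

Definition zclosed (C : fieldType) (n : nat) (H : set 'M[C]_n) : Prop :=
  exists I : set (mxpol C n),
    H = [set g | forall p, I p -> mxeval idfun p g = 0].

Definition zconnected (C : fieldType) (n : nat) (H : set 'M[C]_n) : Prop :=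
  forall U V : set 'M[C]_n, zclosed U -> zclosed V ->
    H `<=` U `|` V -> H `&` U `&` V = set0 -> H `<=` U \/ H `<=` V.

Definition is_mxgroup (C : fieldType) (n : nat) (H : set 'M[C]_n) : Prop :=
  [/\ forall g, H g -> g \in unitmx,
      H 1%:M,
      forall g h, H g -> H h -> H (g *m h)
    & forall g, H g -> H (invmx g)].

Definition mxderived (C : fieldType) (n : nat) (H : set 'M[C]_n) :
    set 'M[C]_n :=
  smallest (@is_mxgroup C n)
    [set a *m b *m invmx a *m invmx b | a in H & b in H].

Definition mxsolvable (C : fieldType) (n : nat) (H : set 'M[C]_n) : Prop :=
  exists k : nat, iter k (@mxderived C n) H `<=` [set 1%:M].

Definition mxnormal (C : fieldType) (n : nat) (N H : set 'M[C]_n) : Prop :=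
  N `<=` H /\ forall g h, H g -> N h -> N (g *m h *m invmx g).

(* The radical, i.e. the largest closed connected solvable normal subgroup, is
   trivial. *)
Definition semisimple (C : fieldType) (n : nat) (H : set 'M[C]_n) : Prop :=
  forall N : set 'M[C]_n, is_mxgroup N -> zclosed N -> zconnected N ->
    mxsolvable N -> mxnormal N H -> N `<=` [set 1%:M].

Definition subgroup_SL (K : rcfType) (n : nat) (G : seq (mxpol K n)) : Prop :=
  is_mxgroup (geom G) /\ forall g, geom G g -> \det g = 1.

Definition self_adjoint (K : rcfType) (n : nat) (G : seq (mxpol K n)) : Prop :=
  forall g, geom G g -> geom G g^T.

Definition split_torus (K : rcfType) (n : nat) (S : seq (mxpol K n)) : Prop :=
  [/\ is_mxgroup (geom S),
      zconnected (geom S)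
    & exists2 P : 'M[K]_n, P \in unitmx &
        forall s, geom S s ->
          is_diag_mx (map_mx (@real_complex K) P *m s
                        *m map_mx (@real_complex K) (invmx P))].

Definition maximal_split_torus (K : rcfType) (n : nat)
    (G S : seq (mxpol K n)) : Prop :=
  [/\ split_torus S,
      geom S `<=` geom G
    & forall T : seq (mxpol K n), split_torus T -> geom T `<=` geom G ->
        geom S `<=` geom T -> geom T = geom S].

(* A semialgebraic formula over K: a finite disjunction of systems
   "p = 0 for p in c.1 and 0 < q for q in c.2". *)
Definition saform (K : fieldType) (n : nat) :=
  seq (seq (mxpol K n) * seq (mxpol K n)).

(* The set defined by a formula over an ordered field L containing K: for L = K
   the semialgebraic set itself, in general its L-extension. *)
Definition sa_ext (K L : rcfType) (iota : {rmorphism K -> L}) (n : nat)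
    (V : saform K n) : set 'M[L]_n :=
  [set g | exists2 c, c \in V &
     (forall p, p \in c.1 -> mxeval iota p g = 0) /\
     (forall q, q \in c.2 -> 0 < mxeval iota q g)].

Definition open_in (K : rcfType) (n : nat) (X U : set 'M[K]_n) : Prop :=
  forall x, X x -> U x -> \forall y \near x, X y -> U y.

Definition sa_connected (K : rcfType) (n : nat) (X : set 'M[K]_n) : Prop :=
  forall U V : saform K n,
    let U' := X `&` sa_ext idfun U in let V' := X `&` sa_ext idfun V in
    open_in X U' -> open_in X V' -> X = U' `|` V' -> U' `&` V' = set0 ->
    U' = set0 \/ V' = set0.

(* [C] defines the semialgebraic connected component of X containing x, i.e. the
   largest semialgebraically connected semialgebraic subset of X through x. *)
Definition sa_component (K : rcfType) (n : nat) (X : set 'M[K]_n) (x : 'M[K]_n)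
    (C : saform K n) : Prop :=
  [/\ sa_ext idfun C `<=` X,
      sa_ext idfun C x,
      sa_connected (sa_ext idfun C)
    & forall B : saform K n, sa_ext idfun B `<=` X -> sa_ext idfun B x ->
        sa_connected (sa_ext idfun B) -> sa_ext idfun B `<=` sa_ext idfun C].

Definition mxexp (R : realType) (n : nat) (X : 'M[R]_n) : 'M[R]_n :=
  limn (series (fun k : nat => (k`!%:R)^-1 *: X ^+ k)).

(* The Lie algebra of a closed subgroup H of GL_n(R). *)
Definition lie (R : realType) (n : nat) (H : set 'M[R]_n) : set 'M[R]_n :=
  [set X | forall t : R, H (mxexp (t *: X))].

(* Elements of the dual of a linear subspace a of M_n(R) are represented by
   linear forms on M_n(R), of which only the restriction to a matters. *)
Definition is_root (R : realType) (n : nat) (g a : set 'M[R]_n)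
    (alpha : {scalar 'M[R]_n}) : Prop :=
  (exists2 H, a H & alpha H != 0) /\
  (exists X, [/\ g X, X != 0
     & forall H, a H -> H *m X - X *m H = alpha H *: X]).

Definition root_basis (R : realType) (n : nat) (g a : set 'M[R]_n) (r : nat)
    (Delta : 'I_r -> {scalar 'M[R]_n}) : Prop :=
  [/\ forall i, is_root g a (Delta i),
      forall c : 'I_r -> R,
        (forall H, a H -> \sum_i c i * Delta i H = 0) -> forall i, c i = 0
    & forall beta : {scalar 'M[R]_n}, is_root g a beta ->
        exists2 z : 'I_r -> int,
          (forall i, 0 <= z i) \/ (forall i, z i <= 0) &
          forall H, a H -> beta H = \sum_i (z i)%:~R * Delta i H].

(* [chi] is (a polynomial over K representing) the algebraic character of the
   torus S such that chi (exp H) = e^(alpha H) for H in a. *)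
Definition root_character (K : rcfType) (R : realType)
    (iR : {rmorphism K -> R}) (n : nat) (S : seq (mxpol K n))
    (a : set 'M[R]_n) (alpha : {scalar 'M[R]_n}) (chi : mxpol K n) : Prop :=
  [/\ forall s, geom S s -> mxeval (@real_complex K) chi s != 0,
      forall s t, geom S s -> geom S t ->
        mxeval (@real_complex K) chi (s *m t) =
        mxeval (@real_complex K) chi s * mxeval (@real_complex K) chi t
    & forall H, a H -> mxeval iR chi (mxexp H) = expR (alpha H)].

Definition SO (F : rcfType) (n : nat) : set 'M[F]_n :=
  [set k | k *m k^T = 1%:M /\ \det k = 1].

Definition chamber (K F : rcfType) (iF : {rmorphism K -> F}) (n : nat)
    (A : set 'M[F]_n) (r : nat) (chi : 'I_r -> mxpol K n) : set 'M[F]_n :=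
  [set a | A a /\ forall i, 1 <= mxeval iF (chi i) a].

Definition symact (F : rcfType) (n : nat) (g x : 'M[F]_n) : 'M[F]_n :=
  g *m x *m g^T.

Definition symspace (F : rcfType) (n : nat) (G : set 'M[F]_n) : set 'M[F]_n :=
  [set symact g 1%:M | g in G].

Definition dcoset (F : rcfType) (n : nat) (K : set 'M[F]_n) (a : 'M[F]_n) :
    set 'M[F]_n :=
  [set k *m a *m l | k in K & l in K].

Definition mxnormaliser (F : rcfType) (n : nat) (K A : set 'M[F]_n) :
    set 'M[F]_n :=
  [set k | K k /\ [set k *m a *m invmx k | a in A] = A].

(* The orbit of a under W_s = Nor_K(A) / Cen_K(A). The centraliser acts
   trivially on A, so this is the orbit under Nor_K(A). *)
Definition weyl_orbit (F : rcfType) (n : nat) (K A : set 'M[F]_n)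
    (a : 'M[F]_n) : set 'M[F]_n :=
  [set w *m a *m invmx w | w in mxnormaliser K A].

(* Main.v *)
(* The Cartan decomposition, the uniqueness of the Cartan projection and the fact that elements of A
   in the same double coset of K are conjugate under the normaliser of A in K are first-order
   statements over the base field. Quantifier elimination transfers them between real closed fields,
   so that it suffices to prove them over R.

   Over R, let g be in G and let k maximise tr (k X k^T rho) on K, where exp (2X) = g^T g and rho is
   strictly dominant in a. The first variation shows that k X k^T commutes with rho, hence lies in a
   by maximality of the split torus, and the second variation shows that it is dominant. The same
   maximisation on the centraliser of H' in K gives the Weyl group element.

   Uniqueness is proved without highest weight representations. For a strictly dominant rho, let J be
   the set of weights of the standard representation whose value at rho is at least c. Near 1, an
   element of G(C) is a product u q, where u is triangular for the ordering by dominant elements and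
   q stabilises the span of J; hence a minor with columns J and rows f vanishes near 1 if f has
   larger weight than J at some dominant H, and by Zariski connectedness of G it vanishes on G. If
   exp H' = k exp H l, then some minor of k with columns J is nonzero, which gives that the sums over
   J of the weights at H and at H' are equal. Summing over c, tr (rho (H - H')) = 0 for all strictly
   dominant rho, so that H = H'. *)
Require Import Defs.
From HB Require Import structures.
From mathcomp Require Import all_boot all_order all_algebra.
From mathcomp Require Import all_classical all_reals all_analysis.
From mathcomp Require qe_rcf.
From mathcomp Require Import perm.
From mathcomp Require Import ring lra zify.
Set Implicit Arguments.
Unset Strict Implicit.
Unset Printing Implicit Defensive.
Import Order.TTheory GRing.Theory Num.Theory numFieldNormedType.Exports.
Local Open Scope ring_scope.

(** * Transfer between real closed fields *)

(** Maximality of the torus and Zariski connectedness are hypotheses on points over K and K[i],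
    where completeness fails, while the exponential lives over R. Every passage between the two
    sides has to be a first-order sentence, and this dictates the formulations. Maximality is
    exploited over K: a symmetric positive definite g centralising the positive part of S generates
    with S a split torus, cut out by the binomials of a saturated character lattice, so g lies in S;
    this sentence is then moved to R. Connectedness is exploited over K too: the points y such that
    a given polynomial vanishes on G near y form a set whose stabiliser has finite index, and a
    finite list of coset representatives is what is moved from R to K. Over R the analysis is
    elementary: sequential tangent vectors, and a penalised minimisation in the role of the inverse
    function theorem for a product of two closed subgroups. Roots refer to the real Lie algebra,
    whereas the open cell lives in G(C); root vectors of the Lie algebra of G(C) are brought back to
    real ones through their nilpotency. *)

Section QEMap.
Variables (K L : rcfType) (iota : {rmorphism K -> L}).
Implicit Types (p q : qe_rcf.polyF K).

Fixpoint mapt (t : qe_rcf.term K) : qe_rcf.term L :=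
  match t with
  | qe_rcf.Var i => qe_rcf.Var _ i
  | qe_rcf.Const c => qe_rcf.Const (iota c)
  | qe_rcf.NatConst m => qe_rcf.NatConst _ m
  | qe_rcf.Add u v => qe_rcf.Add (mapt u) (mapt v)
  | qe_rcf.Opp u => qe_rcf.Opp (mapt u)
  | qe_rcf.NatMul u m => qe_rcf.NatMul (mapt u) m
  | qe_rcf.Mul u v => qe_rcf.Mul (mapt u) (mapt v)
  | qe_rcf.Exp u m => qe_rcf.Exp (mapt u) m
  end.

(* Quantifier elimination commutes with this change of coefficients, so that it yields formulas
   over K valid in every real closed extension. *)
Fixpoint mapf (f : qe_rcf.formula K) : qe_rcf.formula L :=
  match f with
  | qe_rcf.Bool b => qe_rcf.Bool b
  | qe_rcf.Equal u v => qe_rcf.Equal (mapt u) (mapt v)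
  | qe_rcf.Lt u v => qe_rcf.Lt (mapt u) (mapt v)
  | qe_rcf.Le u v => qe_rcf.Le (mapt u) (mapt v)
  | qe_rcf.And f g => qe_rcf.And (mapf f) (mapf g)
  | qe_rcf.Or f g => qe_rcf.Or (mapf f) (mapf g)
  | qe_rcf.Implies f g => qe_rcf.Implies (mapf f) (mapf g)
  | qe_rcf.Not f => qe_rcf.Not (mapf f)
  end.

Local Notation mapp := (map mapt).

Lemma mapf_If a b c :
  mapf (qe_rcf.If a b c) = qe_rcf.If (mapf a) (mapf b) (mapf c).
Proof. by []. Qed.

(** The elimination procedure is in continuation-passing style: a routine receives what is to be
    done with its result. Commutation with [mapf] is therefore proved for corresponding
    continuations, here and in the lemmas of the same shape below. *)
Lemma mapf_Size p k k' : (forall m, mapf (k m) = k' m) ->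
  mapf (qe_rcf.Size p k) = qe_rcf.Size (mapp p) k'.
Proof.
elim: p k k' => [|c p IH] k k' kE /=; first exact: kE.
rewrite /qe_rcf.bind_def; apply: IH => -[|m]; last exact: kE.
by rewrite mapf_If !kE.
Qed.

Lemma mapf_LeadCoef p k k' : (forall t, mapf (k t) = k' (mapt t)) ->
  mapf (qe_rcf.LeadCoef p k) = qe_rcf.LeadCoef (mapp p) k'.
Proof.
elim: p k k' => [|c p IH] k k' kE /=; first by rewrite kE /= rmorph0.
by rewrite /qe_rcf.bind_def; apply: IH => t; rewrite mapf_If !kE.
Qed.

Lemma mapp_AmulXn a m : mapp (qe_rcf.AmulXn a m) = qe_rcf.AmulXn (mapt a) m.
Proof. by elim: m => //= m ->; rewrite rmorph0. Qed.

Lemma mapp_Add p q : mapp (qe_rcf.AddPoly p q) = qe_rcf.AddPoly (mapp p) (mapp q).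
Proof. by elim: p q => //= a p IH [|b q] //=; rewrite IH. Qed.

Lemma mapp_Scal c p : mapp (qe_rcf.ScalPoly c p) = qe_rcf.ScalPoly (mapt c) (mapp p).
Proof. by rewrite /qe_rcf.ScalPoly -!map_comp; apply: eq_map. Qed.

Lemma mapp_Mul p q : mapp (qe_rcf.MulPoly p q) = qe_rcf.MulPoly (mapp p) (mapp q).
Proof. by elim: p => //= a p IH; rewrite mapp_Add mapp_Scal /= IH. Qed.

Lemma mapp_Exp p m : mapp (qe_rcf.ExpPoly p m) = qe_rcf.ExpPoly (mapp p) m.
Proof.
rewrite /qe_rcf.ExpPoly; case: m => //= m.
by elim: m => //= m IH; rewrite mapp_Mul IH.
Qed.

Lemma mapp_Opp p : mapp (qe_rcf.OppPoly p) = qe_rcf.OppPoly (mapp p).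
Proof. by rewrite /qe_rcf.OppPoly mapp_Scal /= rmorphN1. Qed.

Lemma mapp_NatMul m p : mapp (qe_rcf.NatMulPoly m p) = qe_rcf.NatMulPoly m (mapp p).
Proof. exact: mapp_Scal. Qed.

Lemma mapp_Deriv p : mapp (qe_rcf.Deriv p) = qe_rcf.Deriv (mapp p).
Proof. by elim: p => //= a p IH; rewrite mapp_Add /= IH. Qed.

Definition mapE := (mapp_AmulXn, mapp_Add, mapp_Scal, mapp_Mul, mapp_Exp,
  mapp_Opp, mapp_NatMul, mapp_Deriv).

Lemma mapf_Isnull p k k' : (forall b, mapf (k b) = k' b) ->
  mapf (qe_rcf.Isnull p k) = qe_rcf.Isnull (mapp p) k'.
Proof. by move=> kE; apply: mapf_Size => m; apply: kE. Qed.

Lemma mapf_LtSize p q k k' : (forall b, mapf (k b) = k' b) ->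
  mapf (qe_rcf.LtSize p q k) = qe_rcf.LtSize (mapp p) (mapp q) k'.
Proof. by move=> kE; apply: mapf_Size => m; apply: mapf_Size => l; apply: kE. Qed.

Lemma mapf_Rediv_rec_loop q sq cq c qq r m k k' :
  (forall c qq r, mapf (k (c, qq, r)) = k' (c, mapp qq, mapp r)) ->
  mapf (qe_rcf.Rediv_rec_loop q sq cq c qq r m k) =
  qe_rcf.Rediv_rec_loop (mapp q) sq (mapt cq) c (mapp qq) (mapp r) m k'.
Proof.
move=> kE; elim: m c qq r => [|m IH] c qq r /=; apply: mapf_Size => s;
  case: ifP => // _; apply: mapf_LeadCoef => t; first by rewrite kE !mapE.
by rewrite IH !mapE.
Qed.

Lemma mapf_Rediv p q k k' :
  (forall c qq r, mapf (k (c, qq, r)) = k' (c, mapp qq, mapp r)) ->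
  mapf (qe_rcf.Rediv p q k) = qe_rcf.Rediv (mapp p) (mapp q) k'.
Proof.
move=> kE; apply: mapf_Isnull => -[]; first by rewrite kE /= rmorph0.
apply: mapf_Size => s; apply: mapf_Size => s'; apply: mapf_LeadCoef => t.
by rewrite (mapf_Rediv_rec_loop _ _ _ _ _ _ _ kE) /= rmorph0.
Qed.

Lemma mapf_Rgcd_loop m p q k k' : (forall r, mapf (k r) = k' (mapp r)) ->
  mapf (qe_rcf.Rgcd_loop m p q k) = qe_rcf.Rgcd_loop m (mapp p) (mapp q) k'.
Proof.
move=> kE; elim: m p q => [|m IH] p q /=;
  by apply: mapf_Rediv => c qq r; apply: mapf_Isnull => -[].
Qed.

Lemma mapf_Rgcd p q k k' : (forall r, mapf (k r) = k' (mapp r)) ->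
  mapf (qe_rcf.Rgcd p q k) = qe_rcf.Rgcd (mapp p) (mapp q) k'.
Proof.
move=> kE; apply: mapf_LtSize => -[]; apply: mapf_Isnull => -[] //=;
  by apply: mapf_Size => s; apply: mapf_Rgcd_loop.
Qed.

Lemma mapf_BigRgcd ps k k' : (forall r, mapf (k r) = k' (mapp r)) ->
  mapf (qe_rcf.BigRgcd ps k) = qe_rcf.BigRgcd (map mapp ps) k'.
Proof.
elim: ps k k' => [|p ps IH] k k' kE /=; first by rewrite kE /= rmorph0.
by apply: IH => r; apply: mapf_Rgcd.
Qed.

Lemma mapf_Changes s k k' : (forall m, mapf (k m) = k' m) ->
  mapf (qe_rcf.Changes s k) = qe_rcf.Changes (mapp s) k'.
Proof.
elim: s k k' => [|a s IH] k k' kE /=; first exact: kE.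
apply: IH => v; rewrite mapf_If !kE /=.
by case: s.
Qed.

Lemma mapf_SeqPInfty ps k k' : (forall s, mapf (k s) = k' (mapp s)) ->
  mapf (qe_rcf.SeqPInfty ps k) = qe_rcf.SeqPInfty (map mapp ps) k'.
Proof.
elim: ps k k' => [|p ps IH] k k' kE /=; first exact: kE.
by apply: mapf_LeadCoef => t; apply: IH => s; rewrite kE.
Qed.

Lemma mapf_SeqMInfty ps k k' : (forall s, mapf (k s) = k' (mapp s)) ->
  mapf (qe_rcf.SeqMInfty ps k) = qe_rcf.SeqMInfty (map mapp ps) k'.
Proof.
elim: ps k k' => [|p ps IH] k k' kE /=; first exact: kE.
apply: mapf_LeadCoef => t; apply: mapf_Size => m; apply: IH => s.
by rewrite kE /= rmorphN1.
Qed.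

Lemma mapf_ChangesPoly ps k k' : (forall m, mapf (k m) = k' m) ->
  mapf (qe_rcf.ChangesPoly ps k) = qe_rcf.ChangesPoly (map mapp ps) k'.
Proof.
move=> kE; apply: mapf_SeqMInfty => s; apply: mapf_SeqPInfty => s'.
by apply: mapf_Changes => v; apply: mapf_Changes => v'; apply: kE.
Qed.

Lemma mapf_NextMod p q k k' : (forall r, mapf (k r) = k' (mapp r)) ->
  mapf (qe_rcf.NextMod p q k) = qe_rcf.NextMod (mapp p) (mapp q) k'.
Proof.
move=> kE; apply: mapf_LeadCoef => t; apply: mapf_Rediv => c qq r.
by apply: mapf_Rediv => c' qq' r'; rewrite kE !mapE.
Qed.

Lemma mapf_ModsAux p q m k k' : (forall s, mapf (k s) = k' (map mapp s)) ->
  mapf (qe_rcf.ModsAux p q m k) = qe_rcf.ModsAux (mapp p) (mapp q) m k'.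
Proof.
elim: m p q k k' => [|m IH] p q k k' kE /=; first exact: kE.
apply: mapf_Isnull => -[]; first exact: kE.
by apply: mapf_NextMod => r; apply: IH => s; rewrite kE.
Qed.

Lemma mapf_Mods p q k k' : (forall s, mapf (k s) = k' (map mapp s)) ->
  mapf (qe_rcf.Mods p q k) = qe_rcf.Mods (mapp p) (mapp q) k'.
Proof.
by move=> kE; apply: mapf_Size => s; apply: mapf_Size => s'; apply: mapf_ModsAux.
Qed.

Lemma mapp_PolyComb sq sc :
  mapp (qe_rcf.PolyComb sq sc) = qe_rcf.PolyComb (map mapp sq) sc.
Proof.
rewrite /qe_rcf.PolyComb size_map /reducebig.
elim: (seq.iota 0 _) => //= i s IH; rewrite mapp_Mul IH mapp_Exp.
congr (qe_rcf.MulPoly (qe_rcf.ExpPoly _ _) _).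
have [lt|le] := ltnP i (size sq); first by rewrite (nth_map [::]).
by rewrite !nth_default ?size_map.
Qed.

Lemma mapp_Pcq sq i : mapp (qe_rcf.Pcq sq i) = qe_rcf.Pcq (map mapp sq) i.
Proof.
rewrite /qe_rcf.Pcq size_map; set s := qe_rcf_th.sg_tab _.
have [lt|le] := ltnP i (size s); last by rewrite !nth_default ?size_map.
by rewrite !(nth_map [::]) // mapp_PolyComb.
Qed.

Lemma mapf_TaqR p q k k' : (forall m, mapf (k m) = k' m) ->
  mapf (qe_rcf.TaqR p q k) = qe_rcf.TaqR (mapp p) (mapp q) k'.
Proof.
move=> kE; rewrite /qe_rcf.TaqR -mapp_Deriv -mapp_Mul.
by apply: mapf_Mods => s; apply: mapf_ChangesPoly.
Qed.

Lemma mapf_TaqsR p sq i k k' : (forall t, mapf (k t) = k' (mapt t)) ->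
  mapf (qe_rcf.TaqsR p sq i k) = qe_rcf.TaqsR (mapp p) (map mapp sq) i k'.
Proof.
move=> kE; rewrite /qe_rcf.TaqsR -mapp_Pcq.
by apply: mapf_TaqR => m; rewrite kE /= rmorph_int.
Qed.

Lemma mapp_Bounding sq :
  mapp (qe_rcf.BoundingPoly sq) = qe_rcf.BoundingPoly (map mapp sq).
Proof.
rewrite /qe_rcf.BoundingPoly mapp_Deriv; congr qe_rcf.Deriv.
by rewrite /reducebig; elim: sq => //= p s IH; rewrite mapp_Mul IH.
Qed.

(** These coefficients are entries of the inverse of an integer sign matrix, computed in the field
    at hand; a field morphism fixes the integers and commutes with inversion. *)
Lemma map_coefs m i : iota (qe_rcf_th.coefs K m i) = qe_rcf_th.coefs L m i.
Proof.
rewrite /qe_rcf_th.coefs.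
have [lt|le] := ltnP i (3 ^ m)%N; last first.
  by rewrite !nth_default ?rmorph0 // size_map size_enum_ord.
have sizeE : size (enum 'I_(3 ^ m)) = (3 ^ m)%N by rewrite size_enum_ord.
have ltE := leq_trans lt (eq_leq (esym sizeE)); rewrite enumT in sizeE.
have ltE' := leq_trans lt (eq_leq (esym sizeE)).
rewrite !(nth_map (Ordinal lt)); try exact: ltE; try exact: ltE'.
have -> : map_mx (intmul 1) (qe_rcf_th.ctmat m) =
    map_mx iota (map_mx (intmul 1) (qe_rcf_th.ctmat m)) :> 'M[L]_(3 ^ m).
  by apply/matrixP => a b; rewrite !mxE rmorph_int.
by rewrite -map_invmx !castmxE !mxE.
Qed.

Lemma mapt_Coefs m i : mapt (qe_rcf.Coefs K m i) = qe_rcf.Coefs L m i.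
Proof.
rewrite /qe_rcf.Coefs /=; case: m => [|[|m]]; last by rewrite map_coefs.
  by rewrite rmorph_nat.
by case: i => [|[|[|i]]] /=; rewrite ?rmorph0 ?fmorphV ?rmorph_nat // !nth_nil rmorph0.
Qed.

Lemma mapf_CcountWeak p sq k k' : (forall t, mapf (k t) = k' (mapt t)) ->
  mapf (qe_rcf.CcountWeak p sq k) = qe_rcf.CcountWeak (mapp p) (map mapp sq) k'.
Proof.
move=> kE; rewrite /qe_rcf.CcountWeak size_map.
set Aux := (fix aux s i k := match i with 0 => _ | _ => _ end).
set Aux' := (fix aux s i k := match i with 0 => _ | _ => _ end).
(* The initial accumulator 0 is displayed as the image of a term, so that the induction can run over
   an arbitrary accumulator. *)
rewrite -[X in Aux' X]/(mapt (qe_rcf.NatConst _ 0)).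
elim: (3 ^ _)%N (qe_rcf.NatConst K 0) => /= [|m IH] t; first exact: kE.
by apply: mapf_TaqsR => u; rewrite IH -mapt_Coefs.
Qed.

Lemma mapf_CcountGt0 sp sq : mapf (qe_rcf.CcountGt0 sp sq) =
  qe_rcf.CcountGt0 (map mapp sp) (map mapp sq).
Proof.
apply: mapf_BigRgcd => p; apply: mapf_Isnull => -[] /=; last exact: mapf_CcountWeak.
rewrite -mapp_Bounding; apply: mapf_CcountWeak => t /=.
congr (qe_rcf.Or _ (qe_rcf.Or _ _)); rewrite /reducebig.
  elim: sq => //= q s ->; congr (qe_rcf.And _ _).
  exact: mapf_LeadCoef.
elim: sq => //= q s ->; congr (qe_rcf.And _ _).
by apply: mapf_Size => m; apply: mapf_LeadCoef.
Qed.

Lemma mapp_abstrX i t : mapp (qe_rcf.abstrX i t) = qe_rcf.abstrX i (mapt t).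
Proof.
elim: t => //=.
- by move=> m; case: ifP.
- by move=> u IHu v IHv; rewrite !mapE IHu IHv.
- by move=> u IHu; rewrite !mapE IHu.
- by move=> u IHu m; rewrite !mapE IHu.
- by move=> u IHu v IHv; rewrite !mapE IHu IHv.
- by move=> u IHu m; rewrite !mapE IHu.
Qed.

End QEMap.

(** Summing over the support isolates the coefficients, the only place where the embedding [io]
    enters. *)
Lemma mxevalE (K L : fieldType) (io : {rmorphism K -> L}) n (p : mxpol K n)
    (g : 'M[L]_n) :
  mxeval io p g =
  \sum_(m <- msupp p) io (mcoeff m p) * \prod_(k < n * n) mxvec g 0 k ^+ m k.
Proof.
rewrite /mxeval /map_mpoly /mmap raddf_sum /=; apply: eq_bigr => m _.
rewrite rmorphM /= mevalC; congr (_ * _).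
by rewrite /mmap1 rmorph_prod /=; apply: eq_bigr => k _; rewrite rmorphXn /= mevalXU.
Qed.

(** * Predicates defined uniformly over all real closed extensions of K *)

Section Definable.
Variable K : rcfType.

Fixpoint teval (L : rcfType) (io : {rmorphism K -> L}) (e : nat -> L)
    (t : qe_rcf.term K) : L :=
  match t with
  | qe_rcf.Var i => e i
  | qe_rcf.Const c => io c
  | qe_rcf.NatConst m => m%:R
  | qe_rcf.Add u v => teval io e u + teval io e v
  | qe_rcf.Opp u => - teval io e u
  | qe_rcf.NatMul u m => teval io e u *+ m
  | qe_rcf.Mul u v => teval io e u * teval io e v
  | qe_rcf.Exp u m => teval io e u ^+ m
  end.

Definition clause := (seq (qe_rcf.term K) * seq (qe_rcf.term K))%type.

Definition cholds (L : rcfType) (io : {rmorphism K -> L}) (e : nat -> L)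
    (c : clause) : bool :=
  all (fun t => teval io e t == 0) c.1 && all (fun t => 0 < teval io e t) c.2.

(** Environments are total functions on [nat], so that no list of free variables has to be carried
    along. *)
Definition fam := forall L : rcfType, {rmorphism K -> L} -> (nat -> L) -> Prop.
Definition tfam := forall L : rcfType, {rmorphism K -> L} -> (nat -> L) -> L.

(* [Q] is defined by one quantifier-free formula over K, valid in all real closed extensions. *)
Definition def (Q : fam) := exists D : seq clause,
  forall L io e, Q L io e <-> has (cholds io e) D.

Definition tdef (T : tfam) := exists t : qe_rcf.term K,
  forall L io e, T L io e = teval io e t.

Lemma def_ext (Q Q' : fam) : (forall L io e, Q' L io e <-> Q L io e) ->
  def Q -> def Q'.
Proof. by move=> QQ [D DP]; exists D => L io e; rewrite QQ. Qed.

Lemma tdef_var i : tdef (fun L _ e => e i).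
Proof. by exists (qe_rcf.Var _ i). Qed.
Lemma tdef_const c : tdef (fun L io _ => io c).
Proof. by exists (qe_rcf.Const c). Qed.
Lemma tdef_nat m : tdef (fun L _ _ => m%:R).
Proof. by exists (qe_rcf.NatConst _ m). Qed.
Lemma tdef_0 : tdef (fun L _ _ => 0).
Proof. by exists (qe_rcf.NatConst _ 0). Qed.
Lemma tdef_1 : tdef (fun L _ _ => 1).
Proof. by exists (qe_rcf.NatConst _ 1). Qed.
Lemma tdef_add (T U : tfam) : tdef T -> tdef U ->
  tdef (fun L io e => T L io e + U L io e).
Proof.
by move=> [t tE] [u uE]; exists (qe_rcf.Add t u) => L io e; rewrite tE uE.
Qed.
Lemma tdef_mul (T U : tfam) : tdef T -> tdef U ->
  tdef (fun L io e => T L io e * U L io e).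
Proof.
by move=> [t tE] [u uE]; exists (qe_rcf.Mul t u) => L io e; rewrite tE uE.
Qed.
Lemma tdef_opp (T : tfam) : tdef T -> tdef (fun L io e => - T L io e).
Proof. by move=> [t tE]; exists (qe_rcf.Opp t) => L io e; rewrite tE. Qed.
Lemma tdef_exp (T : tfam) m : tdef T -> tdef (fun L io e => T L io e ^+ m).
Proof. by move=> [t tE]; exists (qe_rcf.Exp t m) => L io e; rewrite tE. Qed.
Lemma tdef_ext (T U : tfam) : (forall L io e, U L io e = T L io e) ->
  tdef T -> tdef U.
Proof. by move=> TU [t tE]; exists t => L io e; rewrite TU. Qed.

Lemma tdef_sum (I : Type) (s : seq I) (P : pred I) (T : I -> tfam) :
  (forall i, tdef (T i)) -> tdef (fun L io e => \sum_(i <- s | P i) T i L io e).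
Proof.
move=> TP; elim: s => [|i s IH].
  by apply: tdef_ext tdef_0 => L io e; rewrite big_nil.
case Pi: (P i).
  by apply: tdef_ext (tdef_add (TP i) IH) => L io e; rewrite big_cons Pi.
by apply: tdef_ext IH => L io e; rewrite big_cons Pi.
Qed.

Lemma tdef_prod (I : Type) (s : seq I) (P : pred I) (T : I -> tfam) :
  (forall i, tdef (T i)) -> tdef (fun L io e => \prod_(i <- s | P i) T i L io e).
Proof.
move=> TP; elim: s => [|i s IH].
  by apply: tdef_ext tdef_1 => L io e; rewrite big_nil.
case Pi: (P i).
  by apply: tdef_ext (tdef_mul (TP i) IH) => L io e; rewrite big_cons Pi.
by apply: tdef_ext IH => L io e; rewrite big_cons Pi.
Qed.

Lemma def_eq (T U : tfam) : tdef T -> tdef U ->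
  def (fun L io e => T L io e = U L io e).
Proof.
move=> [t tE] [u uE]; exists [:: ([:: qe_rcf.Add t (qe_rcf.Opp u)], [::])].
move=> L io e; rewrite /= /cholds /= !andbT orbF subr_eq0 tE uE.
by split => [->|/eqP].
Qed.

Lemma def_lt (T U : tfam) : tdef T -> tdef U ->
  def (fun L io e => T L io e < U L io e).
Proof.
move=> [t tE] [u uE]; exists [:: ([::], [:: qe_rcf.Add u (qe_rcf.Opp t)])].
by move=> L io e; rewrite /= /cholds /= !andbT orbF subr_gt0 tE uE.
Qed.

Lemma def_true : def (fun _ _ _ => True).
Proof. by exists [:: ([::], [::])]. Qed.

Lemma def_false : def (fun _ _ _ => False).
Proof. by exists [::]. Qed.

Lemma def_or (P Q : fam) : def P -> def Q ->
  def (fun L io e => P L io e \/ Q L io e).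
Proof.
move=> [D DP] [D' DQ]; exists (D ++ D') => L io e.
by rewrite has_cat DP DQ; split => /orP.
Qed.

Lemma def_and (P Q : fam) : def P -> def Q ->
  def (fun L io e => P L io e /\ Q L io e).
Proof.
move=> [D DP] [D' DQ].
exists [seq (c.1 ++ c'.1, c.2 ++ c'.2) | c <- D, c' <- D'] => L io e.
have cat c c' : cholds io e (c.1 ++ c'.1, c.2 ++ c'.2) =
    cholds io e c && cholds io e c'.
  by rewrite /cholds /= !all_cat andbACA.
rewrite DP DQ; elim: D {DP} => [|c D IH] /=; first by split => -[].
have hasE : has [pred x : clause | cholds io e (c.1 ++ x.1, c.2 ++ x.2)] D' =
    cholds io e c && has (cholds io e) D'.
  by elim: D' {DQ IH} => [|c' D' IH] /=; rewrite ?andbF // cat IH andb_orr.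
rewrite has_cat has_map /preim hasE.
by move: IH; case: (has _ D); case: (has _ D'); case: (cholds io e c) => /= -[h1 h2];
  split => // h; have := h1; have := h2; intuition.
Qed.

(** By trichotomy the negation of an equation or of a strict inequality is a disjunction of two
    atoms of these same kinds, so clauses never have to contain negations. *)
Lemma def_not (P : fam) : def P -> def (fun L io e => ~ P L io e).
Proof.
move=> [D DP]; suff: def (fun L io e => ~ has (cholds io e) D).
  by apply: def_ext => L io e; rewrite DP.
elim: D {P DP} => [|[s1 s2] D IH] /=.
  by apply: def_ext def_true => L io e; split.
suff h : def (fun L io e => ~ cholds io e (s1, s2)).
  apply: def_ext (def_and h IH) => L io e.
  by case: (cholds io e _); case: has => /=; split => // -[].
clear IH; have h1 : def (fun L io e => ~~ all (fun t => teval io e t == 0) s1).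
  elim: s1 => [|t s IH] /=; first by apply: def_ext def_false.
  have h0 : def (fun L io e => teval io e t < 0).
    by apply: def_lt; [exists t|exact: tdef_0].
  have h0' : def (fun L io e => 0 < teval io e t).
    by apply: def_lt; [exact: tdef_0|exists t].
  apply: def_ext (def_or (def_or h0 h0') IH) => L io e.
  by rewrite negb_and neq_lt; split => [/orP[/orP|]|[/orP ->|->]]; rewrite ?orbT; auto.
have h2 : def (fun L io e => ~~ all (fun t => 0 < teval io e t) s2).
  elim: s2 => [|t s IH] /=; first by apply: def_ext def_false.
  have h0 : def (fun L io e => teval io e t < 0).
    by apply: def_lt; [exists t|exact: tdef_0].
  have h0' : def (fun L io e => teval io e t = 0).
    by apply: def_eq; [exists t|exact: tdef_0].
  apply: def_ext (def_or (def_or h0 h0') IH) => L io e.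
  rewrite negb_and -leNgt le_eqVlt; split => [/orP[/orP[/eqP|]|]|]; auto.
  by case=> [[->|->]|->]; rewrite ?eqxx ?orbT.
apply: def_ext (def_or h1 h2) => L io e; rewrite /cholds /=.
by split => [/negP|[] h]; [rewrite negb_and => /orP|rewrite (negbTE h)|rewrite (negbTE h) andbF].
Qed.

Lemma def_imp (P Q : fam) : def P -> def Q ->
  def (fun L io e => P L io e -> Q L io e).
Proof.
move=> dP dQ; apply: def_ext (def_or (def_not dP) dQ) => L io e.
split=> [PQ|[nP|//]]; last by move/nP.
by have [p|np] := pselect (P L io e); [right; apply: PQ|left].
Qed.

Lemma def_iff (P Q : fam) : def P -> def Q ->
  def (fun L io e => P L io e <-> Q L io e).
Proof. by move=> dP dQ; apply: def_and; apply: def_imp. Qed.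

Lemma def_le (T U : tfam) : tdef T -> tdef U ->
  def (fun L io e => T L io e <= U L io e).
Proof.
move=> dT dU; apply: def_ext (def_not (def_lt dU dT)) => L io e.
by rewrite leNgt; split => /negP.
Qed.

Lemma def_meta_all (I : Type) (s : seq I) (Q : I -> fam) :
  (forall i, def (Q i)) -> def (fun L io e => \big[and/True]_(i <- s) Q i L io e).
Proof.
move=> dQ; elim: s => [|i s IH].
  by apply: def_ext def_true => L io e; rewrite big_nil.
by apply: def_ext (def_and (dQ i) IH) => L io e; rewrite big_cons.
Qed.

Lemma def_forall_fin (I : finType) (Q : I -> fam) :
  (forall i, def (Q i)) -> def (fun L io e => forall i, Q i L io e).
Proof.
move=> /(def_meta_all (enum I)); apply: def_ext => L io e.
have -> : (forall i, Q i L io e) <-> (forall i, i \in enum I -> Q i L io e).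
  by split => h i => [_|]; [exact: h|apply: h; rewrite mem_enum].
elim: (enum I) => [|i s IH]; first by rewrite big_nil; split.
rewrite big_cons -IH; split => [h|[hi hs] j].
  by split=> [|j js]; apply: h; rewrite in_cons ?eqxx ?js ?orbT.
by rewrite in_cons => /predU1P[->//|/hs].
Qed.

Lemma def_exists_fin (I : finType) (Q : I -> fam) :
  (forall i, def (Q i)) -> def (fun L io e => exists i, Q i L io e).
Proof.
move=> dQ; apply: def_ext (def_not (def_forall_fin (fun i => def_not (dQ i)))).
move=> L io e; split => [[i Qi] /(_ i)//|h]; apply: contrapT => h'.
by apply: h => i Qi; apply: h'; exists i.
Qed.

Fixpoint tsub (s : nat -> qe_rcf.term K) (t : qe_rcf.term K) :=
  match t with
  | qe_rcf.Var i => s i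
  | qe_rcf.Const c => qe_rcf.Const c
  | qe_rcf.NatConst m => qe_rcf.NatConst _ m
  | qe_rcf.Add u v => qe_rcf.Add (tsub s u) (tsub s v)
  | qe_rcf.Opp u => qe_rcf.Opp (tsub s u)
  | qe_rcf.NatMul u m => qe_rcf.NatMul (tsub s u) m
  | qe_rcf.Mul u v => qe_rcf.Mul (tsub s u) (tsub s v)
  | qe_rcf.Exp u m => qe_rcf.Exp (tsub s u) m
  end.

Lemma teval_sub (L : rcfType) (io : {rmorphism K -> L}) (e : nat -> L) s t :
  teval io e (tsub s t) = teval io (fun i => teval io e (s i)) t.
Proof. by elim: t => //= [u -> v ->|u ->|u -> m|u -> v ->|u -> m]. Qed.

Lemma def_subst (Q : fam) s : def Q ->
  def (fun L io e => Q L io (fun i => teval io e (s i))).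
Proof.
move=> [D DP]; exists [seq (map (tsub s) c.1, map (tsub s) c.2) | c : clause <- D].
move=> L io e; rewrite DP has_map; rewrite (eq_has (a2 := cholds io (fun i => teval io e (s i)))) //.
by move=> c /=; rewrite /cholds /= !all_map; congr (_ && _); apply: eq_all => t /=;
  rewrite teval_sub.
Qed.

(** In a real closed field the positive elements are the nonzero squares, so every ring morphism
    preserves and reflects the order. *)
Lemma iotaP_lt (L : rcfType) (io : {rmorphism K -> L}) x : (0 < io x) = (0 < x).
Proof.
have pos y : 0 < y -> 0 < io y.
  move=> y0; rewrite -[y]sqr_sqrtr ?ltW // rmorphXn /= lt_def sqr_ge0 andbT.
  by rewrite expf_neq0 // fmorph_eq0 gt_eqF // sqrtr_gt0.
apply/idP/idP => [|/pos//]; rewrite !ltNge; apply: contra.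
by rewrite le_eqVlt => /orP[/eqP ->|]; rewrite ?rmorph0 // -oppr_gt0 => /pos;
  rewrite rmorphN oppr_gt0 => /ltW.
Qed.

Lemma teval_io (L : rcfType) (io : {rmorphism K -> L}) (e : nat -> K) t :
  teval io (fun i => io (e i)) t = io (teval idfun e t).
Proof.
elim: t => //=.
- by move=> m; rewrite rmorph_nat.
- by move=> u -> v ->; rewrite rmorphD.
- by move=> u ->; rewrite rmorphN.
- by move=> u -> m; rewrite rmorphMn.
- by move=> u -> v ->; rewrite rmorphM.
- by move=> u -> m; rewrite rmorphXn.
Qed.

(** The same clauses define the predicate over K and over L, and an atom has the same truth value at
    a point of K and at its image. *)
Lemma transfer (Q : fam) : def Q -> forall (L : rcfType) (io : {rmorphism K -> L}) e,
  Q K idfun e <-> Q L io (fun i => io (e i)).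
Proof.
move=> [D DP] L io e; rewrite !DP.
have -> // : has (cholds io (fun i => io (e i))) D = has (cholds idfun e) D.
apply: eq_has => c; rewrite /cholds; congr (_ && _); apply: eq_all => t;
  by rewrite teval_io ?iotaP_lt ?fmorph_eq0.
Qed.

Fixpoint tbd (t : qe_rcf.term K) : nat :=
  match t with
  | qe_rcf.Var i => i.+1
  | qe_rcf.Add u v | qe_rcf.Mul u v => maxn (tbd u) (tbd v)
  | qe_rcf.Opp u | qe_rcf.NatMul u _ | qe_rcf.Exp u _ => tbd u
  | _ => 0%N
  end.

Lemma eval_mapt (L : rcfType) (io : {rmorphism K -> L}) (s : seq L) (e : nat -> L) t :
  (forall i, (i < tbd t)%N -> s`_i = e i) ->
  qe_rcf.eval s (mapt io t) = teval io e t.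
Proof.
elim: t => //=.
- by move=> i; apply.
- move=> u IHu v IHv h; rewrite IHu ?IHv // => i hi; apply: h;
    by rewrite leq_max hi ?orbT.
- by move=> u IHu h; rewrite IHu.
- by move=> u IHu m h; rewrite IHu.
- move=> u IHu v IHv h; rewrite IHu ?IHv // => i hi; apply: h;
    by rewrite leq_max hi ?orbT.
- by move=> u IHu m h; rewrite IHu.
Qed.

Lemma def_qf (f : qe_rcf.formula K) N :
  def (fun L io e => qe_rcf.qf_eval (mkseq e N) (mapf io f)).
Proof.
have dt t : tdef (fun L io e => qe_rcf.eval (mkseq e N) (mapt io t)).
  (* A missing entry of the list is read as 0, hence the constant 0 in place of the variables from
     [N] on. *)
  exists (tsub (fun i => if (i < N)%N then qe_rcf.Var _ i else qe_rcf.NatConst _ 0) t).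
  move=> L io e; rewrite teval_sub; apply: eval_mapt => i _.
  by case: ltnP => h /=; [rewrite nth_mkseq|rewrite nth_default ?size_mkseq].
elim: f => //=.
- by case; [apply: def_ext def_true|apply: def_ext def_false].
- move=> u v; apply: def_ext (def_eq (dt u) (dt v)) => L io e.
  by split => [/eqP|->]; rewrite ?eqxx.
- by move=> u v; apply: def_lt.
- by move=> u v; apply: def_le.
- by move=> f dF g dG; apply: def_ext (def_and dF dG) => L io e; split => /andP.
- by move=> f dF g dG; apply: def_ext (def_or dF dG) => L io e; split => /orP.
- by move=> f dF g dG; apply: def_ext (def_imp dF dG) => L io e; split => /implyP.
- by move=> f dF; apply: def_ext (def_not dF) => L io e; split => /negP.
Qed.

Definition upd (L : Type) (e : nat -> L) k x i := if i == k then x else e i.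

(** An existential quantifier distributes over the disjunction of clauses. For one clause, the terms
    become polynomials in the variable k, and [CcountGt0] decides by counting roots whether they
    have a common solution; its output commutes with [mapf], so one formula over K serves all
    extensions. *)
Lemma def_ex_upd k (Q : fam) : def Q ->
  def (fun L io e => exists x, Q L io (upd e k x)).
Proof.
move=> [D DP]; suff: def (fun L io e => exists x, has (cholds io (upd e k x)) D).
  by apply: def_ext => L io e; split => -[x hx]; exists x; apply/DP.
elim: D {Q DP} => [|c D IH] /=; first by apply: def_ext def_false => L io e; split => // -[].
suff h : def (fun L io e => exists x, cholds io (upd e k x) c).
  apply: def_ext (def_or h IH) => L io e; split.
    by case=> x /orP[]; [left|right]; exists x.
  by case=> -[x hx]; exists x; rewrite hx ?orbT.
(* [N] exceeds k and all variables of the clause, so that the list [mkseq e N] loses nothing. *)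
pose N := maxn k.+1 (foldr (fun t => maxn (tbd t)) 0%N (c.1 ++ c.2)).
have : all (fun t => (tbd t <= N)%N) (c.1 ++ c.2).
  rewrite /N; elim: (c.1 ++ c.2) => //= u s IHs; apply/andP; split.
    by rewrite !leq_max leqnn orbT.
  apply: sub_all IHs => t; rewrite !leq_max; case/orP => ->; by rewrite ?orbT.
rewrite all_cat => /andP[tN1 tN2].
have eq_all' (a1 a2 P : pred (qe_rcf.term K)) s : (forall t, P t -> a1 t = a2 t) ->
    all P s -> all a1 s = all a2 s.
  by move=> aa; elim: s => //= t s IHs /andP[/aa -> /IHs ->].
pose f := qe_rcf.CcountGt0 (map (qe_rcf.abstrX k) c.1) (map (qe_rcf.abstrX k) c.2).
apply: def_ext (def_qf f N) => L io e.
rewrite mapf_CcountGt0 -!map_comp.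
have mE s : map (map (mapt io) \o qe_rcf.abstrX k) s =
    map (fun t => qe_rcf.abstrX k (mapt io t)) s.
  by apply: eq_map => t /=; rewrite mapp_abstrX.
rewrite !mE qe_rcf.eval_CcountGt0 -!map_comp; set s := mkseq e N.
have evE x t : (tbd t <= N)%N ->
    (qe_rcf.eval_poly s (qe_rcf.abstrX k (mapt io t))).[x] = teval io (upd e k x) t.
  move=> tb; rewrite qe_rcf.abstrXP; apply: eval_mapt => i hi.
  rewrite nth_set_nth /= /upd; case: eqP => // _.
  by rewrite nth_mkseq // (leq_trans hi).
have andE x : cholds io (upd e k x) c =
  \big[andb/true]_(p <- map ((qe_rcf.eval_poly s) \o (fun t => qe_rcf.abstrX k (mapt io t))) c.1) (p.[x] == 0)
  && \big[andb/true]_(q <- map ((qe_rcf.eval_poly s) \o (fun t => qe_rcf.abstrX k (mapt io t))) c.2) (q.[x] > 0).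
  rewrite !big_all !all_map /cholds; congr (_ && _).
    by apply: eq_all' tN1 => t /(evE x) /= ->.
  by apply: eq_all' tN2 => t /(evE x) /= ->.
split=> [[x hx]|/qe_rcf_th.ccount_gt0P[x hx]]; last by exists x; rewrite andE.
by apply/qe_rcf_th.ccount_gt0P; exists x; rewrite -andE.
Qed.

(** As with de Bruijn indices, the m bound values occupy the first places and the old environment is
    shifted by m. *)
Lemma def_ex_fun m (Q : fam) : def Q ->
  def (fun L io e => exists f : nat -> L, Q L io (fun i => if (i < m)%N then f i else e (i - m)%N)).
Proof.
move=> dQ; suff h : def (fun L io e => exists f : nat -> L,
    Q L io (fun i => if (i < m)%N then f i else e i)).
  apply: def_ext (def_subst (fun i => qe_rcf.Var _ (i - m)) h) => L io e /=.
  by split.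
elim: m => [|m IH].
  apply: def_ext dQ => L io e; split => [[f]|h]; first by rewrite (_ : (fun _ => _) = e).
  by exists e; rewrite (_ : (fun _ => _) = e).
apply: def_ext (def_ex_upd m IH) => L io e.
have E (f : nat -> L) (x : L) : f m = x ->
    (fun i => if (i < m.+1)%N then f i else e i) =
    (fun i => if (i < m)%N then f i else upd e m x i).
  move=> fm; apply/funext => i; rewrite /upd ltnS leq_eqVlt.
  by case: eqP => [->|_] /=; rewrite ?ltnn.
split=> [[f Qf]|[x [f Qf]]]; first by exists (f m), f; rewrite -E.
exists (upd f m x); rewrite (E _ x) /upd ?eqxx //.
congr (Q L io _): Qf; apply/funext => i; case: ifP => // im.
by rewrite (ltn_eqF im).
Qed.

Definition vmx (L : Type) p q (e : nat -> L) : 'M[L]_(p, q) :=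
  \matrix_(i, j) e (mxvec_index i j).
Definition vsh (L : Type) m (e : nat -> L) : nat -> L := fun i => e (m + i)%N.

Lemma def_exM p q (B : forall L : rcfType, {rmorphism K -> L} -> (nat -> L) -> 'M[L]_(p, q) -> Prop) :
  def (fun L io e => B L io (vsh (p * q) e) (vmx p q e)) ->
  def (fun L io e => exists M, B L io e M).
Proof.
move=> /(def_ex_fun (p * q)); apply: def_ext => L io e.
have shE (f : nat -> L) :
    vsh (p * q) (fun i => if (i < p * q)%N then f i else e (i - p * q)%N) = e.
  by apply/funext => i; rewrite /vsh ltnNge leq_addr /= addKn.
have mxE' (f : nat -> L) :
    vmx p q (fun i => if (i < p * q)%N then f i else e (i - p * q)%N) = vmx p q f.
  by apply/matrixP => i j; rewrite !mxE ltn_ord.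
split=> [[M BM]|[f]]; last by rewrite shE; eexists; eassumption.
exists (fun i => if insub i is Some k then mxvec M 0 k else 0).
rewrite shE mxE' (_ : vmx p q _ = M) //.
by apply/matrixP => i j; rewrite !mxE valK mxvecE.
Qed.

Lemma def_allM p q (B : forall L : rcfType, {rmorphism K -> L} -> (nat -> L) -> 'M[L]_(p, q) -> Prop) :
  def (fun L io e => B L io (vsh (p * q) e) (vmx p q e)) ->
  def (fun L io e => forall M, B L io e M).
Proof.
move=> h; have := def_not (def_exM (B := fun L io e M => ~ B L io e M) (def_not h)).
apply: def_ext => L io e; split=> [h1 [M]|h1 M]; first by apply.
by apply: contrapT => h2; apply: h1; exists M.
Qed.

Lemma def_exS (B : forall L : rcfType, {rmorphism K -> L} -> (nat -> L) -> L -> Prop) :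
  def (fun L io e => B L io (vsh 1 e) (e 0%N)) ->
  def (fun L io e => exists x, B L io e x).
Proof.
move=> /(def_ex_fun 1); apply: def_ext => L io e.
have shE (f : nat -> L) : vsh 1 (fun i => if (i < 1)%N then f i else e (i - 1)%N) = e.
  by apply/funext => i; rewrite /vsh /= add1n subn1.
by split=> [[x Bx]|[f]]; [exists (fun=> x)|]; rewrite shE // => Bf; exists (f 0%N).
Qed.

Lemma def_allS (B : forall L : rcfType, {rmorphism K -> L} -> (nat -> L) -> L -> Prop) :
  def (fun L io e => B L io (vsh 1 e) (e 0%N)) ->
  def (fun L io e => forall x, B L io e x).
Proof.
move=> h; have := def_not (def_exS (B := fun L io e x => ~ B L io e x) (def_not h)).
apply: def_ext => L io e; split=> [h1 [M]|h1 M]; first by apply.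
by apply: contrapT => h2; apply: h1; exists M.
Qed.

End Definable.

(** * Definability of statements on real and complex matrices *)

Section DefMx.
Variable K : rcfType.

Definition mxfam p q :=
  forall L : rcfType, {rmorphism K -> L} -> (nat -> L) -> 'M[L]_(p, q).
Definition cfam :=
  forall L : rcfType, {rmorphism K -> L} -> (nat -> L) -> complex L.
Definition cmxfam p q :=
  forall L : rcfType, {rmorphism K -> L} -> (nat -> L) -> 'M[complex L]_(p, q).

Definition mdef p q (M : mxfam p q) :=
  forall i j, tdef (fun L io e => M L io e i j).
Definition cdef (z : cfam) :=
  tdef (fun L io e => complex.Re (z L io e)) /\
  tdef (fun L io e => complex.Im (z L io e)).
Definition cmdef p q (M : cmxfam p q) :=
  forall i j, cdef (fun L io e => M L io e i j).

Lemma mdef_vmx p q (f : nat -> nat) :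
  mdef (fun (L : rcfType) (_ : {rmorphism K -> L}) e => vmx p q (fun i => e (f i))).
Proof.
move=> i j; apply: tdef_ext (tdef_var _ (f (mxvec_index i j))) => L io e.
by rewrite mxE.
Qed.
Lemma mdef_entry p q (M : mxfam p q) i j : mdef M -> tdef (fun L io e => M L io e i j).
Proof. exact. Qed.
Lemma mdef_const p q (M : 'M[K]_(p, q)) : mdef (fun L io e => map_mx io M).
Proof. by move=> i j; apply: tdef_ext (tdef_const (M i j)) => L io e; rewrite mxE. Qed.
Lemma mdef_1 p : mdef (fun L _ _ => 1%:M : 'M[L]_p).
Proof.
by move=> i j; apply: tdef_ext (tdef_nat K (i == j)) => L io e; rewrite mxE.
Qed.
Lemma mdef_0 p q : mdef (fun L _ _ => 0 : 'M[L]_(p, q)).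
Proof. by move=> i j; apply: tdef_ext (tdef_0 K) => L io e; rewrite mxE. Qed.
Lemma mdef_tr p q (M : mxfam p q) : mdef M -> mdef (fun L io e => (M L io e)^T).
Proof. by move=> dM i j; apply: tdef_ext (dM j i) => L io e; rewrite mxE. Qed.
Lemma mdef_mul p q r (M : mxfam p q) (N : mxfam q r) : mdef M -> mdef N ->
  mdef (fun L io e => M L io e *m N L io e).
Proof.
move=> dM dN i j; apply: tdef_ext (tdef_sum (index_enum 'I_q) xpredT
  (fun k => tdef_mul (dM i k) (dN k j))) => L io e; rewrite mxE //.
Qed.
Lemma mdef_sub p q (M N : mxfam p q) : mdef M -> mdef N ->
  mdef (fun L io e => M L io e - N L io e).
Proof.
move=> dM dN i j; apply: tdef_ext (tdef_add (dM i j) (tdef_opp (dN i j))) => L io e.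
by rewrite !mxE.
Qed.
Lemma def_eqmx p q (M N : mxfam p q) : mdef M -> mdef N ->
  def (fun L io e => M L io e = N L io e).
Proof.
move=> dM dN; apply: def_ext (def_forall_fin (fun i => def_forall_fin
  (fun j => def_eq (dM i j) (dN i j)))) => L io e.
by split=> [-> //|h]; apply/matrixP.
Qed.
Lemma tdef_det p (M : mxfam p p) : mdef M -> tdef (fun L io e => \det (M L io e)).
Proof.
move=> dM; rewrite /determinant; apply: tdef_sum => s; apply: tdef_mul.
  by apply: tdef_exp; apply: tdef_opp; apply: tdef_1.
by apply: tdef_prod => i; apply: dM.
Qed.
Lemma tdef_mxeval n (p : mxpol K n) (M : mxfam n n) : mdef M ->
  tdef (fun L io e => mxeval io p (M L io e)).
Proof.
move=> dM; apply: (@tdef_ext _ (fun L io e => \sum_(m <- msupp p) io (mcoeff m p) *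
   \prod_(k < n * n) mxvec (M L io e) 0 k ^+ m k)).
  by move=> L io e; rewrite mxevalE.
apply: tdef_sum => m; apply: tdef_mul; first exact: tdef_const.
apply: tdef_prod => k; apply: tdef_exp.
case/mxvec_indexP: k => i j; apply: tdef_ext (dM i j) => L io e.
by rewrite mxvecE.
Qed.

Lemma def_normlt (T U : tfam K) : tdef T -> tdef U ->
  def (fun L io e => `|T L io e| < U L io e).
Proof.
move=> dT dU; apply: def_ext (def_and (def_lt (tdef_opp dU) dT) (def_lt dT dU)) => L io e.
by rewrite ltr_norml; split => /andP.
Qed.

Lemma cdef_ext (z w : cfam) : (forall L io e, w L io e = z L io e) -> cdef z -> cdef w.
Proof. by move=> zw [d1 d2]; split; [apply: tdef_ext d1|apply: tdef_ext d2] => L io e; rewrite zw. Qed.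
Lemma cdef_add (z w : cfam) : cdef z -> cdef w -> cdef (fun L io e => z L io e + w L io e).
Proof.
move=> [z1 z2] [w1 w2]; split.
  by apply: tdef_ext (tdef_add z1 w1) => L io e; rewrite raddfD.
by apply: tdef_ext (tdef_add z2 w2) => L io e; rewrite raddfD.
Qed.
Lemma cdef_opp (z : cfam) : cdef z -> cdef (fun L io e => - z L io e).
Proof.
move=> [z1 z2]; split.
  by apply: tdef_ext (tdef_opp z1) => L io e; rewrite raddfN.
by apply: tdef_ext (tdef_opp z2) => L io e; rewrite raddfN.
Qed.
Lemma cdef_mul (z w : cfam) : cdef z -> cdef w -> cdef (fun L io e => z L io e * w L io e).
Proof.
move=> [z1 z2] [w1 w2]; split.
  apply: tdef_ext (tdef_add (tdef_mul z1 w1) (tdef_opp (tdef_mul z2 w2))) => L io e.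
  by case: (z L io e) (w L io e) => a b [c d].
apply: tdef_ext (tdef_add (tdef_mul z1 w2) (tdef_mul z2 w1)) => L io e.
by case: (z L io e) (w L io e) => a b [c d].
Qed.
Lemma cdef_real (T : tfam K) : tdef T -> cdef (fun L io e => real_complex L (T L io e)).
Proof. by move=> dT; split => //=; apply: tdef_0. Qed.
Lemma cdef_0 : cdef (fun L _ _ => 0).
Proof. by split; apply: tdef_0. Qed.
Lemma cdef_1 : cdef (fun L _ _ => 1).
Proof. by split; [apply: tdef_1|apply: tdef_0]. Qed.
Lemma cdef_exp (z : cfam) m : cdef z -> cdef (fun L io e => z L io e ^+ m).
Proof.
move=> dz; elim: m => [|m IH]; first exact: cdef_1.
by apply: cdef_ext (cdef_mul dz IH) => L io e; rewrite exprS.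
Qed.
Lemma cdef_sum (I : Type) (s : seq I) (T : I -> cfam) :
  (forall i, cdef (T i)) -> cdef (fun L io e => \sum_(i <- s) T i L io e).
Proof.
move=> TP; elim: s => [|i s IH].
  by apply: cdef_ext cdef_0 => L io e; rewrite big_nil.
by apply: cdef_ext (cdef_add (TP i) IH) => L io e; rewrite big_cons.
Qed.
Lemma cdef_prod (I : Type) (s : seq I) (T : I -> cfam) :
  (forall i, cdef (T i)) -> cdef (fun L io e => \prod_(i <- s) T i L io e).
Proof.
move=> TP; elim: s => [|i s IH].
  by apply: cdef_ext cdef_1 => L io e; rewrite big_nil.
by apply: cdef_ext (cdef_mul (TP i) IH) => L io e; rewrite big_cons.
Qed.
Lemma def_eqc (z w : cfam) : cdef z -> cdef w -> def (fun L io e => z L io e = w L io e).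
Proof.
move=> [z1 z2] [w1 w2]; apply: def_ext (def_and (def_eq z1 w1) (def_eq z2 w2)) => L io e.
by case: (z L io e) (w L io e) => a b [c d] /=; split => [[-> ->]|[-> ->]].
Qed.

(** The imaginary part occupies the first places and the real part the next ones, because [def_exC]
    quantifies the real part outermost. *)
Definition cvmx (L : rcfType) p q (e : nat -> L) : 'M[complex L]_(p, q) :=
  \matrix_(i, j) Complex (vmx p q (vsh (p * q) e) i j) (vmx p q e i j).

Lemma cmdef_cvmx p q (f : nat -> nat) :
  cmdef (fun (L : rcfType) (_ : {rmorphism K -> L}) e => cvmx p q (fun i => e (f i))).
Proof.
move=> i j; split.
  apply: tdef_ext (mdef_vmx (fun k => f (p * q + k)%N) i j) => L io e.
  by rewrite !mxE.
by apply: tdef_ext (mdef_vmx f i j) => L io e; rewrite !mxE.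
Qed.
Lemma cmdef_entry p q (M : cmxfam p q) i j : cmdef M -> cdef (fun L io e => M L io e i j).
Proof. exact. Qed.
Lemma cmdef_mul p q r (M : cmxfam p q) (N : cmxfam q r) : cmdef M -> cmdef N ->
  cmdef (fun L io e => M L io e *m N L io e).
Proof.
move=> dM dN i j; apply: cdef_ext (cdef_sum (index_enum 'I_q)
  (fun k => cdef_mul (dM i k) (dN k j))) => L io e; rewrite mxE //.
Qed.
Lemma cmdef_sub p q (M N : cmxfam p q) : cmdef M -> cmdef N ->
  cmdef (fun L io e => M L io e - N L io e).
Proof.
move=> dM dN i j; apply: cdef_ext (cdef_add (dM i j) (cdef_opp (dN i j))) => L io e.
by rewrite !mxE.
Qed.
Lemma cmdef_tr p q (M : cmxfam p q) : cmdef M -> cmdef (fun L io e => (M L io e)^T).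
Proof. by move=> dM i j; apply: cdef_ext (dM j i) => L io e; rewrite mxE. Qed.
Lemma cmdef_1 p : cmdef (fun L _ _ => 1%:M : 'M[complex L]_p).
Proof.
move=> i j; case ij: (i == j); first by apply: cdef_ext cdef_1 => L io e; rewrite mxE ij.
by apply: cdef_ext cdef_0 => L io e; rewrite mxE ij.
Qed.
Lemma cmdef_real p q (M : mxfam p q) : mdef M ->
  cmdef (fun L io e => map_mx (@real_complex L) (M L io e)).
Proof. by move=> dM i j; apply: cdef_ext (cdef_real (dM i j)) => L io e; rewrite mxE. Qed.
Lemma def_eqcmx p q (M N : cmxfam p q) : cmdef M -> cmdef N ->
  def (fun L io e => M L io e = N L io e).
Proof.
move=> dM dN; apply: def_ext (def_forall_fin (fun i => def_forall_fin
  (fun j => def_eqc (dM i j) (dN i j)))) => L io e.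
by split=> [-> //|h]; apply/matrixP.
Qed.

Definition cio (L : rcfType) (io : {rmorphism K -> L}) : {rmorphism K -> complex L} :=
  @real_complex L \o io.

Lemma cdef_mxeval n (p : mxpol K n) (M : cmxfam n n) : cmdef M ->
  cdef (fun L io e => mxeval (cio io) p (M L io e)).
Proof.
move=> dM; apply: (@cdef_ext (fun L io e => \sum_(m <- msupp p) cio io (mcoeff m p) *
   \prod_(k < n * n) mxvec (M L io e) 0 k ^+ m k)).
  by move=> L io e; rewrite mxevalE.
apply: cdef_sum => m; apply: cdef_mul.
  by apply: cdef_real; apply: tdef_const.
apply: cdef_prod => k; apply: cdef_exp.
case/mxvec_indexP: k => i j; apply: cdef_ext (dM i j) => L io e.
by rewrite mxvecE.
Qed.

Lemma def_exC p q (B : forall L : rcfType, {rmorphism K -> L} -> (nat -> L) ->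
    'M[complex L]_(p, q) -> Prop) :
  def (fun L io e => B L io (vsh (p * q) (vsh (p * q) e)) (cvmx p q e)) ->
  def (fun L io e => exists M, B L io e M).
Proof.
move=> dB; suff : def (fun L io e => exists X : 'M[L]_(p, q), exists Y : 'M[L]_(p, q),
    B L io e (\matrix_(i, j) Complex (X i j) (Y i j))).
  apply: def_ext => L io e; split=> [[M BM]|[X [Y BXY]]]; last by eexists; eassumption.
  exists (map_mx (@complex.Re L) M), (map_mx (@complex.Im L) M).
  rewrite (_ : \matrix_(_, _) _ = M) //; apply/matrixP => i j; rewrite !mxE.
  by case: (M i j).
by apply: def_exM; apply: def_exM.
Qed.

Lemma def_allC p q (B : forall L : rcfType, {rmorphism K -> L} -> (nat -> L) ->
    'M[complex L]_(p, q) -> Prop) :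
  def (fun L io e => B L io (vsh (p * q) (vsh (p * q) e)) (cvmx p q e)) ->
  def (fun L io e => forall M, B L io e M).
Proof.
move=> h; have := def_not (def_exC (B := fun L io e M => ~ B L io e M) (def_not h)).
apply: def_ext => L io e; split=> [h1 [M]|h1 M]; first by apply.
by apply: contrapT => h2; apply: h1; exists M.
Qed.

Lemma def_points n (V : seq (mxpol K n)) (M : mxfam n n) : mdef M ->
  def (fun L io e => points io V (M L io e)).
Proof.
move=> dM; suff : def (fun L io e => all (fun p => mxeval io p (M L io e) == 0) V).
  apply: def_ext => L io e; split=> [h|/allP h p pV]; last exact/eqP/h.
  by apply/allP => p pV; apply/eqP/h.
elim: V => [|p V IH]; first by apply: def_ext (def_true _) => L io e.
apply: def_ext (def_and (def_eq (tdef_mxeval p dM) (tdef_0 K)) IH) => L io e /=.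
by split => [/andP[/eqP]|[-> ->]]; rewrite ?eqxx.
Qed.

Lemma def_cpoints n (V : seq (mxpol K n)) (M : cmxfam n n) : cmdef M ->
  def (fun L io e => points (cio io) V (M L io e)).
Proof.
move=> dM; suff : def (fun L io e => all (fun p => mxeval (cio io) p (M L io e) == 0) V).
  apply: def_ext => L io e; split=> [h|/allP h p pV]; last exact/eqP/h.
  by apply/allP => p pV; apply/eqP/h.
elim: V => [|p V IH]; first by apply: def_ext (def_true _) => L io e.
apply: def_ext (def_and (def_eqc (cdef_mxeval p dM) cdef_0) IH) => L io e /=.
by split => [/andP[/eqP]|[-> ->]]; rewrite ?eqxx.
Qed.

Lemma def_sa_ext n (V : saform K n) (M : mxfam n n) : mdef M ->
  def (fun L io e => sa_ext io V (M L io e)).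
Proof.
move=> dM; suff : def (fun L io e => has (fun c : seq (mxpol K n) * seq (mxpol K n) =>
    all (fun p => mxeval io p (M L io e) == 0) c.1 &&
    all (fun p => 0 < mxeval io p (M L io e)) c.2) V).
  apply: def_ext => L io e; split=> [[c cV [h1 h2]]|/hasP[c cV /andP[/allP h1 /allP h2]]].
    by apply/hasP; exists c => //; apply/andP; split; apply/allP => p pV; [apply/eqP/h1|apply/h2].
  by exists c => //; split=> p pV; [apply/eqP/h1|apply/h2].
elim: V => [|c V IH]; first by apply: def_ext (def_false _) => L io e.
suff h : def (fun L io e => all (fun p => mxeval io p (M L io e) == 0) c.1 &&
    all (fun p => 0 < mxeval io p (M L io e)) c.2).
  by apply: def_ext (def_or h IH) => L io e /=; split => /orP.
suff [h1 h2] : def (fun L io e => all (fun p => mxeval io p (M L io e) == 0) c.1) /\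
    def (fun L io e => all (fun p => 0 < mxeval io p (M L io e)) c.2).
  by apply: def_ext (def_and h1 h2) => L io e /=; split => /andP.
split.
  elim: c.1 => [|p s IHs]; first by apply: def_ext (def_true _) => L io e.
  apply: def_ext (def_and (def_eq (tdef_mxeval p dM) (tdef_0 K)) IHs) => L io e /=.
  by split => [/andP[/eqP]|[-> ->]]; rewrite ?eqxx.
elim: c.2 => [|p s IHs]; first by apply: def_ext (def_true _) => L io e.
apply: def_ext (def_and (def_lt (tdef_0 K) (tdef_mxeval p dM)) IHs) => L io e /=.
by split=> [/andP|h]; last exact/andP.
Qed.

End DefMx.

Ltac def_step :=
  first
  [ exact: def_true | exact: def_false
  | apply: def_iff | apply: def_and | apply: def_or | apply: def_not
  | apply: def_sa_ext | apply: def_cpoints | apply: def_points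
  | apply: def_imp
  | apply: def_allM | apply: def_exM | apply: def_allC | apply: def_exC
  | apply: def_allS | apply: def_exS
  | apply: def_forall_fin => ? | apply: def_exists_fin => ?
  | apply: def_eqmx | apply: def_eqcmx | apply: def_eqc | apply: def_eq
  | apply: def_normlt | apply: def_lt | apply: def_le
  | apply: mdef_vmx | apply: mdef_const | apply: mdef_1 | apply: mdef_0
  | apply: mdef_tr | apply: mdef_mul | apply: mdef_sub
  | apply: cmdef_cvmx | apply: cmdef_real | apply: cmdef_1 | apply: cmdef_tr
  | apply: cmdef_mul | apply: cmdef_sub
  | apply: tdef_det | apply: tdef_mxeval | apply: cdef_mxeval
  | apply: tdef_0 | apply: tdef_1 | apply: tdef_const | apply: tdef_add
  | apply: tdef_opp | apply: tdef_mul | exact: tdef_var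
  | apply: mdef_entry | apply: cmdef_entry
  | match goal with |- tdef (fun L io e => complex.Re _) => refine (proj1 (_ : cdef _)) end
  | match goal with |- tdef (fun L io e => complex.Im _) => refine (proj2 (_ : cdef _)) end ].
Ltac definable := rewrite /vsh /=; repeat def_step.

(** * Characters, tori and Zariski connectedness *)

Section Artin.
Variables (C : fieldType) (E : Type) (op : E -> E -> E) (one : E).
Variables (I : finType) (chi : I -> E -> C).
Hypothesis chiM : forall i a b, chi i (op a b) = chi i a * chi i b.
Hypothesis chi1 : forall i, chi i one = 1.

(** Independence of distinct characters makes the coefficients over each class of equal characters
    sum to 0, and a [Phi] constant on the classes sees nothing else. The induction is on the number
    of characters: an element a that separates two of them splits the index set into strictly
    smaller parts. *)
Lemma artin_fin (c Phi : I -> C) :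
  (forall e, \sum_i c i * chi i e = 0) ->
  (forall i j, (forall e, chi i e = chi j e) -> Phi i = Phi j) ->
  \sum_i c i * Phi i = 0.
Proof.
move=> h hP.
suff gen (m : nat) (J : {set I}) (d Psi : I -> C) : (#|J| <= m)%N ->
    (forall e, \sum_(i in J) d i * chi i e = 0) ->
    {in J &, forall i j, (forall e, chi i e = chi j e) -> Psi i = Psi j} ->
    \sum_(i in J) d i * Psi i = 0.
  have eT (F : I -> C) : \sum_(i in [set: I]) F i = \sum_i F i.
    by apply: eq_bigl => i; rewrite inE.
  have := gen #|[set: I]| [set: I] c Phi (leqnn _).
  by rewrite !eT; apply => // [e|i j _ _]; [rewrite eT|apply: hP].
elim: m J d Psi => [|m IH] J d Psi.
  by rewrite leqn0 cards_eq0 => /eqP -> _ _; rewrite big_set0.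
move=> Jm hd hPsi.
have [allE|] := pselect {in J &, forall i j, forall e, chi i e = chi j e}.
  have [->|[i0 i0J]] := set_0Vmem J; first by rewrite big_set0.
  rewrite (eq_bigr (fun i => d i * chi i one * Psi i0)).
    by rewrite -big_distrl /= hd mul0r.
  by move=> i iJ; rewrite chi1 mulr1 (hPsi i i0) // => e; apply: allE.
move=> /existsNP[i0 /existsNP[j0 /not_implyP[i0J /not_implyP[j0J /existsNP[a /eqP nij]]]]].
pose J1 := [set i in J | chi i a != chi i0 a].
pose J0 := [set i in J | chi i a == chi i0 a].
have split (F : I -> C) : \sum_(i in J) F i = \sum_(i in J0) F i + \sum_(i in J1) F i.
  rewrite (bigID (fun i => chi i a == chi i0 a)) /=; congr (_ + _);
  by apply: eq_bigl => i; rewrite inE.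
have J1m : (#|J1| <= m)%N.
  rewrite -ltnS (leq_trans _ Jm) // proper_card //; apply/properP.
  by split; [apply/fintype.subsetP => i; rewrite inE => /andP[]|exists i0; rewrite ?inE ?eqxx ?andbF].
have J0m : (#|J0| <= m)%N.
  rewrite -ltnS (leq_trans _ Jm) // proper_card //; apply/properP.
  split; [by apply/fintype.subsetP => i; rewrite inE => /andP[]|exists j0 => //].
  by rewrite inE eq_sym (negbTE nij) andbF.
have h1 Psi1 : {in J1 &, forall i j, (forall e, chi i e = chi j e) -> Psi1 i = Psi1 j} ->
    \sum_(i in J1) d i * Psi1 i = 0.
  move=> hPsi1.
  (* Replacing e by [op a e] and subtracting [chi i0 a] times the original relation removes [J0] and
     multiplies the other terms by [chi i a - chi i0 a], nonzero on [J1]; the weight is divided by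
     this factor in return. *)
  rewrite (eq_bigr (fun i => (d i * (chi i a - chi i0 a)) * (Psi1 i / (chi i a - chi i0 a)))).
    apply: IH => // [e|i j iJ jJ ij]; last by rewrite (hPsi1 i j iJ jJ ij) ij.
    transitivity (\sum_(i in J) (d i * chi i (op a e) - d i * chi i e * chi i0 a)).
      have z : \sum_(i in J0) (d i * chi i (op a e) - d i * chi i e * chi i0 a) = 0.
        by apply: big1 => i; rewrite inE => /andP[_ /eqP ia]; rewrite chiM ia; ring.
      rewrite split z add0r.
      by apply: eq_bigr => i _; rewrite chiM; ring.
    by rewrite sumrB -big_distrl /= !hd mul0r subrr.
  move=> i; rewrite inE => /andP[_ ne].
  by move: ne; rewrite -subr_eq0; move: (chi i a - _) => b b0; field.
have sub01 i : (i \in J0) || (i \in J1) -> i \in J by rewrite !inE -andb_orr => /andP[].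
have z1 : \sum_(i in J1) d i * Psi i = 0.
  by apply: h1 => i j iJ jJ; apply: hPsi; apply: sub01; rewrite ?iJ ?jJ ?orbT.
rewrite split z1 addr0; apply: IH => // [e|i j iJ jJ]; last by apply: hPsi; apply: sub01; rewrite ?iJ ?jJ.
have := hd e; rewrite split (h1 (fun i => chi i e)) ?addr0 // => i j _ _; exact.
Qed.

End Artin.

(* Independence of characters, for a family that may contain repetitions. *)
Lemma artin (C : fieldType) (E : Type) (op : E -> E -> E) (one : E)
    (T : Type) (s : seq T) (c : T -> C) (chi : T -> E -> C) (Phi : T -> C) :
  (forall i a b, chi i (op a b) = chi i a * chi i b) ->
  (forall i, chi i one = 1) ->
  (forall e, \sum_(i <- s) c i * chi i e = 0) ->
  (forall i j, (forall e, chi i e = chi j e) -> Phi i = Phi j) ->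
  \sum_(i <- s) c i * Phi i = 0.
Proof.
move=> chiM chi1 h hP; rewrite big_tnth.
pose t i := tnth (in_tuple s) i.
have h' e : \sum_i c (t i) * chi (t i) e = 0 by rewrite -[RHS](h e) [RHS]big_tnth.
by apply: (@artin_fin C E op one _ (fun i => chi (t i)) _ _
  (fun i => c (t i)) (fun i => Phi (t i)) h') => // i j; apply: hP.
Qed.

(** Polynomial functions as an inductive predicate: closure under composition, determinants or
    passage to real and imaginary parts needs no polynomial arithmetic, and an actual polynomial is
    recovered only where one is required. *)
Inductive palg (C : pzRingType) (I X : Type) (x : I -> X -> C) : (X -> C) -> Prop :=
| palg_const c : palg x (fun=> c)
| palg_coord i : palg x (x i)
| palg_add f g : palg x f -> palg x g -> palg x (fun y => f y + g y)
| palg_mul f g : palg x f -> palg x g -> palg x (fun y => f y * g y).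

Section Palg.
Variables (C : comNzRingType) (I X : Type) (x : I -> X -> C).

Lemma palg_ext f g : (forall y, g y = f y) -> palg x f -> palg x g.
Proof. by move=> /funext ->. Qed.

Lemma palg_sum (J : Type) (s : seq J) (P : pred J) (F : J -> X -> C) :
  (forall j, palg x (F j)) -> palg x (fun y => \sum_(j <- s | P j) F j y).
Proof.
move=> hF; elim: s => [|j s IH].
  by apply: palg_ext (palg_const _ 0) => y; rewrite big_nil.
case Pj: (P j); last by apply: palg_ext IH => y; rewrite big_cons Pj.
by apply: palg_ext (palg_add (hF j) IH) => y; rewrite big_cons Pj.
Qed.

Lemma palg_prod (J : Type) (s : seq J) (P : pred J) (F : J -> X -> C) :
  (forall j, palg x (F j)) -> palg x (fun y => \prod_(j <- s | P j) F j y).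
Proof.
move=> hF; elim: s => [|j s IH].
  by apply: palg_ext (palg_const _ 1) => y; rewrite big_nil.
case Pj: (P j); last by apply: palg_ext IH => y; rewrite big_cons Pj.
by apply: palg_ext (palg_mul (hF j) IH) => y; rewrite big_cons Pj.
Qed.

Lemma palg_exp f m : palg x f -> palg x (fun y => f y ^+ m).
Proof.
move=> hf; elim: m => [|m IH]; first exact: palg_const.
by apply: palg_ext (palg_mul hf IH) => y; rewrite exprS.
Qed.

Lemma palg_opp f : palg x f -> palg x (fun y => - f y).
Proof.
by move=> hf; apply: palg_ext (palg_mul (palg_const x (-1)) hf) => y; rewrite mulN1r.
Qed.

Lemma palg_sub f g : palg x f -> palg x g -> palg x (fun y => f y - g y).
Proof. by move=> hf hg; apply: palg_add => //; apply: palg_opp. Qed.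

Lemma palg_comp (J Y : Type) (z : J -> Y -> C) (h : Y -> X) f :
  (forall i, palg z (fun y => x i (h y))) -> palg x f -> palg z (fun y => f (h y)).
Proof.
move=> hx; elim => [c|i|g g' _ hg _ hg'|g g' _ hg _ hg'] //.
- exact: palg_const.
- exact: palg_add.
- exact: palg_mul.
Qed.

Definition mpalg p q (M : X -> 'M[C]_(p, q)) := forall i j, palg x (fun y => M y i j).

Lemma mpalg_mul p q r (M : X -> 'M[C]_(p, q)) (N : X -> 'M[C]_(q, r)) :
  mpalg M -> mpalg N -> mpalg (fun y => M y *m N y).
Proof.
move=> hM hN i j; apply: palg_ext (palg_sum _ _ (fun k => palg_mul (hM i k) (hN k j))).
by move=> y; rewrite mxE.
Qed.
Lemma mpalg_const p q (M : 'M[C]_(p, q)) : mpalg (fun=> M).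
Proof. by move=> i j; apply: palg_const. Qed.
Lemma mpalg_tr p q (M : X -> 'M[C]_(p, q)) : mpalg M -> mpalg (fun y => (M y)^T).
Proof. by move=> hM i j; apply: palg_ext (hM j i) => y; rewrite mxE. Qed.
Lemma palg_det p (M : X -> 'M[C]_p) : mpalg M -> palg x (fun y => \det (M y)).
Proof.
move=> hM; rewrite /determinant; apply: palg_sum => s; apply: palg_mul.
  exact: palg_const.
by apply: palg_prod.
Qed.
Lemma mpalg_adj p (M : X -> 'M[C]_p) : mpalg M -> mpalg (fun y => \adj (M y)).
Proof.
move=> hM i j; apply: (@palg_ext (fun y => (-1) ^+ (j + i) * \det (row' j (col' i (M y))))).
  by move=> y; rewrite mxE.
apply: palg_mul; first exact: palg_const.
by apply: palg_det => a b; apply: palg_ext (hM (lift j a) (lift i b)) => y; rewrite !mxE.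
Qed.

End Palg.

Section PalgMx.
Variables (K C : fieldType) (io : {rmorphism K -> C}) (n : nat).

Definition mxcoord (ij : 'I_n * 'I_n) (g : 'M[C]_n) : C := g ij.1 ij.2.

Lemma mpalg_id : mpalg mxcoord (fun g => g).
Proof. by move=> i j; apply: (palg_coord mxcoord (i, j)). Qed.

Lemma palg_mxeval (I X : Type) (x : I -> X -> C) (p : mxpol K n) (M : X -> 'M[C]_n) :
  mpalg x M -> palg x (fun y => mxeval io p (M y)).
Proof.
move=> hM; apply: (palg_ext (fun y => mxevalE io p (M y))).
apply: palg_sum => m; apply: palg_mul; first exact: palg_const.
apply: palg_prod => k; apply: palg_exp.
by case/mxvec_indexP: k => i j; apply: palg_ext (hM i j) => y; rewrite mxvecE.
Qed.

Lemma mxevalC (c : K) (g : 'M[C]_n) : mxeval io (mpolyC _ c) g = io c.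
Proof. by rewrite /mxeval map_mpolyC mevalC. Qed.
Lemma mxevalX i j (g : 'M[C]_n) : mxeval io (mpolyX _ (mnm1 (mxvec_index i j))) g = g i j.
Proof. by rewrite /mxeval map_mpolyX mevalXU mxvecE. Qed.
Lemma mxevalD (p q : mxpol K n) (g : 'M[C]_n) :
  mxeval io (p + q) g = mxeval io p g + mxeval io q g.
Proof. by rewrite /mxeval !rmorphD. Qed.
Lemma mxevalM (p q : mxpol K n) (g : 'M[C]_n) :
  mxeval io (p * q) g = mxeval io p g * mxeval io q g.
Proof. by rewrite /mxeval !rmorphM. Qed.

End PalgMx.

Section Powers.
Variables (C : fieldType) (N : nat).

Definition rvcoord (i : 'I_N) (v : 'rV[C]_N) : C := v 0 i.
Definition mpow (v : 'rV[C]_N) (m : multinom N) : C := \prod_i v 0 i ^+ m i.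

Lemma palg_mpoly f : palg rvcoord f ->
  exists q : mpoly N C, forall v, f v = \sum_(m <- msupp q) mcoeff m q * mpow v m.
Proof.
move=> hf; suff [q qE] : exists q : mpoly N C, forall v, f v = meval (v 0) q.
  by exists q => v; rewrite qE mevalE.
elim: hf => [c|i|g g' _ [q qE] _ [q' qE']|g g' _ [q qE] _ [q' qE']].
- by exists (mpolyC _ c) => v; rewrite mevalC.
- by exists (mpolyX _ (mnm1 i)) => v; rewrite mevalXU.
- by exists (q + q') => v; rewrite mevalD qE qE'.
- by exists (q * q') => v; rewrite mevalM qE qE'.
Qed.

(** Each monomial gives a character of the monoid E through v, so a polynomial vanishing on E is a
    vanishing combination of characters. It then vanishes at every w at which monomials that agree
    on E still agree: the closure of such a monoid is cut out by binomials. *)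
Lemma palg_artin (E : Type) (op : E -> E -> E) (one : E) (v : E -> 'rV[C]_N)
    (f : 'rV[C]_N -> C) (w : 'rV[C]_N) :
  palg rvcoord f ->
  (forall a b i, v (op a b) 0 i = v a 0 i * v b 0 i) ->
  (forall i, v one 0 i = 1) ->
  (forall e, f (v e) = 0) ->
  (forall m m', (forall e, mpow (v e) m = mpow (v e) m') -> mpow w m = mpow w m') ->
  f w = 0.
Proof.
move=> /palg_mpoly[q qE] vM v1 fv hw; rewrite qE.
apply: (@artin C E op one _ _ (fun m => mcoeff m q) (fun m e => mpow (v e) m) (mpow w)) => //.
- by move=> m a b; rewrite /mpow -big_split /=; apply: eq_bigr => i _; rewrite vM exprMn.
- by move=> m; rewrite /mpow big1 // => i _; rewrite v1 expr1n.
- by move=> e; rewrite -qE fv.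
Qed.

(** The monoid is the additive monoid of natural numbers, acting through the powers of v. *)
Lemma palg_powers (f : 'rV[C]_N -> C) (v w : 'rV[C]_N) :
  palg rvcoord f -> (forall k : nat, f (\row_i v 0 i ^+ k) = 0) ->
  (forall m m', mpow v m = mpow v m' -> mpow w m = mpow w m') -> f w = 0.
Proof.
move=> hf fv hw; apply: (@palg_artin nat addn 0%N (fun k => \row_i v 0 i ^+ k)) => //.
- by move=> a b i; rewrite !mxE exprD.
- by move=> i; rewrite mxE.
- move=> m m' h; apply: hw; have := h 1%N; rewrite /mpow.
  under eq_bigr do rewrite mxE expr1; move=> ->.
  by under eq_bigr do rewrite mxE expr1.
Qed.

Lemma mpalg_diag n (P Q : 'M[C]_(n, N)) :
  mpalg rvcoord (fun v => P *m diag_mx v *m Q^T).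
Proof.
apply: mpalg_mul; last exact: mpalg_const.
apply: mpalg_mul; first exact: mpalg_const.
move=> i j; case ij: (i == j).
  apply: palg_ext (palg_coord rvcoord j) => v.
  by rewrite mxE ij (eqP ij) mulr1n.
by apply: palg_ext (palg_const _ 0) => v; rewrite mxE ij mulr0n.
Qed.

End Powers.

Lemma diag_conj_horner (K : fieldType) n (P : 'M[K]_n.+1) (d : 'rV[K]_n.+1) (p : {poly K}) :
  P \in unitmx -> horner_mx (invmx P *m diag_mx d *m P) p =
  invmx P *m diag_mx (map_mx (horner p) d) *m P.
Proof.
move=> uP; have uV : invmx P \in unitmx by rewrite unitmx_inv.
by have := mxpoly.horner_mx_uconj p (diag_mx d) uV; rewrite invmxK mxpoly.horner_mx_diag.
Qed.

(* The minimal polynomial divides the product of the linear factors given by the spectral theorem over K[i]. *)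
Lemma symmetric_diagonalizable (K : rcfType) n (g : 'M[K]_n) : g^T = g ->
  exists2 P : 'M[K]_n, P \in unitmx & exists d, g = invmx P *m diag_mx d *m P.
Proof.
case: n g => [|n] g gT.
  by exists 1%:M; [rewrite unitmx1|exists 0; apply/matrixP => -[]].
suff : exists2 rs : seq K, uniq rs & (mxminpoly g %| \prod_(x <- rs) ('X - x%:P))%R.
  move=> /mxpoly.diagonalizableP[P uP /(mxpoly.diagonalizable_forLR uP)[d gE]].
  by exists P => //; exists d; rewrite gE mxpoly.conjumx ?unitmx_inv // invmxK.
pose gc := map_mx (@real_complex K) g.
have herm : gc \is hermsymmx.
  apply: spectral.realsym_hermsym.
    by apply/is_hermitianmxP; rewrite expr0 scale1r map_mx_id // /gc map_trmx gT.
  apply/mxOverP => i j; rewrite mxE.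
  by apply/complex.complex_realP; exists (g i j).
have /spectral.orthomx_spectralP := spectral.hermitian_normalmx herm.
have uP := spectral.spectral_unit gc.
have /mxOverP dreal := spectral.hermitian_spectral_diag_real herm.
set P := spectral.spectralmx gc in uP *; set d := spectral.spectral_diag gc in dreal * => gE.
pose r := \row_i complex.Re (d 0 i).
have dE : d = map_mx (@real_complex K) r.
  by apply/rowP => i; rewrite !mxE complex.RRe_real // dreal.
exists (undup [seq r 0 i | i <- enum 'I_n.+1]); first exact: undup_uniq.
apply: mxpoly.mxminpoly_min; set p := \prod_(x <- _) _.
apply: (map_mx_inj (f := @real_complex K)); rewrite map_mx0.
rewrite mxpoly.map_horner_mx -/gc gE (diag_conj_horner _ _ uP).
rewrite (_ : map_mx _ d = 0) ?raddf0 ?mulmx0 ?mul0mx //.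
apply/rowP => i; rewrite !mxE dE mxE horner_map /=.
suff /rootP -> : root p (r 0 i) by rewrite rmorph0.
by rewrite /p root_prod_XsubC mem_undup map_f ?mem_enum.
Qed.

(** A finite family taken from Z with the largest possible rank spans Z; no closure property of Z is
    involved. *)
Lemma rank_set (F : fieldType) N (Z : 'rV[F]_N -> Prop) :
  exists k (X : 'M[F]_(k, N)), (forall i, Z (row i X)) /\
    forall z, Z z -> (z <= X)%MS.
Proof.
pose P r := `[< exists k (X : 'M[F]_(k, N)), (forall i, Z (row i X)) /\ \rank X = r >].
have P0 : exists r, P r.
  by exists 0; apply/asboolP; exists 0, 0; split; [case|rewrite mxrank0].
have PN r : P r -> (r <= N)%N by move/asboolP => [k [X [_ <-]]]; apply: rank_leq_col.
have [r /asboolP[k [X [XZ rX]]] rmax] := ex_maxnP P0 PN.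
exists k, X; split=> // z Zz; apply: contrapT => /negP nz.
suff /rmax : P (\rank (col_mx X z)).
  rewrite -addsmxE leqNgt -rX => /negP; apply.
  have : (X < X + z)%MS by rewrite /ltmx addsmxSl addsmx_sub (negbTE nz) andbF.
  by rewrite ltmxErank => /andP[].
apply/asboolP; exists (k + 1)%N, (col_mx X z); split => // i.
by rewrite -(splitK i); case: (fintype.split i) => j /=; rewrite ?rowKu ?rowKd // row_id.
Qed.

(** * Saturated sublattices of the character lattice *)

Section Lattice.
Variables (n : nat) (M : 'rV[int]_n -> Prop).
Hypothesis M0 : M 0.
Hypothesis MD : forall a b, M a -> M b -> M (a + b).
Hypothesis MN : forall a, M a -> M (- a).
Hypothesis M_sat : forall (k : int) a, k != 0 -> M (k *: a) -> M a.

Lemma lattice_scale (k : int) a : M a -> M (k *: a).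
Proof.
move=> Ma; have Mnat (m : nat) : M (m%:Z *: a).
  by elim: m => [|m IH]; rewrite ?scale0r // intS scalerDl scale1r; apply: MD.
by case: k => m; rewrite ?NegzE ?scaleNr; [apply: Mnat|apply/MN/Mnat].
Qed.

Lemma lattice_comb k (X : 'M[int]_(k, n)) (c : 'rV[int]_k) :
  (forall i, M (row i X)) -> M (c *m X).
Proof.
move=> XM; rewrite mulmx_sum_row.
by elim/big_rec: _ => // i a _ Ma; apply: MD => //; apply: lattice_scale.
Qed.

(** Finitely many elements of M, the rows of [N0], span it over the rationals. In the Smith form
    [N0] = L D R, a row of R with nonzero invariant factor has a multiple in M, hence lies in M by
    saturation; the coordinates along the other rows vanish on M since M is in the rational span of
    [N0]. *)
Lemma lattice_basis : exists2 R : 'M[int]_n, R \in unitmx & exists J : pred 'I_n,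
  (forall j, J j -> M (row j R)) /\
  forall m, M m -> forall j, ~~ J j -> (m *m invmx R) 0 j = 0.
Proof.
pose toQ p q (A : 'M[int]_(p, q)) : 'M[rat]_(p, q) := map_mx intr A.
have [k [X [XM Xmax]]] := rank_set (fun z => exists2 m, M m & z = toQ 1%N n m).
have /choice[Y YP] : forall i, exists m, M m /\ row i X = toQ 1%N n m.
  by move=> i; have [m Mm mE] := XM i; exists m.
pose N0 := \matrix_i Y i.
have N0M i : M (row i N0) by rewrite rowK; case: (YP i).
have XE : X = toQ k n N0.
  by apply/row_matrixP => i; rewrite /toQ -map_row rowK; case: (YP i).
have [L uL [R uR [d _ N0E]]] := int_Smith_normal_form N0.
exists R => //; set D := \matrix_(i, j) _ in N0E.
pose J (j : 'I_n) := (j < k)%N && (d`_j != 0).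
exists J; split=> [j /andP[jk dj]|m Mm j Jj].
  pose i := Ordinal jk; apply: (@M_sat d`_j) => //.
  have -> : d`_j *: row j R = row i (invmx L) *m N0.
    rewrite -row_mul N0E -!mulmxA mulKmx // row_mul; apply/rowP => l; rewrite !mxE (bigD1 j) //= big1 => [|j' ne].
      by rewrite !mxE eqxx mulr1n addr0.
    by rewrite !mxE eq_sym (negbTE (ne : j' != j :> nat)) mulr0n mul0r.
  exact: lattice_comb.
have /submxP[y yE] : (toQ 1%N n m <= X)%MS by apply: Xmax; exists m.
apply: (@intr_inj rat); rewrite rmorph0.
have : toQ 1%N n (m *m invmx R) = y *m toQ k k L *m toQ k n D.
  rewrite /toQ map_mxM -/(toQ 1%N n m) yE XE N0E /toQ !map_mxM -!mulmxA -map_mxM.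
  by rewrite mulmxV // map_mx1 mulmx1.
move=> /matrixP/(_ 0 j); rewrite !mxE => ->; apply: big1 => i _.
rewrite /toQ !mxE; case: eqP => ij; last by rewrite mulr0n rmorph0 mulr0.
by move: Jj; rewrite /J -ij ltn_ord /= negbK => /eqP ->; rewrite mul0rn rmorph0 mulr0.
Qed.
End Lattice.

(** * Characters and monomial maps of the diagonal torus *)

Section Monomials.
Variables (C : fieldType) (n : nat).
Implicit Types (z w : 'rV[C]_n) (m : 'rV[int]_n) (B : 'M[int]_n).

Definition zpow z m : C := \prod_i z 0 i ^ m 0 i.
(** The endomorphism of the diagonal torus attached to an integer matrix; a unimodular matrix gives
    an automorphism. *)
Definition mono B z : 'rV[C]_n := \row_i zpow z (row i B).
Definition nz z := forall i, z 0 i != 0.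

Lemma zpow0 z : zpow z 0 = 1.
Proof. by rewrite /zpow big1 // => i _; rewrite mxE expr0z. Qed.

Lemma zpowD z m m' : nz z -> zpow z (m + m') = zpow z m * zpow z m'.
Proof.
by move=> z0; rewrite /zpow -big_split /=; apply: eq_bigr => i _; rewrite mxE expfzDr.
Qed.

Lemma zpowZ z (k : int) m : zpow z (k *: m) = zpow z m ^ k.
Proof.
rewrite /zpow; elim/big_ind2: _ => [|x y x' y' -> ->|i _]; first by rewrite exp1rz.
  by rewrite expfzMl.
by rewrite mxE exprz_exp mulrC.
Qed.

Lemma zpow_neq0 z m : nz z -> zpow z m != 0.
Proof. by move=> z0; apply/prodf_neq0 => i _; apply: expfz_neq0. Qed.

Lemma zpowN z m : nz z -> zpow z (- m) = (zpow z m)^-1.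
Proof. by move=> z0; rewrite -scaleN1r zpowZ exprN1. Qed.

Lemma zpow_sum z (I : Type) (s : seq I) (F : I -> 'rV[int]_n) : nz z ->
  zpow z (\sum_(i <- s) F i) = \prod_(i <- s) zpow z (F i).
Proof.
move=> z0; elim: s => [|i s IH]; first by rewrite !big_nil zpow0.
by rewrite !big_cons zpowD // IH.
Qed.

Lemma nz_mono B z : nz z -> nz (mono B z).
Proof. by move=> z0 i; rewrite mxE zpow_neq0. Qed.

Lemma zpow_mono B z m : nz z -> zpow (mono B z) m = zpow z (m *m B).
Proof.
move=> z0; rewrite mulmx_sum_row zpow_sum //.
by apply: eq_bigr => i _; rewrite zpowZ mxE.
Qed.

Lemma zpow_delta z i : zpow z (delta_mx 0 i) = z 0 i.
Proof.
rewrite /zpow (bigD1 i) //= big1 ?mulr1 ?mxE ?eqxx ?expr1z // => j ji.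
by rewrite mxE (negbTE ji) andbF expr0z.
Qed.

Lemma mono_mono B B' z : nz z -> mono B (mono B' z) = mono (B *m B') z.
Proof. by move=> z0; apply/rowP => i; rewrite !mxE zpow_mono // row_mul. Qed.

Lemma mono1 z : mono 1%:M z = z.
Proof. by apply/rowP => i; rewrite mxE row1 zpow_delta. Qed.

Lemma zpow_mul z w m : zpow (\row_i (z 0 i * w 0 i)) m = zpow z m * zpow w m.
Proof. by rewrite /zpow -big_split; apply: eq_bigr => i _; rewrite mxE expfzMl. Qed.

Lemma mpow_zpow z (m : multinom n) : mpow z m = zpow z (\row_i (m i)%:Z).
Proof. by apply: eq_bigr => i _; rewrite mxE. Qed.

End Monomials.

(** After the change of coordinates [mono R], these are the points with nonzero coordinates whose
    coordinates in J equal 1. *)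
Definition torus (C : fieldType) n (R : 'M[int]_n) (J : pred 'I_n) (t : 'rV[C]_n) :=
  nz t /\ forall j, J j -> zpow t (row j R) = 1.

Lemma poly_zero_fun (C : numFieldType) (p : {poly C}) : (forall x, p.[x] = 0) -> p = 0.
Proof.
move=> p0; apply/eqP; apply: contraT => pn0.
have := max_poly_roots (rs := [seq i%:R | i <- iota 0 (size p)]) pn0.
rewrite size_map size_iota ltnn => -> //; first by apply/allP => x _; apply/rootP.
by rewrite map_inj_uniq ?iota_uniq // => i j /eqP; rewrite eqr_nat => /eqP.
Qed.

(* Any two points of a torus lie on a rational curve contained in it. *)
Lemma torus_irreducible (C : numFieldType) n (R : 'M[int]_n) (J : pred 'I_n)
    (f g : 'rV[C]_n -> C) : R \in unitmx ->
  palg (@rvcoord C n) f -> palg (@rvcoord C n) g ->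
  (forall t, torus R J t -> f t * g t = 0) ->
  (forall t, torus R J t -> f t = 0) \/ (forall t, torus R J t -> g t = 0).
Proof.
move=> uR hf hg fg; apply: contrapT => /not_orP[].
move=> /existsNP[s /not_implyP[[s0 sJ] /eqP fs]].
move=> /existsNP[t /not_implyP[[t0 tJ] /eqP gt]].
pose z := mono R s; pose w := mono R t.
have z0 : nz z by apply: nz_mono.
have w0 : nz w by apply: nz_mono.
(* In the coordinates [mono R] the line through z and w keeps its J-coordinates equal to 1, so it
   leaves the torus only at the zeros of [D], the product of its coordinates. *)
pose lp i : {poly C} := (z 0 i)%:P + (w 0 i - z 0 i) *: 'X.
pose D : {poly C} := \prod_i lp i.
pose l (x : C) : 'rV_n := \row_i (lp i).[x].
have lE x i : l x 0 i = z 0 i + (w 0 i - z 0 i) * x.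
  by rewrite [LHS]mxE /lp hornerD hornerZ hornerC hornerX.
have l0 : l 0 = z by apply/rowP => i; rewrite lE mulr0 addr0.
have l1 : l 1 = w by apply/rowP => i; rewrite lE mulr1 addrC subrK.
have DE x : D.[x] = \prod_i l x 0 i.
  by rewrite /D horner_prod; apply: eq_bigr => i _; rewrite mxE.
have Dnz x : nz (l x) <-> D.[x] != 0.
  rewrite DE; split=> [h|/prodf_neq0 h i]; last exact: h.
  exact/prodf_neq0.
pose c x := mono (invmx R) (l x).
have cT x : D.[x] != 0 -> torus R J (c x).
  move=> /Dnz lx; split; first exact: nz_mono.
  move=> j Jj; rewrite zpow_mono // -row_mul mulmxV // row1 zpow_delta.
  by rewrite lE [z 0 j]mxE [w 0 j]mxE sJ // tJ // subrr mul0r addr0.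
(* Along the curve a polynomial function becomes rational, with a power of [D] as denominator. *)
pose ratf (h : C -> C) := exists (N : nat) (p : {poly C}),
  forall x, D.[x] != 0 -> h x * D.[x] ^+ N = p.[x].
have ratM h h' : ratf h -> ratf h' -> ratf (fun x => h x * h' x).
  move=> [N [p pE]] [N' [p' pE']]; exists (N + N')%N, (p * p') => x Dx.
  by rewrite hornerM -pE // -pE' // exprD; ring.
have rat1 (a : C) : ratf (fun=> a).
  by exists 0, a%:P => x _; rewrite hornerC expr0 mulr1.
have ratE h h' : (forall x, h' x = h x) -> ratf h -> ratf h' by move=> /funext ->.
have ratX h (k : nat) : ratf h -> ratf (fun x => h x ^+ k).
  move=> rh; elim: k => [|k IH]; first exact: rat1.
  by apply: ratE (ratM _ _ rh IH) => x; rewrite exprS.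
have ratl i : ratf (fun x => l x 0 i).
  by exists 0, (lp i) => x _; rewrite expr0 mulr1 mxE.
have ratV i : ratf (fun x => (l x 0 i)^-1).
  exists 1, (\prod_(j | j != i) lp j) => x /Dnz lx.
  rewrite expr1 DE (bigD1 i) //= mulKf // horner_prod.
  by apply: eq_bigr => j _; rewrite mxE.
have ratz i (k : int) : ratf (fun x => l x 0 i ^ k).
  case: k => k; first exact: ratX.
  by apply: ratE (ratX _ k.+1 (ratV i)) => x; rewrite NegzE -exprnN exprVn.
have ratc i : ratf (fun x => c x 0 i).
  apply: (ratE (fun x => \prod_j l x 0 j ^ invmx R i j)).
    by move=> x; rewrite mxE /zpow; apply: eq_bigr => j _; rewrite [row _ _ _ _]mxE.
  elim: (index_enum _) => [|j r IH].
    by apply: ratE (rat1 1) => x; rewrite big_nil.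
  by apply: ratE (ratM _ _ (ratz j (invmx R i j)) IH) => x; rewrite big_cons.
have ratp h : palg (@rvcoord C n) h -> ratf (fun x => h (c x)).
  elim=> [a|i|h1 h2 _ [N [p pE]] _ [N' [p' pE']]|h1 h2 _ r1 _ r2].
  - exact: rat1.
  - exact: ratc.
  - exists (N + N')%N, (p * D ^+ N' + p' * D ^+ N) => x Dx.
    by rewrite hornerD !hornerM !horner_exp -pE // -pE' // exprD; ring.
  - exact: ratM.
have [N [p pE]] := ratp f hf; have [N' [p' pE']] := ratp g hg.
have D0 : D.[0] != 0 by apply/Dnz; rewrite l0.
have D1 : D.[1] != 0 by apply/Dnz; rewrite l1.
have cK x v : nz v -> l x = mono R v -> c x = v.
  by move=> v0 lx; rewrite /c lx mono_mono // mulVmx // mono1.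
have p0 : p.[0] != 0 by rewrite -pE // (cK _ s) // mulf_neq0 // expf_neq0.
have p1 : p'.[1] != 0 by rewrite -pE' // (cK _ t) // mulf_neq0 // expf_neq0.
(* The factor [D] takes care of the parameters at which the curve leaves the torus. None of the
   three factors is the zero polynomial, by the values at 0 and 1. *)
suff : p * p' * D = 0.
  move/eqP; rewrite !mulf_eq0; case/orP => [/orP[]|] /eqP pz.
  - by move: p0; rewrite pz horner0 eqxx.
  - by move: p1; rewrite pz horner0 eqxx.
  - by move: D0; rewrite pz horner0 eqxx.
apply: poly_zero_fun => x; rewrite !hornerM.
have [->|Dx] := eqVneq D.[x] 0; first by rewrite mulr0.
by rewrite -pE // -pE' // mulrACA fg ?mul0r //; apply: cT.
Qed.

(** * Zariski closed sets of matrices *)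

Lemma palg_mxpol (C : fieldType) n (f : 'M[C]_n -> C) : palg (@mxcoord C n) f ->
  exists q : mxpol C n, forall g, mxeval idfun q g = f g.
Proof.
elim=> [c|[i j]|g g' _ [q qE] _ [q' qE']|g g' _ [q qE] _ [q' qE']].
- by exists (mpolyC _ c) => g; rewrite mxevalC.
- by exists (mpolyX _ (mnm1 (mxvec_index i j))) => g; rewrite mxevalX.
- by exists (q + q') => h; rewrite mxevalD qE qE'.
- by exists (q * q') => h; rewrite mxevalM qE qE'.
Qed.

Lemma zclosed_palg (C : fieldType) n (I : Type) (f : I -> 'M[C]_n -> C) :
  (forall i, palg (@mxcoord C n) (f i)) ->
  zclosed (fun g => forall i, f i g = 0).
Proof.
move=> /(fun h i => palg_mxpol (h i)) /choice[q qE].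
exists (fun p => exists i, p = q i); apply/seteqP; split=> g /=.
  by move=> fg p [i ->]; rewrite qE.
by move=> h i; rewrite -qE; apply: h; exists i.
Qed.

Lemma zclosedE (C : fieldType) n (H : 'M[C]_n -> Prop) : zclosed H ->
  exists (I : Type) (f : I -> 'M[C]_n -> C),
    (forall i, palg (@mxcoord C n) (f i)) /\ forall g, H g <-> forall i, f i g = 0.
Proof.
move=> [I ->]; exists {p | I p}, (fun p g => mxeval idfun (sval p) g); split.
  by move=> p; apply: palg_mxeval; apply: mpalg_id.
by move=> g; split=> [h [p Ip]|h p Ip]; [apply: h|apply: (h (exist _ p Ip))].
Qed.

Lemma zclosed_eq (C : fieldType) n (H H' : 'M[C]_n -> Prop) :
  (forall g, H g <-> H' g) -> zclosed H -> zclosed H'.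
Proof. by move=> h; rewrite (_ : H' = H) //; apply/funext => g; apply/propext; split; apply h. Qed.

Lemma zclosedU (C : fieldType) n (H H' : 'M[C]_n -> Prop) :
  zclosed H -> zclosed H' -> zclosed (fun g => H g \/ H' g).
Proof.
move=> /zclosedE[I [f [hf HE]]] /zclosedE[I' [f' [hf' HE']]].
apply: zclosed_eq (zclosed_palg (fun ij : I * I' => palg_mul (hf ij.1) (hf' ij.2))) => g.
rewrite HE HE'; split=> [h|[] h [i j]]; last 2 first.
- by rewrite /= h mul0r.
- by rewrite /= h mulr0.
have [?|/existsNP[i /eqP ni]] := pselect (forall i, f i g = 0); first by left.
right => j; have /eqP := h (i, j); rewrite mulf_eq0 (negbTE ni) /=; exact/eqP.
Qed.

Lemma zclosed0 (C : fieldType) n : zclosed (fun _ : 'M[C]_n => False).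
Proof.
apply: zclosed_eq (zclosed_palg (fun i : unit => palg_const (@mxcoord C n) 1)) => g.
by split=> [/(_ tt)/eqP|//]; rewrite oner_eq0.
Qed.

Lemma zclosed_comp (C : fieldType) n (H : 'M[C]_n -> Prop) (h : 'M[C]_n -> 'M[C]_n) :
  mpalg (@mxcoord C n) h -> zclosed H -> zclosed (fun g => H (h g)).
Proof.
move=> hh /zclosedE[I [f [hf HE]]].
apply: zclosed_eq (zclosed_palg (f := fun i g => f i (h g)) _) => [g|i]; first by rewrite HE.
by apply: palg_comp (hf i) => -[a b]; apply: hh.
Qed.

Lemma zclosedI (C : fieldType) n (H H' : 'M[C]_n -> Prop) :
  zclosed H -> zclosed H' -> zclosed (fun g => H g /\ H' g).
Proof.
move=> /zclosedE[I [f [hf HE]]] /zclosedE[I' [f' [hf' HE']]].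
apply: zclosed_eq (zclosed_palg (f := fun ij : I + I' =>
  match ij with inl i => f i | inr j => f' j end) _) => [g|[i|j]] //.
rewrite HE HE'; split=> [h|[h h'] [i|j]] //.
by split=> i; [apply: (h (inl i))|apply: (h (inr i))].
Qed.

Lemma zclosed_points (K C : fieldType) (io : {rmorphism K -> C}) n (V : seq (mxpol K n)) :
  zclosed (points io V).
Proof.
apply: zclosed_eq (zclosed_palg (f := fun (p : {p | p \in V}) g => mxeval io (sval p) g) _).
  by move=> g; split=> [h p pV|h [p pV]]; [apply: (h (exist _ p pV))|apply: h].
by move=> p; apply: palg_mxeval; apply: mpalg_id.
Qed.

(** The cosets [s i] H other than H form a finite union of closed sets disjoint from H; as G is
    covered by H and this union, connectedness leaves one of them, and 1 lies in H. *)
Lemma zconnected_finite_index (C : fieldType) n (G H : 'M[C]_n -> Prop) N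
    (s : 'I_N -> 'M[C]_n) :
  zconnected G -> zclosed H -> is_mxgroup H -> G 1%:M ->
  (forall i, s i \in unitmx) ->
  (forall g, G g -> exists i, H (invmx (s i) *m g)) ->
  forall g, G g -> H g.
Proof.
move=> Gc Hcl [HU H1 HM HV] G1 su cover g Gg.
pose V (g : 'M[C]_n) := exists i, ~ H (s i) /\ H (invmx (s i) *m g).
have Vcl : zclosed V.
  suff h (l : seq 'I_N) : zclosed (fun g => exists i, i \in l /\ (~ H (s i) /\ H (invmx (s i) *m g))).
    apply: zclosed_eq (h (enum 'I_N)) => x; split=> [[i [_ h']]|[i h']]; exists i => //.
    by rewrite mem_enum.
  elim: l => [|i l IH]; first by apply: zclosed_eq (@zclosed0 C n) => x; split=> // -[i []].
  have h : zclosed (fun x => ~ H (s i) /\ H (invmx (s i) *m x)).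
    have [Hsi|nHsi] := pselect (H (s i)).
      by apply: zclosed_eq (@zclosed0 C n) => x; split=> // -[].
    apply: zclosed_eq (zclosed_comp (h := fun x => invmx (s i) *m x) _ Hcl) => [x|].
      by split=> [|[]].
    by apply: mpalg_mul; [apply: mpalg_const|apply: mpalg_id].
  apply: zclosed_eq (zclosedU h IH) => x; split.
    by case=> [h'|[j [jl h']]]; [exists i; rewrite mem_head|exists j; rewrite in_cons jl orbT].
  by case=> j []; rewrite in_cons => /predU1P[-> h'|jl h']; [left|right; exists j].
have disj x : H x -> ~ V x.
  move=> Hx [i [nHsi Hy]]; apply: nHsi.
  suff -> : s i = x *m invmx (invmx (s i) *m x) by apply: HM => //; apply: HV.
  have uy := HU _ Hy; set y := invmx (s i) *m x in uy *.
  by apply: (can_inj (mulmxK uy)); rewrite mulmxKV // /y mulKVmx.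
have [] := Gc H V Hcl Vcl.
- move=> x' Gx; have [i Hi] := cover x' Gx.
  have [Hsi|nHsi] := pselect (H (s i)); last by right; exists i.
  by left; rewrite -(mulKVmx (su i) x'); apply: HM.
- by apply/seteqP; split=> // x [[_ Hx] /(disj x Hx)].
- by apply.
- by move=> /(_ _ G1) /(disj _ H1).
Qed.

(** * Transfer of algebraic groups to real and complex points *)

Section Facts.
Variables (K : rcfType) (n : nat).
Implicit Types (V W : seq (mxpol K n)).

(** The sentence first descends from L to K and is then lifted to L'; no morphism between L and L'
    is involved. *)
Lemma xfer (Q : forall L : rcfType, {rmorphism K -> L} -> Prop) :
  def (fun L io _ => Q L io) ->
  forall (L L' : rcfType) (io : {rmorphism K -> L}) (io' : {rmorphism K -> L'}),
  Q L io -> Q L' io'.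
Proof.
move=> dQ L L' io io' h; apply/(transfer dQ io' (fun=> 0)).
exact/(transfer dQ io (fun=> 0)).
Qed.

Lemma geomE V : geom V = points (cio idfun) V.
Proof.
by apply/seteqP; split=> g h p pV; have := h p pV; rewrite !mxevalE.
Qed.

Lemma points_real (L : rcfType) (io : {rmorphism K -> L}) V (g : 'M[L]_n) :
  points io V g <-> points (cio io) V (map_mx (@real_complex L) g).
Proof.
have E p : mxeval (cio io) p (map_mx (@real_complex L) g) = real_complex L (mxeval io p g).
  rewrite !mxevalE rmorph_sum; apply: eq_bigr => m _; rewrite rmorphM rmorph_prod.
  congr (_ * _); apply: eq_bigr => k _; rewrite rmorphXn; congr (_ ^+ _).
  by case/mxvec_indexP: k => i j; rewrite !mxvecE mxE.
split=> h p pV; first by rewrite E h ?rmorph0.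
by apply: (@complex.complexI L); rewrite -E h ?rmorph0.
Qed.

(** The defining equations have real coefficients. *)
Lemma cpoints_conj (L : rcfType) (io : {rmorphism K -> L}) V (g : 'M[complex L]_n) :
  points (cio io) V g -> points (cio io) V (map_mx (@complex.conjc L) g).
Proof.
move=> h p pV; suff -> : mxeval (cio io) p (map_mx (@complex.conjc L) g) =
    complex.conjc (mxeval (cio io) p g) by rewrite h ?rmorph0.
rewrite !mxevalE (rmorph_sum (@complex.conjc L)) /=; apply: eq_bigr => m _; rewrite rmorphM (rmorph_prod (@complex.conjc L)).
congr (_ * _); first exact: esym (complex.conjc_real _).
apply: eq_bigr => k _; rewrite rmorphXn; congr (_ ^+ _).
by case/mxvec_indexP: k => i j; rewrite !mxvecE mxE.
Qed.

Section Group.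
Variable V : seq (mxpol K n).
Hypothesis grp : is_mxgroup (geom V).
Variables (L : rcfType) (io : {rmorphism K -> L}).

Lemma cgroup : is_mxgroup (points (cio io) V).
Proof.
case: grp; rewrite !geomE => hU h1 hM hV.
have d1 : def (fun (L : rcfType) (io : {rmorphism K -> L}) (_ : nat -> L) => points (cio io) V 1%:M).
  by definable.
have dM : def (fun (L : rcfType) (io : {rmorphism K -> L}) (_ : nat -> L) =>
  forall g h, points (cio io) V g -> points (cio io) V h -> points (cio io) V (g *m h)).
  by definable.
(* Inversion is not among the term constructors, so the inverse is introduced by a quantifier. *)
have dV : def (fun (L : rcfType) (io : {rmorphism K -> L}) (_ : nat -> L) =>
  forall g, points (cio io) V g -> exists h, points (cio io) V h /\ g *m h = 1%:M).
  by definable.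
have h1' : points (cio io) V 1%:M := xfer d1 io h1.
have hM' := xfer dM io hM.
have hV' : forall g, points (cio io) V g -> exists h, points (cio io) V h /\ g *m h = 1%:M.
  apply: (@xfer _ dV K L idfun io) => g Vg.
  by exists (invmx g); split; [apply: hV|apply/mulmxV/hU].
split=> // g Vg; have [h [Vh gh]] := hV' g Vg; first by have [] := mulmx1_unit gh.
have [ug _] := mulmx1_unit gh.
by rewrite -(mulmx1 (invmx g)) -gh mulKmx.
Qed.

Lemma rgroup : is_mxgroup (points io V).
Proof.
have [hU h1 hM hV] := cgroup.
split=> [g|||g].
- by move=> /points_real/hU; rewrite map_unitmx.
- by apply/points_real; rewrite map_mx1.
- by move=> g h /points_real Vg /points_real Vh; apply/points_real; rewrite map_mxM; apply: hM.
- by move=> /points_real Vg; apply/points_real; rewrite map_invmx; apply: hV.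
Qed.

End Group.

Lemma cpoints_tr V : (forall g, geom V g -> geom V g^T) ->
  forall (L : rcfType) (io : {rmorphism K -> L}) g,
  points (cio io) V g -> points (cio io) V g^T.
Proof.
rewrite geomE => h L io.
have dQ : def (fun (L : rcfType) (io : {rmorphism K -> L}) (_ : nat -> L) => forall g, points (cio io) V g -> points (cio io) V g^T) by definable.
apply: (@xfer _ dQ K L idfun io h).
Qed.

Lemma points_tr V : (forall g, geom V g -> geom V g^T) ->
  forall (L : rcfType) (io : {rmorphism K -> L}) g,
  points io V g -> points io V g^T.
Proof.
move=> h L io g /points_real Vg; apply/points_real; rewrite -map_trmx.
exact: cpoints_tr.
Qed.

Lemma points_sym V : (forall g, geom V g -> g^T = g) ->
  forall (L : rcfType) (io : {rmorphism K -> L}) g, points io V g -> g^T = g.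
Proof.
rewrite geomE => h L io.
have dQ : def (fun (L : rcfType) (io : {rmorphism K -> L}) (_ : nat -> L) => forall g, points io V g -> g^T = g).
  by definable.
apply: (@xfer _ dQ K L idfun io).
move=> g /points_real/h/(congr1 (map_mx (@complex.Re K))).
rewrite map_trmx -!map_mx_comp => E.
by apply/matrixP => i j; move/matrixP: E => /(_ i j); rewrite !mxE.
Qed.

Lemma points_det V : (forall g, geom V g -> \det g = 1) ->
  forall (L : rcfType) (io : {rmorphism K -> L}) g, points io V g -> \det g = 1.
Proof.
rewrite geomE => h L io.
have dQ : def (fun (L : rcfType) (io : {rmorphism K -> L}) (_ : nat -> L) => forall g, points io V g -> \det g = 1) by definable.
apply: (@xfer _ dQ K L idfun io).
move=> g /points_real/h; rewrite det_map_mx => /(congr1 (@complex.Re K)) //.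
Qed.

Lemma points_sub V W : (geom V `<=` geom W)%classic ->
  forall (L : rcfType) (io : {rmorphism K -> L}) g, points io V g -> points io W g.
Proof.
rewrite !geomE => h L io.
have dQ : def (fun (L : rcfType) (io : {rmorphism K -> L}) (_ : nat -> L) => forall g, points io V g -> points io W g) by definable.
apply: (@xfer _ dQ K L idfun io).
by move=> g /points_real/h/points_real.
Qed.

Lemma points_diag V (P : 'M[K]_n) :
  (forall s, geom V s -> is_diag_mx (map_mx (@real_complex K) P *m s
                        *m map_mx (@real_complex K) (invmx P))) ->
  forall (L : rcfType) (io : {rmorphism K -> L}) s, points io V s ->
  forall i j, i != j -> (map_mx io P *m s *m map_mx io (invmx P)) i j = 0.
Proof.
rewrite geomE => h L io s Vs i j ij; move: s Vs.
have dQ : def (fun (L : rcfType) (io : {rmorphism K -> L}) (_ : nat -> L) => forall s, points io V s ->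
   (map_mx io P *m s *m map_mx io (invmx P)) i j = 0) by definable.
apply: (@xfer _ dQ K L idfun io).
move=> g /points_real/h/is_diag_mxP/(_ _ _ ij); rewrite -!map_mxM mxE.
by move/(congr1 (@complex.Re K)) => /= E; rewrite !map_mx_id.
Qed.

End Facts.

Lemma torus_char (C : fieldType) n (R : 'M[int]_n) (J : pred 'I_n) (t : 'rV[C]_n) m :
  R \in unitmx -> torus R J t -> (forall j, ~~ J j -> (m *m invmx R) 0 j = 0) ->
  zpow t m = 1.
Proof.
move=> uR [t0 tJ] mJ; rewrite -[m](mulmxKV uR) -zpow_mono // /zpow big1 // => j _.
have [Jj|/mJ ->] := boolP (J j); last by rewrite expr0z.
by rewrite [mono _ _ _ _]mxE tJ // exp1rz.
Qed.

Definition pospart (k : int) : nat := if k is Posz a then a else 0%N.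
Definition negpart (k : int) : nat := if k is Negz a then a.+1 else 0%N.

Lemma zpow_pos_neg (C : fieldType) n (t : 'rV[C]_n) (m : 'rV[int]_n) :
  zpow t m = (\prod_i t 0 i ^+ pospart (m 0 i)) / (\prod_i t 0 i ^+ negpart (m 0 i)).
Proof.
rewrite -prodf_div; apply: eq_bigr => i _.
by case: (m 0 i) => k; rewrite /= ?divr1 // NegzE -exprnN div1r.
Qed.

(** Clearing denominators turns a condition on a Laurent monomial into a binomial equation, which
    can be listed among the equations of an algebraic set. *)
Lemma zpow_eq1 (C : fieldType) n (t : 'rV[C]_n) (m : 'rV[int]_n) : nz t ->
  zpow t m = 1 <->
  \prod_i t 0 i ^+ pospart (m 0 i) = \prod_i t 0 i ^+ negpart (m 0 i).
Proof.
move=> t0; rewrite zpow_pos_neg.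
have n0 : \prod_i t 0 i ^+ negpart (m 0 i) != 0.
  by apply/prodf_neq0 => i _; apply: expf_neq0.
split=> [/(congr1 ( *%R^~ (\prod_i t 0 i ^+ negpart (m 0 i))))|->].
  by rewrite mul1r divfK.
by rewrite divff.
Qed.

(** * Tori as hulls of diagonalisable monoids *)

Section Hull.
Variables (K : rcfType) (n : nat) (Q : 'M[K]_n).
Hypothesis uQ : Q \in unitmx.
Local Notation C := (complex K).
Local Notation toC := (map_mx (@real_complex K)).

Definition conjX (i j : 'I_n) : mxpol K n :=
  \sum_a \sum_b mpolyC _ (Q i a * invmx Q b j) * mpolyX _ (mnm1 (mxvec_index a b)).

Lemma mxeval_rmorph (L : fieldType) (io : {rmorphism K -> L}) (g : 'M[L]_n) :
  exists f : {rmorphism mxpol K n -> L}, forall p, mxeval io p g = f p.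
Proof.
by exists (meval (fun k => mxvec g 0 k) \o map_mpoly io).
Qed.

Lemma mxeval_conjX (L : fieldType) (io : {rmorphism K -> L}) (g : 'M[L]_n) i j :
  mxeval io (conjX i j) g = (map_mx io Q *m g *m map_mx io (invmx Q)) i j.
Proof.
have [f fE] := mxeval_rmorph io g.
rewrite fE /conjX rmorph_sum mxE; under eq_bigr do rewrite rmorph_sum.
rewrite exchange_big /=; apply: eq_bigr => b _.
rewrite mxE big_distrl /=; apply: eq_bigr => a _.
by rewrite rmorphM -!fE mxevalC mxevalX !mxE rmorphM; ring.
Qed.

(** In the basis given by Q: off-diagonal entries vanish, the characters in J are trivial, and the
    determinant is 1. The last equation makes the diagonal entries nonzero, so that the binomials
    express the characters faithfully. *)
Definition hull_eqs (R : 'M[int]_n) (J : pred 'I_n) : seq (mxpol K n) :=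
  [seq conjX ij.1 ij.2 | ij <- enum [pred ij : 'I_n * 'I_n | ij.1 != ij.2]] ++
  [seq \prod_i conjX i i ^+ pospart (R j i) -
       \prod_i conjX i i ^+ negpart (R j i) | j <- enum J] ++
  [:: \prod_i conjX i i - 1].

Definition dconj (t : 'rV[C]_n) : 'M[C]_n :=
  invmx (toC Q) *m diag_mx t *m toC Q.

Lemma utoC : toC Q \in unitmx. Proof. by rewrite map_unitmx. Qed.

Lemma dconjM t t' : dconj t *m dconj t' = dconj (\row_i (t 0 i * t' 0 i)).
Proof.
rewrite /dconj !mulmxA (mulmxK utoC) -(mulmxA _ (diag_mx t)) mulmx_diag.
by congr (_ *m diag_mx _ *m _); apply/rowP => i; rewrite !mxE.
Qed.

Lemma dconj1 : dconj (const_mx 1) = 1%:M.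
Proof. by rewrite /dconj diag_const_mx mulmx1 mulVmx // utoC. Qed.

(** The hypothesis on [const_mx 1] places the determinant among the characters trivial on the torus,
    so the determinant equation discards none of its points. *)
Lemma geom_hull (R : 'M[int]_n) (J : pred 'I_n) : R \in unitmx ->
  (forall j, ~~ J j -> (const_mx 1 *m invmx R : 'rV_n) 0 j = 0) ->
  forall g, geom (hull_eqs R J) g <-> exists2 t, torus R J t & g = dconj t.
Proof.
move=> uR ones g.
have cE i j : mxeval (@real_complex K) (conjX i j) g =
    (toC Q *m g *m invmx (toC Q)) i j by rewrite mxeval_conjX map_invmx.
have [f fE] := mxeval_rmorph (@real_complex K) g.
pose t : 'rV[C]_n := \row_i (toC Q *m g *m invmx (toC Q)) i i.
have tE i : t 0 i = f (conjX i i) by rewrite mxE -fE cE.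
have relE j : f (\prod_i conjX i i ^+ pospart (R j i) -
       \prod_i conjX i i ^+ negpart (R j i)) =
    \prod_i t 0 i ^+ pospart (row j R 0 i) - \prod_i t 0 i ^+ negpart (row j R 0 i).
  rewrite rmorphB !rmorph_prod; congr (_ - _); apply: eq_bigr => i _;
  by rewrite rmorphXn /= tE mxE.
have oneE : f (\prod_i conjX i i - 1) = \prod_i t 0 i - 1.
  rewrite rmorphB rmorph1 rmorph_prod; congr (_ - _).
  by apply: eq_bigr => i _; rewrite tE.
have zones (s : 'rV[C]_n) : zpow s (const_mx 1) = \prod_i s 0 i.
  by apply: eq_bigr => i _; rewrite mxE expr1z.
split=> [h|[s sT gE] p].
  have diag i j : i != j -> (toC Q *m g *m invmx (toC Q)) i j = 0.
    move=> ij; rewrite -cE h // mem_cat; apply/orP; left.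
    by apply/mapP; exists (i, j); rewrite ?mem_enum.
  have t0 : nz t.
    have : \prod_i t 0 i = 1.
      by apply/eqP; rewrite -subr_eq0 -oneE -fE h // !mem_cat mem_seq1 eqxx !orbT.
    by move=> t1 i; move: (oner_neq0 C); rewrite -t1 => /prodf_neq0; apply.
  exists t; first split=> // j Jj.
    apply/zpow_eq1 => //; apply/eqP; rewrite -subr_eq0 -relE -fE h //.
    rewrite !mem_cat; apply/orP; right; apply/orP; left.
    by apply/mapP; exists j; rewrite ?mem_enum.
  rewrite /dconj; suff <- : toC Q *m g *m invmx (toC Q) = diag_mx t.
    by rewrite !mulmxA mulVmx ?utoC // mul1mx mulmxKV ?utoC.
  apply/matrixP => i j; rewrite [RHS]mxE; have [<-|ij] := eqVneq i j.
    by rewrite mulr1n [RHS]mxE.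
  by rewrite mulr0n diag.
have tEs : t = s.
  by apply/rowP => i; rewrite mxE gE /dconj !mulmxA mulmxK ?utoC // mulmxV ?utoC // mul1mx mxE eqxx mulr1n.
have [s0 sJ] := sT.
rewrite !mem_cat => /or3P[/mapP[[i j]]|/mapP[j]|].
- rewrite mem_enum => /= ij ->; rewrite cE gE /dconj !mulmxA mulmxK ?utoC // mulmxV ?utoC // mul1mx.
  by rewrite mxE (negbTE ij).
- rewrite mem_enum => Jj ->; rewrite fE relE tEs; apply/eqP; rewrite subr_eq0.
  by apply/eqP; apply/zpow_eq1 => //; apply: sJ.
- rewrite mem_seq1 => /eqP ->; rewrite fE oneE tEs -zones.
  by rewrite (torus_char uR sT ones) subrr.
Qed.

Section Family.
Variables (E : Type) (op : E -> E -> E) (one : E) (v : E -> 'rV[C]_n).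
Hypothesis vnz : forall e, nz (v e).
Hypothesis vM : forall a b i, v (op a b) 0 i = v a 0 i * v b 0 i.
Hypothesis v1 : forall i, v one 0 i = 1.
Hypothesis vdet : forall e, \prod_i v e 0 i = 1.
Hypothesis vsat : forall (k : int) m, k != 0 -> (forall e, zpow (v e) (k *: m) = 1) ->
  forall e, zpow (v e) m = 1.

(* The closure of a monoid of diagonalisable matrices without torsion characters is a
   split torus; it is cut out by the characters that are trivial on the monoid. *)
Lemma torus_hull : exists (R : 'M[int]_n) (J : pred 'I_n) (V : seq (mxpol K n)),
  [/\ R \in unitmx,
      forall g, geom V g <-> exists2 t, torus R J t & g = dconj t,
      split_torus V,
      forall e, torus R J (v e)
    & (forall m, (forall e, zpow (v e) m = 1) -> forall j, ~~ J j -> (m *m invmx R) 0 j = 0) /\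
      forall W : seq (mxpol K n), (forall e, geom W (dconj (v e))) -> (geom V `<=` geom W)%classic].
Proof.
have [||||R uR [J [JR Jm]]] := @lattice_basis n (fun m => forall e, zpow (v e) m = 1).
- by move=> e; rewrite zpow0.
- by move=> a b ha hb e; rewrite zpowD // ha hb mulr1.
- by move=> a ha e; rewrite zpowN // ha invr1.
- by move=> k a k0 h; apply: vsat k0 h.
have ones : forall j, ~~ J j -> (const_mx 1 *m invmx R : 'rV_n) 0 j = 0.
  apply: Jm => e; rewrite -(vdet e); apply: eq_bigr => i _.
  by rewrite mxE expr1z.
have gE := geom_hull uR ones.
exists R, J, (hull_eqs R J).
have vT e : torus R J (v e) by split=> // j Jj; apply: JR.
have tM s t : torus R J s -> torus R J t -> torus R J (\row_i (s 0 i * t 0 i)).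
  move=> [s0 sJ] [t0 tJ]; split=> [i|j Jj]; first by rewrite mxE mulf_neq0.
  by rewrite zpow_mul sJ // tJ // mulr1.
have t1 : torus R J (const_mx 1 : 'rV[C]_n).
  split=> [i|j Jj]; first by rewrite mxE oner_neq0.
  by rewrite /zpow big1 // => i _; rewrite [const_mx _ _ _]mxE exp1rz.
have tV s : torus R J s -> torus R J (\row_i (s 0 i)^-1).
  move=> [s0 sJ]; split=> [i|j Jj]; first by rewrite mxE invr_eq0.
  rewrite -[RHS]invr1 -(sJ j Jj) /zpow -prodfV; apply: eq_bigr => i _.
  by rewrite [X in X ^ _]mxE exprz_inv invr_expz.
split=> //.
- split.
  + split=> [g /gE[t [t0 _] ->]||g h /gE[s sT ->] /gE[t tT ->]|g /gE[t tT ->]].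
    * rewrite /dconj !unitmx_mul unitmx_inv !utoC andbT /=.
      by rewrite unitmxE det_diag unitfE; apply/prodf_neq0.
    * by apply/gE; exists (const_mx 1); rewrite ?dconj1.
    * by apply/gE; exists (\row_i (s 0 i * t 0 i)); [apply: tM|rewrite dconjM].
    * apply/gE; exists (\row_i (t 0 i)^-1); first exact: tV.
      have tt : dconj t *m dconj (\row_i (t 0 i)^-1) = 1%:M.
        rewrite dconjM -dconj1; congr dconj; apply/rowP => i; rewrite !mxE divff //.
        by case: tT.
      have [ut _] := mulmx1_unit tt.
      by rewrite -(mulmx1 (invmx _)) -tt mulKmx.
  + move=> U W /zclosedE[I [f [hf fE]]] /zclosedE[I' [f' [hf' fE']]] cover disj.
    have dpal : mpalg (@rvcoord C n) dconj.
      have := @mpalg_diag C n n (invmx (toC Q)) (toC Q)^T.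
      by rewrite trmxK.
    (* If neither closed set contains the torus, one equation of each fails somewhere on it, while
       the product of the two equations vanishes on the whole torus: this contradicts
       irreducibility. *)
    apply: contrapT => /not_orP[/existsNP[g /not_implyP[/gE[s sT ->] nU]]].
    move=> /existsNP[h /not_implyP[/gE[t tT ->] nW]].
    have [i fi] : exists i, f i (dconj s) <> 0.
      by apply: contrapT => /forallNP h'; apply: nU; apply/fE => i; apply: contrapT.
    have [j fj] : exists j, f' j (dconj t) <> 0.
      by apply: contrapT => /forallNP h'; apply: nW; apply/fE' => j; apply: contrapT.
    have pal I0 (F : I0 -> 'M[C]_n -> C) k : (forall k, palg (@mxcoord C n) (F k)) ->
        palg (@rvcoord C n) (fun t => F k (dconj t)).
      by move=> hF; apply: palg_comp (hF k) => -[a b]; apply: dpal.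
    have [|h1|h1] := torus_irreducible (J := J) uR (pal _ _ i hf) (pal _ _ j hf').
    * move=> r rT; have /cover : geom (hull_eqs R J) (dconj r) by apply/gE; exists r.
      by case=> [/fE ->|/fE' ->]; rewrite ?mul0r ?mulr0.
    * exact: fi (h1 s sT).
    * exact: fj (h1 t tT).
  + exists Q => // g /gE[t tT ->].
    by rewrite map_invmx /dconj !mulmxA mulmxK ?utoC // mulmxV ?utoC // mul1mx diag_mx_is_diag.
split=> // W hW g /gE[t tT ->] p pW.
(* Two monomials that agree on the monoid differ by a character trivial on it, hence by a character
   trivial on the torus. *)
apply: (@palg_artin C n E op one v (fun t => mxeval (@real_complex K) p (dconj t))) => //.
- apply: palg_mxeval; have := @mpalg_diag C n n (invmx (toC Q)) (toC Q)^T.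
  by rewrite trmxK.
- by move=> e; apply: hW.
- move=> m m' h; have t0 : nz t by case: tT.
  pose z (m : multinom n) : 'rV[int]_n := \row_i (m i)%:Z.
  have : zpow t (z m - z m') = 1.
    apply: torus_char uR tT _; apply: Jm => e.
    by rewrite zpowD // zpowN // -!mpow_zpow h divff // mpow_zpow zpow_neq0.
  rewrite zpowD // zpowN // -!mpow_zpow => /(congr1 ( *%R^~ (mpow t m'))).
  by rewrite mul1r divfK // mpow_zpow zpow_neq0.
Qed.
End Family.
End Hull.

Section MaximalTorus.
Variables (K : rcfType) (n : nat) (G S : seq (mxpol K n)).
Hypothesis G_SL : subgroup_SL G.
Hypothesis S_max : maximal_split_torus G S.
Local Notation C := (complex K).
Local Notation toC := (map_mx (@real_complex K)).

Section Coordinates.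
Variable Q : 'M[K]_n.
Hypothesis uQ : Q \in unitmx.
Hypothesis S_diag : forall s, geom S s -> is_diag_mx (toC Q *m s *m toC (invmx Q)).

Definition dcoord (s : 'M[C]_n) : 'rV[C]_n := \row_i (toC Q *m s *m toC (invmx Q)) i i.

Lemma dcoord_dconj t : dcoord (dconj Q t) = t.
Proof.
apply/rowP => i; rewrite mxE /dconj map_invmx !mulmxA mulmxK ?utoC //.
by rewrite mulmxV ?utoC // mul1mx mxE eqxx mulr1n.
Qed.

Lemma dconj_dcoord s : geom S s -> dconj Q (dcoord s) = s.
Proof.
move=> /S_diag /is_diag_mxP sd; rewrite /dconj.
suff -> : diag_mx (dcoord s) = toC Q *m s *m toC (invmx Q).
  by rewrite map_invmx !mulmxA mulVmx ?utoC // mul1mx mulmxKV ?utoC.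
apply/matrixP => i j; rewrite mxE; have [<-|ij] := eqVneq i j.
  by rewrite mulr1n mxE.
by rewrite mulr0n sd.
Qed.

Lemma S_group : is_mxgroup (geom S). Proof. by case: S_max => -[]. Qed.

Lemma dcoordM s s' : geom S s -> geom S s' ->
  dcoord (s *m s') = \row_i (dcoord s 0 i * dcoord s' 0 i).
Proof.
move=> Ss Ss'; rewrite -{1}(dconj_dcoord Ss) -{1}(dconj_dcoord Ss').
by rewrite dconjM // dcoord_dconj.
Qed.

Lemma dcoord1 : dcoord 1%:M = const_mx 1.
Proof. by rewrite -(dconj1 uQ) dcoord_dconj. Qed.

Lemma det_dconj t : \det (dconj Q t) = \prod_i t 0 i.
Proof.
rewrite /dconj !det_mulmx det_diag det_inv mulrAC mulVf ?mul1r //.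
by rewrite -unitfE -unitmxE utoC.
Qed.

Lemma S_det s : geom S s -> \det s = 1.
Proof. by case: S_max => _ SG _ /SG; case: G_SL => _; apply. Qed.

Lemma dcoord_prod s : geom S s -> \prod_i dcoord s 0 i = 1.
Proof. by move=> Ss; rewrite -det_dconj dconj_dcoord // S_det. Qed.

Lemma dcoord_nz s : geom S s -> nz (dcoord s).
Proof.
move=> /dcoord_prod h i; move: (oner_neq0 C); rewrite -h => /prodf_neq0; exact.
Qed.

Lemma palg_dcoord i : palg (@mxcoord C n) (fun s => dcoord s 0 i).
Proof.
apply: (palg_ext (f := fun s => (toC Q *m s *m toC (invmx Q)) i i)).
  by move=> s; rewrite mxE.
apply: mpalg_mul; last exact: mpalg_const.
by apply: mpalg_mul; [apply: mpalg_const|apply: mpalg_id].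
Qed.

(* The image of a connected group under a character of finite order is connected,
   hence trivial. *)
Lemma S_char_sat (k : int) m : k != 0 ->
  (forall s, geom S s -> zpow (dcoord s) (k *: m) = 1) ->
  forall s, geom S s -> zpow (dcoord s) m = 1.
Proof.
move=> k0 h s Ss; apply/zpow_eq1; first exact: dcoord_nz.
pose a s := \prod_i dcoord s 0 i ^+ pospart (m 0 i).
pose b s := \prod_i dcoord s 0 i ^+ negpart (m 0 i).
pose k' := `|k|%N.
have k'0 : (0 < k')%N by rewrite absz_gt0.
have palga : palg (@mxcoord C n) a by apply: palg_prod => i; apply/palg_exp/palg_dcoord.
have palgb : palg (@mxcoord C n) b by apply: palg_prod => i; apply/palg_exp/palg_dcoord.
(* The cofactor of a - b in a^k' - b^k'. Since the k-th power of the character is trivial, S is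
   covered by the closed sets a = b and q = 0; they are disjoint because a = b gives q = k'
   b^(k'-1), which is nonzero. *)
pose q s := \sum_(i < k') a s ^+ (k'.-1 - i) * b s ^+ i.
have Ucl : zclosed (fun s => a s = b s).
  apply: zclosed_eq (zclosed_palg (fun _ : unit => palg_sub palga palgb)) => x.
  by split=> [/(_ tt)/eqP|-> _]; rewrite ?subrr // subr_eq0 => /eqP.
have Vcl : zclosed (fun s => q s = 0).
  apply: zclosed_eq (zclosed_palg (f := fun _ : unit => q) _) => [x|_].
    by split=> [/(_ tt)|].
  by apply: palg_sum => i; apply: palg_mul; apply: palg_exp.
have b0 x : geom S x -> b x != 0.
  by move=> Sx; apply/prodf_neq0 => i _; apply/expf_neq0/dcoord_nz.
have qab x : geom S x -> a x = b x -> q x != 0.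
  move=> Sx ab; rewrite /q ab (eq_bigr (fun=> b x ^+ k'.-1)) => [|i _].
    by rewrite sumr_const card_ord -mulr_natr mulf_neq0 ?expf_neq0 ?b0 // pnatr_eq0 -lt0n.
  by rewrite -exprD subnK // -ltnS prednK.
have Sc : zconnected (geom S) by case: S_max => -[].
have [||hU|hV] := Sc _ _ Ucl Vcl.
- move=> x Sx; have : a x ^+ k' = b x ^+ k'.
    have x0 := dcoord_nz Sx.
    have := h x Sx; rewrite zpowZ zpow_pos_neg -/(a x) -/(b x) => abk.
    have {abk} : (a x / b x) ^+ k' = 1.
      by move: abk; rewrite /k'; case: (k) => l //; rewrite NegzE -exprnN => /(congr1 GRing.inv); rewrite invrK invr1.
    by rewrite expr_div_n => /(congr1 ( *%R^~ (b x ^+ k'))); rewrite divfK ?expf_neq0 ?b0 // mul1r.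
  move/eqP; rewrite -subr_eq0 subrXX mulf_eq0 subr_eq0 => /orP[/eqP|/eqP]; first by left.
  by right.
- apply/seteqP; split=> // x [[Sx ab] /= qx].
  by have := qab x Sx ab; rewrite qx eqxx.
- exact: hU.
- have S1 : geom S 1%:M by case: S_group.
  have := qab _ S1; rewrite (hV _ S1) eqxx => ab; suff : false by [].
  apply: ab; rewrite /a /b dcoord1.
  by transitivity (1 : C); [|symmetry]; apply: big1 => i _; rewrite mxE expr1n.
Qed.

Variable d : 'rV[K]_n.
Hypothesis d_pos : forall i, 0 < d 0 i.
Hypothesis Gd : geom G (dconj Q (toC d)).

Lemma zpow_real (m : 'rV[int]_n) : zpow (toC d) m = real_complex K (zpow d m).
Proof. by rewrite /zpow rmorph_prod; apply: eq_bigr => i _; rewrite fmorphXz mxE. Qed.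

Lemma zpow_pos_eq1 (k : int) (m : 'rV[int]_n) : k != 0 -> zpow d m ^ k = 1 -> zpow d m = 1.
Proof.
have p0 : 0 < zpow d m by apply: prodr_gt0 => i _; apply: exprz_gt0.
move: (zpow d m) p0 => x x0; case: k => k k0.
  by move/eqP; rewrite -[_ ^ _]/(x ^+ k) pexpr_eq1 ?ltW // => [/eqP|]; rewrite // lt0n.
rewrite NegzE -exprnN => /(congr1 GRing.inv); rewrite invrK invr1 => /eqP.
by rewrite pexpr_eq1 ?ltW // => /eqP.
Qed.

(** The hull of the monoid generated by S and the positive diagonal element d is a split torus
    between S and G, hence equals S by maximality; in particular d lies in S. Torsion characters are
    excluded on S by connectedness and on the powers of d by positivity. *)
Lemma torus_coordinates : exists (R : 'M[int]_n) (J : pred 'I_n),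
  [/\ R \in unitmx,
      forall x, geom S x <-> exists2 t, torus R J t & x = dconj Q t,
      geom S (dconj Q (toC d))
    & forall m, (forall s, geom S s -> zpow (dcoord s) m = 1) ->
        forall j, ~~ J j -> (m *m invmx R) 0 j = 0].
Proof.
pose E := ({s | geom S s} * nat)%type.
have S1 : geom S 1%:M by case: S_group.
have SM (s t : {s | geom S s}) : geom S (sval s *m sval t).
  by case: S_group => _ _ h _; case: s t => s hs [t ht]; apply: h.
pose op (x y : E) : E := (exist _ _ (SM x.1 y.1), (x.2 + y.2)%N).
pose one : E := (exist _ _ S1, 0%N).
pose v (x : E) : 'rV[C]_n := \row_i (dcoord (sval x.1) 0 i * toC d 0 i ^+ x.2).
have d0 : nz (toC d).
  by move=> i; rewrite mxE fmorph_eq0 gt_eqF.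
have detd : \prod_i toC d 0 i = 1.
  by rewrite -det_dconj; case: G_SL => _; apply.
have vE x : dconj Q (v x) = sval x.1 *m dconj Q (\row_i toC d 0 i ^+ x.2).
  have E' := dconj_dcoord (svalP x.1).
  transitivity (dconj Q (dcoord (sval x.1)) *m dconj Q (\row_i toC d 0 i ^+ x.2)).
    by rewrite (dconjM uQ); congr dconj; apply/rowP => i; rewrite !mxE.
  by rewrite E'.
have vnz x : nz (v x).
  by move=> i; rewrite mxE mulf_neq0 ?expf_neq0 //; apply/dcoord_nz/svalP.
have vM x y i : v (op x y) 0 i = v x 0 i * v y 0 i.
  by rewrite mxE /= (dcoordM (svalP x.1) (svalP y.1)) !mxE exprD; ring.
have v1 i : v one 0 i = 1 by rewrite mxE /= dcoord1 mxE expr0 mulr1.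
have vdet x : \prod_i v x 0 i = 1.
  rewrite (eq_bigr (fun i => dcoord (sval x.1) 0 i * toC d 0 i ^+ x.2)) => [|i _]; last by rewrite mxE.
  by rewrite big_split /= (dcoord_prod (svalP x.1)) prodrXl detd expr1n mul1r.
have vz x m : zpow (v x) m = zpow (dcoord (sval x.1)) m * zpow (toC d) m ^+ x.2.
  rewrite (_ : v x = \row_i (dcoord (sval x.1) 0 i * (\row_j toC d 0 j ^+ x.2) 0 i)).
    rewrite zpow_mul; congr (_ * _); rewrite /zpow -prodrXl; apply: eq_bigr => i _.
    by rewrite mxE -[_ ^+ x.2]/(_ ^ (x.2 : int)) exprz_exp mulrC -exprz_exp.
  by apply/rowP => i; rewrite !mxE.
have vsat (k : int) m : k != 0 -> (forall e, zpow (v e) (k *: m) = 1) ->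
    forall e, zpow (v e) m = 1.
  move=> k0 h [[s Ss] l]; rewrite vz /=.
  have -> : zpow (toC d) m = 1.
    rewrite zpow_real (@zpow_pos_eq1 k) ?rmorph1 //.
    apply: (@complex.complexI K); rewrite rmorph1 -(h (exist _ _ S1, 1%N)) vz /= dcoord1.
    have -> : zpow (const_mx 1 : 'rV[C]_n) (k *: m) = 1.
      by rewrite /zpow; apply: big1 => i _; rewrite [X in X ^ _]mxE exp1rz.
    by rewrite zpow_real -!zpowZ expr1 mul1r.
  rewrite expr1n mulr1; apply: (S_char_sat k0 _ Ss) => s' Ss'.
  by have := h (exist _ _ Ss', 0%N); rewrite vz /= expr0 mulr1.
have [R [J [V [uR VE Vt vT [Jm Vsub]]]]] := torus_hull uQ vnz vM v1 vdet vsat.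
have SV : (geom S `<=` geom V)%classic.
  move=> s Ss; apply/VE; exists (dcoord s); last by rewrite dconj_dcoord.
  have := vT (exist _ _ Ss, 0%N); rewrite (_ : v _ = dcoord s) //.
  by apply/rowP => i; rewrite mxE /= expr0 mulr1.
have [GM GG] : is_mxgroup (geom G) /\ (geom S `<=` geom G)%classic.
  by case: G_SL S_max => ? _ [].
have GV : (geom V `<=` geom G)%classic.
  apply: Vsub => x; rewrite vE; case: GM => _ G1 GM' _.
  apply: (GM' _ _ _ _); first by apply/GG/svalP.
  elim: (x.2) => [|l IH].
    rewrite (_ : \row_ _ _ = const_mx 1) ?dconj1 //.
    by apply/rowP => i; rewrite !mxE expr0.
  rewrite (_ : \row_i _ = \row_i (toC d 0 i * (\row_i toC d 0 i ^+ l) 0 i)).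
    rewrite -(dconjM uQ (toC d) (\row_i toC d 0 i ^+ l)).
    exact: (GM' _ _ Gd IH).
  by apply/rowP => i; rewrite !mxE exprS.
have VS : geom V = geom S by case: S_max => _ _; apply.
exists R, J; split=> //.
- by move=> x; rewrite -VS.
- rewrite -VS; apply/VE; exists (toC d) => //.
  have := vT (exist _ _ S1, 1%N); rewrite (_ : v _ = toC d) //.
  by apply/rowP => i; rewrite mxE /= dcoord1 mxE expr1 mul1r.
- move=> m h; apply: Jm => -[[s Ss] l]; rewrite vz /= h // mul1r.
  have := h (dconj Q (toC d)); rewrite dcoord_dconj => ->; first by rewrite expr1n.
  rewrite -VS; apply/VE; exists (toC d) => //.
  have := vT (exist _ _ S1, 1%N); rewrite (_ : v _ = toC d) //.
  by apply/rowP => i; rewrite mxE /= dcoord1 mxE expr1 mul1r.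
Qed.

End Coordinates.
End MaximalTorus.

(** * Positive elements of a torus and their centraliser *)

Definition posdef (L : rcfType) n (g : 'M[L]_n) :=
  forall v : 'rV[L]_n, ~ v = 0 -> 0 < (v *m g *m v^T) 0 0.

Lemma sqnorm_ge0 (L : realDomainType) n (v : 'rV[L]_n) : 0 <= (v *m v^T) 0 0.
Proof. by rewrite mxE sumr_ge0 // => i _; rewrite mxE -expr2 sqr_ge0. Qed.

(** A row v of Q is a left eigenvector, so the eigenvalue is the quotient of v g v^T by v v^T; Q
    need not be orthogonal. *)
Lemma posdef_diag (L : rcfType) n (Q : 'M[L]_n) d : Q \in unitmx ->
  posdef (invmx Q *m diag_mx d *m Q) -> forall i, 0 < d 0 i.
Proof.
move=> uQ pd i; set g := (_ *m Q) in pd; pose v := row i Q.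
have vg : v *m g = d 0 i *: v.
  rewrite /v /g -row_mul !mulmxA mulmxV // mul1mx row_mul.
  apply/rowP => j; rewrite !mxE (bigD1 i) //= big1 => [|k ki]; last first.
    by rewrite !mxE eq_sym (negbTE ki) mul0r.
  by rewrite !mxE eqxx mulr1n addr0.
have v0 : ~ v = 0.
  move=> v0; have : row i (Q *m invmx Q) = 0 by rewrite row_mul -/v v0 mul0mx.
  by rewrite mulmxV // row1 => /rowP/(_ i)/eqP; rewrite !mxE !eqxx oner_eq0.
have := pd v v0; rewrite vg -scalemxAl mxE => h.
by rewrite ltNge; apply: contraL h => d0; rewrite -leNgt mulr_le0_ge0 // sqnorm_ge0.
Qed.

(** An explicit first-order candidate for the identity component, meaningful over every extension;
    the identification is made in [component_pos_torus]. *)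
Definition pos_torus (K L : rcfType) (io : {rmorphism K -> L}) n (S : seq (mxpol K n))
    (P : 'M[K]_n) (x : 'M[L]_n) :=
  points io S x /\ forall i, 0 < (map_mx io P *m x *m map_mx io (invmx P)) i i.

Section Centraliser.
Variables (K : rcfType) (n : nat) (G S : seq (mxpol K n)) (P : 'M[K]_n).
Hypothesis G_SL : subgroup_SL G.
Hypothesis S_max : maximal_split_torus G S.
Hypothesis uP : P \in unitmx.
Local Notation C := (complex K).
Local Notation toC := (map_mx (@real_complex K)).
Hypothesis S_diag : forall s, geom S s -> is_diag_mx (toC P *m s *m toC (invmx P)).

(** Commuting with the positive torus forces g to preserve the weight spaces of S. Being symmetric,
    g is diagonalisable over K, and together with the weight projections [E i] it is diagonal in a
    common basis Q. There S is diagonal too, and [torus_coordinates], applied to the eigenvalues of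
    g, puts g into S. *)
Lemma centraliser_sub_torus (g : 'M[K]_n) :
  points idfun G g -> g^T = g -> posdef g ->
  (forall a, pos_torus idfun S P a -> g *m a = a *m g) -> pos_torus idfun S P g.
Proof.
move=> Gg gT gpos gcomm.
have geomR V (x : 'M[K]_n) : points idfun V x <-> geom V (toC x) by rewrite geomE; exact: points_real.
have G1 : geom G 1%:M by case: G_SL => -[].
have one_pos i : 0 < (const_mx 1 : 'rV[K]_n) 0 i by rewrite mxE.
have toC1 : toC (const_mx 1) = const_mx 1 :> 'rV[C]_n by rewrite map_const_mx.
have G1' : geom G (dconj P (toC (const_mx 1))) by rewrite toC1 dconj1.
(* With d = 1 the lemma merely parametrises S. *)
have [R [J [uR SE _ Sm]]] := torus_coordinates G_SL S_max uP S_diag one_pos G1'.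
pose sim i j := `[< forall s, geom S s -> dcoord P s 0 i = dcoord P s 0 j >].
pose g' := P *m g *m invmx P.
have g'sim i j : g' i j != 0 -> sim i j.
  move=> nz'; apply: contrapT => nsim.
  pose m : 'rV[int]_n := delta_mx 0 i - delta_mx 0 j.
  have mE (F : fieldType) (t : 'rV[F]_n) : nz t -> zpow t m = t 0 i / t 0 j.
    by move=> t0; rewrite zpowD // zpowN // !zpow_delta.
  have [l /andP[lJ ml]] : exists l, ~~ J l && ((m *m invmx R) 0 l != 0).
    apply: contrapT => /forallNP h; apply: nsim; apply/asboolP => s /SE[t tT ->].
    rewrite dcoord_dconj //; have t0 : nz t by case: tT.
    have : zpow t m = 1.
      apply: torus_char uR tT _ => l lJ; apply: contrapT => /eqP ml.
      by apply: (h l); rewrite lJ ml.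
    by rewrite mE // => /(congr1 ( *%R^~ (t 0 j))); rewrite divfK // mul1r.
  (* A positive point of S on which the weights of i and j differ: their quotient m has a nonzero
     exponent at some l outside J, and giving the coordinate l the value 2 makes m a nontrivial
     power of 2. *)
  pose z : 'rV[K]_n := \row_k (if k == l then 2 else 1).
  have zpos k : 0 < z 0 k by rewrite mxE; case: ifP.
  pose t := mono (invmx R) z.
  have z0 : nz z by move=> k; rewrite gt_eqF.
  have t0 : nz t by apply: nz_mono.
  have tpos k : 0 < t 0 k by rewrite mxE; apply: prodr_gt0 => k' _; apply: exprz_gt0.
  have tcpos : torus R J (toC t).
    split=> [k|k Jk]; first by rewrite mxE fmorph_eq0 t0.
    rewrite zpow_real zpow_mono // -row_mul mulmxV // row1 zpow_delta mxE.
    by case: eqP => [kl|_]; rewrite ?rmorph1 //; rewrite -kl Jk in lJ.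
  pose x := invmx P *m diag_mx t *m P.
  have xE : toC x = dconj P (toC t).
    by rewrite /x /dconj !map_mxM map_invmx map_diag_mx.
  have Px : P *m x *m invmx P = diag_mx t.
    by rewrite /x !mulmxA mulmxV // mul1mx mulmxK.
  have Ax : pos_torus idfun S P x.
    split; first by apply/geomR/SE; exists (toC t).
    by move=> k; rewrite !map_mx_id // Px mxE eqxx mulr1n.
  have : g' *m diag_mx t = diag_mx t *m g'.
    have := gcomm x Ax; move: (x) Px => y <- gy.
    by rewrite /g' !mulmxA !mulmxKV // -(mulmxA P g) gy mulmxA.
  rewrite mul_mx_diag mul_diag_mx => /matrixP/(_ i j).
  rewrite [LHS]mxE [RHS]mxE mulrC => /(mulIf nz') tij.
  have : zpow t m = 1 by rewrite mE // tij divff.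
  rewrite zpow_mono // /zpow (bigD1 l) //= big1 => [|k kl]; last first.
    by rewrite mxE (negbTE kl) exp1rz.
  rewrite mulr1 [z 0 l]mxE eqxx; move: (_ 0 l) ml => [k|k] k0 /eqP.
    by rewrite -[_ ^ _]/((2 : K) ^+ k) pexpr_eq1 // ?lt0n // (eqr_nat K 2 1).
  by rewrite NegzE -exprnN invr_eq1 pexpr_eq1 // (eqr_nat K 2 1).
have simsym i j : sim i j = sim j i.
  by apply/asboolP/asboolP => h s /h.
pose E i := invmx P *m diag_mx (\row_j (sim i j)%:R) *m P.
have PE i : P *m E i *m invmx P = diag_mx (\row_j (sim i j)%:R).
  by rewrite /E !mulmxA mulmxV // mul1mx mulmxK.
have simtr i j k : sim i j -> sim j k -> sim i k.
  by move=> /asboolP h /asboolP h'; apply/asboolP => s Ss; rewrite h ?h'.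
have gE i : g *m E i = E i *m g.
  have : g' *m diag_mx (\row_j (sim i j)%:R) = diag_mx (\row_j (sim i j)%:R) *m g'.
    rewrite mul_mx_diag mul_diag_mx; apply/matrixP => a b; rewrite [LHS]mxE [RHS]mxE.
    have [->|/g'sim ab] := eqVneq (g' a b) 0; first by rewrite mulr0 mul0r.
    rewrite mulrC; congr (_ * _); rewrite !mxE; congr (_ %:R); congr nat_of_bool.
    by apply/idP/idP => h; [apply: (simtr _ _ _ h); rewrite simsym|apply: (simtr _ _ _ h ab)].
  rewrite -(PE i) /g' !mulmxA mulmxKV // mulmxKV // => /(congr1 (mulmx (invmx P))).
  by rewrite !mulmxA mulVmx // !mul1mx => /(congr1 (mulmx^~ P)); rewrite !mulmxKV.
have EE i j : E i *m E j = E j *m E i.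
  rewrite /E !mulmxA !mulmxK // -(mulmxA (invmx P)) -[in RHS](mulmxA (invmx P)).
  by rewrite diag_mxC.
have [Q uQ Qd] : exists2 Q : 'M[K]_n, Q \in unitmx &
    is_diag_mx (Q *m g *m invmx Q) /\ forall i, is_diag_mx (Q *m E i *m invmx Q).
  have [|Q uQ /= /andP[gd Ed]] := (mxpoly.codiagonalizableP (g :: [seq E i | i <- enum 'I_n])).1.
    split.
      move=> A B; rewrite !inE => /predU1P[->|/mapP[i _ ->]] /predU1P[->|/mapP[j _ ->]].
      - by [].
      - exact: gE.
      - exact: esym (gE i).
      - exact: EE.
    move=> A; rewrite inE => /predU1P[->|/mapP[i _ ->]].
      have [Q uQ [d gd]] := symmetric_diagonalizable gT.
      exists Q => //; apply/(mxpoly.diagonalizable_forLR uQ); exists d.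
      by rewrite mxpoly.conjumx ?unitmx_inv // invmxK.
    exists P => //; apply/(mxpoly.diagonalizable_forLR uP); eexists.
    by rewrite mxpoly.conjumx ?unitmx_inv // invmxK.
  exists Q => //; split=> [|i].
    by move/(mxpoly.diagonalizable_forP g uQ): gd => gd; apply/is_diag_mxP => i j ij; apply: gd.
  move/allP: Ed => /(_ (E i)); rewrite map_f ?mem_enum // => /(_ isT) Ed.
  by move/(mxpoly.diagonalizable_forP (E i) uQ): Ed => Ed'; apply/is_diag_mxP => k j kj; apply: Ed'.
have [d gd] : exists d, g = invmx Q *m diag_mx d *m Q.
  case: Qd => /is_diag_mxP gdiag _; exists (\row_i (Q *m g *m invmx Q) i i).
  suff <- : Q *m g *m invmx Q = diag_mx (\row_i (Q *m g *m invmx Q) i i).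
    by rewrite !mulmxA mulVmx // mul1mx mulmxKV.
  apply/matrixP => i j; rewrite [RHS]mxE; have [<-|ij] := eqVneq i j.
    by rewrite mulr1n [RHS]mxE.
  by rewrite mulr0n gdiag.
have dpos : forall i, 0 < d 0 i by apply: posdef_diag uQ _; rewrite -gd.
have SdQ s : geom S s -> is_diag_mx (toC Q *m s *m toC (invmx Q)).
  (* The sum over i meets each weight space once per index in it, hence the division by its
     dimension. *)
  move=> Ss; pose c i := dcoord P s 0 i / (\sum_j (sim i j)%:R).
  have cnz i : (\sum_j (sim i j)%:R : C) != 0.
    rewrite -natr_sum pnatr_eq0 (bigD1 i) //= (_ : sim i i) //.
    by apply/asboolP.
  have sE : s = \sum_i c i *: toC (E i).
    rewrite -[LHS](dconj_dcoord uP S_diag Ss) /dconj.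
    transitivity (invmx (toC P) *m (\sum_i c i *: diag_mx (\row_j (sim i j)%:R)) *m toC P).
      congr (_ *m _ *m _); apply/matrixP => a b; rewrite summxE [LHS]mxE.
      have -> : \sum_i (c i *: diag_mx (\row_j (sim i j)%:R)) a b =
          \sum_i c i * ((sim i a)%:R *+ (a == b)).
        by apply: eq_bigr => i _; rewrite 3!mxE.
      have [_|ab] := eqVneq a b; last first.
        by rewrite mulr0n; symmetry; apply: big1 => i _; rewrite mulr0n mulr0.
      rewrite mulr1n; transitivity (\sum_i c a * (sim a i)%:R).
        by rewrite -big_distrr /= divfK.
      apply: eq_bigr => i _; rewrite mulr1n (simsym i a).
      case ai: (sim a i); last by rewrite !mulr0.
      rewrite !mulr1 /c; congr (_ / _); first by move/asboolP: ai; apply.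
      apply: eq_bigr => j _; congr (_ %:R); congr nat_of_bool.
      by apply/idP/idP => h; [apply: (simtr _ _ _ _ h); rewrite simsym|apply: (simtr _ _ _ ai h)].
    rewrite mulmx_sumr mulmx_suml; apply: eq_bigr => i _.
    rewrite -scalemxAr -scalemxAl; congr (_ *: _).
    rewrite /E !map_mxM map_invmx map_diag_mx; congr (_ *m diag_mx _ *m _).
    by apply/rowP => j; rewrite !mxE rmorph_nat.
  rewrite sE mulmx_sumr mulmx_suml; apply/is_diag_mxP => a b ab.
  rewrite summxE big1 // => i _; rewrite -scalemxAr -scalemxAl mxE.
  case: Qd => _ /(_ i)/is_diag_mxP/(_ a b ab) Eab.
  by rewrite -!map_mxM mxE Eab rmorph0 mulr0.
have gdc : dconj Q (toC d) = toC g.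
  by rewrite gd /dconj !map_mxM map_invmx map_diag_mx.
have Ggd : geom G (dconj Q (toC d)) by rewrite gdc; apply/geomR.
have [R' [J' [_ _ Sg _]]] := torus_coordinates G_SL S_max uQ SdQ dpos Ggd.
rewrite gdc in Sg; split; first exact/geomR.
have gP : P *m g *m invmx P = diag_mx (\row_i (P *m g *m invmx P) i i).
  have /is_diag_mxP gdiag := S_diag Sg.
  apply/matrixP => i j; rewrite [RHS]mxE; have [<-|ij] := eqVneq i j.
    by rewrite mulr1n [RHS]mxE.
  have := gdiag i j ij; rewrite -!map_mxM mxE mulr0n => /eqP.
  by rewrite fmorph_eq0 => /eqP.
have gE' : g = invmx P *m diag_mx (\row_i (P *m g *m invmx P) i i) *m P.
  by rewrite -gP !mulmxA mulVmx // mul1mx mulmxKV.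
move=> i; rewrite !map_mx_id //.
have := posdef_diag uP (d := \row_i (P *m g *m invmx P) i i).
by rewrite -gE' => /(_ gpos i); rewrite mxE.
Qed.
End Centraliser.

(** * Matrix norm, exponential and Lie algebras of closed groups *)

Section Nrm.
Variable R : realType.

(** This norm is submultiplicative and invariant under transposition, but the identity has norm n:
    hence the factors [n%:R] in the estimates. *)
Definition nrm p q (x : 'M[R]_(p, q)) : R := \sum_i \sum_j `|x i j|.

Section Basics.
Variables p q : nat.
Implicit Types x y : 'M[R]_(p, q).

Lemma nrm_ge0 x : 0 <= nrm x.
Proof. by apply: sumr_ge0 => i _; apply: sumr_ge0. Qed.

Lemma nrm0 : nrm (0 : 'M[R]_(p, q)) = 0.
Proof. by rewrite /nrm big1 // => i _; rewrite big1 // => j _; rewrite mxE normr0. Qed.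

Lemma le_nrm x i j : `|x i j| <= nrm x.
Proof.
rewrite /nrm (bigD1 i) //= (bigD1 j) //= -addrA lerDl addr_ge0 ?sumr_ge0 // => k _.
exact: sumr_ge0.
Qed.

Lemma nrm_eq0 x : nrm x <= 0 -> x = 0.
Proof.
move=> h; apply/matrixP => i j; rewrite mxE; apply/eqP; rewrite -normr_le0.
exact: le_trans (le_nrm x i j) h.
Qed.

Lemma nrmD x y : nrm (x + y) <= nrm x + nrm y.
Proof.
rewrite /nrm -big_split; apply: ler_sum => i _; rewrite -big_split.
by apply: ler_sum => j _; rewrite mxE ler_normD.
Qed.

Lemma nrmN x : nrm (- x) = nrm x.
Proof. by rewrite /nrm; apply: eq_bigr => i _; apply: eq_bigr => j _; rewrite mxE normrN. Qed.

Lemma nrmZ (c : R) x : nrm (c *: x) = `|c| * nrm x.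
Proof.
rewrite /nrm big_distrr; apply: eq_bigr => i _; rewrite /= big_distrr.
by apply: eq_bigr => j _; rewrite mxE normrM.
Qed.

Lemma nrmB x y : nrm (x - y) <= nrm x + nrm y.
Proof. by rewrite -(nrmN y) nrmD. Qed.

Lemma nrmC x y : nrm (x - y) = nrm (y - x).
Proof. by rewrite -nrmN opprB. Qed.

Lemma nrm_triangle z x y : nrm (x - y) <= nrm (x - z) + nrm (z - y).
Proof. by rewrite -[x - y](subrKA z) nrmD. Qed.

Lemma nrm_sum (I : Type) (s : seq I) (P : pred I) (F : I -> 'M[R]_(p, q)) :
  nrm (\sum_(i <- s | P i) F i) <= \sum_(i <- s | P i) nrm (F i).
Proof.
elim/big_ind2: _ => [|a b c d h h'|//]; first by rewrite nrm0.
by apply: le_trans (nrmD _ _) _; apply: lerD.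
Qed.

Lemma nrm_le_dist x y : nrm x <= nrm y + nrm (x - y).
Proof. by rewrite -{1}[x](subrK y) addrC [leRHS]addrC addrC nrmD. Qed.

End Basics.

Lemma nrm_tr p q (x : 'M[R]_(p, q)) : nrm x^T = nrm x.
Proof.
rewrite /nrm exchange_big; apply: eq_bigr => i _; apply: eq_bigr => j _.
by rewrite mxE.
Qed.

Lemma nrmM p q r (x : 'M[R]_(p, q)) (y : 'M[R]_(q, r)) :
  nrm (x *m y) <= nrm x * nrm y.
Proof.
apply: (@le_trans _ _ (\sum_i \sum_k \sum_j `|x i j| * `|y j k|)).
  apply: ler_sum => i _; apply: ler_sum => k _; rewrite mxE.
  apply: le_trans (ler_norm_sum _ _ _) _.
  by apply: ler_sum => j _; rewrite normrM.
rewrite /nrm big_distrl; apply: ler_sum => i _ /=.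
rewrite exchange_big big_distrl; apply: ler_sum => j _ /=.
rewrite -big_distrr ler_wpM2l //=.
rewrite (bigD1 j) //= lerDl; apply: sumr_ge0 => k _; exact: sumr_ge0.
Qed.

Lemma nrm1 p : nrm (1%:M : 'M[R]_p) = p%:R.
Proof.
rewrite /nrm (eq_bigr (fun=> 1)) => [|i _]; first by rewrite sumr_const card_ord.
rewrite (bigD1 i) //= mxE eqxx normr1 big1 ?addr0 // => j ji.
by rewrite mxE eq_sym (negbTE ji) normr0.
Qed.

Lemma nrm_row_mx p q r (x : 'M[R]_(p, q)) (y : 'M[R]_(p, r)) :
  nrm (row_mx x y) = nrm x + nrm y.
Proof.
rewrite /nrm -big_split; apply: eq_bigr => i _ /=; rewrite big_split_ord /=.
by congr (_ + _); apply: eq_bigr => j _; rewrite ?row_mxEl ?row_mxEr.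
Qed.

Lemma nrm_pow n (a : 'M[R]_n) k : nrm ((1 + a) ^+ k) <= n%:R * (1 + nrm a) ^+ k.
Proof.
elim: k => [|k IH]; first by rewrite !expr0 nrm1 mulr1.
rewrite exprSr mulrDr mulr1 exprSr mulrA mulrDr mulr1.
apply: le_trans (nrmD _ _) _; apply: lerD => //.
by apply: le_trans (nrmM _ _) _; rewrite ler_wpM2r // nrm_ge0.
Qed.

Lemma nrm_exp n (a : 'M[R]_n) k : nrm (a ^+ k) <= n%:R * nrm a ^+ k.
Proof.
case: k => [|k]; first by rewrite !expr0 nrm1 mulr1.
case: n a => [|n] a.
  by rewrite (_ : a ^+ k.+1 = 0) ?nrm0 ?mul0r //; apply/matrixP => -[].
apply: (@le_trans _ _ (nrm a ^+ k.+1)); last first.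
  by rewrite ler_peMl ?exprn_ge0 ?nrm_ge0 // ler1n.
elim: k => [|k IH]; first by rewrite !expr1.
rewrite exprSr [leRHS]exprSr; apply: le_trans (nrmM _ _) _.
by rewrite ler_wpM2r // nrm_ge0.
Qed.

Lemma nrm_powB n (a b : 'M[R]_n) k c : nrm a <= c -> nrm b <= c ->
  nrm ((1 + a) ^+ k - (1 + b) ^+ k) <= k%:R * n%:R ^+ 2 * nrm (a - b) * (1 + c) ^+ k.
Proof.
move=> ac bc; have c0 : 0 <= c by apply: le_trans ac; apply: nrm_ge0.
have c1 : 1 <= 1 + c by rewrite lerDl.
have pw l (x : 'M[R]_n) : nrm x <= c -> nrm ((1 + x) ^+ l) <= n%:R * (1 + c) ^+ l.
  move=> xc; apply: le_trans (nrm_pow _ _) _; rewrite ler_wpM2l // lerXn2r ?nnegrE ?addr_ge0 ?nrm_ge0 //.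
  by rewrite lerD2l.
elim: k => [|k IH]; first by rewrite !expr0 subrr nrm0 !mul0r.
have -> : (1 + a) ^+ k.+1 - (1 + b) ^+ k.+1 =
    ((1 + a) ^+ k - (1 + b) ^+ k) + (((1 + a) ^+ k - (1 + b) ^+ k) *m a + (1 + b) ^+ k *m (a - b)).
  rewrite !exprSr !mulrDr !mulr1 opprD addrACA; congr (_ + _).
  by rewrite mulmxBl mulmxBr subrKA.
apply: le_trans (nrmD _ _) _; apply: (@le_trans _ _
  (nrm ((1 + a) ^+ k - (1 + b) ^+ k) * (1 + c) + n%:R * (1 + c) ^+ k * nrm (a - b))).
  rewrite mulrDr mulr1 -addrA lerD2l; apply: le_trans (nrmD _ _) _; apply: lerD.
    by apply: le_trans (nrmM _ _) _; rewrite ler_wpM2l // nrm_ge0.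
  by apply: le_trans (nrmM _ _) _; rewrite ler_wpM2r ?nrm_ge0 // pw.
have n2 : (n%:R : R) <= n%:R ^+ 2.
  case: (n) => [|l]; first by rewrite expr2 mul0r.
  by rewrite expr2 ler_peMl // ler1n.
rewrite [leRHS](_ : _ = k%:R * n%:R ^+ 2 * nrm (a - b) * (1 + c) ^+ k * (1 + c) +
   n%:R ^+ 2 * (1 + c) ^+ k * (1 + c) * nrm (a - b)); last first.
  by rewrite -(natr1 k) (exprSr (1 + c) k); ring.
apply: lerD; first by rewrite ler_wpM2r // addr_ge0.
rewrite ler_wpM2r ?nrm_ge0 // -mulrA ler_pM //.
- by rewrite exprn_ge0 // addr_ge0.
- by rewrite ler_peMr // exprn_ge0 // addr_ge0.
Qed.

(** Closedness in terms of [nrm], so that closed subgroups can be handled by inequalities alone. *)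
Definition nclosed p q (Z : 'M[R]_(p, q) -> Prop) := forall x,
  (forall e, 0 < e -> exists2 z, Z z & nrm (z - x) < e) -> Z x.

(** Bolzano-Weierstrass, from the compactness of a product of segments; a cluster value is enough
    for all uses, so no subsequence is extracted. *)
Lemma cluster_seq p q (u : nat -> 'M[R]_(p, q)) c : (forall k, nrm (u k) <= c) ->
  exists l, forall e, 0 < e -> forall N, exists2 k, (N <= k)%N & nrm (u k - l) < e.
Proof.
move=> uc; pose A : set 'rV[R]_(p * q) := [set v | forall i, (`[- c, c]%classic) (v ord0 i)]%classic.
have Ac : compact A.
  apply: (@rV_compact R (p * q)%N (fun=> `[- c, c]%classic)) => i.
  exact: segment_compact.
pose F := ((fun k => mxvec (u k)) @ \oo)%classic.
have FA : F A.
  exists 0 => // k _ i /=; case/mxvec_indexP: i => i j.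
  by rewrite mxvecE in_itv /= -ler_norml (le_trans (le_nrm _ _ _)).
have [v [_ clv]] := Ac F _ FA.
exists (vec_mx v) => e e0 N.
(* The successor keeps the sum of the p q entries strictly below e and covers empty matrices. *)
pose e' := e / (p * q).+1%:R.
have e'0 : 0 < e' by rewrite divr_gt0.
have [w [[k Nk <-] /= vw]] := clv ((fun k => mxvec (u k)) @` [set k | (N <= k)%N])%classic (ball v e')
   (ex_intro2 _ _ N I (fun k Nk => ex_intro2 _ _ k Nk erefl)) (nbhsx_ballx v e' e'0).
exists k => //.
apply: (@le_lt_trans _ _ (\sum_(i < p) \sum_(j < q) e')).
  apply: ler_sum => i _; apply: ler_sum => j _.
  case: (vw) => _ /(_ ord0 (mxvec_index i j)); rewrite /ball /= mxvecE => /ltW.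
  by rewrite distrC !mxE.
rewrite !sumr_const !card_ord -mulrnA mulnC /e' -mulrnAr.
rewrite -[ltRHS]mulr1 ltr_pM2l // -mulr_natr mulrC ltr_pdivrMr // mul1r ltr_nat //.
Qed.

Lemma ext_value p q (Z : 'M[R]_(p, q) -> Prop) (f : 'M[R]_(p, q) -> R) z0 c :
  Z z0 -> nclosed Z -> (forall z, Z z -> nrm z <= c) ->
  (forall x, Z x -> forall e, 0 < e -> exists2 d, 0 < d &
     forall y, Z y -> nrm (y - x) < d -> `|f y - f x| < e) ->
  exists2 x, Z x & forall y, Z y -> f y <= f x.
Proof.
move=> Zz0 Zcl Zc fc.
have lim (u : nat -> 'M[R]_(p, q)) : (forall k, Z (u k)) ->
    exists2 l, Z l & forall e, 0 < e -> forall N, exists2 k, (N <= k)%N & `|f (u k) - f l| < e.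
  move=> Zu; have [l lP] := cluster_seq (fun k => Zc _ (Zu k)).
  have Zl : Z l by apply: Zcl => e e0; have [k _ uk] := lP e e0 0; exists (u k).
  exists l => // e e0 N; have [d d0 dP] := fc l Zl e e0.
  by have [k Nk uk] := lP d d0 N; exists k => //; apply: dP.
have [M fM] : exists M, forall y, Z y -> f y <= M.
  apply: contrapT => /forallNP h.
  have /choice[u uP] : forall k : nat, exists y, Z y /\ k%:R < f y.
    move=> k; have := h k%:R => /existsNP[y /not_implyP[Zy /negP]].
    by rewrite -ltNge; exists y.
  have [l Zl lP] := lim u (fun k => (uP k).1).
  have [k Nk fk] := lP 1 ltr01 (Num.truncn `|f l + 1|).+1.
  have := (uP k).2; apply/negP; rewrite -leNgt.
  have : f (u k) < f l + 1 by rewrite addrC -ltrBlDr; apply: le_lt_trans (ler_norm _) fk.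
  move=> /ltW /le_trans; apply; apply: le_trans (ler_norm _) _.
  by apply: le_trans (ltW (truncnS_gt _)) _; rewrite ler_nat.
pose T := (f @` [set z | Z z])%classic.
have Tsup : has_sup T.
  by split; [exists (f z0); exists z0|exists M => _ [z Zz <-]; apply: fM].
have /choice[u uP] : forall k : nat, exists y, Z y /\ sup T - k.+1%:R^-1 < f y.
  move=> k; have [|_ [y Zy <-] fy] := sup_adherent (eps := k.+1%:R^-1) _ Tsup; first by rewrite invr_gt0.
  by exists y.
have [l Zl lP] := lim u (fun k => (uP k).1).
exists l => // y Zy; apply: (@le_trans _ _ (sup T)).
  by apply: sup_upper_bound => //; exists y.
apply/ler_addgt0Pr => e e0; have e2 : 0 < e / 2 by rewrite divr_gt0.
have [k Nk fk] := lP (e / 2) e2 (Num.truncn (e / 2)^-1).+1.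
have h1 : f (u k) < f l + e / 2.
  by rewrite addrC -ltrBlDr; apply: le_lt_trans (ler_norm _) fk.
have h2 := (uP k).2; have h3 : k.+1%:R^-1 <= e / 2.
  rewrite -[leRHS]invrK lef_pV2 ?posrE ?invr_gt0 //.
  by apply: le_trans (ltW (truncnS_gt _)) _; rewrite ler_nat ltnW.
move: (k.+1%:R^-1) (f (u k)) (f l) (sup T) h1 h2 h3 => a b c' d h1 h2 h3; lra.
Qed.

End Nrm.

Lemma mx_exprZn (F : comPzRingType) n (c : F) (X : 'M[F]_n) k :
  (c *: X) ^+ k = c ^+ k *: X ^+ k.
Proof.
elim: k => [|k IH]; first by rewrite !expr0 scale1r.
by rewrite !exprSr IH; apply/matrixP => i j; rewrite -[_ * _]/(_ *m _) -[X ^+ k * X]/(X ^+ k *m X) -scalemxAl -scalemxAr scalerA.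
Qed.

(** * The matrix exponential *)

Section Exp.
Variable R : realType.

Definition es (y : R) N : R := \sum_(0 <= k < N) y ^+ k / k`!%:R.

Lemma es_cvg y e : 0 < e -> exists N0, forall N, (N0 <= N)%N -> `|expR y - es y N| < e.
Proof.
move=> e0; have /cvgrPdist_lt/(_ e e0)[N0 _ h] := @is_cvg_series_exp_coeff R y.
by exists N0 => N /h.
Qed.

Lemma es_nd y N M : 0 <= y -> (N <= M)%N -> es y N <= es y M.
Proof.
move=> y0 NM; rewrite /es [leRHS](big_cat_nat (n := N)) //= lerDl; apply: sumr_ge0 => k _.
by rewrite divr_ge0 // exprn_ge0.
Qed.

Lemma es_le y N : 0 <= y -> es y N <= expR y.
Proof.
move=> y0; apply/ler_addgt0Pr => e e0; have [N0 h] := es_cvg y e0.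
apply: (le_trans (es_nd y0 (leq_maxl N N0))).
have := h _ (leq_maxr N N0); rewrite ltr_norml => /andP[h1 _].
by apply/ltW; move: h1; rewrite ltrBrDl -ltrBlDr opprK || lra.
Qed.

(** Since (k + m)! is at least k!, the tail after m terms is dominated termwise by y^m times the
    series. *)
Lemma es_tail y m : 0 <= y -> expR y - es y m <= y ^+ m * expR y.
Proof.
move=> y0; apply/ler_addgt0Pr => e e0; have [N0 h] := es_cvg y e0.
have := h (m + N0)%N (leq_addl _ _); rewrite ltr_norml => /andP[_ h1].
have h2 : es y (m + N0) - es y m <= y ^+ m * expR y.
  have -> : es y (m + N0) = es y m + \sum_(m <= k < m + N0) y ^+ k / k`!%:R.
    by rewrite /es -big_cat_nat ?leq_addr.
  rewrite addrC addKr.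
  apply: (@le_trans _ _ (y ^+ m * es y N0)); last by rewrite ler_wpM2l ?exprn_ge0 ?es_le.
  have -> : \sum_(m <= k < m + N0) y ^+ k / k`!%:R = \sum_(0 <= k < N0) y ^+ (k + m) / (k + m)`!%:R.
    by rewrite -{1}[m]add0n big_addn addKn.
  rewrite /es big_distrr /=; apply: ler_sum => k _; rewrite addnC exprD -mulrA.
  rewrite ler_wpM2l ?exprn_ge0 // ler_wpM2l ?exprn_ge0 // lef_pV2 ?posrE ?ltr0n ?fact_gt0 // ler_nat.
  by elim: (m) => // l IH; rewrite addSn factS (leq_trans IH) // leq_pmull.
apply: (@le_trans _ _ ((expR y - es y (m + N0)) + (es y (m + N0) - es y m))).
  by rewrite subrKA.
by rewrite addrC lerD // ltW.
Qed.

Variable n : nat.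
Implicit Types X : 'M[R]_n.

Definition eS X N : 'M[R]_n := \sum_(0 <= k < N) (k`!%:R)^-1 *: X ^+ k.

Lemma eS_dist X N M : (N <= M)%N ->
  nrm (eS X M - eS X N) <= n%:R * (es (nrm X) M - es (nrm X) N).
Proof.
move=> NM.
have -> : eS X M = eS X N + \sum_(N <= k < M) (k`!%:R)^-1 *: X ^+ k.
  by rewrite /eS -big_cat_nat.
have -> : es (nrm X) M = es (nrm X) N + \sum_(N <= k < M) nrm X ^+ k / k`!%:R.
  by rewrite /es -big_cat_nat.
rewrite [X in nrm X]addrC addKr [X in _ * X]addrC addKr big_distrr /=.
apply: le_trans (nrm_sum _ _ _) _; apply: ler_sum => k _.
rewrite nrmZ ger0_norm ?invr_ge0 // [leRHS]mulrA mulrC.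
by rewrite ler_wpM2r ?invr_ge0 // nrm_exp.
Qed.

(** [mxexp] is a formal limit whose value is known only after convergence is proved. The comparison
    with the scalar series turns any cluster value of the partial sums into their limit, and
    compactness provides one. *)
Lemma mxexp_tail_unique X l :
  (forall e, 0 < e -> forall N, exists2 k, (N <= k)%N & nrm (eS X k - l) < e) ->
  mxexp X = l /\ forall N, nrm (mxexp X - eS X N) <= n%:R * (expR (nrm X) - es (nrm X) N).
Proof.
move=> lP.
have tail N : nrm (l - eS X N) <= n%:R * (expR (nrm X) - es (nrm X) N).
  apply/ler_addgt0Pr => e e0; have [M NM h] := lP e e0 N.
  apply: le_trans (nrm_triangle (eS X M) _ _) _; rewrite addrC; apply: lerD.
    apply: le_trans (eS_dist _ NM) _; rewrite ler_wpM2l // lerD2r.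
    by rewrite es_le // nrm_ge0.
  by rewrite nrmC ltW.
suff -> : mxexp X = l by [].
apply: cvg_lim; first exact: norm_hausdorff.
apply/cvg_ballP => e e0.
have e1 : 0 < e / n.+1%:R by rewrite divr_gt0.
have [N0 h] := es_cvg (nrm X) e1; exists N0 => // N /= /h hN; split=> // i j.
apply: (le_lt_trans (y := nrm (l - eS X N))).
  by have := le_nrm (l - eS X N) i j; rewrite !mxE.
apply: le_lt_trans (tail N) _.
apply: (@le_lt_trans _ _ (n%:R * (e / n.+1%:R))).
  by rewrite ler_wpM2l // ltW // (le_lt_trans (ler_norm _) hN).
by rewrite mulrCA gtr_pMr // ltr_pdivrMr // mul1r ltr_nat.
Qed.

Lemma exp_tail X N : nrm (mxexp X - eS X N) <= n%:R * (expR (nrm X) - es (nrm X) N).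
Proof.
have bnd k : nrm (eS X k) <= n%:R * expR (nrm X).
  have := eS_dist X (leq0n k); rewrite /eS /es (big_geq (leqnn 0)) subr0 (big_geq (leqnn 0)) subr0.
  by move=> /le_trans; apply; rewrite ler_wpM2l // es_le // nrm_ge0.
by have [l /mxexp_tail_unique[]] := cluster_seq bnd.
Qed.

Lemma eS_cvg X e : 0 < e -> exists N0, forall N, (N0 <= N)%N -> nrm (eS X N - mxexp X) < e.
Proof.
move=> e0; have e1 : 0 < e / n.+1%:R by rewrite divr_gt0.
have [N0 h] := es_cvg (nrm X) e1; exists N0 => N /h hN; rewrite nrmC.
apply: le_lt_trans (exp_tail X N) _.
apply: (@le_lt_trans _ _ (n%:R * (e / n.+1%:R))).
  by rewrite ler_wpM2l // ltW // (le_lt_trans (ler_norm _) hN).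
by rewrite mulrCA gtr_pMr // ltr_pdivrMr // mul1r ltr_nat.
Qed.

Lemma exp_closed (Z : 'M[R]_n -> Prop) X : nclosed Z -> (forall N, Z (eS X N)) -> Z (mxexp X).
Proof.
move=> Zcl ZS; apply: Zcl => e e0; have [N h] := eS_cvg X e0.
by exists (eS X N) => //; apply: h.
Qed.

Lemma mxexp_unique X l :
  (forall e, 0 < e -> forall N, exists2 k, (N <= k)%N & nrm (eS X k - l) < e) -> mxexp X = l.
Proof. by move=> /mxexp_tail_unique[]. Qed.

Lemma exp_taylor1 X : nrm (mxexp X - (1 + X)) <= n%:R * (nrm X ^+ 2 * expR (nrm X)).
Proof.
have := exp_tail X 2; rewrite /eS big_nat_recr // big_nat1 /=.
rewrite expr0 expr1 fact0 invr1 !scale1r => /le_trans; apply.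
by rewrite ler_wpM2l // es_tail // nrm_ge0.
Qed.

Lemma exp_taylor2 X :
  nrm (mxexp X - (1 + X + 2^-1 *: X ^+ 2)) <= n%:R * (nrm X ^+ 3 * expR (nrm X)).
Proof.
have := exp_tail X 3; rewrite /eS big_nat_recr // big_nat_recr // big_nat1 /=.
rewrite expr0 expr1 fact0 invr1 !scale1r => /le_trans; apply.
by rewrite ler_wpM2l // es_tail // nrm_ge0.
Qed.

(** The k-th coefficient of (1 + X/m)^m is at most 1/k!, so the difference of the two matrix series
    is dominated termwise by the same difference at the scalar [nrm X]. *)
Lemma exp_compound X m : (0 < m)%N ->
  nrm (mxexp X - (1 + m%:R^-1 *: X) ^+ m) <=
  n%:R * (expR (nrm X) - (1 + m%:R^-1 * nrm X) ^+ m).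
Proof.
move=> m0; set y := nrm X; have y0 : 0 <= y by apply: nrm_ge0.
pose c k : R := 'C(m, k)%:R * m%:R^-1 ^+ k.
have cE k : (k <= m)%N -> c k <= k`!%:R^-1.
  move=> km; rewrite /c exprVn ler_pdivrMr ?exprn_gt0 ?ltr0n // mulrC.
  rewrite ler_pdivlMr ?ltr0n ?fact_gt0 // -natrM bin_ffact -natrX ler_nat.
  have : (m ^_ k <= m ^ k)%N.
    by rewrite ffact_prod -[X in (_ <= m ^ X)%N]card_ord -prod_nat_const leq_prod // => i _; rewrite leq_subr.
  by [].
have E1 : (1 + m%:R^-1 *: X) ^+ m = \sum_(0 <= k < m.+1) c k *: X ^+ k.
  rewrite big_mkord exprDn_comm; last exact: commr1 || exact: esym (commr1 _).
  by apply: eq_bigr => k _; rewrite expr1n mul1r mx_exprZn -scaler_nat scalerA.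
have E2 : (1 + m%:R^-1 * y) ^+ m = \sum_(0 <= k < m.+1) c k * y ^+ k.
  rewrite big_mkord exprDn; apply: eq_bigr => k _.
  by rewrite expr1n mul1r exprMn /c -mulr_natl mulrA.
apply: le_trans (nrm_triangle (eS X m.+1) _ _) _.
have -> : expR y - (1 + m%:R^-1 * y) ^+ m =
    (expR y - es y m.+1) + (es y m.+1 - (1 + m%:R^-1 * y) ^+ m) by rewrite subrKA.
rewrite mulrDr; apply: lerD; first exact: exp_tail.
rewrite E1 E2 /eS /es -!sumrB big_distrr /=.
apply: le_trans (nrm_sum _ _ _) _; apply: ler_sum_nat => k /andP[_ km]; rewrite -scalerBl nrmZ ger0_norm ?subr_ge0 ?cE //.
rewrite [y ^+ k / _]mulrC -mulrBl mulrCA ler_wpM2l ?subr_ge0 ?cE //.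
exact: nrm_exp.
Qed.

(** With u = y/m, the left side is the m-th power of e^u minus that of 1 + u. Factoring out e^u - 1
    - u leaves m terms, each at most (e^u)^m = e^y; moreover e^u (1 - u) <= 1 and u <= 1/2 give e^u
    - 1 - u <= 2 u^2. *)
Lemma exp_compound_scalar (y : R) m : (0 < m)%N -> 0 <= y -> 2 * y <= m%:R ->
  expR y - (1 + m%:R^-1 * y) ^+ m <= 2 * y ^+ 2 * expR y / m%:R.
Proof.
move=> m0 y0 ym; have m0' : (0 : R) < m%:R by rewrite ltr0n.
pose u := m%:R^-1 * y; have u0 : 0 <= u by rewrite mulr_ge0 // invr_ge0 ltW.
have u2 : 2 * u <= 1 by rewrite /u mulrCA ler_pdivrMl // mulr1.
have eu : expR u - (1 + u) <= 2 * u ^+ 2.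
  have h : expR u * (1 - u) <= 1.
    have := expR_ge1Dx (- u); rewrite expRN => h.
    rewrite -[leRHS](divff (lt0r_neq0 (expR_gt0 u))) ler_wpM2l // ltW // expR_gt0.
  have e1 := expR_ge1Dx u; rewrite -/u; move: (expR u) h e1 => E h e1; nra.
have yE : expR y = expR u ^+ m.
  by rewrite -expRM_natl /u mulrA divff ?mul1r // gt_eqF.
have a1 : 1 + u <= expR u by apply: expR_ge1Dx.
rewrite -/u yE subrXX.
apply: (@le_trans _ _ ((2 * u ^+ 2) * (m%:R * expR u ^+ m))); last first.
  rewrite /u le_eqVlt; apply/orP; left; apply/eqP.
  by move: (expR _ ^+ m) => E; field; rewrite gt_eqF.
apply: ler_pM => //; first by rewrite subr_ge0.
  by apply: sumr_ge0 => i _; rewrite mulr_ge0 // exprn_ge0 ?expR_ge0 // addr_ge0.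
have -> : m%:R * expR u ^+ m = \sum_(i < m) expR u ^+ m by rewrite sumr_const card_ord mulr_natl.
apply: ler_sum => i _.
apply: (@le_trans _ _ (expR u ^+ (m.-1 - i) * expR u ^+ i)).
  rewrite ler_wpM2l ?exprn_ge0 ?expR_ge0 // lerXn2r ?nnegrE ?addr_ge0 ?expR_ge0 //.
have e1 : 1 <= expR u by apply: le_trans a1; rewrite lerDl.
rewrite -exprD ler_weXn2l //; move: (ltn_ord i); lia.
Qed.

(** The estimate behind [tan_exp]: a need only agree with X/m up to o(1/m). *)
Lemma pow_exp X (a : 'M[R]_n) m : (0 < m)%N -> 2 * nrm X <= m%:R ->
  nrm a <= (nrm X + 1) / m%:R ->
  nrm ((1 + a) ^+ m - mxexp X) <=
  n%:R ^+ 2 * (m%:R * nrm (a - m%:R^-1 *: X)) * expR (nrm X + 1)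
  + n%:R * (2 * nrm X ^+ 2 * expR (nrm X) / m%:R).
Proof.
move=> m0 Xm am; have m0' : (0 : R) < m%:R by rewrite ltr0n.
apply: le_trans (nrm_triangle ((1 + m%:R^-1 *: X) ^+ m) _ _) _; apply: lerD; last first.
  rewrite nrmC; apply: le_trans (exp_compound X m0) _.
  by rewrite ler_wpM2l // exp_compound_scalar // nrm_ge0.
apply: le_trans (nrm_powB _ am _) _.
  by rewrite nrmZ ger0_norm ?invr_ge0 // mulrC ler_wpM2r ?invr_ge0 // lerDl.
have h : (1 + (nrm X + 1) / m%:R) ^+ m <= expR (nrm X + 1).
  have -> : expR (nrm X + 1) = expR ((nrm X + 1) / m%:R) ^+ m.
    by rewrite -expRM_natl mulrCA divff ?mulr1 // gt_eqF.
  by rewrite lerXn2r ?nnegrE ?expR_ge0 ?expR_ge1Dx // addr_ge0 // divr_ge0 // addr_ge0 // nrm_ge0.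
rewrite [leRHS](_ : _ = m%:R * n%:R ^+ 2 * nrm (a - m%:R^-1 *: X) * expR (nrm X + 1)).
  by rewrite ler_wpM2l // !mulr_ge0 ?exprn_ge0 ?nrm_ge0.
by rewrite [_ ^+ 2 * _]mulrCA mulrA.
Qed.

Lemma exp_compound_cvg X e : 0 < e ->
  exists N, forall m, (N < m)%N -> nrm ((1 + m%:R^-1 *: X) ^+ m - mxexp X) < e.
Proof.
move=> e0; set C := n%:R * (2 * nrm X ^+ 2 * expR (nrm X)).
exists (Num.truncn (2 * nrm X + (C + 1) / e)) => m Nm.
have h0 : 0 <= C by rewrite !mulr_ge0 ?expR_ge0 ?exprn_ge0 ?nrm_ge0.
have h1 : 2 * nrm X + (C + 1) / e < m%:R.
  by apply: lt_le_trans (truncnS_gt _) _; rewrite ler_nat.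
have h2 : 0 <= (C + 1) / e by rewrite divr_ge0 ?addr_ge0 // ltW.
have h3 : 0 <= 2 * nrm X by rewrite mulr_ge0 // nrm_ge0.
have m0 : (0 < m)%N by apply: leq_ltn_trans Nm.
have m0' : (0 : R) < m%:R by rewrite ltr0n.
apply: le_lt_trans (pow_exp m0 _ _) _.
- by apply: ltW; apply: le_lt_trans h1; rewrite lerDl.
- by rewrite nrmZ ger0_norm ?invr_ge0 // mulrC ler_wpM2r ?invr_ge0 // lerDl.
rewrite subrr nrm0 mulr0 mulr0 mul0r add0r mulrA -/C ltr_pdivrMr // mulrC.
rewrite -ltr_pdivrMr //; apply: le_lt_trans h1; apply: ler_wpDl => //.
by rewrite ler_pdivrMr // divfK ?gt_eqF // lerDl.
Qed.

Lemma exp_eq0_limit (x : 'M[R]_n) C : 0 <= C ->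
  (forall e, 0 < e -> e <= 1 -> nrm x <= C * e) -> x = 0.
Proof.
move=> C0 h; apply: nrm_eq0; apply/ler_addgt0Pr => e e0; rewrite add0r.
have d0 : 0 < Num.min 1 (e / (C + 1)).
  by rewrite lt_min ltr01 divr_gt0 // ltr_wpDl.
apply: le_trans (h _ d0 _) _; first by rewrite ge_min lexx.
apply: (@le_trans _ _ (C * (e / (C + 1)))).
  by rewrite ler_wpM2l // ge_min lexx orbT.
by rewrite mulrCA ler_piMr ?(ltW e0) // ler_pdivrMr ?mul1r ?lerDl // ltr_wpDl.
Qed.

Lemma mxexp0 : mxexp (0 : 'M[R]_n) = 1%:M.
Proof.
apply: mxexp_unique => e e0 N; exists N.+1 => //.
rewrite /eS big_nat_recl // big1 => [|k _]; last first.
  by rewrite exprS -[0 * _]/(0 *m _) mul0mx scaler0.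
by rewrite expr0 fact0 invr1 scale1r addr0 subrr nrm0.
Qed.

Let product_bound (e p q r s t u : R) : 0 < e -> e <= 1 -> p <= e -> q < e -> r < e -> s <= u + e ->
  0 <= u -> 0 <= t -> 0 <= s -> 0 <= q -> 0 <= r -> p + q * s + t * r <= (1 + 1 + t + u) * e.
Proof. by move=> e0 e1 hp hq hr hs u0 t0 s0 q0 r0; nra. Qed.

(** (1 + X/m)^m (1 - X/m)^m = (1 - X^2/m^2)^m, and X^2/m^2 is o(1/m), so the limit is exp 0 = 1.
    This avoids the product of two exponential series. *)
Lemma mxexpN X : mxexp X *m mxexp (- X) = 1%:M.
Proof.
pose C := n%:R ^+ 2 * (nrm X * nrm X) * expR 1.
apply/eqP; rewrite -subr_eq0; apply/eqP.
apply: (@exp_eq0_limit _ (1 + 1 + nrm (mxexp X) + nrm (mxexp (- X)) )).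
  by rewrite !addr_ge0 // nrm_ge0.
move=> e e0 e1.
have [N1 h1] := exp_compound_cvg X e0; have [N2 h2] := exp_compound_cvg (- X) e0.
pose m := (N1 + N2 + Num.truncn (nrm X * nrm X) + Num.truncn (C / e)).+1.
have m0 : (0 < m)%N by [].
have m0' : (0 : R) < m%:R by rewrite ltr0n.
have {h1} := h1 m ltac:(rewrite /m; lia); have {h2} := h2 m ltac:(rewrite /m; lia).
set b := (_ ^+ m); set a := (_ ^+ m) => hb ha.
have hab : nrm (a *m b - 1) <= e.
  have -> : a *m b = (1 - m%:R^-1 ^+ 2 *: (X *m X)) ^+ m.
    rewrite -[a *m b]/(a * b) /a /b -exprMn_comm; last first.
      rewrite scalerN; apply: commrD; first exact: commr1.
      by apply: commrN; apply: commrD || apply/commr_sym/commrD => //; apply: commr1.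
    congr (_ ^+ m); rewrite scalerN mulrDl mul1r mulrBr mulr1 addrA subrK.
    congr (1 - _); rewrite -[_ * _]/(_ *m _) -scalemxAl -scalemxAr scalerA expr2 //.
  have XX : nrm (- (m%:R^-1 ^+ 2 *: (X *m X))) <= m%:R^-1 ^+ 2 * (nrm X * nrm X).
    by rewrite nrmN nrmZ ger0_norm ?exprn_ge0 ?invr_ge0 // ler_wpM2l ?exprn_ge0 ?invr_ge0 // nrmM.
  have mX : nrm X * nrm X <= m%:R.
    by apply: ltW; apply: lt_le_trans (truncnS_gt _) _; rewrite ler_nat /m ltnS -addnA addnCA leq_addr.
  have := @pow_exp 0 (- (m%:R^-1 ^+ 2 *: (X *m X))) m m0; rewrite nrm0 mulr0 add0r mxexp0.
  move=> /(_ (ltW m0')); rewrite scaler0 subr0 expr0n /= mulr0 !mul0r mulr0 addr0.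
  have -> : (1 : 'M[R]_n) = 1%:M by [].
  move=> h; apply: le_trans (h _) _.
    apply: le_trans XX _; rewrite mul1r expr2 -mulrA ler_piMr ?invr_ge0 //.
    by rewrite mulrC ler_pdivrMr // mul1r.
  apply: (@le_trans _ _ (C / m%:R)).
    rewrite (_ : C / m%:R = n%:R ^+ 2 * (nrm X * nrm X / m%:R) * expR 1); last by rewrite /C mulrAC !mulrA.
    rewrite ler_wpM2r ?expR_ge0 // ler_wpM2l ?exprn_ge0 //.
    apply: (@le_trans _ _ (m%:R * (m%:R^-1 ^+ 2 * (nrm X * nrm X)))); first by rewrite ler_wpM2l.
    by rewrite expr2 -mulrA mulrA divff ?gt_eqF // mul1r mulrC.
  rewrite ler_pdivrMr // -ler_pdivrMl // mulrC.
  by apply: ltW; apply: lt_le_trans (truncnS_gt _) _; rewrite ler_nat /m ltnS leq_addl.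
have -> : mxexp X *m mxexp (- X) - 1%:M =
  (a *m b - 1%:M) - (a - mxexp X) *m b - mxexp X *m (b - mxexp (- X)).
  rewrite mulmxBl mulmxBr opprB opprB addrA addrAC; apply/matrixP => i j; rewrite !mxE; ring.
have bn : nrm b <= nrm (mxexp (- X)) + e.
  by apply: le_trans (nrm_le_dist _ (mxexp (- X))) _; rewrite lerD2l; exact: ltW hb.
apply: (@le_trans _ _ (nrm (a *m b - 1) + nrm (a - mxexp X) * nrm b + nrm (mxexp X) * nrm (b - mxexp (- X)))).
  apply: le_trans (nrmB _ _) _; apply: lerD; last exact: nrmM.
   by apply: le_trans (nrmB _ _) _; rewrite lerD2l nrmM.
apply: product_bound e0 e1 hab ha hb bn _ _ _ _ _; exact: nrm_ge0.
Qed.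

Lemma mxexp_unit X : mxexp X \in unitmx.
Proof. by have [] := mulmx1_unit (mxexpN X). Qed.

Lemma invmx_mxexp X : invmx (mxexp X) = mxexp (- X).
Proof. by rewrite -[RHS](mulKmx (mxexp_unit X)) mxexpN mulmx1. Qed.

End Exp.

Section ExpMore.
Variable R : realType.

(** Carries convergence from the series of X to that of Y; it serves for conjugation, transposition
    and the embedding [jm]. *)
Lemma mxexp_limit n m (Y : 'M[R]_m) (X : 'M[R]_n) l C :
  (forall N, nrm (eS Y N - l) <= C * nrm (eS X N - mxexp X)) -> mxexp Y = l.
Proof.
move=> h; apply: mxexp_unique => e e0 N.
have d0 : 0 < e / (`|C| + 1) by rewrite divr_gt0 // ltr_wpDl.
have [N0 h0] := eS_cvg X d0; exists (maxn N N0); first exact: leq_maxl.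
apply: le_lt_trans (h _) _; have := h0 _ (leq_maxr N N0).
rewrite ltr_pdivlMr ?ltr_wpDl //; apply: le_lt_trans.
rewrite mulrC ler_wpM2l ?nrm_ge0 //; apply: le_trans (ler_norm _) _; by rewrite lerDl.
Qed.


Lemma mxexp_conj n (P X : 'M[R]_n) : P \in unitmx ->
  mxexp (P *m X *m invmx P) = P *m mxexp X *m invmx P.
Proof.
move=> uP; apply: (@mxexp_limit _ _ _ X _ (nrm P * nrm (invmx P))) => N.
have -> : eS (P *m X *m invmx P) N = P *m eS X N *m invmx P.
  rewrite /eS mulmx_sumr mulmx_suml; apply: eq_bigr => k _.
  rewrite -scalemxAr -scalemxAl; congr (_ *: _).
  elim: k => [|k IH]; first by rewrite !expr0 mulmx1 mulmxV.
  by rewrite !exprSr IH -[_ * _]/(_ *m _) -[X ^+ k * X]/(_ *m _) !mulmxA mulmxKV.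
rewrite -mulmxBl -mulmxBr mulrAC.
apply: le_trans (nrmM _ _) _; rewrite ler_wpM2r ?nrm_ge0 //; exact: nrmM.
Qed.

Lemma mxexp_tr n (X : 'M[R]_n) : mxexp X^T = (mxexp X)^T.
Proof.
apply: (@mxexp_limit _ _ _ X _ 1) => N.
have -> : eS X^T N = (eS X N)^T.
  rewrite /eS raddf_sum; apply: eq_bigr => k _ /=; rewrite linearZ /=; congr (_ *: _).
  elim: k => [|k IH]; first by rewrite !expr0 trmx1.
  by rewrite exprS exprSr IH -[_ * _]/(_ *m _) -[X ^+ k * X]/(_ *m _) trmx_mul.
by rewrite mul1r -raddfB nrm_tr.
Qed.

Lemma diag_mx_exp (F : comNzRingType) n (d : 'rV[F]_n) k :
  diag_mx d ^+ k = diag_mx (\row_i d 0 i ^+ k).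
Proof.
elim: k => [|k IH].
  by apply/matrixP => i j; rewrite expr0 !mxE expr0.
rewrite exprSr IH -[_ * _]/(_ *m _) mulmx_diag; congr diag_mx.
by apply/rowP => i; rewrite !mxE exprSr.
Qed.

Lemma mxexp_diag n (d : 'rV[R]_n) :
  mxexp (diag_mx d) = diag_mx (\row_i expR (d 0 i)).
Proof.
apply: mxexp_unique => e e0 N.
have d0 : 0 < e / n.+1%:R by rewrite divr_gt0.
have [M MP] : exists M, forall i, `|expR (d 0 i) - es (d 0 i) M| < e / n.+1%:R /\ (N <= M)%N.
  have /choice[M MP] i := es_cvg (d 0 i) d0.
  exists (N + \sum_i M i)%N => i; split; last exact: leq_addr.
  apply: MP; rewrite (bigD1 i) //= addnCA; exact: leq_addr.
have NM : exists2 M', (N <= M')%N & forall i, `|expR (d 0 i) - es (d 0 i) M'| < e / n.+1%:R.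
  case: (leqP N M) => [NM|MN]; first by exists M => // i; case: (MP i).
  by exists N => // i; case: (MP i) => _; rewrite leqNgt MN.
case: NM => {MP}M NM MP; exists M => //.
have -> : eS (diag_mx d) M - diag_mx (\row_i expR (d 0 i)) =
    diag_mx (\row_i (es (d 0 i) M - expR (d 0 i))).
  apply/matrixP => i j; rewrite /eS !mxE summxE.
  under eq_bigr => k _ do rewrite mxE diag_mx_exp !mxE.
  have [_|ij] := eqVneq i j; last first.
    by rewrite !mulr0n subr0; apply: big1 => k _; rewrite mulr0n mulr0.
  rewrite !mulr1n /es; congr (_ - _); apply: eq_bigr => k _; by rewrite mulr1n mulrC.
apply: (@le_lt_trans _ _ (\sum_(i < n) e / n.+1%:R)).
  apply: ler_sum => i _; rewrite (bigD1 i) //= big1 => [|j ji].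
    by rewrite addr0 !mxE eqxx mulr1n distrC ltW.
  by rewrite mxE eq_sym (negbTE ji) mulr0n normr0.
rewrite sumr_const card_ord -[_ *+ n]mulr_natl mulrCA gtr_pMr // ltr_pdivrMr // mul1r ltr_nat //.
Qed.

End ExpMore.

(** * Tangent vectors and Lie algebras of closed groups *)

Section FirstOrder.
Variables (R : realType) (n : nat).
Implicit Types (X Y : 'M[R]_n) (f g : R -> 'M[R]_n) (G : set 'M[R]_n).

(** One-sided derivative at 0 of a curve issuing from the identity. *)
Definition fo f X := forall e, 0 < e -> exists2 d, 0 < d &
  forall t, 0 < t -> t < d -> nrm (f t - 1%:M - t *: X) <= e * t.

Lemma foM f g X Y : fo f X -> fo g Y -> fo (fun t => f t *m g t) (X + Y).
Proof.
move=> fX gY e e0; pose M := n%:R + nrm Y + 1; pose x := nrm X; pose y := nrm Y.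
have x0 : 0 <= x by apply: nrm_ge0.
have y0 : 0 <= y by apply: nrm_ge0.
have M0 : 0 < 1 + M by rewrite /M addr_gt0 // ltr_wpDl // addr_ge0 // nrm_ge0.
have P0 : 0 < x * (y + 1) + 1 by rewrite ltr_wpDl // mulr_ge0 // addr_ge0.
pose e' := Num.min 1 (e / (2 * (1 + M))).
have e'0 : 0 < e' by rewrite lt_min ltr01 divr_gt0 // mulr_gt0.
have [d1 d10 h1] := fX e' e'0; have [d2 d20 h2] := gY e' e'0.
pose d3 := e / (2 * (x * (y + 1) + 1)).
have d30 : 0 < d3 by rewrite divr_gt0 // mulr_gt0.
exists (Num.min (Num.min d1 d2) (Num.min 1 d3)); first by rewrite !lt_min d10 d20 ltr01 d30.
move=> t t0; rewrite !lt_min => /andP[/andP[td1 td2] /andP[t1 td3]].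
have {h1} := h1 t t0 td1; have {h2} := h2 t t0 td2.
set r := _ - t *: X; set s := _ - t *: Y => hs hr.
have -> : f t *m g t - 1%:M - t *: (X + Y) = s + t *: (X *m (g t - 1%:M)) + r *m g t.
  rewrite /s /r !mulmxBl mulmxBr mul1mx mulmx1 scalerBr scalerDr -scalemxAl.
  apply/matrixP => i j; rewrite !mxE; ring.
have e'1 : e' <= 1 by rewrite ge_min lexx.
have g1 : nrm (g t - 1%:M) <= t * (y + 1).
  have -> : g t - 1%:M = s + t *: Y by rewrite subrK.
  apply: le_trans (nrmD _ _) _; rewrite nrmZ gtr0_norm // mulrDr addrC lerD2l mulr1.
  apply: le_trans hs _; rewrite ler_piMl // ltW //.
have gM : nrm (g t) <= M.
  apply: le_trans (nrm_le_dist _ 1%:M) _; rewrite nrm1 /M -addrA lerD2l.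
  by apply: le_trans g1 _; rewrite ler_piMl ?(ltW t1) // addr_ge0.
apply: le_trans (nrmD _ _) _; apply: (@le_trans _ _ ((e' * t + t * (x * (t * (y + 1)))) + e' * t * M)).
  apply: lerD; last first.
    by apply: le_trans (nrmM _ _) _; apply: ler_pM; rewrite ?nrm_ge0.
  apply: le_trans (nrmD _ _) _; apply: lerD => //.
  rewrite nrmZ gtr0_norm // ler_wpM2l ?(ltW t0) //; apply: le_trans (nrmM _ _) _.
  by rewrite ler_wpM2l.
have E1 : e' * (1 + M) <= e / 2.
  apply: (@le_trans _ _ (e / (2 * (1 + M)) * (1 + M))).
    by rewrite ler_wpM2r ?(ltW M0) // ge_min lexx orbT.
  by rewrite invfM mulrA divfK ?gt_eqF.
have E2 : t * (x * (y + 1)) <= e / 2.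
  apply: (@le_trans _ _ (d3 * (x * (y + 1) + 1))); last by rewrite /d3 invfM mulrA divfK ?gt_eqF.
  apply: ler_pM; rewrite ?(ltW t0) ?(ltW td3) ?lerDl // mulr_ge0 // addr_ge0 //.
have -> : (e' * t + t * (x * (t * (y + 1)))) + e' * t * M = (e' * (1 + M) + t * (x * (y + 1))) * t by ring.
rewrite ler_wpM2r ?(ltW t0) //; apply: le_trans (lerD E1 E2) _.
by rewrite -splitr.
Qed.

Lemma fo_exp X : fo (fun t => mxexp (t *: X)) X.
Proof.
move=> e e0; pose C := n%:R * (nrm X ^+ 2 * expR (nrm X)).
have C0 : 0 < C + 1 by rewrite ltr_wpDl // !mulr_ge0 ?exprn_ge0 ?nrm_ge0 ?expR_ge0.
exists (Num.min 1 (e / (C + 1))); first by rewrite lt_min ltr01 divr_gt0.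
move=> t t0; rewrite lt_min => /andP[t1 te].
have := exp_taylor1 (t *: X); rewrite opprD addrA => /le_trans; apply.
rewrite nrmZ gtr0_norm // exprMn.
apply: (@le_trans _ _ (t ^+ 2 * C)).
  rewrite /C [leRHS]mulrCA ler_wpM2l // -mulrA ler_wpM2l ?exprn_ge0 ?(ltW t0) //.
  rewrite ler_wpM2l ?exprn_ge0 ?nrm_ge0 // ler_expR ler_piMl ?nrm_ge0 // ltW //.
rewrite expr2 -mulrA mulrC ler_wpM2r ?(ltW t0) //.
apply: (@le_trans _ _ (t * (C + 1))); first by rewrite ler_wpM2l ?(ltW t0) // lerDl.
by move: te; rewrite ltr_pdivlMr // => /ltW.
Qed.

(** Some arbitrarily small t suffices, instead of all small t; this weak form is what a cluster
    value of rescaled group elements provides. *)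
Definition tan G X := forall e, 0 < e -> exists2 t, 0 < t < e &
  exists2 g, G g & nrm (g - 1%:M - t *: X) <= e * t.

Lemma fo_tan G f X : fo f X -> (forall t, 0 < t -> G (f t)) -> tan G X.
Proof.
move=> fX Gf e e0; have [d d0 h] := fX e e0; pose t := Num.min d e / 2.
have m0 : 0 < Num.min d e by rewrite lt_min d0.
have t0 : 0 < t by rewrite divr_gt0.
have : t < Num.min d e by rewrite /t ltr_pdivrMr // ltr_pMr // ltr1n.
rewrite lt_min => /andP[td te]; exists t; first by rewrite t0.
by exists (f t); [apply: Gf|apply: h].
Qed.

Lemma tanZ G X s : 0 < s -> tan G X -> tan G (s *: X).
Proof.
move=> s0 tX e e0; pose e' := Num.min (e * s) (e / s).
have e'0 : 0 < e' by rewrite lt_min mulr_gt0 ?divr_gt0.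
have [t /andP[t0 te] [g Gg h]] := tX e' e'0; exists (t / s).
  rewrite divr_gt0 //= ltr_pdivrMr //; apply: lt_le_trans te _.
  by rewrite ge_min lexx.
exists g => //; rewrite scalerA divfK ?gt_eqF //; apply: le_trans h _.
rewrite mulrA mulrAC ler_wpM2r ?(ltW t0) //; by rewrite ge_min lexx orbT.
Qed.

Section Group.
Variable G : set 'M[R]_n.
Hypothesis grp : is_mxgroup G.
Hypothesis Gcl : nclosed G.

Lemma group_exp (g : 'M[R]_n) k : G g -> G (g ^+ k).
Proof.
case: grp => _ G1 GM _ Gg; elim: k => [|k IH]; first by rewrite expr0.
by rewrite exprS; apply: GM.
Qed.

(** The closed subgroup theorem: for g close to 1 + tX and m the integer part of 1/t, the power g^m
    lies in G and is close to exp X. *)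
Lemma tan_exp X : tan G X -> G (mxexp X).
Proof.
move=> tX; apply: Gcl => e e0; pose y := nrm X; have y0 : 0 <= y by apply: nrm_ge0.
(* C is the constant left by [pow_exp]. Of the three bounds in e', the first makes m positive, the
   second gives 2 [nrm X] <= m, and the third makes the final error smaller than e. *)
pose C := n%:R ^+ 2 * (1 + y) * expR (y + 1) + n%:R * (4 * y ^+ 2 * expR y).
have C0 : 0 <= C.
  by rewrite addr_ge0 // !mulr_ge0 ?exprn_ge0 ?expR_ge0 // addr_ge0.
pose e' := Num.min (1 / 2) (Num.min (1 / (4 * (y + 1))) (e / (C + 1))).
have e'0 : 0 < e'.
  have y1 : 0 < y + 1 by rewrite ltr_wpDl.
  have C1 : 0 < C + 1 by rewrite ltr_wpDl.
  by rewrite !lt_min !divr_gt0 ?mulr_gt0.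
have e'1 : e' <= 1 / 2 by rewrite ge_min lexx.
have e'2 : e' <= 1 / (4 * (y + 1)) by rewrite !ge_min lexx orbT.
have e'3 : e' <= e / (C + 1) by rewrite !ge_min lexx !orbT.
have [t /andP[t0 te] [g Gg h]] := tX e' e'0.
pose m := Num.truncn t^-1; pose mr : R := m%:R.
have it0 : 0 < t^-1 by rewrite invr_gt0.
have mt : mr * t <= 1.
  by rewrite -ler_pdivlMr // mul1r /mr /m; have := truncn_le t^-1; rewrite ?(ltW it0) // => ->; rewrite ?ltW.
have mt1 : 1 < (mr + 1) * t.
  by rewrite -ltr_pdivrMr // mul1r /mr natr1 truncnS_gt.
have t2 : t < 1 / 2 by apply: lt_le_trans te e'1.
have m0' : 0 < mr.
  by rewrite ltr0n lt0n; apply/eqP => m0; move: mt1; rewrite /mr m0 add0r mul1r; lra.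
have m0 : (0 < m)%N by rewrite -(ltr0n R).
pose a := g - 1%:M.
have gE : g = 1 + a by rewrite /a addrC subrK.
have a1 : nrm (a - mr^-1 *: X) * mr <= e' + t * y.
  have -> : a - mr^-1 *: X = (a - t *: X) + (t - mr^-1) *: X by rewrite scalerBl addrA subrK.
  apply: (@le_trans _ _ ((e' * t + `|t - mr^-1| * y) * mr)).
    rewrite ler_wpM2r ?(ltW m0') //; apply: le_trans (nrmD _ _) _; apply: lerD => //.
    by rewrite nrmZ.
  rewrite mulrDl; apply: lerD.
    have -> : e' * t * mr = e' * (mr * t) by ring.
    by rewrite ler_piMr ?(ltW e'0).
  rewrite mulrAC ler_wpM2r //.
  rewrite -{2}(gtr0_norm m0') -normrM mulrBl mulVf ?gt_eqF // ler_norml; move: mt mt1 t0; clear; lra.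
have yt : 4 * (y + 1) * t <= 1.
  rewrite -ler_pdivlMl ?mulr_gt0 ?ltr_wpDl // mulr1; apply: le_trans (ltW te) _.
  by rewrite -[leRHS]mul1r.
have y1 : 0 < y + 1 by rewrite ltr_wpDl.
have ym : 2 * nrm X <= m%:R.
  rewrite -/y -/mr -(ler_pM2r t0); move: yt mt1 t2 y1 t0; clear; nra.
have am : nrm a <= (nrm X + 1) / m%:R.
  rewrite ler_pdivlMr // -/mr -/y.
  apply: (@le_trans _ _ ((nrm (a - t *: X) + t * y) * mr)).
    rewrite ler_wpM2r ?(ltW m0') //; have := nrm_le_dist a (t *: X).
    by rewrite nrmZ gtr0_norm // addrC.
  apply: (@le_trans _ _ ((t + t * y) * mr)).
    rewrite ler_wpM2r ?(ltW m0') // lerD2r; apply: le_trans h _.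
    by rewrite ler_piMl ?(ltW t0) //; move: e'1; lra.
  have -> : (t + t * y) * mr = (y + 1) * (mr * t) by ring.
  by rewrite ler_piMr // ltW.
exists (g ^+ m); first exact: group_exp.
rewrite gE; apply: le_lt_trans (pow_exp m0 ym am) _.
rewrite -/y -/mr; apply: (@le_lt_trans _ _ (C * e')).
  have -> : C * e' = n%:R ^+ 2 * ((1 + y) * e') * expR (y + 1) + n%:R * (4 * y ^+ 2 * expR y * e').
    by rewrite /C; ring.
  apply: lerD.
    rewrite ler_wpM2r ?expR_ge0 // ler_wpM2l ?exprn_ge0 // mulrC.
    by apply: le_trans a1 _; rewrite mulrDl mul1r lerD2l mulrC ler_wpM2l // ltW.
  rewrite ler_wpM2l // ler_pdivrMr //.
  have : 1 <= 2 * (e' * mr).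
    by move: mt1 te t2 m0' t0; clear; nra.
  have : 0 <= y ^+ 2 * expR y by rewrite mulr_ge0 ?exprn_ge0 ?expR_ge0.
  have key (z u v : R) : 0 <= z -> 1 <= 2 * (u * v) -> 2 * z <= 4 * z * u * v by nra.
  by move=> /key h1 /h1; rewrite !mulrA.
apply: (@le_lt_trans _ _ (C * (e / (C + 1)))); first by rewrite ler_wpM2l.
by rewrite mulrCA gtr_pMr // ltr_pdivrMr ?mul1r ?ltrDl // ltr_wpDl.
Qed.

Lemma tan_lie X : tan G X -> lie G X.
Proof.
move=> tX t; have [t0|t0|->] := ltgtP t 0; last by rewrite scale0r mxexp0; case: grp.
  rewrite -[t]opprK scaleNr -invmx_mxexp; case: grp => _ _ _; apply.
  by apply: tan_exp; apply: tanZ => //; rewrite oppr_gt0.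
by apply: tan_exp; apply: tanZ.
Qed.

Lemma lie_tan X : lie G X -> tan G X.
Proof. by move=> lX; apply: fo_tan (fo_exp X) _ => t _; apply: lX. Qed.

Lemma lie0 : lie G 0.
Proof. by move=> t; rewrite scaler0 mxexp0; case: grp. Qed.

Lemma lieZ c X : lie G X -> lie G (c *: X).
Proof. by move=> lX t; rewrite scalerA; apply: lX. Qed.

Lemma lieN X : lie G X -> lie G (- X).
Proof. by rewrite -scaleN1r; apply: lieZ. Qed.

(** The product of two one-parameter groups has derivative X + Y at 0; it is not a one-parameter
    group, but a tangent vector is all that is needed. *)
Lemma lieD X Y : lie G X -> lie G Y -> lie G (X + Y).
Proof.
move=> lX lY; apply: tan_lie; apply: fo_tan (foM (fo_exp X) (fo_exp Y)) _ => t _.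
by case: grp => _ _ GM _; apply: GM; [apply: lX|apply: lY].
Qed.

Lemma lieB X Y : lie G X -> lie G Y -> lie G (X - Y).
Proof. by move=> lX lY; apply: lieD => //; apply: lieN. Qed.

Lemma lie_sum I (s : seq I) (P : pred I) (f : I -> 'M[R]_n) :
  (forall i, P i -> lie G (f i)) -> lie G (\sum_(i <- s | P i) f i).
Proof. by move=> h; elim/big_ind: _ => //; [exact: lie0|exact: lieD]. Qed.

Lemma lie_closed : nclosed (lie G).
Proof.
move=> X h; apply: tan_lie => e e0.
have e2 : 0 < e / 2 by rewrite divr_gt0.
have [Y lY XY] := h _ e2; have [t /andP[t0 te] [g Gg hg]] := lie_tan lY e2.
exists t; first by rewrite t0 (lt_trans te) // ltr_pdivrMr // ltr_pMr // ltr1n.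
exists g => //; have -> : g - 1%:M - t *: X = (g - 1%:M - t *: Y) + t *: (Y - X).
  by rewrite scalerBr addrA subrK.
apply: le_trans (nrmD _ _) _; rewrite [e]splitr mulrDl; apply: lerD => //.
by rewrite nrmZ gtr0_norm // mulrC ler_wpM2r // ltW.
Qed.

Lemma lie_Ad (g : 'M[R]_n) X : G g -> lie G X -> lie G (g *m X *m invmx g).
Proof.
case: grp => GU _ GM GV Gg lX t; rewrite scalemxAl scalemxAr mxexp_conj; last exact: GU.
exact: (GM _ _ (GM _ _ Gg (lX t)) (GV _ Gg)).
Qed.

(** The bracket is the limit of (Ad(exp tX) Y - Y)/t, whose members are in the Lie algebra, and the
    Lie algebra is closed. *)
Lemma lie_bracket X Y : lie G X -> lie G Y -> lie G (X *m Y - Y *m X).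
Proof.
move=> lX lY; apply: lie_closed => e e0.
pose y := nrm Y; pose x := nrm X.
have y0 : 0 <= y by apply: nrm_ge0. have x0 : 0 <= x by apply: nrm_ge0.
pose C := (n%:R + x + 1) * y + y + y * x * (x + 1) + 1.
have C0 : 0 < C by rewrite /C ltr_wpDl // !addr_ge0 // !mulr_ge0 ?addr_ge0.
pose e' := Num.min 1 (e / (2 * C)).
have e'0 : 0 < e' by rewrite lt_min ltr01 divr_gt0 // mulr_gt0.
have e'1 : e' <= 1 by rewrite ge_min lexx.
have [d1 d10 h1] := fo_exp X e'0; have [d2 d20 h2] := fo_exp (- X) e'0.
pose t := Num.min (Num.min d1 d2) e' / 2.
have m0 : 0 < Num.min (Num.min d1 d2) e' by rewrite lt_min lt_min d10 d20 e'0.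
have t0 : 0 < t by rewrite divr_gt0.
have : t < Num.min (Num.min d1 d2) e' by rewrite /t ltr_pdivrMr // ltr_pMr // ltr1n.
rewrite lt_min lt_min => /andP[/andP[td1 td2] te'].
have {h1} := h1 t t0 td1; have {h2} := h2 t t0 td2.
rewrite scalerN -invmx_mxexp; set g := mxexp (t *: X).
have Gg : G g by apply: lX.
have gE : forall u v, g *m u *m invmx g - v = (g *m u - v *m g) *m invmx g.
  by move=> u v; rewrite mulmxBl mulmxK ?mxexp_unit.
set gi := invmx g; set s := _ - t *: X; set r := _ - - (t *: X) => hr hs.
exists (t^-1 *: (g *m Y *m gi - Y)).
  by apply: lieZ; apply: lieB => //; apply: lie_Ad.
have gi1 : nrm (gi - 1%:M) <= t * (x + 1).
  have -> : gi - 1%:M = r - t *: X by rewrite /r opprK addrK.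
  apply: le_trans (nrmB _ _) _; rewrite nrmZ gtr0_norm // mulrDr addrC lerD2l mulr1.
  by apply: le_trans hr _; rewrite ler_piMl // ltW.
have giM : nrm gi <= n%:R + x + 1.
  apply: le_trans (nrm_le_dist _ 1%:M) _; rewrite nrm1 -addrA lerD2l.
  apply: le_trans gi1 _; rewrite ler_piMl // ?addr_ge0 //; apply: le_trans (ltW te') e'1.
(* g Y g^-1 - Y - t [X, Y] = s Y g^-1 + Y r + t X Y (g^-1 - 1) *)
have -> : t^-1 *: (g *m Y *m gi - Y) - (X *m Y - Y *m X) =
    t^-1 *: (s *m Y *m gi + Y *m r + t *: (X *m Y *m (gi - 1%:M))).
  rewrite -[X *m Y - Y *m X](scalerK (lt0r_neq0 t0)) -scalerBr; congr (_ *: _).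
  rewrite /s /r !mulmxBl !mulmxBr !mulmx1 !mul1mx -!scalemxAl !mulmxN -scalemxAr.
  apply/matrixP => i j; rewrite !mxE; ring.
rewrite nrmZ gtr0_norm ?invr_gt0 // ltr_pdivrMl //.
apply: (@le_lt_trans _ _ (e' * t * y * (n%:R + x + 1) + y * (e' * t) + t * (x * y * (t * (x + 1))))).
  apply: le_trans (nrmD _ _) _; apply: lerD; last first.
    rewrite nrmZ gtr0_norm // ler_wpM2l ?(ltW t0) //; apply: le_trans (nrmM _ _) _.
    by apply: ler_pM; rewrite ?nrm_ge0 // nrmM.
  apply: le_trans (nrmD _ _) _; apply: lerD; last first.
    by apply: le_trans (nrmM _ _) _; rewrite ler_wpM2l.
  apply: le_trans (nrmM _ _) _; apply: ler_pM; rewrite ?nrm_ge0 //.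
  by apply: le_trans (nrmM _ _) _; rewrite ler_wpM2r.
apply: (@le_lt_trans _ _ (t * (e' * C))).
  apply: (@le_trans _ _ (e' * t * y * (n%:R + x + 1) + y * (e' * t) + t * (x * y * (e' * (x + 1))))).
    rewrite lerD2l ler_wpM2l ?(ltW t0) // ler_wpM2l ?mulr_ge0 // ler_wpM2r ?(ltW te') //.
    by rewrite addr_ge0.
  rewrite -subr_ge0 (_ : _ - _ = t * e'); last by rewrite /C; ring.
  by rewrite mulr_ge0 // ltW.
rewrite ltr_pM2l //; apply: (@le_lt_trans _ _ (e / 2)).
  apply: (@le_trans _ _ (e / (2 * C) * C)).
    by rewrite ler_wpM2r ?(ltW C0) // ge_min lexx orbT.
  by rewrite invfM mulrA divfK ?gt_eqF.
by rewrite ltr_pdivrMr // ltr_pMr // ltr1n.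
Qed.

Lemma lie_tr X : (forall g : 'M[R]_n, G g -> G g^T) -> lie G X -> lie G X^T.
Proof. by move=> GT lX t; rewrite -linearZ mxexp_tr; apply: GT; apply: lX. Qed.

End Group.
End FirstOrder.

(** * Polar decomposition and products of closed subgroups *)

Lemma diag_comm_fun (F : fieldType) n (W : 'M[F]_n) (d d' : 'rV[F]_n) :
  (forall i j, d 0 i = d 0 j -> d' 0 i = d' 0 j) ->
  W *m diag_mx d = diag_mx d *m W -> W *m diag_mx d' = diag_mx d' *m W.
Proof.
move=> h; rewrite !mul_mx_diag !mul_diag_mx => /matrixP E; apply/matrixP => i j.
have := E i j; rewrite !mxE mulrC => Eij.
have [->|nz] := eqVneq (W i j) 0; first by rewrite mulr0 mul0r.
by rewrite mulrC (h i j) //; move/(mulIf nz): Eij.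
Qed.

Lemma diag_sym_fun (F : fieldType) n (P : 'M[F]_n) (d d' : 'rV[F]_n) : P \in unitmx ->
  (forall i j, d 0 i = d 0 j -> d' 0 i = d' 0 j) ->
  (invmx P *m diag_mx d *m P)^T = invmx P *m diag_mx d *m P ->
  (invmx P *m diag_mx d' *m P)^T = invmx P *m diag_mx d' *m P.
Proof.
move=> uP h; have uT : P^T \in unitmx by rewrite unitmx_tr.
have E e : ((invmx P *m diag_mx e *m P)^T = invmx P *m diag_mx e *m P) <->
    (P *m P^T) *m diag_mx e = diag_mx e *m (P *m P^T).
  rewrite !trmx_mul tr_diag_mx trmx_inv; split=> [E|E].
    have := congr1 (fun x => P *m x *m P^T) E.
    by rewrite !mulmxA mulmxKV // mulmxV // mul1mx.
  have := congr1 (fun x => invmx P *m x *m invmx P^T) E.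
  by rewrite !mulmxA mulmxK // mulVmx // mul1mx.
by move=> /E/(diag_comm_fun h)/E.
Qed.

Lemma sqnorm_eq0 (F : realDomainType) n (w : 'rV[F]_n) : (w *m w^T) 0 0 = 0 -> w = 0.
Proof.
rewrite mxE => /eqP; rewrite psumr_eq0 => [/allP h|j _]; last by rewrite mxE -expr2 sqr_ge0.
apply/rowP => i; rewrite [RHS]mxE; have := h i; rewrite mem_index_enum mxE -expr2 sqrf_eq0.
by move=> /(_ isT)/eqP.
Qed.

Lemma orth_entry (R : realType) n (u : 'M[R]_n) i j : u *m u^T = 1%:M -> `|u i j| <= 1.
Proof.
move=> uu1; have uu : (u *m u^T) i i = 1 by rewrite uu1 mxE eqxx.
suff h : `|u i j| ^+ 2 <= 1 by rewrite -(@expr_le1 _ 2).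
apply: (@le_trans _ _ ((u *m u^T) i i)); last by rewrite uu.
rewrite -normrX ger0_norm ?sqr_ge0 // mxE.
rewrite (bigD1 j) //= mxE -expr2 lerDl; apply: sumr_ge0 => k _.
by rewrite mxE -expr2 sqr_ge0.
Qed.

Lemma nrm_orth (R : realType) n (u : 'M[R]_n) : u *m u^T = 1%:M -> nrm u <= n%:R * n%:R.
Proof.
move=> uu; apply: (@le_trans _ _ (\sum_(i < n) \sum_(j < n) 1)).
  by apply: ler_sum => i _; apply: ler_sum => j _; apply: orth_entry.
by rewrite !sumr_const !card_ord -mulrnA natrM.
Qed.

Section Group.
Variable R : realType.

Lemma mxexp_dconj n (P : 'M[R]_n) (h : 'rV[R]_n) : P \in unitmx ->
  mxexp (invmx P *m diag_mx h *m P) = invmx P *m diag_mx (\row_i expR (h 0 i)) *m P.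
Proof.
move=> uP; have := @mxexp_conj _ _ (invmx P) (diag_mx h); rewrite invmxK => -> //.
  by rewrite mxexp_diag.
by rewrite unitmx_inv.
Qed.

Lemma sym_log n (x : 'M[R]_n) : x^T = x -> posdef x -> exists2 X, X^T = X & mxexp X = x.
Proof.
move=> xT xp; have [P uP [d xE]] := symmetric_diagonalizable xT; subst x.
have d0 := posdef_diag uP xp; pose h := \row_i ln (d 0 i).
exists (invmx P *m diag_mx h *m P).
  by apply: diag_sym_fun xT => // i j; rewrite !mxE => ->.
rewrite mxexp_dconj //; congr (_ *m diag_mx _ *m _); apply/rowP => i.
by rewrite !mxE lnK // posrE.
Qed.

Lemma posdef_tr n (g : 'M[R]_n) : g \in unitmx -> posdef (g^T *m g).
Proof.
move=> ug v v0; pose w := v *m g^T.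
have -> : v *m (g^T *m g) *m v^T = w *m w^T by rewrite /w trmx_mul trmxK !mulmxA.
rewrite lt_neqAle sqnorm_ge0 andbT eq_sym; apply/eqP => w0; apply: v0.
have : w = 0.
  exact: sqnorm_eq0.
by rewrite /w => /(congr1 (mulmx^~ (invmx g^T))); rewrite mulmxK ?unitmx_tr // mul0mx.
Qed.

Lemma sym_dconj n (X : 'M[R]_n) : X^T = X ->
  exists2 P : 'M[R]_n, P \in unitmx & exists h, X = invmx P *m diag_mx h *m P.
Proof. exact: symmetric_diagonalizable. Qed.

Lemma scale_dconj n (P : 'M[R]_n) h (c : R) :
  c *: (invmx P *m diag_mx h *m P) = invmx P *m diag_mx (c *: h) *m P.
Proof. by rewrite linearZ /= -scalemxAr -scalemxAl. Qed.

Lemma mxexp_mulrn n (X : 'M[R]_n) m : X^T = X -> mxexp (m%:R *: X) = mxexp X ^+ m.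
Proof.
case/sym_dconj => P uP [h ->]; rewrite scale_dconj !mxexp_dconj //.
elim: m => [|m IH].
  rewrite scale0r expr0 (_ : \row_i _ = const_mx 1).
    by rewrite diag_const_mx mul_mx_scalar scale1r mulVmx.
  by apply/rowP => i; rewrite !mxE expR0.
rewrite exprSr -IH -[_ * _]/(_ *m _) !mulmxA mulmxK // -[in RHS](mulmxA (invmx P)) mulmx_diag.
congr (_ *m diag_mx _ *m _); apply/rowP => i; rewrite !mxE.
by rewrite -natr1 mulrDl mul1r expRD.
Qed.

Variables (n : nat) (G : set 'M[R]_n).
Hypothesis grp : is_mxgroup G.
Hypothesis GT : forall g, G g -> G g^T.

(* Real points of algebraic groups have this property: polynomials vanishing on the powers of
   [mxexp X] vanish on the one-parameter group. *)
Definition powclosed := forall X, X^T = X -> G (mxexp X) -> lie G X.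
Hypothesis Gpow : powclosed.

(** By [powclosed] the logarithm of g^T g lies in the Lie algebra; X is half of it, and u = g
    exp(-X) is orthogonal. *)
Lemma polar g : G g -> exists u X, [/\ X^T = X, lie G X, G u, u *m u^T = 1%:M
  & g = u *m mxexp X].
Proof.
case: (grp) => GU G1 GM GV Gg; have ug := GU _ Gg.
have [|X0 X0T X0E] := @sym_log _ (g^T *m g) _ (posdef_tr ug).
  by rewrite trmx_mul trmxK.
have lX0 : lie G X0 by apply: Gpow => //; rewrite X0E; apply: (GM _ _ (GT Gg) Gg).
pose X := 2^-1 *: X0; have XT : X^T = X by rewrite linearZ /= X0T.
have lX : lie G X by move=> t; rewrite scalerA; apply: lX0.
have X2 : mxexp X *m mxexp X = g^T *m g.
  rewrite -X0E (_ : X0 = 2%:R *: X); first by rewrite mxexp_mulrn // expr2.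
  by rewrite scalerA divff ?scale1r // pnatr_eq0.
have Gy : G (mxexp X) by rewrite -[X]scale1r; apply: lX.
have uy := mxexp_unit X; have yT : (mxexp X)^T = mxexp X by rewrite -mxexp_tr XT.
exists (g *m invmx (mxexp X)), X; split=> //.
- exact: (GM _ _ Gg (GV _ Gy)).
- apply: mulmx1C; rewrite trmx_mul trmx_inv yT -mulmxA (mulmxA g^T) -X2.
  by rewrite mulmxK // mulVmx.
- by rewrite mulmxKV.
Qed.

(* [H] contains the symmetric positive definite elements of [G], and O(n) is covered by finitely many small balls. *)
Lemma open_finite_index (H : set 'M[R]_n) e : is_mxgroup H -> 0 < e ->
  (forall g, G g -> nrm (g - 1%:M) < e -> H g) ->
  exists N (s : 'I_N -> 'M[R]_n), (forall i, s i \in unitmx) /\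
    forall g, G g -> exists i, H (invmx (s i) *m g).
Proof.
case: (grp) => GU G1 GM GV [HU H1 HM HV] e0 He.
have HX X : X^T = X -> lie G X -> H (mxexp X).
  move=> XT lX; have [d d0 hd] := fo_exp X ltr01.
  (* The positive element is a power of exp(X/(m+1)), which lies in the given neighbourhood of 1. *)
  pose m := Num.truncn (Num.max d^-1 ((1 + nrm X) / e)); pose mr : R := m.+1%:R.
  have mr0 : 0 < mr by rewrite ltr0n.
  have : Num.max d^-1 ((1 + nrm X) / e) < mr by apply: truncnS_gt.
  rewrite gt_max => /andP[md me].
  have -> : X = mr *: (mr^-1 *: X) by rewrite scalerA divff ?scale1r // gt_eqF.
  rewrite mxexp_mulrn; last by rewrite linearZ /= XT.
  have Hy : H (mxexp (mr^-1 *: X)).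
    apply: He; first exact: lX.
    have h := hd mr^-1; rewrite invr_gt0 in h.
    apply: le_lt_trans (nrm_le_dist _ (mr^-1 *: X)) _.
    apply: (@le_lt_trans _ _ (mr^-1 * nrm X + 1 * mr^-1)).
      apply: lerD; first by rewrite nrmZ gtr0_norm ?invr_gt0.
      by apply: h => //; rewrite -[ltRHS]invrK ltf_pV2 ?posrE // invr_gt0.
    by rewrite mul1r -[X in _ + X]mulr1 -mulrDr mulrC ltr_pdivrMr // mulrC addrC -ltr_pdivrMr.
  by elim: m.+1 => [|k IH]; rewrite ?expr0 // exprS; apply: (HM _ _ Hy IH).
pose q := (Num.truncn ((n%:R * n%:R * (n%:R * n%:R)) / e)).+1.
have q0 : (0 : R) < q%:R by rewrite ltr0n.
have qe : (n%:R * n%:R * (n%:R * n%:R)) / q%:R < e.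
  by rewrite ltr_pdivrMr // [ltRHS]mulrC -ltr_pdivrMr // truncnS_gt.
clearbody q.
(* Entries of an orthogonal matrix lie in [-1, 1], so q (u + 1) has integer part between 0 and 2q.
   Matrices in one cell differ by at most n^2/q in norm, and left multiplication by v^T costs a
   further n^2. *)
pose cell (u : 'M[R]_n) : {ffun 'I_n * 'I_n -> 'I_(q + q).+1} :=
  [ffun ij => inord (Num.truncn (q%:R * (u ij.1 ij.2 + 1)))].
pose OG u := G u /\ u *m u^T = 1%:M.
have ent := @orth_entry R n.
have nO := @nrm_orth R n.
have cellP u v : u *m u^T = 1%:M -> v *m v^T = 1%:M -> cell u = cell v ->
    nrm (u - v) <= n%:R * n%:R / q%:R.
  move=> uu vv /ffunP E; apply: (@le_trans _ _ (\sum_(i < n) \sum_(j < n) q%:R^-1)).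
    apply: ler_sum => i _; apply: ler_sum => j _.
    have := E (i, j); rewrite !ffunE /=.
    have h (w : 'M[R]_n) : w *m w^T = 1%:M -> 0 <= q%:R * (w i j + 1) /\ (Num.truncn (q%:R * (w i j + 1)) < (q + q).+1)%N.
      move=> /(ent _ i j); rewrite ler_norml => /andP[l1 l2]; split.
        by rewrite mulr_ge0 //; move: l1; clear; lra.
      rewrite ltnS truncn_le_nat -natr1 natrD.
      by move: l2 q0; clear; move: (q%:R) (w i j) => Q x l2 q0; nra.
    have [u0 uq] := h u uu; have [v0 vq] := h v vv.
    move=> /(congr1 (@nat_of_ord _)); rewrite !inordK // => t.
    have := truncnS_gt (q%:R * (u i j + 1)); have := truncnS_gt (q%:R * (v i j + 1)).
    have tl (w : R) : 0 <= w -> (Num.truncn w)%:R <= w by move=> w0; rewrite truncn_le.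
    have := tl _ u0; have := tl _ v0; rewrite t -natr1.
    move: ((Num.truncn _)%:R) => T a1 a2 a3 a4; rewrite !mxE -[q%:R^-1]mul1r ler_pdivlMr //.
    rewrite -{1}(gtr0_norm q0) -normrM ler_norml mulrBl.
    move: a1 a2 a3 a4; rewrite !mulrDr !mulr1 ![q%:R * _]mulrC; clear; lra.
  rewrite !sumr_const !card_ord -mulrnA -[_ *+ _]mulr_natl natrM //.
pose rep c := match pselect (exists u, OG u /\ cell u = c) with
  | left h => projT1 (cid h) | right _ => 1%:M end.
have repP c : OG (rep c).
  rewrite /rep; case: pselect => [h|_]; first by case: (projT2 (cid h)).
  by split=> //; rewrite trmx1 mulmx1.
exists #|{ffun 'I_n * 'I_n -> 'I_(q + q).+1}|, (fun i => rep (enum_val i)).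
split=> [i|g Gg]; first by apply: GU; case: (repP (enum_val i)).
have [u [X [XT lX Gu uu ->]]] := polar Gg; exists (enum_rank (cell u)).
rewrite enum_rankK mulmxA; apply: (HM _ _ _ (HX _ XT lX)).
set v := rep _; have [Gv vv] : OG v by apply: repP.
have cv : cell u = cell v.
  rewrite /v /rep; case: pselect => [h|]; first by case: (projT2 (cid h)).
  by case; exists u; split.
have uv : v \in unitmx := GU _ Gv.
have vT : invmx v = v^T by rewrite -[RHS](mulKmx uv) vv mulmx1.
apply: He; first exact: (GM _ _ (GV _ Gv) Gu).
have -> : invmx v *m u - 1%:M = v^T *m (u - v) by rewrite mulmxBr -vT mulVmx.
apply: le_lt_trans (nrmM _ _) _; rewrite nrm_tr.
apply: le_lt_trans qe; rewrite -mulrA; apply: ler_pM; rewrite ?nrm_ge0 ?nO //.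
exact: cellP.
Qed.

End Group.

(** * Neighbourhoods covered by a product of two closed subgroups *)

Section OpenProduct.
Variables (R : realType) (n : nat).
Implicit Types (G : set 'M[R]_n).

Lemma nrm_dist_dist p q (x y : 'M[R]_(p, q)) : `|nrm x - nrm y| <= nrm (x - y).
Proof.
rewrite ler_norml; have := nrm_le_dist x y; have := nrm_le_dist y x; rewrite (nrmC y).
move: (nrm (x - y)) (nrm x) (nrm y) => a b c; lra.
Qed.

Lemma ext_value_lip p q (Z : 'M[R]_(p, q) -> Prop) (f : 'M[R]_(p, q) -> R) z0 c C :
  Z z0 -> nclosed Z -> (forall z, Z z -> nrm z <= c) ->
  (forall x y, Z x -> Z y -> `|f y - f x| <= C * nrm (y - x)) ->
  exists2 x, Z x & forall y, Z y -> f y <= f x.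
Proof.
move=> Z0 Zc Zb fl; apply: (ext_value Z0 Zc Zb) => x Zx e e0.
exists (e / (`|C| + 1)); first by rewrite divr_gt0 // ltr_wpDl.
move=> y Zy; rewrite ltr_pdivlMr ?ltr_wpDl //; apply: le_lt_trans.
apply: le_trans (fl _ _ Zx Zy) _; rewrite mulrC ler_wpM2l ?nrm_ge0 //.
by apply: le_trans (ler_norm _) _; rewrite lerDl.
Qed.

Lemma nrm_subl (z : 'M[R]_(n, n + n)) : nrm z = nrm (lsubmx z) + nrm (rsubmx z).
Proof. by rewrite -[in LHS](hsubmxK z) nrm_row_mx. Qed.

(** The distance of c g d to 1, with a penalty that keeps c and d in a compact set. *)
Definition pen (k : R) (g c d : 'M[R]_n) :=
  nrm (c *m g *m d - 1%:M) + k * (nrm (c - 1%:M) + nrm (d - 1%:M)).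

(** At c = d = 1 the value is [nrm (g - 1%:M)] < k, whereas the penalty alone exceeds k as soon as c
    and d are farther than 1 from the identity; so the search reduces to a compact set. *)
Lemma pen_min G1 G2 k g : is_mxgroup G1 -> is_mxgroup G2 -> nclosed G1 -> nclosed G2 ->
  0 < k -> nrm (g - 1%:M) < k ->
  exists c d, [/\ G1 c, G2 d & forall c' d', G1 c' -> G2 d' -> pen k g c d <= pen k g c' d'].
Proof.
move=> [_ o1 _ _] [_ o2 _ _] cl1 cl2 k0 gk.
pose Z (z : 'M[R]_(n, n + n)) := [/\ G1 (lsubmx z), G2 (rsubmx z) &
  nrm (lsubmx z - 1%:M) + nrm (rsubmx z - 1%:M) <= 1].
pose z0 : 'M[R]_(n, n + n) := row_mx 1%:M 1%:M.
have Z0 : Z z0 by rewrite /Z row_mxKl row_mxKr subrr nrm0 addr0; split.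
have dl (y z : 'M[R]_(n, n + n)) : nrm (lsubmx y - lsubmx z) <= nrm (y - z).
  by rewrite [leRHS]nrm_subl -raddfB lerDl nrm_ge0.
have dr (y z : 'M[R]_(n, n + n)) : nrm (rsubmx y - rsubmx z) <= nrm (y - z).
  by rewrite [leRHS]nrm_subl -!raddfB lerDr nrm_ge0.
have Zc : nclosed Z.
  move=> z h; split.
  - by apply: cl1 => e e0; have [y [y1 _ _] yz] := h e e0; exists (lsubmx y) => //; apply: le_lt_trans (dl _ _) yz.
  - by apply: cl2 => e e0; have [y [_ y2 _] yz] := h e e0; exists (rsubmx y) => //; apply: le_lt_trans (dr _ _) yz.
  apply/ler_addgt0Pr => e e0; have [y [_ _ y1] yz] := h e e0.
  have := nrm_triangle (lsubmx y) (lsubmx z) 1%:M.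
  have := nrm_triangle (rsubmx y) (rsubmx z) 1%:M.
  move: yz; rewrite nrmC nrm_subl !raddfB /=.
  move: (nrm (lsubmx z - lsubmx y)) (nrm (rsubmx z - rsubmx y)) (nrm (lsubmx y - 1%:M))
    (nrm (rsubmx y - 1%:M)) (nrm (lsubmx z - 1%:M)) (nrm (rsubmx z - 1%:M)) y1 => ? ? ? ? ? ?; lra.
have Zb z : Z z -> nrm z <= n%:R + n%:R + 1.
  move=> [_ _ z1]; rewrite nrm_subl.
  have := nrm_le_dist (lsubmx z) 1%:M; have := nrm_le_dist (rsubmx z) 1%:M.
  by rewrite !nrm1; move: z1; lra.
pose B : R := n%:R + n%:R + 1.
pose f (z : 'M[R]_(n, n + n)) := - pen k g (lsubmx z) (rsubmx z).
have fl x y : Z x -> Z y -> `|f y - f x| <= (B * nrm g + k) * nrm (y - x).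
  move=> Zx Zy.
  have bx := Zb _ Zx; have by' := Zb _ Zy.
  rewrite /f /pen; set cx := lsubmx x; set dx := rsubmx x; set cy := lsubmx y; set dy := rsubmx y.
  have h5 : nrm (cy - cx) + nrm (dy - dx) = nrm (y - x) by rewrite [RHS]nrm_subl !raddfB.
  have h1 : nrm (cy *m g *m dy - 1%:M - (cx *m g *m dx - 1%:M)) <= B * nrm g * nrm (y - x).
    rewrite opprB addrA subrK.
    have -> : cy *m g *m dy - cx *m g *m dx = (cy - cx) *m g *m dy + cx *m g *m (dy - dx).
      by rewrite !mulmxBl mulmxBr subrKA.
    rewrite -h5 mulrDr.
    apply: le_trans (nrmD _ _) _; apply: lerD.
      apply: le_trans (nrmM _ _) _; rewrite -mulrA mulrC; apply: ler_pM; rewrite ?nrm_ge0 //.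
        by apply: le_trans by'; rewrite [leRHS]nrm_subl lerDr nrm_ge0.
      by rewrite mulrC; apply: nrmM.
    apply: le_trans (nrmM _ _) _; rewrite ler_wpM2r ?nrm_ge0 //.
    apply: le_trans (nrmM _ _) _; rewrite ler_wpM2r ?nrm_ge0 //.
    by apply: le_trans bx; rewrite [leRHS]nrm_subl lerDl nrm_ge0.
  have h2 := nrm_dist_dist (cy *m g *m dy - 1%:M) (cx *m g *m dx - 1%:M).
  have h3 := nrm_dist_dist (cy - 1%:M) (cx - 1%:M).
  have h4 := nrm_dist_dist (dy - 1%:M) (dx - 1%:M).
  have E (a b : 'M[R]_n) : a - 1%:M - (b - 1%:M) = a - b by rewrite opprB addrA subrK.
  rewrite E in h3; rewrite E in h4.
  have {}h2 := le_trans h2 h1; rewrite mulrDl.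
  move: h2 h3 h4 h5; move: (nrm (cy *m g *m dy - 1%:M)) (nrm (cx *m g *m dx - 1%:M))
    (nrm (cy - 1%:M)) (nrm (cx - 1%:M)) (nrm (dy - 1%:M)) (nrm (dx - 1%:M)) (nrm (cy - cx))
    (nrm (dy - dx)) (nrm (y - x)) => a1 a2 a3 a4 a5 a6 a7 a8 a9; move: (B * nrm g * a9) => a10.
  rewrite !ler_norml => /andP[l1 l2] /andP[l3 l4] /andP[l5 l6] <-.
  by apply/andP; split; move: k0 l1 l2 l3 l4 l5 l6; clear; nra.
have [z [Z1 Z2 Z3] zmax] := ext_value_lip Z0 Zc Zb fl.
exists (lsubmx z), (rsubmx z); split=> // c' d' Gc Gd.
have [h|h] := lerP (nrm (c' - 1%:M) + nrm (d' - 1%:M)) 1.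
  have := zmax (row_mx c' d'); rewrite /f /Z row_mxKl row_mxKr lerN2; apply.
  by split.
have := zmax z0 Z0; rewrite /f row_mxKl row_mxKr lerN2 => /le_trans; apply.
rewrite /pen mulmx1 mul1mx subrr nrm0 addr0 mulr0 addr0 ltW //.
apply: (lt_trans gk); apply: (@lt_le_trans _ _ (k * (nrm (c' - 1%:M) + nrm (d' - 1%:M)))).
  by rewrite ltr_pMr.
by rewrite lerDr nrm_ge0.
Qed.

Let scale16 (l u : R) : 16 * l * (1 + l) * u <= 1 -> l * (1 + l) * u <= 1 / 16.
Proof. by lra. Qed.

Let second_order_bound (l u : R) : l * (1 + l) * u <= 1 / 16 -> 0 < u ->
  l * u * u * (l * u) <= l * u * (l * u) ->
  1 / 16 * u + 1 / 16 * u + 1 / 8 * u + (l * u * u + l * u * (l * u) + u * (l * u) + l * u * u * (l * u))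
    <= u * (3 / 8).
Proof. by move=> h1 u0 h2; have := ler_wpM2l (ltW u0) h1; lra. Qed.

Let product_contradiction (u l k p q r v w N : R) :
  p <= l * u * N + v -> q <= l * u * N + w -> r <= u * (3 / 8) ->
  2 * k * l * N = 1 / 4 -> 0 < k -> 0 < u -> u + k * (v + w) <= r + k * (p + q) -> False.
Proof.
move=> hp hq hr kE k0 u0 h.
have h2 : k * (p + q) <= 2 * k * l * N * u + k * (v + w).
  apply: (@le_trans _ _ (k * ((l * u * N + v) + (l * u * N + w)))).
    by rewrite ler_pM2l // lerD.
  by rewrite le_eqVlt; apply/orP; left; apply/eqP; ring.
rewrite kE in h2; move: (k * (p + q)) (k * (v + w)) h h2 => a b; lra.
Qed.

(** Otherwise there are g tending to 1 whose penalised minimisers c, d give c g d different from 1.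
    The directions of c g d - 1 cluster at some Z in the Lie algebra of G; moving c and d along the
    two components of Z cancels the error to first order at the price of a small penalty, which
    contradicts minimality. *)
Lemma open_product G G1 G2 M : is_mxgroup G -> nclosed G ->
  is_mxgroup G1 -> is_mxgroup G2 -> nclosed G1 -> nclosed G2 ->
  (forall g, G1 g -> G g) -> (forall g, G2 g -> G g) ->
  (forall Y, lie G Y -> exists Y1 Y2, [/\ lie G1 Y1, lie G2 Y2, Y = Y1 + Y2,
     nrm Y1 <= M * nrm Y & nrm Y2 <= M * nrm Y]) ->
  exists2 e, 0 < e & forall g, G g -> nrm (g - 1%:M) < e ->
    exists c d, [/\ G1 c, G2 d & c *m g *m d = 1%:M].
Proof.
move=> grp cl grp1 grp2 cl1 cl2 s1 s2 split'.
pose L := `|M| + 1; have L1 : 1 <= L by rewrite lerDr.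
have L0 : 0 < L by apply: lt_le_trans L1.
have n0 : (0 : R) < n%:R + 1 by rewrite ltr_wpDl.
(* With this k, a move of relative size L t of both factors, of norm at most n + 1, raises the
   penalty by at most t/4. *)
pose k := (8 * L * (n%:R + 1))^-1; have k0 : 0 < k by rewrite invr_gt0 !mulr_gt0.
have kE : 2 * k * L * (n%:R + 1) = 1 / 4.
  by rewrite /k; field; rewrite !gt_eqF.
apply: contrapT => hno.
have ex (i : nat) : exists cgd : 'M[R]_n * 'M[R]_n * 'M[R]_n,
   let: (c, g, d) := cgd in
   [/\ G g, G1 c /\ G2 d, nrm (g - 1%:M) < Num.min k i.+1%:R^-1, c *m g *m d <> 1%:M &
      forall c' d', G1 c' -> G2 d' -> pen k g c d <= pen k g c' d'].
  have e0 : 0 < Num.min k i.+1%:R^-1. by rewrite lt_min k0 /= invr_gt0 ltr0n.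
  apply: contrapT => h; apply: hno; exists (Num.min k i.+1%:R^-1) => // g Gg ge.
  apply: contrapT => h'; apply: h.
  have gk : nrm (g - 1%:M) < k by apply: lt_le_trans ge _; rewrite ge_min lexx.
  have [c [d [Gc Gd cd]]] := pen_min grp1 grp2 cl1 cl2 k0 gk.
  by exists (c, g, d); split=> // E; apply: h'; exists c, d.
have [s sP] := choice ex; clear ex.
pose x i := (s i).1.1 *m (s i).1.2 *m (s i).2.
pose t i := nrm (x i - 1%:M).
have xP i : [/\ G (x i), 0 < t i, t i < i.+1%:R^-1 & t i <= 1].
  have := sP i; rewrite /t /x; case: (s i) => -[c g] d /= [Gg [Gc Gd] ge ne cd].
  have := cd 1%:M 1%:M; case: (grp1) => _ o1 _ _; case: (grp2) => _ o2 _ _ => /(_ o1 o2).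
  rewrite [leRHS]/pen mulmx1 mul1mx subrr nrm0 addr0 mulr0 addr0 => h.
  have tg : nrm (c *m g *m d - 1%:M) <= nrm (g - 1%:M).
    by apply: le_trans h; rewrite /pen lerDl mulr_ge0 ?addr_ge0 ?nrm_ge0 ?(ltW k0).
  case: (grp) => _ _ GM _; split.
  - exact: (GM _ _ (GM _ _ (s1 _ Gc) Gg) (s2 _ Gd)).
  - rewrite lt_neqAle nrm_ge0 andbT eq_sym; apply/eqP => E; apply: ne.
    by apply/eqP; rewrite -subr_eq0; apply/eqP/nrm_eq0; rewrite E.
  - by apply: le_lt_trans tg _; apply: lt_le_trans ge _; rewrite ge_min lexx orbT.
  - apply: le_trans tg _; apply: le_trans (ltW ge) _; rewrite ge_min; apply/orP; left.
    rewrite invf_le1 ?mulr_gt0 //; move: L1; have : (0 : R) <= n%:R by []. 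
    have key (N l : R) : 0 <= N -> 1 <= l -> 1 <= 8 * l * (N + 1) by nra.
    by move=> N0 l1; apply: key.
(* Since [t i] tends to 0 and [x i] lies in G, every cluster value of these unit directions is a
   tangent vector. *)
pose Y i := (t i)^-1 *: (x i - 1%:M).
have Y1 i : nrm (Y i) <= 1.
  have [_ t0 _ _] := xP i; rewrite nrmZ gtr0_norm ?invr_gt0 // mulVf // gt_eqF //.
have [Z ZP] := cluster_seq Y1.
have tE e : 0 < e -> exists N, forall i, (N <= i)%N -> t i < e.
  move=> e0; exists (Num.truncn e^-1) => i Ni; have [_ _ ti _] := xP i; apply: lt_trans ti _.
  rewrite -[ltRHS]invrK ltf_pV2 ?posrE ?invr_gt0 //.
  by apply: lt_le_trans (truncnS_gt _) _; rewrite ler_nat.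
have lZ : lie G Z.
  apply: tan_lie => // e e0; have [N tN] := tE e e0; have [i Ni Yi] := ZP e e0 N.
  have [Gx t0 _ _] := xP i; exists (t i); first by rewrite t0 tN.
  exists (x i) => //.
  have -> : x i - 1%:M - t i *: Z = t i *: (Y i - Z).
    by rewrite scalerBr scalerA divff ?scale1r // gt_eqF.
  by rewrite nrmZ gtr0_norm // mulrC ler_wpM2r // ltW.
have Z1 : nrm Z <= 1.
  apply/ler_addgt0Pr => e e0; have [i _ Yi] := ZP e e0 0.
  apply: le_trans (nrm_le_dist Z (Y i)) _; apply: lerD => //; by rewrite nrmC ltW.
have [A [B [lA lB ZE nA nB]]] := split' Z lZ.
have bnd (X : 'M[R]_n) : nrm X <= M * nrm Z -> nrm X <= `|M|.
  move/le_trans; apply; apply: le_trans (ler_norm _) _.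
  by rewrite normrM ler_piMr // ger0_norm ?nrm_ge0.
have {}nA := bnd _ nA; have {}nB := bnd _ nB; clear bnd.
have e16 : (0 : R) < 1 / 16 by [].
have [d1 d10 h1] := fo_exp (- A) e16; have [d2 d20 h2] := fo_exp (- B) e16.
(* Below this bound the second-order terms amount to at most t/8. With first-order errors t/16, t/16
   and t/8 the new distance is at most 3t/8, so that even with t/4 of penalty the total drops. *)
pose d3 := (16 * L * (1 + L))^-1.
have d30 : 0 < d3 by rewrite invr_gt0 !mulr_gt0 // ltr_wpDl.
have dm : 0 < Num.min (Num.min d1 d2) d3 by rewrite lt_min lt_min d10 d20.
have [N tN] := tE _ dm; have e8 : (0 : R) < 1 / 8 by [].
have [i Ni Yi] := ZP _ e8 N.
have := tN i Ni; rewrite lt_min lt_min => /andP[/andP[t1 t2] t3].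
have [Gx t0 _ tle] := xP i.
have {h1} := h1 _ t0 t1; have {h2} := h2 _ t0 t2.
set E2 := mxexp (t i *: - B); set E1 := mxexp (t i *: - A).
rewrite !scalerN !opprK => h2 h1.
have sz (E X : 'M[R]_n) : nrm X <= `|M| -> nrm (E - 1%:M + t i *: X) <= 1 / 16 * t i ->
    nrm (E - 1%:M) <= L * t i.
  move=> nX h; rewrite -[E - 1%:M](addrK (t i *: X)); apply: le_trans (nrmB _ _) _.
  rewrite nrmZ gtr0_norm // /L mulrDl addrC mul1r mulrC; apply: lerD; first by rewrite ler_wpM2r // ltW.
  by apply: le_trans h _; move: t0; clear; move: (t i) => T T0; lra.
have b1 := sz _ _ nA h1; have b2 := sz _ _ nB h2.
have GE1 : G1 E1 by rewrite /E1 scalerN -scaleNr; apply: lA.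
have GE2 : G2 E2 by rewrite /E2 scalerN -scaleNr; apply: lB.
have xE : nrm (x i - 1%:M - t i *: Z) <= 1 / 8 * t i.
  have -> : x i - 1%:M - t i *: Z = t i *: (Y i - Z).
    by rewrite scalerBr scalerA divff ?scale1r // gt_eqF.
  by rewrite nrmZ gtr0_norm // mulrC ler_wpM2r // ltW.
have := sP i; move: xE t0 t3 tle Gx b1 b2 h1 h2; rewrite /t /x.
case: (s i) => -[c g] d /=; set y := c *m g *m d; set tt := nrm (y - 1%:M).
move=> xE t0 t3 tle Gx b1 b2 h1 h2 [Gg [Gc Gd] ge ne cd].
have ck : nrm (c - 1%:M) + nrm (d - 1%:M) <= 1.
  have := cd 1%:M 1%:M; case: (grp1) => _ o1 _ _; case: (grp2) => _ o2 _ _ => /(_ o1 o2).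
  rewrite [leRHS]/pen mulmx1 mul1mx subrr nrm0 addr0 mulr0 addr0 /pen => h.
  rewrite -(ler_pM2l k0) mulr1; apply: (@le_trans _ _ (nrm (g - 1%:M))).
    by apply: le_trans h; rewrite lerDr nrm_ge0.
  by apply: le_trans (ltW ge) _; rewrite ge_min lexx.
have c1 := nrm_le_dist c 1%:M; have dd1 := nrm_le_dist d 1%:M; rewrite nrm1 in c1 dd1.
have cn : nrm c <= n%:R + 1.
  by apply: le_trans c1 _; rewrite lerD2l; apply: le_trans _ ck; rewrite lerDl; exact: nrm_ge0.
have dn : nrm d <= n%:R + 1.
  by apply: le_trans dd1 _; rewrite lerD2l; apply: le_trans _ ck; rewrite lerDr; exact: nrm_ge0.
(* The competing pair: c multiplied by exp(-tA) on the left and d by exp(-tB) on the right, where Z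
   = A + B. *)
have := cd (E1 *m c) (d *m E2).
case: (grp1) => _ _ GM1 _; case: (grp2) => _ _ GM2 _.
move=> /(_ (GM1 _ _ GE1 Gc) (GM2 _ _ Gd GE2)); rewrite /pen.
have pc : nrm (E1 *m c - 1%:M) <= L * tt * (n%:R + 1) + nrm (c - 1%:M).
  have -> : E1 *m c - 1%:M = (E1 - 1%:M) *m c + (c - 1%:M) by rewrite mulmxBl mul1mx subrKA.
  apply: le_trans (nrmD _ _) _; rewrite lerD2r; apply: le_trans (nrmM _ _) _.
  exact: ler_pM (nrm_ge0 _) (nrm_ge0 _) b1 cn.
have pd : nrm (d *m E2 - 1%:M) <= L * tt * (n%:R + 1) + nrm (d - 1%:M).
  have -> : d *m E2 - 1%:M = d *m (E2 - 1%:M) + (d - 1%:M) by rewrite mulmxBr mulmx1 subrKA.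
  apply: le_trans (nrmD _ _) _; rewrite lerD2r; apply: le_trans (nrmM _ _) _.
  by rewrite mulrC; exact: ler_pM (nrm_ge0 _) (nrm_ge0 _) b2 dn.
have pv : nrm (E1 *m c *m g *m (d *m E2) - 1%:M) <= tt * (3 / 8).
  have -> : E1 *m c *m g *m (d *m E2) - 1%:M =
     (E1 - 1%:M + tt *: A) + (E2 - 1%:M + tt *: B) + (y - 1%:M - tt *: Z) +
     ((E1 - 1%:M) *m (y - 1%:M) + (E1 - 1%:M) *m (E2 - 1%:M) + (y - 1%:M) *m (E2 - 1%:M) +
      (E1 - 1%:M) *m (y - 1%:M) *m (E2 - 1%:M)).
    have -> : E1 *m c *m g *m (d *m E2) = E1 *m y *m E2 by rewrite /y !mulmxA.
    rewrite ZE scalerDr; clearbody E1 E2 y tt.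
    rewrite !(mulmxBl, mulmxBr, mul1mx, mulmx1).
    move: (E1 *m y *m E2) (E1 *m y) (E1 *m E2) (y *m E2) => m1 m2 m3 m4.
    apply/matrixP => u v; rewrite !mxE; ring.
  apply: (@le_trans _ _ (1 / 16 * tt + 1 / 16 * tt + 1 / 8 * tt + (L * tt * tt + L * tt * (L * tt) + tt * (L * tt) + L * tt * tt * (L * tt)))).
    have q (a b : 'M[R]_n) u v : nrm a <= u -> nrm b <= v -> nrm (a *m b) <= u * v.
      by move=> au bv; apply: le_trans (nrmM _ _) _; apply: ler_pM; rewrite ?nrm_ge0.
    have p (a b : 'M[R]_n) u v : nrm a <= u -> nrm b <= v -> nrm (a + b) <= u + v.
      by move=> au bv; apply: le_trans (nrmD _ _) _; apply: lerD.
    have r : nrm (y - 1%:M) <= tt by [].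
    by apply: (p); [apply: (p) => //; apply: (p)|
      apply: (p); [apply: (p); [apply: (p); apply: (q)|apply: (q)]|apply: (q) => //; apply: (q)]].
  have tL : L * (1 + L) * tt <= 1 / 16.
    have L2 : 0 < 16 * L * (1 + L) by rewrite !mulr_gt0 // ltr_wpDl // ltW.
    have : 16 * L * (1 + L) * tt <= 1.
      by rewrite mulrC -ler_pdivlMr // mul1r ltW.
    exact: scale16.
  have LT : L * tt * tt * (L * tt) <= L * tt * (L * tt).
    have h0 : 0 <= L * tt by rewrite mulr_ge0 // ltW.
    by rewrite ler_wpM2r // ler_piMr.
  exact: second_order_bound.
rewrite -/tt => h.
exact: (@product_contradiction _ _ _ _ _ _ _ _ _ pc pd pv kE k0 t0 h).
Qed.

End OpenProduct.

(** * Variations and weights *)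

Definition lbr (F : pzRingType) n (X Y : 'M[F]_n) := X *m Y - Y *m X.

Section Variation.
Variables (R : realType) (n : nat).
Implicit Types X Y Z : 'M[R]_n.

Lemma norm_mxtrace X : `|\tr X| <= nrm X.
Proof.
apply: le_trans (ler_norm_sum _ _ _) _; apply: ler_sum => i _.
by rewrite (bigD1 i) //= lerDl; apply: sumr_ge0.
Qed.

Lemma conj_expand (a b X : 'M[R]_n) : (1%:M + a + b) *m X *m (1%:M - a + b) =
  X + (a *m X - X *m a) + (b *m X + X *m b - a *m X *m a) +
  (a *m X *m b - b *m X *m a + b *m X *m b).
Proof.
rewrite !(mulmxDl, mulmxDr, mul1mx, mulmx1, mulmxN).
move: (a *m X *m b) (b *m X *m a) (b *m X *m b) (a *m X *m a) (a *m X) (b *m X) (X *m a) (X *m b).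
move=> x1 x2 x3 x4 x5 x6 x7 x8; apply/matrixP => i j; rewrite !mxE; ring.
Qed.

Lemma lbr_lbr Y X : lbr Y (lbr Y X) = Y *m Y *m X + X *m (Y *m Y) - 2 *: (Y *m X *m Y).
Proof.
rewrite /lbr mulmxBr mulmxBl !mulmxA -(mulmxA X) scaler_nat mulr2n.
move: (Y *m Y *m X) (Y *m X *m Y) (X *m (Y *m Y)) => a b c.
apply/matrixP => i j; rewrite !mxE; ring.
Qed.

Lemma exp_conj_taylor Y X : exists2 C, 0 <= C & forall t, 0 < t -> t <= 1 ->
  nrm (mxexp (t *: Y) *m X *m mxexp (- (t *: Y)) -
       (X + t *: lbr Y X + (t ^+ 2 / 2) *: lbr Y (lbr Y X))) <= C * t ^+ 3.
Proof.
pose y := nrm Y; pose x := nrm X.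
have y0 : 0 <= y by apply: nrm_ge0.
have x0 : 0 <= x by apply: nrm_ge0.
pose D := n%:R * (y ^+ 3 * expR y).
have D0 : 0 <= D by rewrite !mulr_ge0 ?exprn_ge0 ?expR_ge0.
pose M := n%:R + y + y * y.
have M0 : 0 <= M by rewrite !addr_ge0 // mulr_ge0.
exists (D * x * (M + D) + M * x * D + (y * x * (y * y) + y * y * x * y + y * y * x * (y * y))).
  by rewrite ?(addr_ge0, mulr_ge0).
move=> t t0 t1; set E := mxexp _; set E' := mxexp (- _).
(* U and U' are the second-order truncations of exp(tY) and exp(-tY); [conj_expand] multiplies them
   out exactly, and the excess over the Taylor polynomial is cubic in t. *)
pose U := 1%:M + t *: Y + (t ^+ 2 / 2) *: (Y *m Y).
pose U' := 1%:M - t *: Y + (t ^+ 2 / 2) *: (Y *m Y).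
have tay Z : nrm Z <= t * y -> nrm (mxexp Z - (1%:M + Z + 2^-1 *: (Z *m Z))) <= D * t ^+ 3.
  move=> Zy; apply: le_trans (exp_taylor2 Z) _.
  have -> : D * t ^+ 3 = n%:R * ((t * y) ^+ 3 * expR y) by rewrite /D exprMn; ring.
  rewrite ler_wpM2l // ler_pM ?exprn_ge0 ?expR_ge0 ?nrm_ge0 //.
    by rewrite lerXn2r ?nnegrE ?nrm_ge0 // mulr_ge0 // ltW.
  by rewrite ler_expR; apply: le_trans Zy _; rewrite ler_piMl.
have rE : nrm (E - U) <= D * t ^+ 3.
  have -> : U = 1%:M + t *: Y + 2^-1 *: ((t *: Y) *m (t *: Y)).
    by rewrite -scalemxAl -scalemxAr !scalerA /U expr2 mulrC mulrA.
  by apply: tay; rewrite nrmZ gtr0_norm.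
have rE' : nrm (E' - U') <= D * t ^+ 3.
  have -> : U' = 1%:M + - (t *: Y) + 2^-1 *: ((- (t *: Y)) *m (- (t *: Y))).
    by rewrite mulNmx mulmxN opprK -scalemxAl -scalemxAr !scalerA /U' expr2 mulrC mulrA.
  by apply: tay; rewrite nrmN nrmZ gtr0_norm.
have t3 : 0 <= t ^+ 3 by rewrite exprn_ge0 // ltW.
have t31 : t ^+ 3 <= 1 by rewrite exprn_ile1 // ltW.
have t2 : 0 <= t ^+ 2 / 2 by rewrite divr_ge0 // exprn_ge0 // ltW.
have t21 : t ^+ 2 / 2 <= 1.
  by rewrite ler_pdivrMr // mul1r (@le_trans _ _ 1) ?ler1n // exprn_ile1 // ltW.
have q2 : nrm (Y *m Y) <= y * y by apply: nrmM.
have bU s : `|s| <= t -> nrm (1%:M + s *: Y + (t ^+ 2 / 2) *: (Y *m Y)) <= M.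
  move=> st; apply: le_trans (nrmD _ _) _; rewrite /M; apply: lerD.
    apply: le_trans (nrmD _ _) _; rewrite nrm1 lerD2l nrmZ ler_piMl //.
    exact: le_trans st t1.
  by rewrite nrmZ ger0_norm //; apply: le_trans q2; rewrite ler_piMl ?nrm_ge0.
have UM : nrm U <= M by apply: bU; rewrite gtr0_norm.
have U'M : nrm U' <= M by rewrite /U' -scaleNr; apply: bU; rewrite normrN gtr0_norm.
have E'M : nrm E' <= M + D.
  apply: le_trans (nrm_le_dist _ U') _; apply: lerD => //; apply: le_trans rE' _.
  by rewrite ler_piMr.
pose a := t *: Y; pose b := (t ^+ 2 / 2) *: (Y *m Y).
have an : nrm a = t * y by rewrite nrmZ gtr0_norm.
have bn : nrm b <= t ^+ 2 * (y * y).
  rewrite nrmZ ger0_norm //; apply: ler_pM; rewrite ?nrm_ge0 //.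
  by rewrite ler_pdivrMr // ler_peMr ?exprn_ge0 ?(ltW t0) // ler1n.
have -> : E *m X *m E' - (X + t *: lbr Y X + (t ^+ 2 / 2) *: lbr Y (lbr Y X)) =
   (E - U) *m X *m E' + U *m X *m (E' - U') + (a *m X *m b - b *m X *m a + b *m X *m b).
  have -> : E *m X *m E' = (E - U) *m X *m E' + U *m X *m (E' - U') + U *m X *m U'.
    rewrite !mulmxBl !mulmxBr; move: (E *m X *m E') (U *m X *m E') (U *m X *m U') => z1 z2 z3.
    by rewrite addrA !subrK.
  rewrite -addrA; congr (_ + _); rewrite conj_expand -/a -/b.
  have -> : t *: lbr Y X = a *m X - X *m a by rewrite /lbr /a scalerBr -scalemxAl -scalemxAr.
  have -> : (t ^+ 2 / 2) *: lbr Y (lbr Y X) = b *m X + X *m b - a *m X *m a.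
    rewrite lbr_lbr scalerBr scalerDr scalerA divfK ?pnatr_eq0 // /a /b.
    by rewrite -!scalemxAl -!scalemxAr scalerA expr2.
  by rewrite addrC addKr.
apply: le_trans (nrmD _ _) _; rewrite mulrDl; apply: lerD.
  apply: le_trans (nrmD _ _) _; rewrite mulrDl; apply: lerD.
    have -> : D * x * (M + D) * t ^+ 3 = (D * t ^+ 3) * x * (M + D) by ring.
    apply: le_trans (nrmM _ _) _; apply: ler_pM; rewrite ?nrm_ge0 //.
    by apply: le_trans (nrmM _ _) _; apply: ler_pM; rewrite ?nrm_ge0.
  have -> : M * x * D * t ^+ 3 = M * x * (D * t ^+ 3) by ring.
  apply: le_trans (nrmM _ _) _; apply: ler_pM; rewrite ?nrm_ge0 //.
  by apply: le_trans (nrmM _ _) _; apply: ler_pM; rewrite ?nrm_ge0.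
have p (u v : 'M[R]_n) a' b' : nrm u <= a' -> nrm v <= b' -> nrm (u *m v : 'M[R]_n) <= a' * b'.
  by move=> h1 h2; apply: le_trans (nrmM _ _) _; apply: ler_pM; rewrite ?nrm_ge0.
have an' : nrm a <= t * y by rewrite an.
have q (u v w : 'M[R]_n) a' b' c' : nrm u <= a' -> nrm v <= b' -> nrm w <= c' ->
    nrm (u *m v *m w : 'M[R]_n) <= a' * b' * c'.
  by move=> h1 h2 h3; apply: (p) => //; apply: (p).
clearbody a b.
have xx : nrm X <= x by [].
apply: (@le_trans _ _ (t * y * x * (t ^+ 2 * (y * y)) + t ^+ 2 * (y * y) * x * (t * y) +
   t ^+ 2 * (y * y) * x * (t ^+ 2 * (y * y)))).
  apply: le_trans (nrmD _ _) _; apply: lerD; last by apply: (q).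
  by apply: le_trans (nrmB _ _) _; apply: lerD; apply: (q).
rewrite mulrDl mulrDl; apply: lerD.
  by rewrite le_eqVlt; apply/orP; left; apply/eqP; ring.
have -> : t ^+ 2 * (y * y) * x * (t ^+ 2 * (y * y)) = y * y * x * (y * y) * (t ^+ 3 * t) by ring.
by rewrite ler_wpM2l ?mulr_ge0 // ler_piMr.
Qed.

(** For small t the term of lowest order decides. *)
Lemma taylor_sign (c1 c2 C : R) : 0 <= C ->
  (forall t, 0 < t -> t <= 1 -> c1 * t + c2 * t ^+ 2 <= C * t ^+ 3) ->
  c1 <= 0 /\ (c1 = 0 -> c2 <= 0).
Proof.
move=> C0 h; split=> [|c10].
  rewrite leNgt; apply/negP => c1p; pose t := Num.min 1 (c1 / (2 * (C + `|c2| + 1))).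
  have B0 : 0 < C + `|c2| + 1 by rewrite ltr_wpDl // addr_ge0.
  have t0 : 0 < t by rewrite lt_min ltr01 divr_gt0 // mulr_gt0.
  have t1 : t <= 1 by rewrite ge_min lexx.
  have t2 : t * (C + `|c2| + 1) <= c1 / 2.
    rewrite -ler_pdivlMr // -mulrA -invfM; rewrite ge_min; apply/orP; right; exact: lexx.
  have := h t t0 t1; have : - `|c2| <= c2 by rewrite lerNl -normrN ler_norm.
  move: (`|c2|) t2 B0 => u t2 B0 cu hh.
  have : c1 + c2 * t <= C * t ^+ 2.
    rewrite -(ler_pM2r t0) mulrDl -mulrA -expr2; apply: le_trans hh _.
    by rewrite -mulrA -exprSr.
  have key (s c : R) : s * (C + u + 1) <= c / 2 -> s <= 1 -> 0 < s -> 0 < c -> - u <= c2 ->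
      c + c2 * s <= C * s ^+ 2 -> False.
    move=> q1 q2 q3 q4 q5 q6.
    have a1 : 0 <= C * s * (1 - s) by rewrite !mulr_ge0 ?(ltW q3) // subr_ge0.
    have a2 : 0 <= (c2 + u) * s by rewrite mulr_ge0 ?(ltW q3) //; lra.
    move: a1 a2 q6 q1; rewrite expr2; lra.
  exact: key.
rewrite leNgt; apply/negP => c2p; pose t := Num.min 1 (c2 / (2 * (C + 1))).
have B0 : 0 < C + 1 by rewrite ltr_wpDl.
have t0 : 0 < t by rewrite lt_min ltr01 divr_gt0 // mulr_gt0.
have t1 : t <= 1 by rewrite ge_min lexx.
have t2 : t * (C + 1) <= c2 / 2.
  rewrite -ler_pdivlMr // -mulrA -invfM; rewrite ge_min; apply/orP; right; exact: lexx.
have := h t t0 t1; rewrite c10 mul0r add0r; have -> : C * t ^+ 3 = C * t * t ^+ 2 by ring.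
rewrite ler_pM2r ?exprn_gt0 // => hh.
have key (s : R) : s * (C + 1) <= c2 / 2 -> 0 < s -> c2 <= C * s -> False by move: c2p => ? ? ? ?; lra.
exact: (key t).
Qed.

Lemma mxtrace_lbr X Y Z : \tr (lbr X Y *m Z) = - \tr (Y *m lbr X Z).
Proof.
rewrite /lbr mulmxBl mulmxBr !raddfB /= opprK addrC -!mulmxA; congr (_ + _).
by rewrite mxtrace_mulC -mulmxA.
Qed.

(* The second variation of [tr (exp(tY) X exp(-tY) Z)] at a maximum. *)
Lemma max_variation Y X Z :
  (forall t, \tr (mxexp (t *: Y) *m X *m mxexp (- (t *: Y)) *m Z) <= \tr (X *m Z)) ->
  \tr (lbr Y X *m Z) = 0 /\ 0 <= \tr (lbr Y X *m lbr Y Z).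
Proof.
have main W : (forall t, \tr (mxexp (t *: W) *m X *m mxexp (- (t *: W)) *m Z) <= \tr (X *m Z)) ->
    \tr (lbr W X *m Z) <= 0 /\ (\tr (lbr W X *m Z) = 0 -> 0 <= \tr (lbr W X *m lbr W Z)).
  move=> h; have [C C0 hC] := exp_conj_taylor W X.
  have [||h1 h2] := @taylor_sign (\tr (lbr W X *m Z)) (\tr (lbr W (lbr W X) *m Z) / 2) (C * nrm Z).
  - by rewrite mulr_ge0 ?nrm_ge0.
  - move=> t t0 t1; have := h t; have := hC t t0 t1; set EX := _ *m _ *m _; set T := X + _ + _ => hE hT.
    have -> : \tr (lbr W X *m Z) * t + \tr (lbr W (lbr W X) *m Z) / 2 * t ^+ 2 = \tr (T *m Z) - \tr (X *m Z).
      rewrite /T (mulmxDl (X + _)) (mulmxDl X) -!scalemxAl !mxtraceD !mxtraceZ; ring.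
    apply: (@le_trans _ _ (\tr (T *m Z) - \tr (EX *m Z))); first by rewrite lerD2l lerN2.
    rewrite -raddfB -mulmxBl; apply: le_trans (ler_norm _) _; apply: le_trans (norm_mxtrace _) _.
    apply: le_trans (nrmM _ _) _; rewrite mulrAC ler_wpM2r ?nrm_ge0 //.
    by rewrite nrmC.
  split=> // /h2; rewrite mxtrace_lbr; lra.
move=> h; have [h1 h2] := main Y h.
(* Reversing the direction turns the first-order inequality into an equality. *)
have [|h3 _] := main (- Y).
  by move=> t; have := h (- t); rewrite scalerN scaleNr.
suff h0 : \tr (lbr Y X *m Z) = 0 by split=> //; apply: h2.
apply/eqP; rewrite eq_le h1 /=; move: h3.
have -> : lbr (- Y) X = - lbr Y X by rewrite /lbr mulNmx mulmxN opprB opprK addrC.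
by rewrite mulNmx raddfN /= oppr_le0.
Qed.

Lemma antisym_lbr X Z : X^T = X -> Z^T = Z -> (lbr X Z)^T = - lbr X Z.
Proof. by move=> hX hZ; rewrite /lbr raddfB /= !trmx_mul hX hZ opprB. Qed.

Lemma mxtrace_tr_gt0 X : \tr (X *m X^T) <= 0 -> X = 0.
Proof.
have E : \tr (X *m X^T) = \sum_i \sum_j X i j ^+ 2.
  by apply: eq_bigr => i _; rewrite mxE; apply: eq_bigr => j _; rewrite mxE expr2.
move=> h; apply/matrixP => i j; rewrite [RHS]mxE; apply/eqP; rewrite -sqrf_eq0.
have h0 k : 0 <= \sum_l X k l ^+ 2 by apply: sumr_ge0 => l _; apply: sqr_ge0.
rewrite eq_le sqr_ge0 andbT; apply: le_trans h; rewrite E (bigD1 i) //= (bigD1 j) //= -addrA lerDl.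
by rewrite addr_ge0 // sumr_ge0 // => l _; apply: sqr_ge0.
Qed.

End Variation.

Section LocallyLipschitz.
Variables (R : realType) (n : nat).

(** Stable under sums and products with no uniformity in the base point, and enough to make zero
    sets of polynomial functions closed. *)
Definition llip (f : 'M[R]_n -> R) := forall x, exists2 C, 0 <= C &
  forall y, nrm (y - x) < 1 -> `|f y - f x| <= C * nrm (y - x).

Lemma palg_llip f : palg (@mxcoord R n) f -> llip f.
Proof.
elim=> [c|[i j]|f' g _ hf _ hg|f' g _ hf _ hg] x.
- by exists 0 => // y _; rewrite subrr normr0 mul0r.
- exists 1 => // y _; rewrite mul1r; apply: le_trans (le_nrm _ i j).
  by rewrite !mxE /mxcoord.
- have [C C0 hC] := hf x; have [D D0 hD] := hg x; exists (C + D); first exact: addr_ge0.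
  move=> y yx; rewrite opprD addrACA mulrDl; apply: le_trans (ler_normD _ _) _.
  by apply: lerD; [apply: hC|apply: hD].
- have [C C0 hC] := hf x; have [D D0 hD] := hg x.
  exists (C * (`|g x| + D) + `|f' x| * D).
    by rewrite addr_ge0 ?mulr_ge0 ?addr_ge0.
  move=> y yx; have {}hC := hC y yx; have {}hD := hD y yx.
  have -> : f' y * g y - f' x * g x = (f' y - f' x) * g y + f' x * (g y - g x).
    by rewrite mulrBl mulrBr subrKA.
  rewrite [leRHS]mulrDl; apply: le_trans (ler_normD _ _) _; rewrite !normrM; apply: lerD.
    rewrite mulrAC; apply: ler_pM => //; rewrite -[g y](subrK (g x)) addrC.
    apply: le_trans (ler_normD _ _) _; rewrite lerD2l; apply: le_trans hD _.
    by rewrite ler_piMr // ltW.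
  by rewrite -mulrA ler_wpM2l.
Qed.

Lemma nclosed_palg (I : Type) (f : I -> 'M[R]_n -> R) :
  (forall i, palg (@mxcoord R n) (f i)) -> nclosed (fun x => forall i, f i x = 0).
Proof.
move=> hf x hx i; have [C C0 hC] := palg_llip (hf i) x.
apply/eqP; rewrite -normr_le0; apply/ler_addgt0Pr => e e0; rewrite add0r.
have d0 : 0 < Num.min 1 (e / (C + 1)) by rewrite lt_min ltr01 divr_gt0 // ltr_wpDl.
have [y fy yx] := hx _ d0; move: yx; rewrite lt_min => /andP[y1 ye].
have := hC y y1; rewrite fy sub0r normrN => /le_trans; apply.
apply: (@le_trans _ _ (C * (e / (C + 1)))); first by rewrite ler_wpM2l // ltW.
by rewrite mulrCA ler_piMr ?(ltW e0) // ler_pdivrMr ?mul1r ?lerDl // ltr_wpDl.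
Qed.

Lemma nclosedI (Z Z' : 'M[R]_n -> Prop) : nclosed Z -> nclosed Z' -> nclosed (fun x => Z x /\ Z' x).
Proof.
move=> h h' x hx; split; [apply: h|apply: h'] => e e0; have [y [Zy Z'y] yx] := hx e e0; by exists y.
Qed.

Lemma nclosed_eqmx p q (f g : 'M[R]_n -> 'M[R]_(p, q)) :
  mpalg (@mxcoord R n) f -> mpalg (@mxcoord R n) g -> nclosed (fun x => f x = g x).
Proof.
move=> hf hg x hx; apply/matrixP => i j; apply/eqP; rewrite -subr_eq0; apply/eqP.
have := @nclosed_palg ('I_p * 'I_q) (fun ij x => f x ij.1 ij.2 - g x ij.1 ij.2).
move=> /(_ _ x _ (i, j)) /= -> //.
  by move=> [k l] /=; apply: palg_sub.
by move=> e e0; have [y fg yx] := hx e e0; exists y => // -[k l] /=; rewrite fg subrr.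
Qed.

Lemma max_orbit (Z : 'M[R]_n -> Prop) X Y : nclosed Z -> Z 1%:M ->
  (forall c, Z c -> c *m c^T = 1%:M) ->
  exists2 c, Z c & forall c', Z c' -> \tr (c' *m X *m c'^T *m Y) <= \tr (c *m X *m c^T *m Y).
Proof.
move=> Zc Z1 Zo; apply: (@ext_value_lip _ _ _ Z (fun c => \tr (c *m X *m c^T *m Y)) 1%:M (n%:R * n%:R)
    (2 * (n%:R * n%:R * nrm X * nrm Y))) => // [z /Zo|x y Zx Zy]; first exact: nrm_orth.
rewrite -raddfB -mulmxBl /=.
have -> : y *m X *m y^T - x *m X *m x^T = (y - x) *m X *m y^T + x *m X *m (y - x)^T.
  by rewrite !mulmxBl linearB /= mulmxBr subrKA.
apply: le_trans (norm_mxtrace _) _; apply: le_trans (nrmM _ _) _.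
have -> : 2 * (n%:R * n%:R * nrm X * nrm Y) * nrm (y - x) =
   (nrm (y - x) * nrm X * (n%:R * n%:R) + n%:R * n%:R * nrm X * nrm (y - x)) * nrm Y by ring.
rewrite ler_wpM2r ?nrm_ge0 //; apply: le_trans (nrmD _ _) _.
apply: lerD; apply: le_trans (nrmM _ _) _; apply: ler_pM; rewrite ?nrm_ge0 ?nrm_tr ?nrm_orth ?Zo //.
  exact: nrmM.
by apply: le_trans (nrmM _ _) _; rewrite ler_wpM2r ?nrm_ge0 // nrm_orth ?Zo.
Qed.

End LocallyLipschitz.

(** * Weight decomposition under a commuting family *)

Section Weights.
Variables (R : realType) (n : nat) (P : 'M[R]_n) (a : set 'M[R]_n).
Hypothesis uP : P \in unitmx.

Definition pc (X : 'M[R]_n) : 'M[R]_n := P *m X *m invmx P.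
Definition lam i (X : 'M[R]_n) : R := pc X i i.

Lemma pcM X Y : pc (X *m Y) = pc X *m pc Y.
Proof. by rewrite /pc !mulmxA mulmxKV. Qed.
Lemma pcB X Y : pc (X - Y) = pc X - pc Y.
Proof. by rewrite /pc mulmxBr mulmxBl. Qed.
Lemma pcD X Y : pc (X + Y) = pc X + pc Y.
Proof. by rewrite /pc mulmxDr mulmxDl. Qed.
Lemma pcZ c X : pc (c *: X) = c *: pc X.
Proof. by rewrite /pc -scalemxAr -scalemxAl. Qed.
Lemma pc_inj X Y : pc X = pc Y -> X = Y.
Proof.
move=> /(congr1 (fun M => invmx P *m M *m P)).
by rewrite /pc !mulmxA mulVmx // !mul1mx !mulmxKV.
Qed.
Lemma pc0 : pc 0 = 0. Proof. by rewrite /pc mulmx0 mul0mx. Qed.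
Lemma pc_sum I (s : seq I) (Q : pred I) (F : I -> 'M[R]_n) :
  pc (\sum_(i <- s | Q i) F i) = \sum_(i <- s | Q i) pc (F i).
Proof. by rewrite /pc mulmx_sumr mulmx_suml. Qed.

Definition pdiag X := forall i j, i != j -> pc X i j = 0.

Lemma pdiagE X : pdiag X -> pc X = diag_mx (\row_i lam i X).
Proof.
move=> h; apply/matrixP => i j; rewrite [RHS]mxE; case: eqVneq => [->|ij].
  by rewrite mulr1n [RHS]mxE.
by rewrite mulr0n h.
Qed.

Hypothesis a_diag : forall H, a H -> pdiag H.

Lemma pc_lbr H X i j : a H -> pc (lbr H X) i j = (lam i H - lam j H) * pc X i j.
Proof.
move=> aH; rewrite /lbr pcB !pcM (pdiagE (a_diag aH)) mul_mx_diag mul_diag_mx.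
move: (pc X) => M; rewrite !mxE mulrBl; congr (_ - _); exact: mulrC.
Qed.

Lemma pdiag_tr X Y : pdiag X -> pdiag Y -> \tr (X *m Y) = \sum_i lam i X * lam i Y.
Proof.
move=> hX hY; have <- : \tr (pc (X *m Y)) = \tr (X *m Y).
  by rewrite /pc mxtrace_mulC mulKmx.
rewrite pcM (pdiagE hX) (pdiagE hY) mulmx_diag mxtrace_diag.
by apply: eq_bigr => i _; rewrite !mxE.
Qed.

Lemma pdiag_comm X Y : pdiag X -> pdiag Y -> X *m Y = Y *m X.
Proof. by move=> hX hY; apply: pc_inj; rewrite !pcM (pdiagE hX) (pdiagE hY) diag_mxC. Qed.

(** In the coordinates of P the matrix position (i, j) has weight [lam i - lam j] under the adjoint
    action of a, so this compares the weights of two positions; weight 0 is included. *)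
Definition samew (p q : 'I_n * 'I_n) : bool :=
  `[< forall H, a H -> lam p.1 H - lam p.2 H = lam q.1 H - lam q.2 H >].

Lemma samew_refl p : samew p p. Proof. exact/asboolP. Qed.
Lemma samew_sym p q : samew p q = samew q p.
Proof. by apply/asboolP/asboolP => h H /h. Qed.
Lemma samew_trans q p r : samew p q -> samew q r -> samew p r.
Proof. by move=> /asboolP h /asboolP h'; apply/asboolP => H aH; rewrite h ?h'. Qed.

Variable V : set 'M[R]_n.
Hypotheses (V0 : V 0) (VD : forall X Y, V X -> V Y -> V (X + Y)).
Hypothesis (VZ : forall c X, V X -> V (c *: X)).
Hypothesis (Vbr : forall H X, a H -> V X -> V (lbr H X)).

(** For each position whose weight differs from that of p, some H in a takes distinct values u at p
    and w there. The operator (ad H - w)/(u - w) preserves V, fixes the weight of p and kills the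
    other; composing them leaves the component. *)
Lemma weight_component X (p : 'I_n * 'I_n) : V X ->
  exists2 Y, V Y & forall k l, pc Y k l = if samew p (k, l) then pc X k l else 0.
Proof.
move=> VX; have kill (s : seq ('I_n * 'I_n)) : exists2 Y, V Y & exists c : 'I_n -> 'I_n -> R,
    (forall k l, pc Y k l = c k l * pc X k l) /\
    (forall k l, samew p (k, l) -> c k l = 1) /\
    (forall q, q \in s -> ~~ samew p q -> c q.1 q.2 = 0).
  elim: s => [|q s [Y VY [c [Yc [c1 c0]]]]].
    by exists X => //; exists (fun _ _ => 1); split=> // k l; rewrite mul1r.
  have [pq|npq] := boolP (samew p q).
    exists Y => //; exists c; split=> //; split=> // q'; rewrite inE => /predU1P[->|]; last exact: c0.
    by rewrite pq.
  have : exists H, a H /\ lam p.1 H - lam p.2 H <> lam q.1 H - lam q.2 H.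
    move/asboolP: npq => /existsNP[H /not_implyP[aH h]]; by exists H.
  case=> H [aH Hpq]; set u := lam p.1 H - lam p.2 H in Hpq; set w := lam q.1 H - lam q.2 H in Hpq.
  have uw : u - w != 0 by rewrite subr_eq0; apply/eqP.
  exists ((u - w)^-1 *: (lbr H Y + (- w) *: Y)).
    by apply: VZ; apply: VD; [apply: Vbr|apply: VZ].
  exists (fun k l => (u - w)^-1 * ((lam k H - lam l H) - w) * c k l); split; last split.
  - move=> k l; rewrite pcZ pcD pcZ [LHS]mxE [X in _ * X]mxE [X in _ * (_ + X)]mxE pc_lbr // Yc; ring.
  - move=> k l kl; rewrite (c1 _ _ kl) mulr1; move/asboolP: kl => /(_ H aH) /= <-.
    by rewrite mulVf.
  - move=> q'; rewrite inE => /predU1P[->|q's] h; first by rewrite -/w subrr mulr0 mul0r.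
    by rewrite c0 // mulr0.
have [Y VY [c [Yc [c1 c0]]]] := kill (enum {: 'I_n * 'I_n}).
exists Y => // k l; rewrite Yc; case: ifPn => [h|h]; first by rewrite c1 // mul1r.
by rewrite (c0 (k, l)) ?mem_enum // mul0r.
Qed.

(** The components at the positions of T are added up; a weight is met once for each of its
    positions, hence the division by [m p]. *)
Lemma weight_mask X (T : pred ('I_n * 'I_n)) : V X ->
  (forall p q, samew p q -> T p -> T q) ->
  exists2 Y, V Y & forall k l, pc Y k l = if T (k, l) then pc X k l else 0.
Proof.
move=> VX hT; have /choice[C CP] : forall p, exists Y, V Y /\
    forall k l, pc Y k l = if samew p (k, l) then pc X k l else 0.
  by move=> p; have [Y VY h] := weight_component p VX; exists Y.
pose m p : R := \sum_q (samew p q)%:R.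
have m0 p : m p != 0.
  rewrite /m -natr_sum pnatr_eq0 (bigD1 p) //= samew_refl; by [].
exists (\sum_(p | T p) (m p)^-1 *: C p).
  by apply: (big_ind V) => // p _; apply: VZ; case: (CP p).
move=> k l; rewrite pc_sum summxE.
have E p : pc ((m p)^-1 *: C p) k l = (m p)^-1 * (if samew p (k, l) then pc X k l else 0).
  by rewrite pcZ mxE; case: (CP p) => _ ->.
under eq_bigr => p _ do rewrite E.
case: ifPn => Tkl; last first.
  rewrite big1 // => p Tp; case: ifPn => h; last by rewrite mulr0.
  by rewrite (hT _ _ h Tp) in Tkl.
transitivity ((m (k, l))^-1 * pc X k l * \sum_p (samew (k, l) p)%:R); last first.
  by rewrite -/(m (k, l)) mulrAC mulVf // mul1r.
rewrite big_distrr /= big_mkcond; apply: eq_bigr => p _ /=.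
have [h|h] := boolP (samew (k, l) p).
  rewrite (hT _ _ h Tkl) samew_sym h mulr1; congr (_^-1 * _).
  apply: eq_bigr => q _; congr (_ %:R); congr nat_of_bool.
  apply/idP/idP => h'; first exact: samew_trans h h'.
  by apply: samew_trans h'; rewrite samew_sym.
by rewrite mulr0; case: ifP => // _; rewrite samew_sym (negbTE h) mulr0.
Qed.

Definition wform i j (X : 'M[R]_n) : R := lam i X - lam j X.

Lemma wform_is_linear i j : scalar (wform i j).
Proof.
move=> c X Y; rewrite /wform /lam pcD pcZ; move: (pc X) (pc Y) => M N; rewrite !mxE; ring.
Qed.

HB.instance Definition _ i j := GRing.isLinear.Build R 'M[R]_n R _ (wform i j) (wform_is_linear i j).

End Weights.

(** * The identity component of a split torus *)

(** Two monomials that agree at the point with coordinates exp(h_i) have the same exponent sum along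
    h, hence agree at all real parameters t; so vanishing at the natural powers propagates to the
    one-parameter group. *)
Lemma palg_exp_real (R : realType) (C : fieldType) (io : {rmorphism R -> C}) N
    (f : 'rV[C]_N -> C) (h : 'rV[R]_N) :
  palg (@rvcoord C N) f ->
  (forall k : nat, f (\row_i io (expR (k%:R * h 0 i))) = 0) ->
  forall t, f (\row_i io (expR (t * h 0 i))) = 0.
Proof.
move=> hf f0 t; apply: (@palg_powers _ _ _ (\row_i io (expR (h 0 i))) _ hf) => [k|m m'].
  rewrite -[RHS](f0 k); congr f; apply/rowP => i.
  by rewrite !mxE -rmorphXn /= expRM_natl.
have E s (l : multinom N) : mpow (\row_i io (expR (s * h 0 i))) l =
    io (expR (s * \sum_i (l i)%:R * h 0 i)).
  rewrite /mpow mulr_sumr expR_sum rmorph_prod; apply: eq_bigr => i _.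
  by rewrite mxE -rmorphXn /= mulrCA expRM_natl.
have -> : \row_i io (expR (h 0 i)) = \row_i io (expR (1 * h 0 i)).
  by apply/rowP => i; rewrite !mxE mul1r.
by rewrite !E !mul1r => /fmorph_inj/expR_inj ->.
Qed.

Lemma mxexp_nat_dconj (R : realType) n (Q : 'M[R]_n) h k : Q \in unitmx ->
  mxexp (k%:R *: (invmx Q *m diag_mx h *m Q)) = mxexp (invmx Q *m diag_mx h *m Q) ^+ k.
Proof.
move=> uQ; elim: k => [|k IH]; first by rewrite scale0r mxexp0 expr0.
rewrite exprSr -IH !scale_dconj !mxexp_dconj // -[_ * _]/(_ *m _) !mulmxA mulmxK //.
rewrite -[in RHS](mulmxA (invmx Q)) mulmx_diag.
congr (_ *m diag_mx _ *m _); apply/rowP => i; rewrite !mxE.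
by rewrite -natr1 mulrDl mul1r expRD.
Qed.

Lemma mxexp_dconjD (R : realType) n (Q X : 'M[R]_n) h s t : Q \in unitmx ->
  X = invmx Q *m diag_mx h *m Q -> mxexp (s *: X) = mxexp (t *: X) *m mxexp ((s - t) *: X).
Proof.
move=> uQ ->; rewrite !scale_dconj !(mxexp_dconj _ uQ) !mulmxA (mulmxK uQ) -[in RHS](mulmxA (invmx Q)) mulmx_diag.
congr (_ *m diag_mx _ *m _); apply/rowP => l; rewrite !mxE -expRD; congr expR; ring.
Qed.

Lemma points_powers (K : rcfType) (R : realType) (iR : {rmorphism K -> R}) n (V : seq (mxpol K n))
    (Q : 'M[R]_n) h : is_mxgroup (geom V) -> Q \in unitmx ->
  points iR V (mxexp (invmx Q *m diag_mx h *m Q)) ->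
  forall t, points iR V (mxexp (t *: (invmx Q *m diag_mx h *m Q))).
Proof.
move=> grp uQ Vx t p pV; have [_ V1 VM _] := rgroup grp iR.
have E s : mxexp (s *: (invmx Q *m diag_mx h *m Q)) =
    invmx Q *m diag_mx (\row_i (expR (s * h 0 i))) *m (Q^T)^T.
  rewrite trmxK scale_dconj mxexp_dconj //; congr (_ *m diag_mx _ *m _).
  by apply/rowP => i; rewrite !mxE.
rewrite E; apply: (@palg_exp_real _ _ idfun _ (fun v => mxeval iR p (invmx Q *m diag_mx v *m Q^T^T))).
  by apply: palg_mxeval; apply: mpalg_diag.
move=> k; rewrite -E; suff : points iR V (mxexp (k%:R *: (invmx Q *m diag_mx h *m Q))) by apply.
rewrite mxexp_nat_dconj //; elim: k => [|k IH]; first by rewrite expr0.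
by rewrite exprS; apply: (VM _ _ Vx IH).
Qed.

Lemma points_powclosed (K : rcfType) (R : realType) (iR : {rmorphism K -> R}) n (V : seq (mxpol K n)) :
  is_mxgroup (geom V) -> powclosed (points iR V).
Proof. by move=> grp X /sym_dconj[Q uQ [h ->]] VX t; apply: points_powers. Qed.

Lemma exp_near1 (R : realType) n (X : 'M[R]_n) e : 0 < e ->
  exists2 d, 0 < d & forall t, `|t| < d -> nrm (mxexp (t *: X) - 1%:M) < e.
Proof.
move=> e0.
have half (Y : 'M[R]_n) : exists2 d, 0 < d & forall t, 0 < t -> t < d -> nrm (mxexp (t *: Y) - 1%:M) < e.
  have [d d0 hd] := fo_exp Y ltr01; exists (Num.min d (e / (nrm Y + 1))).
    by rewrite lt_min d0 divr_gt0 // ltr_wpDl // nrm_ge0.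
  move=> t t0; rewrite lt_min => /andP[td te].
  apply: le_lt_trans (nrm_le_dist _ (t *: Y)) _; rewrite nrmZ gtr0_norm //.
  apply: (@le_lt_trans _ _ (t * nrm Y + 1 * t)); first by rewrite lerD2l hd.
  by rewrite mul1r -{2}[t]mulr1 -mulrDr -ltr_pdivlMr // ltr_wpDl // nrm_ge0.
have [d1 d10 h1] := half X; have [d2 d20 h2] := half (- X).
exists (Num.min d1 d2); first by rewrite lt_min d10.
move=> t; rewrite lt_min => /andP[t1 t2]; have [t0|t0|->] := ltgtP t 0.
- by rewrite ltr0_norm // in t2; have := h2 (- t); rewrite oppr_gt0 scalerN scaleNr opprK; apply.
- by rewrite gtr0_norm // in t1; apply: h1.
- by rewrite scale0r mxexp0 subrr nrm0.
Qed.

Section TorusComponent.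
Variables (K : rcfType) (n : nat) (S : seq (mxpol K n)) (A : saform K n) (P : 'M[K]_n).
Hypothesis S_grp : is_mxgroup (geom S).
Hypothesis uP : P \in unitmx.
Hypothesis S_diag : forall s, geom S s ->
  is_diag_mx (map_mx (@real_complex K) P *m s *m map_mx (@real_complex K) (invmx P)).
Hypothesis A_comp : sa_component (points idfun S) 1%:M A.

Let dc (L : rcfType) (io : {rmorphism K -> L}) (x : 'M[L]_n) i : L :=
  (map_mx io P *m x *m map_mx io (invmx P)) i i.

Lemma dcE (L : rcfType) (io : {rmorphism K -> L}) x : points io S x ->
  x = invmx (map_mx io P) *m diag_mx (\row_i dc io x i) *m map_mx io P.
Proof.
move=> Sx; have uP' : map_mx io P \in unitmx by rewrite map_unitmx.
have E : map_mx io P *m x *m map_mx io (invmx P) = diag_mx (\row_i dc io x i).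
  apply/matrixP => i j; rewrite [RHS]mxE; have [<-|ij] := eqVneq i j; first by rewrite mulr1n [RHS]mxE.
  by rewrite mulr0n (points_diag S_diag Sx ij).
by rewrite -E map_invmx !mulmxA mulVmx // mul1mx mulmxKV.
Qed.

Lemma dc_conj (L : rcfType) (io : {rmorphism K -> L}) d i :
  dc io (invmx (map_mx io P) *m diag_mx d *m map_mx io P) i = d 0 i.
Proof.
have uP' : map_mx io P \in unitmx by rewrite map_unitmx.
by rewrite /dc map_invmx !mulmxA mulmxV // mul1mx mulmxK // mxE eqxx mulr1n.
Qed.

(** Positive eigenvalues have logarithms, and the natural powers of x^-1 y lie in S, hence so does
    the whole one-parameter group. *)
Lemma pos_torus_path (R : realType) (iR : {rmorphism K -> R}) x y :
  pos_torus iR S P x -> pos_torus iR S P y ->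
  exists h, x *m mxexp (invmx (map_mx iR P) *m diag_mx h *m map_mx iR P) = y /\
    forall t, pos_torus iR S P (x *m mxexp (t *: (invmx (map_mx iR P) *m diag_mx h *m map_mx iR P))).
Proof.
case=> Sx xpos [Sy ypos]; set Q := map_mx iR P.
have uQ : Q \in unitmx by rewrite map_unitmx.
have [SU S1 SM SV] := rgroup S_grp iR.
pose h := \row_i (ln (dc iR y i) - ln (dc iR x i)).
pose X := invmx Q *m diag_mx h *m Q.
have DM (d e : 'rV[R]_n) : (invmx Q *m diag_mx d *m Q) *m (invmx Q *m diag_mx e *m Q) =
    invmx Q *m diag_mx (\row_i (d 0 i * e 0 i)) *m Q.
  by rewrite !mulmxA mulmxK // -[in LHS](mulmxA (invmx Q)) mulmx_diag.
have xX : x *m mxexp X = y.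
  rewrite [in LHS](dcE Sx) mxexp_dconj // DM [RHS](dcE Sy).
  congr (_ *m diag_mx _ *m _); apply/rowP => i; rewrite !mxE.
  have px : 0 < dc iR x i := xpos i; have py : 0 < dc iR y i := ypos i.
  by rewrite expRB !lnK ?posrE // mulrC divfK // gt_eqF.
have SX : points iR S (mxexp X).
  by rewrite -[mxexp X](mulKmx (SU _ Sx)) xX; apply: (SM _ _ (SV _ Sx) Sy).
exists h; split=> // t; split; first by apply: (SM _ _ Sx); apply: points_powers.
move=> i; rewrite [in x *m _](dcE Sx) scale_dconj mxexp_dconj // DM -/(dc iR _ i) dc_conj.
by rewrite !mxE mulr_gt0 ?expR_gt0 //; apply: xpos.
Qed.

(** A separation of the positive torus by two semialgebraic sets, with openness written through
    explicit radii: a first-order sentence, which can be carried from K to R, where it is absurd. *)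
Definition clopen_split (U V : saform K n) (L : rcfType) (io : {rmorphism K -> L}) :=
  (exists x, pos_torus io S P x /\ sa_ext io U x) /\
  (exists x, pos_torus io S P x /\ sa_ext io V x) /\
  (forall x, pos_torus io S P x -> sa_ext io U x \/ sa_ext io V x) /\
  (forall x, pos_torus io S P x -> sa_ext io U x -> sa_ext io V x -> False) /\
  (forall x, pos_torus io S P x -> sa_ext io U x -> exists e : L, 0 < e /\ forall y,
     pos_torus io S P y -> (forall i j, `|(y - x) i j| < e) -> sa_ext io U y) /\
  (forall x, pos_torus io S P x -> sa_ext io V x -> exists e : L, 0 < e /\ forall y,
     pos_torus io S P y -> (forall i j, `|(y - x) i j| < e) -> sa_ext io V y).

Lemma def_clopen_split U V : def (fun (L : rcfType) (io : {rmorphism K -> L}) (_ : nat -> L) =>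
  clopen_split U V io).
Proof. by rewrite /clopen_split /pos_torus; definable. Qed.

Lemma pos_torus_connected_real U V (R : realType) (iR : {rmorphism K -> R}) :
  ~ clopen_split U V iR.
Proof.
case=> -[x [Tx Ux]] [[y [Ty Vy]] [cover [disj [Uo Vo]]]].
have [k [xX path]] := pos_torus_path Tx Ty; set Q := map_mx iR P in xX path.
have uQ : Q \in unitmx by rewrite map_unitmx.
pose X := invmx Q *m diag_mx k *m Q; rewrite -/X in xX path.
pose z t := x *m mxexp (t *: X).
have zcont t e : 0 < e -> exists2 d, 0 < d & forall s, `|s - t| < d -> forall i j, `|(z s - z t) i j| < e.
  move=> e0; have [d d0 hd] := @exp_near1 R n X (e / (nrm (z t) + 1)) (divr_gt0 e0 (ltr_wpDl (nrm_ge0 _) ltr01)).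
  exists d => // s /hd h i j; apply: le_lt_trans (le_nrm _ i j) _.
  have zst : z s = z t *m mxexp ((s - t) *: X).
    by rewrite /z (@mxexp_dconjD R n Q X k s t uQ erefl) mulmxA.
  have -> : z s - z t = z t *m (mxexp ((s - t) *: X) - 1%:M) by rewrite zst mulmxBr mulmx1.
  apply: le_lt_trans (nrmM _ _) _.
  apply: (@le_lt_trans _ _ (nrm (z t) * (e / (nrm (z t) + 1)))).
    by rewrite ler_wpM2l ?nrm_ge0 // ltW.
  by rewrite mulrCA gtr_pMr // ltr_pdivrMr ?mul1r ?ltrDl // ltr_wpDl ?nrm_ge0.
have z0 : z 0 = x by rewrite /z scale0r mxexp0 mulmx1.
have z1 : z 1 = y by rewrite /z scale1r.
have {}path t : pos_torus iR S P (z t) := path t.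
clearbody z.
(* A locally constant function with values 1 and -1 along the path, to which the intermediate value
   theorem applies. *)
pose g t : R := if `[< sa_ext iR U (z t) >] then 1 else - 1.
have gc : forall t, {for t, continuous g}.
  move=> t; apply/cvgrPdist_lt => e e0.
  have [d d0 hd] : exists2 d, 0 < d & forall s, `|s - t| < d -> g s = g t.
    rewrite /g; case: asboolP => [Ut|nUt].
      have [e' [e'0 he]] := Uo _ (path t) Ut; have [d d0 hd] := zcont t _ e'0.
      by exists d => // s /hd h; case: asboolP => // -[]; apply: he.
    have Vt : sa_ext iR V (z t) by case: (cover _ (path t)).
    have [e' [e'0 he]] := Vo _ (path t) Vt; have [d d0 hd] := zcont t _ e'0.
    exists d => // s /hd h; case: asboolP => // Us; case: (disj _ (path s) Us); exact: he.
  by apply/nbhs_ballP; exists d => //= s; rewrite /ball /= distrC => /hd ->; rewrite subrr normr0.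
have [|c _ gc0] := @IVT R g 0 1 0 ler01 (continuous_subspaceT gc).
  have -> : g 0 = 1.
    by rewrite /g z0; case: asboolP.
  have -> : g 1 = -1.
    rewrite /g z1; case: asboolP => // Uy; case: (disj _ Ty Uy Vy).
  by rewrite ge_min le_max ler01 lerN10 orbT.
by move/eqP: gc0; rewrite /g; case: ifP => _; rewrite ?oppr_eq0 oner_eq0.
Qed.

Lemma pos_torus1 (L : rcfType) (io : {rmorphism K -> L}) : pos_torus io S P 1%:M.
Proof.
split; first by case: (rgroup S_grp io).
by move=> i; rewrite mulmx1 -map_mxM mulmxV // map_mx1 mxE eqxx.
Qed.

Let q_ex i : exists q : mxpol K n, forall g, mxeval idfun q g = dc idfun g i.
Proof.
apply: palg_mxpol; rewrite /dc; apply: mpalg_mul; last exact: mpalg_const.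
by apply: mpalg_mul; [exact: mpalg_const|exact: mpalg_id].
Qed.

Let q_exN i : exists q : mxpol K n, forall g, mxeval idfun q g = - dc idfun g i.
Proof.
apply: palg_mxpol; apply: palg_opp; rewrite /dc; apply: mpalg_mul; last exact: mpalg_const.
by apply: mpalg_mul; [exact: mpalg_const|exact: mpalg_id].
Qed.

(** On this neighbourhood the diagonal coefficient keeps its sign. *)
Lemma dc_near (x : 'M[K]_n) i : dc idfun x i != 0 ->
  \forall y \near x, `|dc idfun y i - dc idfun x i| < `|dc idfun x i|.
Proof.
move=> nz; pose C := \sum_a \sum_b `|P i a| * `|invmx P b i|.
have C0 : 0 < C + 1 by rewrite ltr_wpDl //; apply: sumr_ge0 => a _; apply: sumr_ge0 => b _; rewrite mulr_ge0.
pose e := `|dc idfun x i| / (C + 1).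
have e0 : 0 < e by rewrite divr_gt0 // normr_gt0.
apply/nbhs_ballP; exists e => //= y [_ yx].
have yx' a b : `|(y - x) a b| <= e by have := yx a b; rewrite /ball /= distrC !mxE => /ltW.
have -> : dc idfun y i - dc idfun x i = \sum_b \sum_a P i a * (y - x) a b * invmx P b i.
  transitivity ((P *m (y - x) *m invmx P) i i).
    by rewrite /dc !map_mx_id // mulmxBr mulmxBl [in RHS]mxE [X in _ = _ + X]mxE.
  rewrite mxE; apply: eq_bigr => b _; rewrite mxE big_distrl; by apply: eq_bigr => a _.
apply: (@le_lt_trans _ _ (C * e)).
  apply: le_trans (ler_norm_sum _ _ _) _; rewrite /C exchange_big /= big_distrl /=; apply: ler_sum => b _.
  apply: le_trans (ler_norm_sum _ _ _) _; rewrite big_distrl /=; apply: ler_sum => a _.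
  by rewrite !normrM -!mulrA ler_wpM2l // mulrC ler_wpM2l.
by rewrite /e mulrCA gtr_pMr ?normr_gt0 // ltr_pdivrMr // mul1r ltrDl.
Qed.

(** The points with all eigenvalues positive and those with some negative eigenvalue form two open
    parts of A, which exhaust it because eigenvalues of an invertible matrix are nonzero. A is
    connected and contains 1, so the second part is empty. *)
Let Apos x : sa_ext idfun A x -> pos_torus idfun S P x.
Proof.
case: (A_comp) => AS A1 Ac _ Ax; split; first exact: AS.
have [q qE] := choice q_ex; have [q' qN] := choice q_exN.
pose U : saform K n := [:: ([::], [seq q i | i <- enum 'I_n])].
pose V : saform K n := [seq ([::], [:: q' i]) | i <- enum 'I_n].
have UE y : sa_ext idfun U y <-> forall i, 0 < dc idfun y i.
  split=> [[c] | h].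
    rewrite inE => /eqP -> [_ h] i; rewrite -qE; apply: h => /=.
    by apply: map_f; rewrite mem_enum.
  exists ([::], [seq q i | i <- enum 'I_n]); first by rewrite inE.
  by split=> // _ /mapP[i _ ->]; rewrite qE.
have VE y : sa_ext idfun V y <-> exists i, dc idfun y i < 0.
  split=> [[c /mapP[i _ ->] [_ h]]|[i yi]].
    by exists i; have := h (q' i); rewrite qN oppr_gt0; apply; rewrite inE.
  exists ([::], [:: q' i]); first by apply: map_f; rewrite mem_enum.
  by split=> // p; rewrite inE => /eqP ->; rewrite qN oppr_gt0.
have nz y i : points idfun S y -> dc idfun y i != 0.
  move=> Sy; have [SU _ _ _] := rgroup S_grp (idfun : {rmorphism K -> K}).
  have E := dcE Sy; set d := \row_i _ in E.
  have := SU _ Sy; rewrite {1}E !unitmx_mul => /andP[/andP[_ ud] _]; move: ud.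
  by rewrite unitmxE det_diag unitfE => /prodf_neq0 /(_ i isT); rewrite mxE.
have [] := Ac U V.
- move=> y Ay [_ /UE Uy]; near=> z => Az; split=> //; apply/UE => i.
  have : forall i, `|dc idfun z i - dc idfun y i| < `|dc idfun y i|.
    by near: z; apply: filter_forall => j; apply: dc_near; rewrite gt_eqF // Uy.
  move=> /(_ i); rewrite (gtr0_norm (Uy i)) ltr_norml => /andP[h _].
  by move: h; rewrite ltrBrDl subrr.
- move=> y Ay [_ /VE[i Vy]]; near=> z => Az; split=> //; apply/VE; exists i.
  have : `|dc idfun z i - dc idfun y i| < `|dc idfun y i|.
    by near: z; apply: dc_near; rewrite lt_eqF.
  rewrite (ltr0_norm Vy) ltr_norml => /andP[_ h].
  by move: h; rewrite ltrBlDr addNr.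
- apply/seteqP; split=> y /=; last by case=> -[].
  move=> Ay; have [h|/existsNP[i h]] := pselect (forall i, 0 < dc idfun y i).
    by left; split=> //; apply/UE.
  right; split=> //; apply/VE; exists i.
  by case: (ltgtP (dc idfun y i) 0) => // y0; have := nz y i (AS _ Ay); rewrite y0 eqxx.
- apply/seteqP; split=> // y /= [[_ /UE h] [_ /VE[i yi]]].
  by have := lt_trans yi (h i); rewrite ltxx.
- move=> /seteqP[h _]; case: (h 1%:M); split=> //; apply/UE => i.
  by case: (pos_torus1 (idfun : {rmorphism K -> K})) => _ /(_ i).
move=> /seteqP[h _] i; have [//|ni] := ltP 0 (dc idfun x i).
case: (h x); split=> //; apply/VE; exists i.
by rewrite lt_neqAle ni andbT; apply: nz; apply: AS.
Unshelve. all: by end_near.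
Qed.

(** It suffices to argue over K. One inclusion is [Apos]. For the other, the positive torus is
    semialgebraic and contains 1, and a separation of it over K would give one over R; maximality of
    the component concludes. *)
Lemma component_pos_torus (R : realType) (iR : {rmorphism K -> R}) :
  forall (L : rcfType) (io : {rmorphism K -> L}) x, sa_ext io A x <-> pos_torus io S P x.
Proof.
move=> L io; suff h0 : forall x, sa_ext idfun A x <-> pos_torus idfun S P x.
  have dQ : def (fun (L : rcfType) (io : {rmorphism K -> L}) (_ : nat -> L) =>
     forall x, sa_ext io A x <-> pos_torus io S P x) by rewrite /pos_torus; definable.
  exact: (@xfer _ _ dQ K L idfun io h0).
move=> x; split; first exact: Apos.
case: (A_comp) => AS A1 _ Amax.
have [q qE] := choice q_ex.
pose B : saform K n := [:: (S, [seq q i | i <- enum 'I_n])].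
have BE y : sa_ext idfun B y <-> pos_torus idfun S P y.
  split=> [[c]|[Sy h]].
    rewrite inE => /eqP -> [Sy h]; split=> // i; rewrite -/(dc idfun y i) -qE; apply: h => /=.
    by apply: map_f; rewrite mem_enum.
  exists (S, [seq q i | i <- enum 'I_n]); first by rewrite inE.
  by split=> // _ /mapP[i _ ->]; rewrite qE; apply: h.
move=> /BE; apply: Amax.
- by move=> y /BE[].
- by apply/BE; apply: pos_torus1.
move=> U V U' V' Uo Vo UV UV0; apply: contrapT => /not_orP[/eqP/set0P[u [Bu Uu]] /eqP/set0P[v [Bv Vv]]].
have op (W : saform K n) : open_in (sa_ext idfun B) (sa_ext idfun B `&` sa_ext idfun W)%classic ->
    forall y, pos_torus idfun S P y -> sa_ext idfun W y -> exists e : K, 0 < e /\ forall z,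
     pos_torus idfun S P z -> (forall i j, `|(z - y) i j| < e) -> sa_ext idfun W z.
  move=> Wo y /BE By Wy; have /nbhs_ballP[e /= e0 he] := Wo y By (conj By Wy).
  exists e; split=> // z /BE Bz zy.
  have hb : ball y e z by split=> // i j; have := zy i j; rewrite /ball /= distrC !mxE.
  by case: (he z hb Bz).
have : clopen_split U V (idfun : {rmorphism K -> K}).
  split; first by exists u; split=> //; apply/BE.
  split; first by exists v; split=> //; apply/BE.
  split.
    move=> y /BE By; have : (U' `|` V')%classic y by rewrite -UV.
    by case=> -[]; [left|right].
  split.
    move=> y /BE By Uy Vy; have : (U' `&` V')%classic y by split; split.
    by rewrite UV0.
  by split; apply: op.
move=> h; apply: (@pos_torus_connected_real U V R iR).
exact: (@xfer _ _ (def_clopen_split U V) K R idfun iR h).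
Qed.

End TorusComponent.

(** * Cartan decomposition over R *)

(** The interface between algebra and analysis: existence of the decomposition and the Weyl group
    element are derived from these properties alone. *)
Record cartan_data (R : realType) n (G A : set 'M[R]_n) (P : 'M[R]_n) r
    (Delta : 'I_r -> {scalar 'M[R]_n}) : Prop := CartanData {
  cd_grp : is_mxgroup G;
  cd_cl : nclosed G;
  cd_tr : forall g, G g -> G g^T;
  cd_pow : powclosed G;
  cd_uP : P \in unitmx;
  cd_Agrp : is_mxgroup A;
  cd_Acl : nclosed A;
  cd_AG : forall x, A x -> G x;
  cd_Asym : forall H, lie A H -> H^T = H;
  cd_Adiag : forall H, lie A H -> pdiag P H;
  cd_Alog : forall x, A x -> exists2 H, lie A H & x = mxexp H;
  cd_Amax : forall X, lie G X -> X^T = X ->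
    (forall H, lie A H -> X *m H = H *m X) -> lie A X;
  cd_basis : root_basis (lie G) (lie A) Delta }.

Lemma mxtrace_lbr_mul (R : realType) n (X Y Z : 'M[R]_n) : \tr (lbr X Y *m Z) = \tr (X *m lbr Y Z).
Proof.
rewrite /lbr mulmxBl mulmxBr !raddfB /= -!mulmxA; congr (_ - _).
by rewrite mxtrace_mulC mulmxA.
Qed.

Lemma intertwine_log (R : realType) n (W : 'M[R]_n) (h h' : 'rV[R]_n) :
  W *m diag_mx (\row_i expR (h' 0 i)) = diag_mx (\row_i expR (h 0 i)) *m W ->
  W *m diag_mx h' = diag_mx h *m W.
Proof.
rewrite !mul_mx_diag !mul_diag_mx => /matrixP EW; apply/matrixP => i j.
have := EW i j; rewrite !mxE mulrC; have [->|nz] := eqVneq (W i j) 0; first by rewrite !mulr0 mul0r.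
by move=> /(mulIf nz)/expR_inj ->; rewrite mulrC.
Qed.

Lemma rank_linear_rows (F : fieldType) k N N' (f : {linear 'rV[F]_N -> 'rV[F]_N'}) (M : 'M[F]_(k, N)) :
  (\rank (\matrix_i f (row i M)) <= \rank M)%N.
Proof.
suff -> : \matrix_i f (row i M) = M *m lin1_mx f by apply: mxrankM_maxl.
by apply/row_matrixP => i; rewrite rowK row_mul mul_rV_lin1.
Qed.

Section Cartan.
Variables (R : realType) (n : nat) (G A : set 'M[R]_n) (P : 'M[R]_n) (r : nat).
Variable Delta : 'I_r -> {scalar 'M[R]_n}.
Hypothesis cd : cartan_data G A P Delta.
Implicit Types X Y H : 'M[R]_n.

Let grp := cd_grp cd.
Let cl := cd_cl cd.
Let uP := cd_uP cd.
Let Agrp := cd_Agrp cd.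
Let Acl := cd_Acl cd.
Let Adiag := cd_Adiag cd.

Lemma lieAG X : lie A X -> lie G X.
Proof. by move=> h t; apply: (cd_AG cd). Qed.

(** Linear independence of the simple roots makes the map from a to their values surjective. *)
Lemma exists_rho : exists2 rho, lie A rho & forall i, Delta i rho = 1.
Proof.
case: (cd_basis cd) => _ free _.
have [k [X [ZX Xspan]]] := rank_set (fun v : 'rV[R]_r => exists2 H, lie A H & v = \row_i Delta i H).
have full : row_full X.
  rewrite -sub1mx; apply: contrapT => /negP hn.
  have : cokermx X != 0 by move: hn; rewrite submxE mul1mx.
  case/eqP; apply/matrixP => i j; rewrite [RHS]mxE.
  apply: (free (fun i => cokermx X i j)) => H aH.
  have : (\row_i Delta i H <= X)%MS by apply: Xspan; exists H.
  rewrite submxE => /eqP/matrixP/(_ 0 j); rewrite [RHS]mxE mxE => E; rewrite -[RHS]E.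
  by apply: eq_bigr => l _; rewrite [X in _ = X * _]mxE mulrC.
have : (const_mx 1 : 'rV[R]_r) \in [pred v | (v <= X)%MS] by rewrite inE submx_full.
rewrite inE => /submxP[u uE].
have /choice[F FP] : forall i, exists H, lie A H /\ row i X = \row_j Delta j H.
  by move=> i; have [H aH E] := ZX i; exists H.
exists (\sum_i u 0 i *: F i).
  by apply: lie_sum => // i _; apply: lieZ; case: (FP i).
move=> j; have := congr1 (fun v : 'rV[R]_r => v 0 j) uE; rewrite [LHS]mxE => ->.
rewrite linear_sum mxE; apply: eq_bigr => i _; rewrite linearZ /=; congr (_ * _).
by have [_ /rowP/(_ j)] := FP i; rewrite !mxE.
Qed.

Definition strict H := lie A H /\ forall i, 0 < Delta i H.
Definition dominant H := lie A H /\ forall i, 0 <= Delta i H.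

(** A nonzero element of the Lie algebra of weight (i, j) makes this weight a root, thus an integer
    combination of simple roots with coefficients of one sign; a strictly dominant element reveals
    that sign, and it governs the values at all dominant elements. *)
Lemma root_strict X i j rho : lie G X -> lie A rho -> strict rho ->
  (forall k l, pc P X k l != 0 -> samew P (lie A) (i, j) (k, l)) -> X != 0 ->
  (exists2 H, lie A H & wform P i j H != 0) ->
  wform P i j rho != 0 /\
  (wform P i j rho < 0 -> forall H, dominant H -> wform P i j H <= 0).
Proof.
move=> gX ar [_ rpos] Xw X0 [H0 aH0 nz].
have root : is_root (lie G) (lie A) (wform P i j : {scalar 'M[R]_n}).
  split; first by exists H0.
  exists X; split=> // H aH; apply: (pc_inj uP); rewrite pcZ -/(lbr H X).
  apply/matrixP => k l; rewrite (pc_lbr uP _ _ _ _ aH) // [RHS]mxE.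
  have [->|h] := eqVneq (pc P X k l) 0; first by rewrite !mulr0.
  by have /asboolP/(_ H aH) /= <- := Xw k l h.
case: (cd_basis cd) => _ _ /(_ _ root)[z zs zE].
have zH H : lie A H -> wform P i j H = \sum_k (z k)%:~R * Delta k H := zE H.
have z0 : exists k, z k != 0.
  apply: contrapT => /forallNP h; move: nz; rewrite zH // big1 ?eqxx // => k _.
  by have /negP := h k; rewrite negbK => /eqP ->; rewrite mul0r.
have [k zk] := z0; rewrite !zH //; case: zs => zs.
  have : 0 < \sum_k (z k)%:~R * Delta k rho.
    rewrite (bigD1 k) //= ltr_pwDl ?sumr_ge0 //.
      by rewrite mulr_gt0 ?ltr0z // lt_neqAle eq_sym zk zs.
    by move=> l _; rewrite mulr_ge0 ?ler0z ?zs // ltW.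
  move=> h; split; first by rewrite gt_eqF.
  by rewrite ltNge ltW.
split.
  have : 0 < \sum_k (- z k)%:~R * Delta k rho.
    rewrite (bigD1 k) //= ltr_pwDl ?sumr_ge0 //.
      by rewrite mulr_gt0 ?ltr0z // oppr_gt0 lt_neqAle zk zs.
    by move=> l _; rewrite mulr_ge0 ?ler0z ?oppr_ge0 ?zs // ltW.
  move=> h; apply: contraTneq h => h; rewrite -leNgt.
  under eq_bigr => l _ do rewrite mulrNz mulNr.
  by rewrite sumrN h oppr0.
move=> _ H [aH dH]; rewrite zH //; apply: sumr_le0 => l _.
by rewrite mulr_le0_ge0 // lerz0.
Qed.

(** A weight component of X survives only if its weight vanishes at rho, which no root does. So X
    has weight 0 for a, and maximality of the torus applies. *)
Lemma commute_strict X rho : lie G X -> X^T = X -> strict rho ->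
  lbr X rho = 0 -> lie A X.
Proof.
move=> gX XT [ar rpos] Xr; apply: (cd_Amax cd) => // H aH.
suff XH : lbr H X = 0 by apply/esym/eqP; rewrite -subr_eq0; apply/eqP.
apply: (pc_inj uP); rewrite pc0; apply/matrixP => i j; rewrite (pc_lbr uP _ _ _ _ aH) // [RHS]mxE.
have [->|nz] := eqVneq (pc P X i j) 0; first by rewrite mulr0.
have rij : lam P i rho - lam P j rho = 0.
  have : pc P (lbr rho X) i j = 0.
    have -> : lbr rho X = 0 by rewrite -[LHS]opprK /lbr opprB -/(lbr X rho) Xr oppr0.
    by rewrite pc0 mxE.
  by rewrite (pc_lbr uP _ _ _ _ ar) // => /eqP; rewrite mulf_eq0 (negbTE nz) orbF => /eqP.
have [Y gY YE] := @weight_component _ _ P (lie A) uP Adiag (lie G) (lieD grp cl)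
  (fun c X => @lieZ _ _ G c X) (fun H X aH => lie_bracket grp cl (lieAG aH)) X (i, j) gX.
have [|h] := eqVneq (lam P i H - lam P j H) 0; first by move=> ->; rewrite mul0r.
have [||//||] := @root_strict Y i j rho gY ar _ _ _ _.
- by [].
- by move=> k l; rewrite YE; case: ifP => //; rewrite eqxx.
- apply: contraNneq nz => Y0; have := YE i j; rewrite Y0 pc0 mxE => ->.
  by rewrite samew_refl.
- by exists H.
by rewrite /wform rij eqxx.
Qed.

Definition orthG (c : 'M[R]_n) := G c /\ c *m c^T = 1%:M.

Lemma orth_inv c : orthG c -> c^T *m c = 1%:M.
Proof. by case=> _ /mulmx1C. Qed.

Lemma orthG1 : orthG 1%:M.
Proof. by split; [case: grp|rewrite trmx1 mulmx1]. Qed.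

Lemma orthGM c d : orthG c -> orthG d -> orthG (c *m d).
Proof.
case: grp => _ _ GM _ [Gc cc] [Gd dd]; split; first exact: GM.
by rewrite trmx_mul mulmxA -(mulmxA c) dd mulmx1.
Qed.

Lemma orthG_tr c : orthG c -> orthG c^T.
Proof. by move=> oc; split; [apply: (cd_tr cd); case: oc|rewrite trmxK orth_inv]. Qed.

Lemma orth_invmx c : orthG c -> invmx c = c^T.
Proof.
move=> oc; have [_ cc] := oc; have [uc _] := mulmx1_unit cc.
by rewrite -[RHS](mulKmx uc) cc mulmx1.
Qed.

Lemma orth_exp Y : lie G Y -> Y^T = - Y -> orthG (mxexp Y).
Proof.
by move=> gY YT; split; [rewrite -[Y]scale1r; apply: gY|rewrite -mxexp_tr YT mxexpN].
Qed.

Lemma nclosed_orthG : nclosed orthG.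
Proof.
apply: nclosedI => //; apply: nclosed_eqmx; last exact: mpalg_const.
by apply: mpalg_mul; [exact: mpalg_id|apply: mpalg_tr; exact: mpalg_id].
Qed.

Lemma lie_orth_conj c X : orthG c -> lie G X -> lie G (c *m X *m c^T).
Proof. by move=> oc gX; rewrite -(orth_invmx oc); apply: lie_Ad => //; case: oc. Qed.

Lemma sym_conj (c : 'M[R]_n) X : X^T = X -> (c *m X *m c^T)^T = c *m X *m c^T.
Proof. by move=> XT; rewrite !trmx_mul trmxK XT mulmxA. Qed.

(** Stated for a set Z because it is used twice: with Z = K for the decomposition and with the
    centraliser of H' in K for the Weyl group element. *)
Lemma maximiser (Z : 'M[R]_n -> Prop) X rho : nclosed Z -> Z 1%:M -> (forall c, Z c -> orthG c) ->
  (forall c Y, Z c -> lie G Y -> Y^T = - Y -> (forall t, Z (mxexp (t *: Y))) ->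
     forall t, Z (mxexp (t *: Y) *m c)) ->
  lie G X -> X^T = X -> lie A rho ->
  exists2 c, Z c & forall Y, lie G Y -> Y^T = - Y -> (forall t, Z (mxexp (t *: Y))) ->
    \tr (lbr Y (c *m X *m c^T) *m rho) = 0 /\
    0 <= \tr (lbr Y (c *m X *m c^T) *m lbr Y rho).
Proof.
move=> Zcl Z1 Zo ZM gX XT ar.
have [c Zc cmax] := max_orbit X rho Zcl Z1 (fun c Zc => (Zo c Zc).2).
exists c => // Y gY YT ZY; apply: max_variation => t.
have := cmax _ (ZM c Y Zc gY YT ZY t); rewrite trmx_mul -mxexp_tr.
by rewrite linearZ /= YT scalerN !mulmxA.
Qed.

Lemma lbr_sym X Y : X^T = X -> Y^T = Y -> (lbr X Y)^T = - lbr X Y.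
Proof. exact: antisym_lbr. Qed.

(** The first variation is tested on the antisymmetric matrix Y = [X, rho], where it equals tr(Y Y),
    that is, minus the squared length of Y. *)
Lemma strict_critical X rho : strict rho -> lie G X -> X^T = X ->
  \tr (lbr (lbr X rho) X *m rho) = 0 -> lie A X.
Proof.
move=> sr gX XT h; apply: (commute_strict gX XT sr).
have ar : lie A rho by case: sr.
have rT := cd_Asym cd ar.
apply: mxtrace_tr_gt0; rewrite (lbr_sym XT rT) mulmxN raddfN /= oppr_le0.
by rewrite -mxtrace_lbr_mul h.
Qed.

(* First order: [X] commutes with [rho]; second order, tested on [E - E^T] for root vectors [E]:
   [X] is dominant. *)
Lemma sym_conj_dominant X : lie G X -> X^T = X ->
  exists2 k, orthG k & dominant (k *m X *m k^T).
Proof.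
move=> gX XT; have [rho ar rho1] := exists_rho.
have sr : strict rho by split=> // i; rewrite rho1.
have [k ok kmax] := maximiser nclosed_orthG orthG1 (fun c h => h)
  (fun c Y oc gY YT oY t => orthGM (oY t) oc) gX XT ar.
exists k => //; set X' := k *m X *m k^T in kmax *.
have X'T : X'^T = X' by apply: sym_conj.
have gX' : lie G X' by apply: lie_orth_conj.
have rT := cd_Asym cd ar.
have oexp Y : lie G Y -> Y^T = - Y -> forall t, orthG (mxexp (t *: Y)).
  move=> gY YT t; apply: orth_exp; first exact: lieZ.
  by rewrite linearZ /= YT scalerN.
have aX' : lie A X'.
  apply: (strict_critical sr) => //.
  have gY : lie G (lbr X' rho) by apply: lie_bracket => //; apply: lieAG.
  have YT := lbr_sym X'T rT.
  by case: (kmax _ gY YT (oexp _ gY YT)).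
split=> // i.
case: (cd_basis cd) => roots _ _; have [_ [E [gE E0 Ew]]] := roots i.
have gET : lie G E^T by apply: lie_tr => //; apply: (cd_tr cd).
have gY : lie G (E - E^T) by apply: lieB.
have YT : (E - E^T)^T = - (E - E^T) by rewrite linearB /= trmxK opprB.
have [_] := kmax _ gY YT (oexp _ gY YT).
have brH H : lie A H -> lbr (E - E^T) H = - (Delta i H *: (E + E^T)).
  move=> aH; have e1 := Ew H aH; have HT := cd_Asym cd aH.
  have e2 : E^T *m H - H *m E^T = Delta i H *: E^T.
    by rewrite -linearZ /= -e1 linearB /= !trmx_mul HT.
  rewrite /lbr mulmxBl mulmxBr scalerDr -e1 -e2.
  move: (E *m H) (H *m E) (E^T *m H) (H *m E^T) => w1 w2 w3 w4.
  by apply/matrixP => u v; rewrite !mxE; ring.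
rewrite !brH // mulNmx mulmxN opprK -scalemxAl -scalemxAr !mxtraceZ rho1 mul1r => h.
rewrite leNgt; apply/negP => neg; have : E + E^T = 0.
  apply: mxtrace_tr_gt0; rewrite linearD /= trmxK [E^T + E]addrC.
  by rewrite -(nmulr_rge0 _ neg).
(* If the simple root were negative at X', then E would be antisymmetric; transposing [rho, E] = E
   gives E = -E, against E nonzero. *)
move=> /eqP; rewrite addr_eq0 => /eqP EE.
have ET : E^T = - E by rewrite [in RHS]EE opprK.
have e1 : rho *m E - E *m rho = E by rewrite (Ew rho ar) rho1 scale1r.
have := congr1 trmx e1; rewrite linearB /= !trmx_mul rT ET mulNmx mulmxN opprK addrC e1.
move=> /eqP; rewrite -addr_eq0 -mulr2n -scaler_nat scaler_eq0 pnatr_eq0 /= => /eqP.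
by move/eqP: E0.
Qed.

Theorem cartan_decomposition g : G g ->
  exists k l H, [/\ orthG k, orthG l, dominant H & g = k *m mxexp H *m l].
Proof.
move=> Gg; have [u [X [XT gX Gu uu gE]]] := polar grp (cd_tr cd) (cd_pow cd) Gg.
have [k ok dH] := sym_conj_dominant gX XT.
exists (u *m k^T), k, (k *m X *m k^T); split=> //; first by apply: orthGM => //; apply: orthG_tr.
have uk : k \in unitmx by case: ok => _ /mulmx1_unit[].
rewrite gE -(orth_invmx ok) mxexp_conj // !mulmxA mulmxKV //.
by rewrite mulmxKV.
Qed.

Lemma sym_exp_inj X Y : X^T = X -> Y^T = Y -> mxexp X = mxexp Y -> X = Y.
Proof.
move=> /sym_dconj[Q uQ [h XE]] /sym_dconj[Q' uQ' [h' YE]]; rewrite XE YE !mxexp_dconj // => E.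
pose W := Q *m invmx Q'.
have EW : W *m diag_mx (\row_i expR (h' 0 i)) = diag_mx (\row_i expR (h 0 i)) *m W.
  have := congr1 (fun M => Q *m M *m invmx Q') E.
  by rewrite !mulmxA mulmxV // mul1mx mulmxK // /W !mulmxA => <-.
have E2 := intertwine_log EW.
have := congr1 (fun M => invmx Q *m M *m Q') E2.
by rewrite /W !mulmxA mulVmx // mul1mx mulmxKV // => <-.
Qed.

(** Passing to exp(2H') = exp(H') exp(H')^T eliminates l, and the exponential is injective on
    symmetric matrices. *)
Lemma cartan_conj H H' (k l : 'M[R]_n) : lie A H -> lie A H' -> orthG k -> orthG l ->
  mxexp H' = k *m mxexp H *m l -> H' = k *m H *m k^T.
Proof.
move=> aH aH' ok ol E; have HT := cd_Asym cd aH; have HT' := cd_Asym cd aH'.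
have [_ kk] := ok; have [_ ll] := ol.
have uk : k \in unitmx by case: (mulmx1_unit kk).
suff h : 2%:R *: H' = k *m (2%:R *: H) *m k^T.
  by apply: (can_inj (scalerK (_ : 2%:R != 0 :> R))); rewrite ?pnatr_eq0 // h -scalemxAr -scalemxAl.
apply: sym_exp_inj; first by rewrite linearZ /= HT'.
  by rewrite sym_conj // linearZ /= HT.
rewrite -(orth_invmx ok) mxexp_conj // (orth_invmx ok) !mxexp_mulrn // !expr2.
have -> : mxexp H' * mxexp H' = mxexp H' *m (mxexp H')^T by rewrite -mxexp_tr HT'.
rewrite {1}E {1}E !trmx_mul -mxexp_tr HT !mulmxA -(mulmxA _ l) ll mulmx1.
by rewrite -!mulmxA.
Qed.

(** By dimension: conjugation by w^T is injective on the finite-dimensional space a, so if it maps a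
    into itself it maps a onto itself. *)
Lemma subspace_conj_eq w : orthG w ->
  (forall H, lie A H -> lie A (w^T *m H *m w)) -> forall H, lie A H -> lie A (w *m H *m w^T).
Proof.
move=> ow hw.
have [k [X [ZX Xspan]]] := rank_set (fun v : 'rV[R]_(n * n) => lie A (vec_mx v)).
have ww : w *m w^T = 1%:M by case: ow.
have wtw := orth_inv ow.
pose F (M : 'M[R]_n) := w^T *m M *m w.
have sub v : (v <= X)%MS -> lie A (vec_mx v).
  move=> /submxP[u ->]; rewrite mulmx_sum_row linear_sum.
  by apply: lie_sum => // i _; rewrite linearZ /=; apply: lieZ; apply: ZX.
pose Y := \matrix_i (mxvec (F (vec_mx (row i X)))) : 'M[R]_(k, n * n).
have YX : (Y <= X)%MS.
  apply/row_subP => i; rewrite rowK; apply: Xspan; rewrite mxvecK; apply: hw; exact: ZX.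
have Ysub v : (v <= Y)%MS -> exists2 z, (z <= X)%MS & v = mxvec (F (vec_mx z)).
  move=> /submxP[u ->]; exists (u *m X); first exact: submxMl.
  rewrite !mulmx_sum_row /F linear_sum mulmx_sumr mulmx_suml linear_sum.
  by apply: eq_bigr => i _; rewrite rowK !linearZ /= -scalemxAl linearZ.
have XY : (X <= Y)%MS.
  pose f : {linear 'rV[R]_(n * n) -> 'rV[R]_(n * n)} := mxvec \o (mulmxr w^T \o mulmx w) \o vec_mx.
  have XE : X = \matrix_i f (row i Y).
    apply/row_matrixP => i; rewrite rowK rowK /f /= mxvecK /F.
    by rewrite !mulmxA ww mul1mx -mulmxA ww mulmx1 vec_mxK.
  have := rank_linear_rows f Y; rewrite -XE => rk.
  by rewrite -(mxrank_leqif_sup YX) eqn_leq rk mxrankS.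
move=> H aH; have : (mxvec H <= Y)%MS.
  by apply: submx_trans XY; apply: Xspan; rewrite mxvecK.
move=> /Ysub[z /sub az] /(congr1 vec_mx); rewrite !mxvecK => ->.
by rewrite /F !mulmxA ww mul1mx -mulmxA ww mulmx1.
Qed.

(** Already k H k^T = H', but k need not normalise a. A correction c centralising H' is chosen so
    that c k rho k^T c^T is critical against rho; it then lies in a, and w = c k normalises a
    because strict elements detect a. *)
Theorem weyl_element H H' (k l : 'M[R]_n) : lie A H -> lie A H' -> orthG k -> orthG l ->
  mxexp H' = k *m mxexp H *m l ->
  exists w, [/\ orthG w, (forall X, lie A X -> lie A (w *m X *m w^T)),
     (forall X, lie A X -> lie A (w^T *m X *m w)) & w *m H *m w^T = H'].
Proof.
move=> aH aH' ok ol E; have HE := cartan_conj aH aH' ok ol E.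
have [rho ar rho1] := exists_rho.
have sr : strict rho by split=> // i; rewrite rho1.
have rT := cd_Asym cd ar; have HT' := cd_Asym cd aH'.
pose Z c := orthG c /\ c *m H' = H' *m c.
have Zcl : nclosed Z.
  apply: nclosedI; first exact: nclosed_orthG.
  by apply: nclosed_eqmx; apply: mpalg_mul; (exact: mpalg_id || exact: mpalg_const).
have Z1 : Z 1%:M by split; [exact: orthG1|rewrite mul1mx mulmx1].
pose X0 := k *m rho *m k^T.
have gX0 : lie G X0 by apply: lie_orth_conj => //; apply: lieAG.
have X0T : X0^T = X0 by apply: sym_conj.
have [c [oc cH] cmax] := maximiser Zcl Z1 (fun c h => h.1)
  (fun c Y Zc gY YT ZY t => conj (orthGM (ZY t).1 Zc.1)
    (etrans (esym (mulmxA _ _ _)) (etrans (congr1 (mulmx _) Zc.2)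
      (etrans (mulmxA _ _ _) (etrans (congr1 (mulmx^~ c) (ZY t).2) (esym (mulmxA _ _ _)))))))
  gX0 X0T ar.
set X' := c *m X0 *m c^T in cmax.
have gX' : lie G X' by apply: lie_orth_conj.
have X'T : X'^T = X' by apply: sym_conj.
have cc := oc.2; have kk := ok.2; have ctc := orth_inv oc; have ktk := orth_inv ok.
have cH' : c *m H' *m c^T = H' by rewrite cH -mulmxA cc mulmx1.
have rH := pdiag_comm uP (Adiag ar) (Adiag aH).
have conjM (d M N : 'M[R]_n) : d^T *m d = 1%:M -> (d *m M *m d^T) *m (d *m N *m d^T) = d *m (M *m N) *m d^T.
  by move=> dd; rewrite !mulmxA -(mulmxA _ d^T) dd mulmx1.
have X'H : X' *m H' = H' *m X'.
  rewrite -cH' /X' !conjM //; congr (_ *m _ *m _); rewrite /X0 HE !conjM //.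
  by rewrite rH.
have aX' : lie A X'.
  apply: (strict_critical sr) => //.
  have gY : lie G (lbr X' rho) by apply: lie_bracket => //; apply: lieAG.
  have YT := lbr_sym X'T rT.
  have rH' := pdiag_comm uP (Adiag ar) (Adiag aH').
  (* The test direction commutes with H', so its one-parameter group stays in the centraliser over
     which c is optimal. *)
  have YH : lbr X' rho *m H' = H' *m lbr X' rho.
    rewrite /lbr mulmxBl mulmxBr; congr (_ - _).
      by rewrite -(mulmxA X') rH' (mulmxA X') X'H -(mulmxA H').
    by rewrite -(mulmxA rho) X'H (mulmxA rho) rH' -(mulmxA H').
  have ZY t : Z (mxexp (t *: lbr X' rho)).
    split; first by apply: orth_exp; [exact: lieZ|rewrite linearZ /= YT scalerN].
    apply: (@exp_closed _ _ (fun M => M *m H' = H' *m M)).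
      by apply: nclosed_eqmx; apply: mpalg_mul; (exact: mpalg_id || exact: mpalg_const).
    move=> N; rewrite /eS mulmx_suml mulmx_sumr; apply: eq_bigr => i _.
    rewrite -scalemxAl -scalemxAr; congr (_ *: _); elim: i => [|i IH].
      by rewrite expr0 mul1mx mulmx1.
    rewrite exprSr -[_ * _]/(_ *m _) -mulmxA -scalemxAl YH scalemxAr mulmxA IH.
    by rewrite -!mulmxA.
  by case: (cmax _ gY YT ZY).
have ow : orthG (c *m k) by apply: orthGM.
have down X : lie A X -> lie A ((c *m k)^T *m X *m (c *m k)).
  move=> aX; have XT := cd_Asym cd aX.
  have owT := orthG_tr ow.
  have gW := lie_orth_conj owT (lieAG aX); have WT := sym_conj (c *m k)^T XT.
  rewrite trmxK in gW WT; apply: (commute_strict gW WT sr).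
  (* w^T X w commutes with rho = w^T X' w, since X and X' both lie in the abelian a. *)
  have rE : rho = (c *m k)^T *m X' *m (c *m k).
    have -> : X' = (c *m k) *m rho *m (c *m k)^T by rewrite /X' /X0 trmx_mul !mulmxA.
    by move: (c *m k) (orth_inv ow) => d dd; rewrite !mulmxA dd mul1mx -mulmxA dd mulmx1.
  rewrite /lbr rE; have := conjM (c *m k)^T; rewrite trmxK => cM.
  rewrite !cM ?(ow.2) //; rewrite (pdiag_comm uP (Adiag aX) (Adiag aX')).
  exact: subrr.
exists (c *m k); split; [exact: ow|exact: (subspace_conj_eq ow down)|exact: down|].
transitivity (c *m (k *m H *m k^T) *m c^T); first by rewrite trmx_mul !mulmxA.
by rewrite -HE.
Qed.

End Cartan.

(** * Complex points and the open cell *)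

Section RealForm.
Variables (R : realType) (n : nat).
Local Notation C := (complex R).
Local Notation toC := (map_mx (@real_complex R)).
Local Notation Rem := (map_mx (@complex.Re R)).
Local Notation Imm := (map_mx (@complex.Im R)).

(* [jc] identifies complex n x n matrices with real 2n x 2n matrices, with left inverse [cz]. *)
Definition jm (A B : 'M[R]_n) : 'M[R]_(n + n) := block_mx A (- B) B A.
Definition jc (g : 'M[C]_n) : 'M[R]_(n + n) := jm (Rem g) (Imm g).
Definition cz (z : 'M[R]_(n + n)) : 'M[C]_n :=
  \matrix_(i, j) Complex (ulsubmx z i j) (dlsubmx z i j).

Lemma Re_cz z : Rem (cz z) = ulsubmx z. Proof. by apply/matrixP => i j; rewrite !mxE. Qed.
Lemma Im_cz z : Imm (cz z) = dlsubmx z. Proof. by apply/matrixP => i j; rewrite !mxE. Qed.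
Lemma jcK g : cz (jc g) = g.
Proof.
apply/matrixP => i j; rewrite mxE /jc /jm block_mxKul block_mxKdl !mxE.
by case: (g i j).
Qed.
Lemma ReM (g h : 'M[C]_n) : Rem (g *m h) = Rem g *m Rem h - Imm g *m Imm h.
Proof.
apply/matrixP => i j; rewrite !mxE raddf_sum -sumrB; apply: eq_bigr => k _; rewrite !mxE.
by case: (g i k) (h k j) => a b [c d].
Qed.
Lemma ImM (g h : 'M[C]_n) : Imm (g *m h) = Rem g *m Imm h + Imm g *m Rem h.
Proof.
apply/matrixP => i j; rewrite !mxE raddf_sum -big_split; apply: eq_bigr => k _; rewrite !mxE.
by case: (g i k) (h k j) => a b [c d].
Qed.
Lemma jcM g h : jc (g *m h) = jc g *m jc h.
Proof.
rewrite /jc /jm mulmx_block ReM ImM !mulNmx !mulmxN; congr (block_mx _ _ _ _); last by rewrite addrC.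
  by rewrite opprD addrC.
by rewrite addrC.
Qed.
Lemma jc1 : jc 1%:M = 1%:M.
Proof.
rewrite /jc /jm -[RHS]submxK; have -> : Rem (1%:M : 'M[C]_n) = 1%:M.
  by apply/matrixP => i j; rewrite !mxE; case: eqP.
have -> : Imm (1%:M : 'M[C]_n) = 0 by apply/matrixP => i j; rewrite !mxE; case: eqP.
by rewrite oppr0 -scalar_mx_block submxK.
Qed.
Lemma jcB g h : jc (g - h) = jc g - jc h.
Proof.
rewrite /jc /jm opp_block_mx add_block_mx; congr (block_mx _ _ _ _); apply/matrixP => i j; rewrite !mxE ?raddfB //=.
Qed.
Lemma jcD g h : jc (g + h) = jc g + jc h.
Proof.
rewrite /jc /jm add_block_mx; congr (block_mx _ _ _ _); apply/matrixP => i j; rewrite !mxE ?raddfD //=.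
Qed.
Lemma jc0 : jc 0 = 0. Proof. by rewrite -(subrr (0 : 'M[C]_n)) jcB subrr. Qed.
Lemma jc_sum I (s : seq I) (F : I -> 'M[C]_n) : jc (\sum_(i <- s) F i) = \sum_(i <- s) jc (F i).
Proof. by elim: s => [|i s IH]; rewrite ?big_nil ?jc0 // !big_cons jcD IH. Qed.
Lemma jcZ (c : R) g : jc (real_complex R c *: g) = c *: jc g.
Proof.
rewrite /jc /jm scale_block_mx; congr (block_mx _ _ _ _); apply/matrixP => i j; rewrite !mxE;
case: (g i j) => a b /=; by rewrite ?mul0r ?subr0 ?addr0 ?mulrN.
Qed.
Lemma jc_exp g k : jc (g ^+ k) = jc g ^+ k.
Proof.
elim: k => [|k IH]; first by rewrite !expr0 jc1.
by rewrite !exprSr -[_ * g]/(_ *m g) jcM IH.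
Qed.
Lemma jcV g : g \in unitmx -> jc g \in unitmx /\ invmx (jc g) = jc (invmx g).
Proof.
move=> ug; have e : jc g *m jc (invmx g) = 1%:M by rewrite -jcM mulmxV // jc1.
have [u1 _] := mulmx1_unit e; split=> //.
by rewrite -[RHS](mulKmx u1) e mulmx1.
Qed.
Lemma jc_real (X : 'M[R]_n) : jc (toC X) = jm X 0.
Proof. by rewrite /jc; congr (jm _ _); apply/matrixP => i j; rewrite !mxE. Qed.
Lemma jc_tr g : (jc g)^T = jc (map_mx (@complex.conjc R) g)^T.
Proof.
rewrite /jc /jm tr_block_mx; congr (block_mx _ _ _ _); apply/matrixP => i j; rewrite !mxE //=; case: (g j i) => //= a b; by rewrite opprK.
Qed.

Lemma nrm_jc (g : 'M[C]_n) i j : `|complex.Re (g i j)| <= nrm (jc g) /\ `|complex.Im (g i j)| <= nrm (jc g).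
Proof.
split.
  have := le_nrm (jc g) (lshift n i) (lshift n j).
  by rewrite /jc /jm block_mxEul mxE.
have := le_nrm (jc g) (rshift n i) (lshift n j).
by rewrite /jc /jm block_mxEdl mxE.
Qed.

Lemma nrm_jc_le (g : 'M[C]_n) e : (forall i j, `|complex.Re (g i j)| <= e /\ `|complex.Im (g i j)| <= e) ->
  nrm (jc g) <= (n + n)%:R * (n + n)%:R * e.
Proof.
move=> h; apply: (@le_trans _ _ (\sum_(i < n + n) \sum_(j < n + n) e)).
  apply: ler_sum => i _; apply: ler_sum => j _; rewrite /jc /jm.
  case: (splitP i) => i' hi; [have -> : i = lshift n i' by apply: val_inj|have -> : i = rshift n i' by apply: val_inj];
  case: (splitP j) => j' hj; [have -> : j = lshift n j' by apply: val_inj|have -> : j = rshift n j' by apply: val_inj|have -> : j = lshift n j' by apply: val_inj|have -> : j = rshift n j' by apply: val_inj];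
  rewrite ?block_mxEul ?block_mxEur ?block_mxEdl ?block_mxEdr ?mxE ?normrN ?mxE; by case: (h i' j').
rewrite !sumr_const !card_ord -mulrnA -[_ *+ _]mulr_natl natrM //.
Qed.

Lemma palg_ReIm (I X : Type) (x : I -> X -> R) (f : 'M[C]_n -> C) (M : X -> 'M[C]_n) :
  palg (@mxcoord C n) f ->
  (forall i j, palg x (fun y => complex.Re (M y i j)) /\ palg x (fun y => complex.Im (M y i j))) ->
  palg x (fun y => complex.Re (f (M y))) /\ palg x (fun y => complex.Im (f (M y))).
Proof.
move=> hf hM; elim: hf => [c|[i j]|f1 f2 _ [h1 h2] _ [h3 h4]|f1 f2 _ [h1 h2] _ [h3 h4]].
- by split; apply: palg_const.
- exact: hM.
- split; [apply: palg_ext (palg_add h1 h3) => y|apply: palg_ext (palg_add h2 h4) => y];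
  by rewrite raddfD.
- split; [apply: palg_ext (palg_sub (palg_mul h1 h3) (palg_mul h2 h4)) => y|
          apply: palg_ext (palg_add (palg_mul h1 h4) (palg_mul h2 h3)) => y];
  by case: (f1 (M y)) (f2 (M y)) => a b [c d].
Qed.

Variables (K : rcfType) (iR : {rmorphism K -> R}) (G : seq (mxpol K n)).
Hypothesis G_grp : is_mxgroup (geom G).
Hypothesis G_tr : forall g, geom G g -> geom G g^T.

(** The complex group as a closed group of real matrices, to which the real theory of exponentials,
    tangent vectors and polar decomposition applies verbatim. *)
Definition Gam (z : 'M[R]_(n + n)) := points (cio iR) G (cz z) /\ z = jc (cz z).

Lemma Gam_jc g : Gam (jc g) <-> points (cio iR) G g.
Proof. by rewrite /Gam jcK; split=> [[]|]. Qed.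

Lemma Gam_group : is_mxgroup Gam.
Proof.
have [GU G1 GM GV] := cgroup G_grp iR; split.
- by move=> z [Gz ->]; apply: (jcV (GU _ Gz)).1.
- by rewrite -jc1; apply/Gam_jc.
- by move=> z w [Gz ->] [Gw ->]; rewrite -jcM; apply/Gam_jc; apply: GM.
- by move=> z [Gz ->]; rewrite (jcV (GU _ Gz)).2; apply/Gam_jc; apply: GV.
Qed.

Lemma Gam_tr z : Gam z -> Gam z^T.
Proof.
move=> [Gz ->]; rewrite jc_tr; apply/Gam_jc.
by apply: (cpoints_tr G_tr); apply: cpoints_conj.
Qed.

Lemma mpalg_sub_id (p q : 'I_n -> 'I_(n + n)) i j :
  palg (@mxcoord R (n + n)) (fun z => z (p i) (q j)).
Proof. exact: mpalg_id. Qed.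

Lemma nclosed_jc : nclosed (fun z => z = jc (cz z)).
Proof.
apply: nclosed_eqmx; first exact: mpalg_id.
move=> i j; rewrite /jc /jm.
case: (splitP i) => i' hi; [have -> : i = lshift n i' by apply: val_inj|have -> : i = rshift n i' by apply: val_inj];
case: (splitP j) => j' hj; [have -> : j = lshift n j' by apply: val_inj|have -> : j = rshift n j' by apply: val_inj|have -> : j = lshift n j' by apply: val_inj|have -> : j = rshift n j' by apply: val_inj].
- by apply: palg_ext (mpalg_sub_id (lshift n) (lshift n) i' j') => z; rewrite block_mxEul !mxE.
- by apply: palg_ext (palg_opp (mpalg_sub_id (@rshift n n) (lshift n) i' j')) => z; rewrite block_mxEur !mxE.
- by apply: palg_ext (mpalg_sub_id (@rshift n n) (lshift n) i' j') => z; rewrite block_mxEdl !mxE.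
- by apply: palg_ext (mpalg_sub_id (lshift n) (lshift n) i' j') => z; rewrite block_mxEdr !mxE.
Qed.

Lemma Gam_closed : nclosed Gam.
Proof.
apply: nclosedI nclosed_jc.
have h p : palg (@mxcoord R (n + n)) (fun z => complex.Re (mxeval (cio iR) p (cz z))) /\
           palg (@mxcoord R (n + n)) (fun z => complex.Im (mxeval (cio iR) p (cz z))).
  apply: (@palg_ReIm _ _ _ (mxeval (cio iR) p) cz).
    by apply: palg_mxeval; apply: mpalg_id.
  move=> i j; split.
    by apply: palg_ext (mpalg_sub_id (lshift n) (lshift n) i j) => z; rewrite !mxE.
  by apply: palg_ext (mpalg_sub_id (@rshift n n) (lshift n) i j) => z; rewrite !mxE.
have c1 := @nclosed_palg R (n + n) {p | p \in G} _ (fun p => (h (sval p)).1).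
have c2 := @nclosed_palg R (n + n) {p | p \in G} _ (fun p => (h (sval p)).2).
move=> z hz p pG.
suff [e1 e2] : complex.Re (mxeval (cio iR) p (cz z)) = 0 /\ complex.Im (mxeval (cio iR) p (cz z)) = 0.
  by move: e1 e2; case: (mxeval _ _ _) => a b /= -> ->.
split.
  apply: (c1 z _ (exist _ p pG)) => e e0; have [y Gy yz] := hz e e0; exists y => // -[q qG] /=.
  by rewrite (Gy q qG).
apply: (c2 z _ (exist _ p pG)) => e e0; have [y Gy yz] := hz e e0; exists y => // -[q qG] /=.
by rewrite (Gy q qG).
Qed.

(** Both membership conditions, the equations of G and the block shape, are polynomial along
    exp(tX), so they pass from natural t to all real t. *)
Lemma Gam_powclosed : powclosed Gam.
Proof.
move=> X /sym_dconj[Q uQ [h ->]] GX t.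
have GXk (k : nat) : Gam (mxexp (k%:R *: (invmx Q *m diag_mx h *m Q))).
  by rewrite mxexp_nat_dconj //; apply: group_exp => //; apply: Gam_group.
pose Z (v : 'rV[C]_(n + n)) := toC (invmx Q) *m diag_mx v *m (toC Q)^T^T.
have ZE s : Z (\row_i (real_complex R (expR (s * h 0 i)))) = toC (mxexp (s *: (invmx Q *m diag_mx h *m Q))).
  rewrite scale_dconj mxexp_dconj // /Z trmxK !map_mxM map_diag_mx; congr (_ *m diag_mx _ *m _).
  by apply/rowP => i; rewrite !mxE.
have Zp : mpalg (@rvcoord C (n + n)) Z by apply: mpalg_diag.
have lift (f : 'M[C]_(n + n) -> C) :
    palg (@rvcoord C (n + n)) (fun v => f (Z v)) ->
    (forall k : nat, f (toC (mxexp (k%:R *: (invmx Q *m diag_mx h *m Q)))) = 0) ->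
    f (toC (mxexp (t *: (invmx Q *m diag_mx h *m Q)))) = 0.
  move=> hf fk; rewrite -ZE; apply: (@palg_exp_real R _ (@real_complex R) _ (fun v => f (Z v)) h hf).
  by move=> k; rewrite ZE.
(* [cz] takes real parts implicitly and is not polynomial in a complex argument; [cc] is complex
   linear and coincides with [cz] on real matrices. *)
pose cc (Y : 'M[C]_(n + n)) := ulsubmx Y + Complex 0 1 *: dlsubmx Y : 'M[C]_n.
have ccE z : cc (toC z) = cz z.
  have E (a b : R) : real_complex R a + Complex 0 1 * real_complex R b = Complex a b.
    by apply/eqP; rewrite complex.eq_complex /= !(mul0r, mulr0, mul1r, subr0, addr0, add0r) !eqxx.
  by apply/matrixP => i j; rewrite !mxE E.
split.
  move=> p pG; rewrite -ccE; apply: (lift (fun Y => mxeval (cio iR) p (cc Y))) => //.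
    apply: palg_mxeval => i j.
    apply: palg_ext (palg_add (Zp (lshift n i) (lshift n j)) (palg_mul (palg_const _ (Complex 0 1)) (Zp (rshift n i) (lshift n j)))) => v.
    by rewrite !mxE.
  by move=> k; rewrite ccE; case: (GXk k) => /(_ p pG).
set z := mxexp (t *: _).
have e1 i j : z (rshift n i) (rshift n j) = z (lshift n i) (lshift n j).
  apply/eqP; rewrite -subr_eq0; apply/eqP; apply: (@complex.complexI R); rewrite rmorphB rmorph0.
  have := lift (fun Y => Y (rshift n i) (rshift n j) - Y (lshift n i) (lshift n j)).
  rewrite -/z !mxE; apply; first exact: palg_sub.
  move=> k; case: (GXk k) => _ ->; rewrite [X in X - _]mxE [X in _ - X]mxE /jc /jm.
  by rewrite block_mxEdr block_mxEul subrr.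
have e2 i j : z (lshift n i) (rshift n j) = - z (rshift n i) (lshift n j).
  apply/eqP; rewrite -addr_eq0; apply/eqP; apply: (@complex.complexI R); rewrite rmorphD rmorph0.
  have := lift (fun Y => Y (lshift n i) (rshift n j) + Y (rshift n i) (lshift n j)).
  rewrite -/z !mxE; apply; first exact: palg_add.
  move=> k; case: (GXk k) => _ ->; rewrite [X in X + _]mxE [X in _ + X]mxE /jc /jm.
  by rewrite block_mxEur block_mxEdl [X in real_complex R X + _]mxE -rmorphD addNr rmorph0.
rewrite -[LHS]submxK /jc /jm Re_cz Im_cz; congr (block_mx _ _ _ _); apply/matrixP => i j; by rewrite !mxE.
Qed.

End RealForm.

Section Pattern.
Variables (F : fieldType).

(** For a reflexive and transitive r these matrices form an algebra containing the inverses of its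
    invertible members, as with block triangular matrices. *)
Definition pattern n (r : rel 'I_n) (M : 'M[F]_n) := forall i j, M i j != 0 -> r i j.

Lemma patternM n (r : rel 'I_n) (M N : 'M[F]_n) : transitive r ->
  pattern r M -> pattern r N -> pattern r (M *m N).
Proof.
move=> rt hM hN i j; rewrite mxE; apply: contraNT => nr; rewrite big1 // => k _.
have [->|/hM ik] := eqVneq (M i k) 0; first by rewrite mul0r.
have [->|/hN kj] := eqVneq (N k j) 0; first by rewrite mulr0.
by rewrite (rt _ _ _ ik kj) in nr.
Qed.

Lemma patternD n (r : rel 'I_n) (M N : 'M[F]_n) : pattern r M -> pattern r N -> pattern r (M + N).
Proof.
move=> hM hN i j; rewrite mxE => h; have [M0|/hM //] := eqVneq (M i j) 0.
by apply: hN; rewrite M0 add0r in h.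
Qed.

Lemma patternZ n (r : rel 'I_n) c (M : 'M[F]_n) : pattern r M -> pattern r (c *: M).
Proof. by move=> hM i j; rewrite mxE mulf_eq0 negb_or => /andP[_ /hM]. Qed.

Lemma pattern_scalar n (r : rel 'I_n) c : reflexive r -> pattern r (c%:M : 'M[F]_n).
Proof.
move=> rr i j; rewrite mxE; have [->|ij] := eqVneq i j; first by rewrite rr.
by rewrite mulr0n eqxx.
Qed.

(* By Cayley-Hamilton, the inverse is a polynomial in the matrix. *)
Lemma pattern_inv n (r : rel 'I_n) (M : 'M[F]_n) : reflexive r -> transitive r -> M \in unitmx ->
  pattern r M -> pattern r (invmx M).
Proof.
move=> rr rt; case: n r M rr rt => [|n] r M rr rt uM hM; first by case.
have hq (q : {poly F}) : pattern r (horner_mx M q).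
  elim/poly_ind: q => [|q c IH]; first by rewrite rmorph0 => i j; rewrite mxE eqxx.
  rewrite rmorphD rmorphM /= horner_mx_X horner_mx_C.
  by apply: patternD; [apply: patternM|apply: pattern_scalar].
set p := char_poly M; pose q := drop_poly 1 p; pose c := p`_0.
have c0 : c != 0.
  by rewrite /c /p char_poly_det mulf_eq0 signr_eq0 /= -unitfE -unitmxE.
have pE : p = q * 'X + c%:P.
  rewrite -[LHS](poly_take_drop 1) addrC expr1; congr (_ + _).
  by apply/polyP => i; rewrite coef_take_poly coefC; case: i.
have := Cayley_Hamilton M; rewrite -/p pE rmorphD rmorphM /= horner_mx_X horner_mx_C => E.
have -> : invmx M = - c^-1 *: horner_mx M q.
  apply: (can_inj (mulmxK uM)); rewrite mulVmx // -scalemxAl.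
  have -> : horner_mx M q *m M = - c%:M by apply/eqP; rewrite -addr_eq0; apply/eqP.
  by rewrite scaleNr scalerN opprK scale_scalar_mx mulVf.
exact: patternZ.
Qed.

End Pattern.

Section Half.
Variables (R : realType) (n : nat).
Implicit Types (A B X : 'M[R]_n).

Lemma unsplit_split (k : 'I_(n + n)) : unsplit (fintype.split k) = k.
Proof. by apply: val_inj; case: splitP. Qed.

Definition idx (k : 'I_(n + n)) : 'I_n := match fintype.split k with inl i => i | inr i => i end.
Lemma idxl i : idx (lshift n i) = i. Proof. by rewrite /idx (unsplitK (inl i)). Qed.
Lemma idxr i : idx (rshift n i) = i. Proof. by rewrite /idx (unsplitK (inr i)). Qed.

Lemma jmM A B A' B' : jm A B *m jm A' B' = jm (A *m A' - B *m B') (A *m B' + B *m A').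
Proof.
rewrite /jm mulmx_block !mulNmx !mulmxN; congr (block_mx _ _ _ _); last by rewrite addrC.
  by rewrite opprD addrC addrC.
by rewrite addrC.
Qed.
Lemma jm1 : jm 1%:M 0 = 1%:M :> 'M[R]_(n + n).
Proof. by rewrite /jm oppr0 -scalar_mx_block. Qed.
Lemma jmD A B A' B' : jm A B + jm A' B' = jm (A + A') (B + B').
Proof. by rewrite /jm add_block_mx opprD. Qed.
Lemma jmZ c A B : c *: jm A B = jm (c *: A) (c *: B).
Proof. by rewrite /jm scale_block_mx scalerN. Qed.
Lemma jmE A B k l : jm A B k l =
  match fintype.split k, fintype.split l with
  | inl i, inl j => A i j | inl i, inr j => - B i j | inr i, inl j => B i j | inr i, inr j => A i j end.
Proof.
rewrite -{1}(unsplit_split k) -{1}(unsplit_split l) /jm; case: (fintype.split k) => i; case: (fintype.split l) => j /=;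
by rewrite ?block_mxEul ?block_mxEur ?block_mxEdl ?block_mxEdr ?mxE.
Qed.
Lemma jc_czE (z : 'M[R]_(n + n)) : z = jc (cz z) -> z = jm (ulsubmx z) (dlsubmx z).
Proof. by move=> {1}->; rewrite /jc Re_cz Im_cz. Qed.

Lemma mxexp_jm X : mxexp (jm X 0) = jm (mxexp X) 0.
Proof.
apply: (@mxexp_limit _ _ _ _ X _ ((n + n)%:R * (n + n)%:R)) => N.
have -> : eS (jm X 0) N = jm (eS X N) 0.
  rewrite /eS; elim: N => [|N IH]; first by rewrite !big_geq // /jm oppr0 block_mx0.
  rewrite !big_nat_recr //= IH; set Y := \sum_(_ <= _ < _) _.
  have -> : jm X 0 ^+ N = jm (X ^+ N) 0.
    elim: N {IH Y} => [|N IH]; first by rewrite !expr0; exact: esym jm1.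
    by rewrite !exprSr IH -[_ * _]/(_ *m _) jmM !mul0mx mulmx0 subr0 addr0.
  by rewrite jmZ scaler0 jmD addr0.
have -> : jm (eS X N) 0 - jm (mxexp X) 0 = jc (map_mx (@real_complex R) (eS X N - mxexp X)).
  by rewrite jc_real -scaleN1r jmZ scaler0 jmD addr0 scaleN1r.
apply: nrm_jc_le => i j; rewrite !mxE /= normr0 nrm_ge0; split=> //.
by have := le_nrm (eS X N - mxexp X) i j; rewrite !mxE.
Qed.

End Half.

Lemma map_mx_pow (F F' : pzRingType) (f : {rmorphism F -> F'}) n (M : 'M[F]_n) k :
  map_mx f (M ^+ k) = map_mx f M ^+ k.
Proof.
elim: k => [|k IH]; first by rewrite !expr0; exact: map_mx1.
by rewrite !exprSr -[M ^+ k * M]/(M ^+ k *m M) map_mxM IH.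
Qed.

Lemma palg_poly (C : comNzRingType) (f : C -> C) : palg (fun _ : unit => id) f ->
  exists q : {poly C}, forall z, f z = q.[z].
Proof.
elim=> [c|[]|g g' _ [q qE] _ [q' qE']|g g' _ [q qE] _ [q' qE']].
- by exists c%:P => z; rewrite hornerC.
- by exists 'X => z; rewrite hornerX.
- by exists (q + q') => z; rewrite hornerD qE qE'.
- by exists (q * q') => z; rewrite hornerM qE qE'.
Qed.

(** * Real root vectors from the Lie algebra of the complex group *)

Section RootVectors.
Variables (R : realType) (n : nat) (K : rcfType) (iR : {rmorphism K -> R}) (G : seq (mxpol K n)).
Variables (A : set 'M[R]_n) (P : 'M[R]_n) (r : nat) (Delta : 'I_r -> {scalar 'M[R]_n}).
Hypothesis G_grp : is_mxgroup (geom G).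
Hypothesis G_tr : forall g, geom G g -> geom G g^T.
Hypothesis cd : cartan_data (points iR G) A P Delta.
Local Notation C := (complex R).
Local Notation toC := (map_mx (@real_complex R)).
Local Notation Gm := (Gam iR G).
Let uP := cd_uP cd.
Let Ggrp : is_mxgroup Gm := Gam_group iR G_grp.
Let Gcl : nclosed Gm := @Gam_closed _ _ _ iR G.

Definition PP : 'M[R]_(n + n) := jm P 0.
Lemma PP_unit : PP \in unitmx /\ invmx PP = jm (invmx P) 0.
Proof.
have e : PP *m jm (invmx P) 0 = 1%:M by rewrite jmM !mulmx0 !mul0mx subr0 addr0 mulmxV // jm1.
have [u _] := mulmx1_unit e; split=> //; by rewrite -[RHS](mulKmx u) e mulmx1.
Qed.
Lemma pc_jm X Y : pc PP (jm X Y) = jm (pc P X) (pc P Y).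
Proof. by rewrite /pc PP_unit.2 !jmM !(mulmx0, mul0mx, subr0, addr0, add0r). Qed.

Lemma lie_Gam_jc Z : lie Gm Z -> Z = jm (ulsubmx Z) (dlsubmx Z).
Proof.
move=> gZ; apply: jc_czE; apply: nclosed_jc => e e0.
have [d d0 hd] := fo_exp Z (divr_gt0 e0 (ltr0n R 2)).
pose t := d / 2; have t0 : 0 < t by rewrite divr_gt0.
have td : t < d by rewrite ltr_pdivrMr // ltr_pMr // ltr1n.
exists (t^-1 *: (mxexp (t *: Z) - 1%:M)).
  have [_ E] := gZ t; have := jc_czE E; set a := ulsubmx _; set b := dlsubmx _ => ->.
  rewrite -jm1 -scaleN1r jmZ jmD jmZ; set a' := _ *: (a + _); set b' := _ *: _.
  have -> : jm a' b' = jc (\matrix_(i, j) Complex (a' i j) (b' i j)).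
    by rewrite /jc; congr (jm _ _); apply/matrixP => i j; rewrite !mxE.
  by rewrite jcK.
have -> : t^-1 *: (mxexp (t *: Z) - 1%:M) - Z = t^-1 *: (mxexp (t *: Z) - 1%:M - t *: Z).
  by rewrite [in RHS]scalerBr scalerA mulVf ?scale1r // gt_eqF.
rewrite nrmZ gtr0_norm ?invr_gt0 // ltr_pdivrMl //; apply: le_lt_trans (hd t t0 td) _.
by rewrite mulrC ltr_pM2l // ltr_pdivrMr // ltr_pMr // ltr1n.
Qed.

Lemma lie_Gam_real X : lie Gm (jm X 0) <-> lie (points iR G) X.
Proof.
split=> h t; have := h t; rewrite ?jmZ ?scaler0 ?mxexp_jm.
  by rewrite -jc_real => /Gam_jc /points_real.
move=> Gt; rewrite -jc_real; apply/Gam_jc; exact/points_real.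
Qed.

(** On 2n x 2n matrices complex conjugation is conjugation by diag(1, -1), and the points of G are
    stable under it. *)
Lemma lie_Gam_conj X Y : lie Gm (jm X Y) -> lie Gm (jm X (- Y)).
Proof.
move=> h t; pose s : 'M[R]_(n + n) := block_mx 1%:M 0 0 (- 1%:M).
have ss : s *m s = 1%:M.
  by rewrite /s mulmx_block !(mulmx0, mul0mx, addr0, add0r) mulmx1 mulmxN mulNmx mulmx1 opprK -scalar_mx_block.
have [us _] := mulmx1_unit ss.
have sV : invmx s = s by rewrite -[RHS](mulKmx us) ss mulmx1.
have sj A' B' : s *m jm A' B' *m s = jm A' (- B').
  rewrite /s /jm !mulmx_block !(mulmx0, mul0mx, addr0, add0r, mul1mx, mulmx1, mulmxN, mulNmx, opprK).
  by [].
have -> : t *: jm X (- Y) = s *m (t *: jm X Y) *m invmx s.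
  by rewrite sV -scalemxAr -scalemxAl sj.
rewrite mxexp_conj // sV; have [Gg ->] := h t; set g := cz _ in Gg *.
have -> : s *m jc g *m s = jc (map_mx (@complex.conjc R) g).
  by rewrite /jc sj; congr (jm _ _); apply/matrixP => i j; rewrite !mxE; case: (g i j).
by apply/Gam_jc; apply: cpoints_conj.
Qed.

(* [exp (z W)] is a polynomial in [z] for nilpotent [W]; it lies in the algebraic group for all
   purely imaginary [z], hence for all [z]. *)
Lemma lie_Gam_nilpotent W m : W ^+ m = 0 -> lie Gm (jm 0 W) -> lie (points iR G) W.
Proof.
move=> Wm h.
have nil p (B : 'M[R]_p) N : B ^+ m = 0 -> (m <= N)%N -> eS B N = eS B m.
  move=> Bm /subnKC <-; elim: (N - m)%N => [|k IH]; first by rewrite addn0.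
  rewrite addnS /eS big_nat_recr //= -/(eS B (m + k)) IH exprD Bm.
  by rewrite -[0 * _]/(0 *m _) mul0mx scaler0 addr0.
have nilexp p (B : 'M[R]_p) : B ^+ m = 0 -> mxexp B = eS B m.
  move=> Bm; apply: mxexp_unique => e e0 N; exists (maxn m N); first exact: leq_maxr.
  by rewrite nil ?leq_maxl // subrr nrm0.
pose E (z : C) : 'M[C]_n := \sum_(0 <= k < m) (z ^+ k * (k`!%:R)^-1) *: toC (W ^+ k).
have Ejc (z : C) (X : 'M[R]_(n + n)) : X = jc (z *: toC W) -> mxexp X = jc (E z).
  move=> XE; have Xm : X ^+ m = 0.
    by rewrite XE -jc_exp mx_exprZn -map_mx_pow Wm map_mx0 scaler0 jc0.
  rewrite nilexp // /eS /E jc_sum; apply: eq_bigr => k _.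
  rewrite XE -jc_exp mx_exprZn -jcZ scalerA map_mx_pow; congr (jc (_ *: _)).
  by rewrite mulrC fmorphV rmorph_nat.
have Eim t p : p \in G -> mxeval (cio iR) p (E (Complex 0 t)) = 0.
  move=> pG; have := h t; rewrite (Ejc (Complex 0 t)) => [/Gam_jc /(_ p pG) //|].
  rewrite jmZ scaler0 /jc; congr (jm _ _); apply/matrixP => i j; rewrite !mxE /=.
    by rewrite mul0r mulr0 subr0.
  by rewrite mul0r add0r.
move=> t; apply/points_real => p pG.
have [q qE] : exists q : {poly C}, forall z, mxeval (cio iR) p (E z) = q.[z].
  apply: (@palg_poly C (fun z => mxeval (cio iR) p (E z))); apply: palg_mxeval => i j.
  apply: (@palg_ext _ _ _ _ (fun z => \sum_(0 <= k < m) z ^+ k * ((k`!%:R)^-1 * toC (W ^+ k) i j))).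
    by move=> z; rewrite /E summxE; apply: eq_bigr => k _; rewrite mxE mulrA.
  apply: palg_sum => k; apply: palg_mul; last exact: palg_const.
  by apply: palg_exp; apply: (palg_coord _ tt).
have q0 : q = 0.
  apply/eqP; apply: contraT => qn0.
  have := max_poly_roots (rs := [seq Complex 0 (i%:R : R) | i <- iota 0 (size q)]) qn0.
  rewrite size_map size_iota ltnn => -> //; first by apply/allP => _ /mapP[i _ ->]; apply/rootP; rewrite -qE Eim.
  by rewrite map_inj_uniq ?iota_uniq // => i j [] /eqP; rewrite eqr_nat => /eqP.
have -> : toC (mxexp (t *: W)) = E (real_complex R t).
  rewrite nilexp; last by rewrite mx_exprZn Wm scaler0.
  rewrite /eS /E raddf_sum; apply: eq_bigr => k _ /=.
  rewrite mx_exprZn scalerA map_mxZ; congr (_ *: _).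
  by rewrite rmorphM fmorphV rmorph_nat rmorphXn mulrC.
by rewrite qE q0 horner0.
Qed.

End RootVectors.

Lemma sum_inj_set (R : nmodType) p n (J : {set 'I_n}) (h : 'I_p -> 'I_n) (F : 'I_n -> R) :
  injective h -> (forall k, h k \in J) -> p = #|J| -> \sum_k F (h k) = \sum_(i in J) F i.
Proof.
move=> hi hJ pJ; have <- : [set h k | k in 'I_p] = J.
  apply/eqP; rewrite eqEcard card_imset // card_ord -pJ leqnn andbT.
  by apply/fintype.subsetP => _ /imsetP[k _ ->].
by rewrite big_imset //= => k l _ _ /hi.
Qed.

Lemma det_mxsub_mul (F : comNzRingType) p n (f c : 'I_p -> 'I_n) (M N : 'M[F]_n) :
  \det (mxsub f c (M *m N)) =
  \sum_(h : {ffun 'I_p -> 'I_n}) (\prod_k M (f k) (h k)) * \det (mxsub h c N).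
Proof.
transitivity (\sum_(s : 'S_p) \sum_(h : {ffun 'I_p -> 'I_n})
    (-1) ^+ s * (\prod_k (M (f k) (h k) * N (h k) (c (s k))))).
  apply: eq_bigr => s _; rewrite -big_distrr /=; congr (_ * _).
  rewrite -(bigA_distr_bigA (fun k j => M (f k) j * N j (c (s k)))) /=.
  by apply: eq_bigr => k _; rewrite !mxE.
rewrite exchange_big; apply: eq_bigr => h _; rewrite big_distrr /=.
apply: eq_bigr => s _; rewrite big_split /= mulrCA; congr (_ * (_ * _)).
by apply: eq_bigr => k _; rewrite mxE.
Qed.

Lemma mxB_entry (F : zmodType) p m (M N : 'M[F]_(p, m)) k l : (M - N) k l = M k l - N k l.
Proof. by rewrite !mxE. Qed.

Section OpenCell.
Variables (R : realType) (n : nat) (K : rcfType) (iR : {rmorphism K -> R}) (G : seq (mxpol K n)).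
Variables (A : set 'M[R]_n) (P : 'M[R]_n) (r : nat) (Delta : 'I_r -> {scalar 'M[R]_n}).
Hypothesis G_grp : is_mxgroup (geom G).
Hypothesis G_tr : forall g, geom G g -> geom G g^T.
Hypothesis cd : cartan_data (points iR G) A P Delta.
Local Notation C := (complex R).
Local Notation toC := (map_mx (@real_complex R)).
Local Notation Gm := (Gam iR G).
Local Notation PP := (PP P).
Let uP := cd_uP cd.
Let Ggrp : is_mxgroup Gm := Gam_group iR G_grp.
Let Gcl : nclosed Gm := @Gam_closed _ _ _ iR G.
Let uPP : PP \in unitmx := (PP_unit cd).1.
Variable rho : 'M[R]_n.
Hypothesis sr : strict A Delta rho.
Let ar : lie A rho := sr.1.

(** W^k moves the eigenvalues of rho by k w, while their differences stay bounded. *)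
Lemma weight_nilpotent W i j : wform P i j rho != 0 ->
  (forall k l, pc P W k l != 0 -> samew P (lie A) (i, j) (k, l)) -> exists m, W ^+ m = 0.
Proof.
set w := wform P i j rho => w0 Wsupp.
have pw k a b : pc P (W ^+ k) a b != 0 -> lam P a rho - lam P b rho = k%:R * w.
  elim: k a b => [|k IH] a b.
    rewrite expr0 mul0r /pc mulmx1 mulmxV // mxE; have [->|ab] := eqVneq a b; first by rewrite subrr.
    by rewrite mulr0n eqxx.
  rewrite exprSr -[W ^+ k * W]/(_ *m _) pcM // mxE => h.
  have [c [h1 h2]] : exists c, pc P (W ^+ k) a c != 0 /\ pc P W c b != 0.
    apply: contrapT => /forallNP h'; move: h; rewrite big1 ?eqxx // => c _.
    have [->|h1] := eqVneq (pc P (W ^+ k) a c) 0; first by rewrite mul0r.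
    have [->|h2] := eqVneq (pc P W c b) 0; first by rewrite mulr0.
    by case: (h' c).
  have := Wsupp _ _ h2 => /asboolP/(_ rho ar) /= E.
  by rewrite -[LHS](subrKA (lam P c rho)) (IH _ _ h1) -E -natr1 mulrDl mul1r.
pose B := \sum_a `|lam P a rho|.
exists (Num.truncn ((B + B) / `|w|)).+1; apply: (pc_inj uP); rewrite pc0; apply/matrixP => a b; rewrite [RHS]mxE.
apply/eqP; apply: contraT => /pw E.
have : `|lam P a rho - lam P b rho| <= B + B.
  apply: le_trans (ler_normB _ _) _; apply: lerD.
    by rewrite /B (bigD1 a) //= lerDl sumr_ge0.
  by rewrite /B (bigD1 b) //= lerDl sumr_ge0.
rewrite E normrM ger0_norm // -ler_pdivlMr ?normr_gt0 //.
by rewrite leNgt truncnS_gt.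
Qed.

(** Write Y = B + iW. The Lie algebra is stable under conjugation, so it contains B; if B = 0, the
    element iW is nilpotent by its weight, and nilpotency yields W itself. Thus weights of the
    complex group are roots in the sense of the real Lie algebra. *)
Lemma real_root_vector Y i j : lie Gm Y -> Y != 0 ->
  (forall k l, pc PP Y k l != 0 -> samew P (lie A) (i, j) (idx k, idx l)) ->
  wform P i j rho != 0 ->
  exists X, [/\ lie (points iR G) X, X != 0 &
    forall k l, pc P X k l != 0 -> samew P (lie A) (i, j) (k, l)].
Proof.
move=> gY Y0 Ysupp w0.
have [B [W YE]] : exists B W, Y = jm B W by exists (ulsubmx Y), (dlsubmx Y); exact: lie_Gam_jc gY.
have E k l : pc PP Y k l = jm (pc P B) (pc P W) k l by rewrite YE (pc_jm cd).
have split_l (i' : 'I_n) : fintype.split (lshift n i') = inl i' := unsplitK (inl i').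
have split_r (i' : 'I_n) : fintype.split (rshift n i') = inr i' := unsplitK (inr i').
have Bs k l : pc P B k l != 0 -> samew P (lie A) (i, j) (k, l).
  move=> h; have := Ysupp (lshift n k) (lshift n l); rewrite E jmE !split_l !idxl; exact.
have Ws k l : pc P W k l != 0 -> samew P (lie A) (i, j) (k, l).
  move=> h; have := Ysupp (rshift n k) (lshift n l); rewrite E jmE split_l split_r idxl idxr; exact.
have gBW : lie Gm (jm B W) by rewrite -YE.
have gB : lie (points iR G) B.
  apply/lie_Gam_real; have -> : jm B 0 = 2^-1 *: (jm B W + jm B (- W)).
    by rewrite jmD subrr jmZ scaler0 -[B + B]mulr2n -[B *+ 2]scaler_nat scalerA mulVf ?scale1r // pnatr_eq0.
  exact: (lieZ _ (lieD Ggrp Gcl gBW (lie_Gam_conj gBW))).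
have [B0|B0] := eqVneq B 0; last by exists B.
have W0 : W != 0 by apply: contraNneq Y0 => W0; rewrite YE B0 W0 /jm oppr0 block_mx0.
rewrite B0 in gBW; have [m Wm] := weight_nilpotent w0 Ws.
have gW := lie_Gam_nilpotent Wm gBW.
exists W; split; [exact: gW|exact: W0|exact: Ws].
Qed.

Definition aa : set 'M[R]_(n + n) := fun X => exists2 H, lie A H & X = jm H 0.

Lemma lam_jm k H : lam PP k (jm H 0) = lam P (idx k) H.
Proof.
rewrite /lam (pc_jm cd) jmE /idx; case: (fintype.split k) => i //.
Qed.

Lemma aa_diag H : aa H -> pdiag PP H.
Proof.
case=> H' aH' -> k l kl; rewrite (pc_jm cd) jmE pc0.
have kk := unsplit_split k; have ll := unsplit_split l.
have h i j : k = lshift n i /\ l = lshift n j \/ k = rshift n i /\ l = rshift n j -> pc P H' i j = 0.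
  by move=> e; apply: (cd_Adiag cd aH'); apply: contraNneq kl => ij; case: e => -[-> ->]; rewrite ij.
case: (fintype.split k) kk => i kk; case: (fintype.split l) ll => j ll.
- by apply: h; left.
- by rewrite mxE oppr0.
- by rewrite mxE.
- by apply: h; right.
Qed.

Lemma samew_idx p q : samew PP aa p q -> samew P (lie A) (idx p.1, idx p.2) (idx q.1, idx q.2).
Proof.
move=> /asboolP h; apply/asboolP => H aH /=.
by have := h (jm H 0) (ex_intro2 _ _ H aH erefl); rewrite !lam_jm.
Qed.

Lemma aa_bracket H X : aa H -> lie Gm X -> lie Gm (lbr H X).
Proof.
case=> H' aH' ->; apply: lie_bracket => //; apply/lie_Gam_real.
exact: (lieAG cd).
Qed.

(** A preorder that compares weights on the whole closed chamber at once, so that the group u it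
    defines does not depend on rho. *)
Definition rneg (i j : 'I_n) : bool :=
  `[< forall H, dominant A Delta H -> lam P i H <= lam P j H >].

Definition gpat (T : rel 'I_n) (z : 'M[R]_(n + n)) :=
  Gm z /\ pattern (fun k l => T (idx k) (idx l)) (pc PP z).

Lemma gpat_group T : reflexive T -> transitive T -> is_mxgroup (gpat T).
Proof.
move=> Tr Tt; have [GU G1 GM GV] := Ggrp; pose T' k l := T (idx k) (idx l).
have T'r : reflexive T' by move=> k; apply: Tr.
have T't : transitive T' by move=> k l m; apply: Tt.
split.
- by move=> z [/GU].
- by split=> //; rewrite /pc mulmx1 mulmxV //; apply: pattern_scalar.
- move=> z w [Gz hz] [Gw hw]; split; first exact: GM.
  by rewrite pcM //; apply: patternM.
- move=> z [Gz hz]; split; first exact: GV.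
  have uz := GU _ Gz; have -> : pc PP (invmx z) = invmx (pc PP z).
    have e : pc PP z *m pc PP (invmx z) = 1%:M by rewrite -pcM // mulmxV // /pc mulmx1 mulmxV.
    have [u _] := mulmx1_unit e; by rewrite -[LHS](mulKmx u) e mulmx1.
  apply: pattern_inv => //; by rewrite /pc !unitmx_mul uPP uz unitmx_inv uPP.
Qed.

Lemma nclosed_pat T : nclosed (fun z => pattern (fun k l => T (idx k) (idx l)) (pc PP z)).
Proof.
pose I := {kl : 'I_(n + n) * 'I_(n + n) | ~~ T (idx kl.1) (idx kl.2)}.
have c := @nclosed_palg R (n + n) I (fun kl z => pc PP z (sval kl).1 (sval kl).2).
move=> z hz k l; apply: contraNT => Tkl; apply/eqP.
apply: (c _ z _ (exist _ (k, l) Tkl)).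
  move=> -[[k' l'] ?] /=; rewrite /pc; apply: mpalg_mul; last exact: mpalg_const.
  by apply: mpalg_mul; [exact: mpalg_const|exact: mpalg_id].
move=> e e0; have [y hy yz] := hz e e0; exists y => // -[[k' l'] /= ni].
by apply/eqP; apply: contraT => /hy; rewrite (negbTE ni).
Qed.

Lemma gpat_lie T Y : reflexive T -> transitive T -> lie Gm Y ->
  pattern (fun k l => T (idx k) (idx l)) (pc PP Y) -> lie (gpat T) Y.
Proof.
move=> Tr Tt gY hY t; split; first exact: gY.
apply: (@exp_closed _ _ (fun z => pattern (fun k l => T (idx k) (idx l)) (pc PP z)) _ (@nclosed_pat T)).
move=> N; rewrite /eS pc_sum; elim/big_ind: _ => [k l|X Y' hX hY'|k _].
- by rewrite mxE eqxx.
- exact: patternD.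
rewrite pcZ; apply: patternZ; rewrite mx_exprZn pcZ; apply: patternZ.
elim: k => [|k IH].
  by rewrite expr0 /pc mulmx1 mulmxV //; apply: pattern_scalar => l; apply: Tr.
rewrite exprSr -[_ * Y]/(_ *m Y) pcM //; apply: patternM => // a b c; exact: Tt.
Qed.

(** The entries of negative weight at rho are split off; by [root_strict] such weights are
    nonpositive on all dominant elements. Masking entries does not increase the norm in the
    coordinates of [PP], so only the change of basis enters the constant, which must be uniform for
    [open_product]. *)
Lemma lie_split Y : lie Gm Y -> exists Y1 Y2, [/\ lie Gm Y1, lie Gm Y2, Y = Y1 + Y2 &
  [/\ nrm Y1 <= (1 + (nrm (invmx PP) * nrm PP) ^+ 2) * nrm Y,
      nrm Y2 <= (1 + (nrm (invmx PP) * nrm PP) ^+ 2) * nrm Y,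
      pattern (fun k l => rneg (idx k) (idx l)) (pc PP Y1) &
      forall k l, pc PP Y2 k l != 0 -> lam P (idx l) rho <= lam P (idx k) rho]].
Proof.
move=> gY; pose T (p : 'I_(n + n) * 'I_(n + n)) := lam P (idx p.1) rho < lam P (idx p.2) rho.
have Tw p q : samew PP aa p q -> T p -> T q.
  by move=> /samew_idx/asboolP/(_ rho ar) /=; rewrite /T -subr_lt0 => ->; rewrite subr_lt0.
have [Y1 gY1 Y1E] := @weight_mask _ _ PP aa uPP aa_diag (lie Gm) (lie0 Ggrp) (lieD Ggrp Gcl)
  (fun c X => @lieZ _ _ Gm c X) aa_bracket Y T gY Tw.
exists Y1, (Y - Y1); split; [exact: gY1|exact: (lieB Ggrp Gcl gY gY1)|by rewrite addrC subrK|].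
have n1 : nrm Y1 <= (nrm (invmx PP) * nrm PP) ^+ 2 * nrm Y.
  have -> : Y1 = invmx PP *m pc PP Y1 *m PP.
    by rewrite /pc !mulmxA mulVmx // mul1mx mulmxKV.
  apply: le_trans (nrmM _ _) _; apply: (@le_trans _ _ (nrm (invmx PP) * nrm (pc PP Y) * nrm PP)).
    rewrite ler_wpM2r ?nrm_ge0 //; apply: le_trans (nrmM _ _) _; rewrite ler_wpM2l ?nrm_ge0 //.
    apply: ler_sum => k _; apply: ler_sum => l _; rewrite Y1E; case: ifP => // _.
    by rewrite normr0.
  have : nrm (pc PP Y) <= nrm PP * nrm Y * nrm (invmx PP).
    apply: le_trans (nrmM _ _) _; rewrite ler_wpM2r ?nrm_ge0 //; exact: nrmM.
  move=> h; rewrite [leRHS](_ : _ = nrm (invmx PP) * (nrm PP * nrm Y * nrm (invmx PP)) * nrm PP); last first.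
    by rewrite expr2; ring.
  by rewrite ler_wpM2r ?nrm_ge0 // ler_wpM2l ?nrm_ge0.
split.
- by apply: le_trans n1 _; rewrite mulrDl mul1r lerDr nrm_ge0.
- by apply: le_trans (nrmB _ _) _; rewrite mulrDl mul1r lerD2l.
- move=> k l; rewrite Y1E; case: ifPn => [Tkl nz|]; last by rewrite eqxx.
  have [Yc gYc YcE] := @weight_component _ _ PP aa uPP aa_diag (lie Gm) (lieD Ggrp Gcl)
    (fun c X => @lieZ _ _ Gm c X) aa_bracket Y (k, l) gY.
  have Yc0 : Yc != 0.
    apply: contraNneq nz => Yc0; have := YcE k l; rewrite Yc0 pc0 mxE samew_refl => <-; exact: eqxx.
  have wn : wform P (idx k) (idx l) rho < 0 by rewrite /wform subr_lt0.
  have Ycs k' l' : pc PP Yc k' l' != 0 -> samew P (lie A) (idx k, idx l) (idx k', idx l').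
    rewrite YcE; case: ifPn => [/samew_idx //|]; by rewrite eqxx.
  have [X [gX X0 Xs]] := real_root_vector gYc Yc0 Ycs (ltr0_neq0 wn).
  have [_ /(_ wn) h] := root_strict cd gX ar sr Xs X0 (ex_intro2 _ _ rho ar (ltr0_neq0 wn)).
  by apply/asboolP => H dH; have := h H dH; rewrite /wform subr_le0.
- move=> k l; rewrite pcB mxB_entry Y1E; case: ifPn => [_|]; first by rewrite subrr eqxx.
  by rewrite /T -leNgt.
Qed.

Variable c : R.
Let J := [set i | c <= lam P i rho].
Definition rJ (i j : 'I_n) : bool := (j \in J) ==> (i \in J).

Lemma open_cell : exists2 e, 0 < e & forall z, Gm z -> nrm (z - 1%:M) < e ->
  exists u q, [/\ gpat rneg u, gpat rJ q & z = u *m q].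
Proof.
have nr : reflexive rneg by move=> i; apply/asboolP.
have nt : transitive rneg.
  by move=> j i k /asboolP h1 /asboolP h2; apply/asboolP => H dH; apply: le_trans (h1 H dH) (h2 H dH).
have jr : reflexive rJ by move=> i; apply/implyP.
have jt : transitive rJ.
  by move=> j i k /implyP h1 /implyP h2; apply/implyP => /h2/h1.
have g1 := gpat_group nr nt; have g2 := gpat_group jr jt.
have ncl T : nclosed (gpat T) by apply: nclosedI => //; apply: nclosed_pat.
have [||||Y gY|e e0 he] := @open_product _ _ Gm (gpat rneg) (gpat rJ) (1 + (nrm (invmx PP) * nrm PP) ^+ 2) Ggrp Gcl g1 g2.
- exact: ncl.
- exact: ncl.
- by move=> z [].
- by move=> z [].
- have [Y1 [Y2 [gY1 gY2 YE [n1 n2 p1 p2]]]] := lie_split gY; exists Y1, Y2.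
  have p2' : pattern (fun k l => rJ (idx k) (idx l)) (pc PP Y2).
    by move=> k l /p2 h; apply/implyP; rewrite !inE => h'; apply: le_trans h' h.
  split; [exact: gpat_lie nr nt gY1 p1|exact: gpat_lie jr jt gY2 p2'|exact: YE|exact: n1|exact: n2].
exists e => // z Gz ze; have [u [q [gu gq uq]]] := he z Gz ze.
have [U1 _ _ V1] := g1; have [U2 _ _ V2] := g2.
exists (invmx u), (invmx q); split; [exact: V1|exact: V2|].
apply: (can_inj (mulKmx (U1 _ gu))); rewrite mulmxA mulmxV ?U1 // mul1mx.
by rewrite -[LHS](mulmxK (U2 _ gq)) uq mul1mx.
Qed.

Definition pcC (g : 'M[C]_n) := toC P *m g *m toC (invmx P).

Lemma pc_jc g : pc PP (jc g) = jc (pcC g).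
Proof. by rewrite /pcC !jcM !jc_real /pc (PP_unit cd).2. Qed.

Lemma gpat_pcC T g : gpat T (jc g) -> pattern T (pcC g).
Proof.
move=> [_]; rewrite pc_jc => h i j; set M := pcC g in h *.
have split_l (i' : 'I_n) : fintype.split (lshift n i') = inl i' := unsplitK (inl i').
have split_r (i' : 'I_n) : fintype.split (rshift n i') = inr i' := unsplitK (inr i').
have h1 := h (lshift n i) (lshift n j); have h2 := h (rshift n i) (lshift n j).
rewrite /jc jmE !split_l !idxl mxE in h1; rewrite /jc jmE split_l split_r idxl idxr mxE in h2.
move=> nz; have [e1|/h1 //] := eqVneq (complex.Re (M i j)) 0.
have [e2|/h2 //] := eqVneq (complex.Im (M i j)) 0.
by move: nz e1 e2; case: (M i j) => a b /= nz ea eb; move: nz; rewrite ea eb eqxx.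
Qed.

(* Cauchy-Binet for [z = u q] on the open cell: the minors of [q] with columns in [J] are
   supported on the rows [J], and a nonzero entry [u_ij] forces the weight of [i] to be at most
   that of [j]. *)
Lemma minor_open_cell p (f cJ : 'I_p -> 'I_n) H : p = #|J| -> injective cJ -> (forall k, cJ k \in J) ->
  dominant A Delta H -> \sum_k lam P (cJ k) H < \sum_k lam P (f k) H ->
  exists2 e, 0 < e & forall g, points (cio iR) G g -> nrm (jc (g - 1%:M)) < e ->
    \det (mxsub f cJ (pcC g)) = 0.
Proof.
move=> pJ cinj cJJ dH lt; have [e e0 he] := open_cell; exists e => // g Gg ge.
have [|u [q [gu gq zE]]] := he (jc g) ((Gam_jc _ _ _).2 Gg); first by rewrite -jc1 -jcB.
have uE : u = jc (cz u) by case: gu => -[].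
have qE : q = jc (cz q) by case: gq => -[].
have gE : g = cz u *m cz q by rewrite -[LHS]jcK zE {1}uE {1}qE -jcM jcK.
have pu : pattern rneg (pcC (cz u)) by apply: gpat_pcC; rewrite -uE.
have pq : pattern rJ (pcC (cz q)) by apply: gpat_pcC; rewrite -qE.
have PP1 : toC (invmx P) *m toC P = 1%:M by rewrite -map_mxM mulVmx // map_mx1.
have -> : pcC g = pcC (cz u) *m pcC (cz q).
  by rewrite gE /pcC !mulmxA -(mulmxA _ (toC (invmx P)) (toC P)) PP1 mulmx1.
rewrite det_mxsub_mul; apply: big1 => h _.
have [/forallP hJ|/forallPn[k kJ]] := boolP [forall k, h k \in J]; last first.
  have -> : \det (mxsub h cJ (pcC (cz q))) = 0; last by rewrite mulr0.
  rewrite (expand_det_row _ k); apply: big1 => l _; rewrite mxE.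
  have -> : pcC (cz q) (h k) (cJ l) = 0.
    by apply/eqP; apply: contraT => /pq; rewrite /rJ cJJ (negbTE kJ).
  by rewrite mul0r.
have [/injectiveP hi|] := boolP (injectiveb h); last first.
  move=> /injectivePn[k [l kl E]]; rewrite (@determinant_alternate _ _ _ k l) ?mulr0 // => m.
  by rewrite !mxE E.
have [/prodf_neq0 U|/negPn/eqP ->] := boolP (\prod_k pcC (cz u) (f k) (h k) != 0); last by rewrite mul0r.
have : \sum_k lam P (f k) H <= \sum_k lam P (h k) H.
  by apply: ler_sum => k _; have /pu/asboolP := U k isT; apply.
by rewrite (sum_inj_set (fun i => lam P i H) hi hJ pJ) -(sum_inj_set (fun i => lam P i H) cinj cJJ pJ) leNgt lt.
Qed.

End OpenCell.

(** * Density of neighbourhoods of the identity *)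

(** The right translates of a polynomial span a finite-dimensional space; the number of terms bounds
    the rank in [vnear_uniform]. *)
Lemma palg_separated (C : fieldType) n (f : 'M[C]_n -> C) : palg (@mxcoord C n) f ->
  exists s : seq (('M[C]_n -> C) * ('M[C]_n -> C)),
    forall y x, f (y *m x) = \sum_(uw <- s) uw.1 x * uw.2 y.
Proof.
elim=> [c|[i j]|g g' _ [s sE] _ [t tE]|g g' _ [s sE] _ [t tE]].
- by exists [:: (fun=> c, fun=> 1)] => y x; rewrite big_seq1 /= mulr1.
- exists [seq (fun x : 'M[C]_n => x k j, fun y : 'M[C]_n => y i k) | k <- enum 'I_n] => y x.
  rewrite big_map big_enum /= /mxcoord /= mxE; by apply: eq_bigr => k _; rewrite mulrC.
- by exists (s ++ t) => y x; rewrite big_cat /= sE tE.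
- exists [seq (fun x => a.1 x * b.1 x, fun y => a.2 y * b.2 y) | a <- s, b <- t] => y x.
  rewrite sE tE big_allpairs_dep /= big_distrl /=; apply: eq_bigr => a _.
  by rewrite big_distrr /=; apply: eq_bigr => b _; rewrite mulrACA.
Qed.

Lemma stab_group (C : fieldType) n (G B : 'M[C]_n -> Prop) : is_mxgroup G ->
  is_mxgroup (fun h => G h /\ forall y, B y -> B (y *m h) /\ B (y *m invmx h)).
Proof.
case=> GU G1 GM GV; split.
- by move=> g [/GU].
- by split=> // y By; rewrite invmx1 mulmx1.
- move=> g h [Gg hg] [Gh hh]; split=> [|y By]; first exact: GM.
  split; first by rewrite mulmxA; apply: (hh _ (hg _ By).1).1.
  have -> : invmx (g *m h) = invmx h *m invmx g.
    have ugh : g *m h \in unitmx by apply: GU; apply: GM.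
    apply: (can_inj (mulKmx ugh)); rewrite mulmxV // mulmxA mulmxK ?mulmxV //; exact: GU.
  by rewrite mulmxA; apply: (hg _ (hh _ By).2).2.
- move=> g [Gg hg]; split=> [|y By]; first exact: GV.
  by rewrite invmxK; have [] := hg _ By.
Qed.

Section Density.
Variables (K : rcfType) (n : nat) (G : seq (mxpol K n)) (q : mxpol K n).
Hypothesis G_grp : is_mxgroup (geom G).
Hypothesis G_det : forall g, geom G g -> \det g = 1.
Hypothesis G_tr : forall g, geom G g -> geom G g^T.
Hypothesis G_conn : zconnected (geom G).

Definition cnear (L : rcfType) (g : 'M[complex L]_n) (e : L) := forall i j,
  `|complex.Re ((g - 1%:M) i j)| < e /\ `|complex.Im ((g - 1%:M) i j)| < e.

(** Such y are those where q vanishes on a neighbourhood in yG, with radius e measured after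
    translation back to 1. The set is stable under the group of its right translations, which is
    what makes q vanish on whole cosets. *)
Definition vnear (L : rcfType) (io : {rmorphism K -> L}) (e : L) (y : 'M[complex L]_n) :=
  forall x, points (cio io) G x -> cnear x e -> mxeval (cio io) q (y *m x) = 0.

Definition vstab (L : rcfType) (io : {rmorphism K -> L}) (e : L) (h : 'M[complex L]_n) :=
  forall y, vnear io e y -> vnear io e (y *m h) /\
    (forall k, h *m k = 1%:M -> vnear io e (y *m k)).

(** All that the analysis over R contributes, as a sentence for each N. The N coset representatives
    are the rows of one matrix, so that a single quantifier introduces them; inverses are quantified
    in [vstab]. *)
Definition finite_stab N (L : rcfType) (io : {rmorphism K -> L}) :=
  exists S : 'M[complex L]_(N, n * n), exists e0 : L, 0 < e0 /\
    (exists e : L, 0 < e /\ vnear io e 1%:M) /\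
    (forall y : 'M[complex L]_n, forall e : L, 0 < e -> vnear io e y -> vnear io e0 y) /\
    (forall i, points (cio io) G (vec_mx (row i S))) /\
    (forall g, points (cio io) G g -> exists i : 'I_N, exists k, points (cio io) G k /\
       vstab io e0 k /\ vec_mx (row i S) *m k = g).

Lemma cmdef_vecrow N (M : cmxfam K N (n * n)) i : cmdef M ->
  cmdef (fun L io e => vec_mx (row i (M L io e))).
Proof. by move=> dM a b; apply: cdef_ext (dM i (mxvec_index a b)) => L io e; rewrite !mxE. Qed.

Lemma def_finite_stab N : def (fun (L : rcfType) (io : {rmorphism K -> L}) (_ : nat -> L) =>
  finite_stab N io).
Proof.
rewrite /finite_stab /vstab /vnear /cnear /vsh /=.
repeat first [exact: cdef_0 | apply: cmdef_vecrow | def_step].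
Qed.

Section Real.
Variables (R : realType) (iR : {rmorphism K -> R}).
Local Notation C := (complex R).
Local Notation Gm := (Gam iR G).

Lemma cnear_nrm (g : 'M[C]_n) e : nrm (jc (g - 1%:M)) < e -> cnear g e.
Proof. by move=> h i j; have [h1 h2] := nrm_jc (g - 1%:M) i j; split; apply: le_lt_trans h. Qed.

Lemma nrm_cnear (g : 'M[C]_n) e : cnear g e -> nrm (jc (g - 1%:M)) <= (n + n)%:R * (n + n)%:R * e.
Proof. by move=> h; apply: nrm_jc_le => i j; have [h1 h2] := h i j; rewrite !ltW. Qed.

(** Vanishing at y is orthogonality of a fixed vector to the values u(x) for x near 1. Their span
    shrinks with the radius, and its dimension stabilises at some [e0]. *)
Lemma vnear_uniform : exists2 e0 : R, 0 < e0 & forall y e, 0 < e -> vnear iR e y -> vnear iR e0 y.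
Proof.
have [s sE] := palg_separated (palg_mxeval (cio iR) q (@mpalg_id C n)).
pose N := size s; pose d : ('M[C]_n -> C) * ('M[C]_n -> C) := (fun=> 0, fun=> 0).
pose u x : 'rV[C]_N := \row_i (nth d s i).1 x.
pose w y : 'cV[C]_N := \col_i (nth d s i).2 y.
have uw y x : mxeval (cio iR) q (y *m x) = (u x *m w y) 0 0.
  by rewrite sE (big_nth d) big_mkord mxE; apply: eq_bigr => i _; rewrite !mxE.
pose Z e (z : 'rV[C]_N) := exists x, [/\ points (cio iR) G x, cnear x e & z = u x].
pose Q (e : R) k (X : 'M[C]_(k, N)) := (forall i, Z e (row i X)) /\ forall z, Z e z -> (z <= X)%MS.
pose Pr r := `[< exists e k (X : 'M[C]_(k, N)), [/\ 0 < e, Q e k X & \rank X = r] >].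
have exP : exists r, Pr r.
  have [k [X QX]] := rank_set (Z 1); exists (\rank X); apply/asboolP; exists 1, k, X; by split.
case: (ex_minnP exP) => r /asboolP[e0 [k [X [e00 [XZ Xs] Xr]]]] rmin.
exists e0 => // y e e_gt0 By x Gx xe0; rewrite uw.
pose e' := Num.min e e0; have e'0 : 0 < e' by rewrite lt_min e_gt0.
have mono (a b : R) (g : 'M[C]_n) : a <= b -> cnear g a -> cnear g b.
  by move=> ab h i j; have [h1 h2] := h i j; split; apply: lt_le_trans ab.
have [k' [X' [X'Z X's]]] := rank_set (Z e').
have X'X : (X' <= X)%MS.
  apply/row_subP => i; apply: Xs; have [x' [Gx' nx' ->]] := X'Z i; exists x'; split=> //.
  by apply: mono nx'; rewrite ge_min lexx orbT.
have : (X <= X')%MS.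
  rewrite -(mxrank_leqif_sup X'X) eqn_leq mxrankS //= Xr; apply: rmin.
  by apply/asboolP; exists e', k', X'.
have ux : (u x <= X)%MS by apply: Xs; exists x.
move=> /(submx_trans ux)/submxP[v ->]; rewrite -mulmxA (_ : X' *m w y = 0) ?mulmx0 ?mxE //.
apply/row_matrixP => i; rewrite row_mul row0; apply/matrixP => a b; rewrite !ord1 [RHS]mxE.
have [x' [Gx' nx' ->]] := X'Z i; rewrite -uw; apply: By => //.
by apply: mono nx'; rewrite ge_min lexx.
Qed.

Lemma vstabE e (h : 'M[C]_n) : h \in unitmx ->
  vstab iR e h <-> forall y, vnear iR e y -> vnear iR e (y *m h) /\ vnear iR e (y *m invmx h).
Proof.
move=> uh; split=> hv y By; have [h1 h2] := hv y By; (split; first exact: h1).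
  exact: (h2 _ (mulmxV uh)).
move=> k hk; rewrite -(mulKmx uh k) hk mulmx1; exact: h2.
Qed.

(** A right translation by h close to 1 shrinks the radius of vanishing, and [vnear_uniform]
    restores it. *)
Lemma vstab_near e0 : 0 < e0 -> (forall y e, 0 < e -> vnear iR e y -> vnear iR e0 y) ->
  exists2 e1, 0 < e1 & forall h, points (cio iR) G h -> nrm (jc (h - 1%:M)) < e1 -> vstab iR e0 h.
Proof.
move=> e00 uni; have [GU G1 GM GV] := cgroup G_grp iR.
pose N2 : R := (n + n)%:R; have N20 : 0 <= N2 by [].
have sub h : points (cio iR) G h -> nrm (jc (h - 1%:M)) < e0 / 2 ->
    forall y, vnear iR e0 y -> vnear iR e0 (y *m h).
  move=> Gh hn y By; pose D := N2 * N2 * (nrm (jc h) + 1) + 1.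
  have D0 : 0 < D by rewrite ltr_wpDl // !mulr_ge0 // addr_ge0 ?nrm_ge0.
  apply: (uni _ (e0 / 2 / D)); first by rewrite !divr_gt0.
  move=> x Gx /nrm_cnear xn; rewrite -mulmxA; apply: By; first exact: GM.
  apply: cnear_nrm; have -> : h *m x - 1%:M = (h - 1%:M) + h *m (x - 1%:M).
    by rewrite mulmxBr mulmx1 [RHS]addrC subrKA.
  rewrite jcD jcM; apply: le_lt_trans (nrmD _ _) _; rewrite [ltRHS]splitr; apply: ltr_leD => //.
  apply: le_trans (nrmM _ _) _; apply: (@le_trans _ _ (nrm (jc h) * (N2 * N2 * (e0 / 2 / D)))).
    by rewrite ler_wpM2l ?nrm_ge0.
  have -> : nrm (jc h) * (N2 * N2 * (e0 / 2 / D)) = (e0 / 2) * ((N2 * N2 * nrm (jc h)) / D) by ring.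
  rewrite ler_piMr // ?divr_ge0 ?(ltW e00) // ler_pdivrMr // mul1r /D mulrDr mulr1 -addrA lerDl.
  by rewrite addr_ge0 // mulr_ge0.
pose e1 := Num.min (1 / 2) (e0 / 2 / (2 * N2 + 1)).
have P0 : 0 < 2 * N2 + 1 by rewrite ltr_wpDl // mulr_ge0.
exists e1; first by rewrite lt_min !divr_gt0.
move=> h Gh; rewrite lt_min => /andP[h12 h1]; apply/(vstabE _ (GU _ Gh)) => y By.
have eD : e0 / 2 / (2 * N2 + 1) <= e0 / 2.
  by rewrite ler_pdivrMr // ler_peMr ?divr_ge0 ?(ltW e00) // lerDr mulr_ge0.
split; first by apply: sub => //; apply: lt_le_trans h1 eD.
apply: sub (GV _ Gh) _ _ By; set k := invmx h.
have kE : k - 1%:M = - (k *m (h - 1%:M)) by rewrite mulmxBr mulVmx ?GU // mulmx1 opprB.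
have nk : nrm (jc (k - 1%:M)) <= nrm (jc k) * nrm (jc (h - 1%:M)).
  rewrite {1}kE -sub0r jcB jc0 sub0r nrmN jcM; exact: nrmM.
have nk2 : nrm (jc k) <= N2 + nrm (jc (k - 1%:M)).
  apply: le_trans (nrm_le_dist _ 1%:M) _; rewrite nrm1 -jc1 -jcB //.
rewrite ltr_pdivlMr // in h1; move: nk nk2 h12 h1.
have := nrm_ge0 (jc (h - 1%:M)); have := nrm_ge0 (jc (k - 1%:M)).
move: (nrm (jc (k - 1%:M))) (nrm (jc k)) (nrm (jc (h - 1%:M))) => a b d a0 d0 h1 h2 h3 h4.
have key (N : R) : a <= (N + a) * d -> d * (2 * N + 1) < e0 / 2 -> a < e0 / 2.
  move=> h5 h6; have h7 : 0 <= a * (1 / 2 - d) by apply: mulr_ge0; [exact: a0|rewrite subr_ge0; exact: ltW h3].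
  by move: h5 h6 h7 d0; lra.
by apply: (key N2) => //; apply: le_trans h1 _; rewrite ler_wpM2r.
Qed.

Lemma finite_stab_real e : 0 < e -> vnear iR e 1%:M -> exists N, finite_stab N iR.
Proof.
move=> e_gt0 B1; have [e0 e00 uni] := vnear_uniform.
have [GU G1 GM GV] := cgroup G_grp iR.
have [e1 e10 nb] := vstab_near e00 uni.
pose H (h : 'M[C]_n) := points (cio iR) G h /\
  forall y, vnear iR e0 y -> vnear iR e0 (y *m h) /\ vnear iR e0 (y *m invmx h).
have Hg : is_mxgroup H := stab_group _ (cgroup G_grp iR).
have [HU H1 HM HV] := Hg.
have HI h : points (cio iR) G h -> vstab iR e0 h -> H h.
  by move=> Gh vh; split; [exact: Gh|apply/(vstabE _ (GU _ Gh))].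
have HO h : H h -> vstab iR e0 h.
  by case=> Gh hh; apply/(vstabE _ (GU _ Gh)).
clearbody H.
pose H' : set 'M[R]_(n + n) := fun z => H (cz z) /\ z = jc (cz z).
have H'I h : H h -> H' (jc h) by move=> Hh; split; rewrite jcK.
have H'g : is_mxgroup H'.
  split.
  - by move=> z [/HU uz ->]; apply: (jcV uz).1.
  - by rewrite -jc1; apply: H'I.
  - by move=> z w [Hz ->] [Hw ->]; rewrite -jcM; apply: H'I; apply: HM.
  - by move=> z [Hz ->]; rewrite (jcV (HU _ Hz)).2; apply: H'I; apply: HV.
have [|N [s [us cover]]] := open_finite_index (Gam_group iR G_grp) (@Gam_tr _ _ _ iR G G_tr)
    (@Gam_powclosed _ _ _ iR G G_grp) H'g e10.
  move=> z [Gz zE] ze; split; last exact: zE.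
  by apply: (HI _ Gz); apply: (nb _ Gz); rewrite jcB -zE jc1.
exists N.
(* The representatives found among 2n x 2n matrices are not known to come from G; each coset that
   meets G gets one that does. *)
have /choice[sg sgP] : forall i, exists g, points (cio iR) G g /\
    ((exists2 g', points (cio iR) G g' & H' (invmx (s i) *m jc g')) -> H' (invmx (s i) *m jc g)).
  move=> i; have [[g' Gg' Hg']|h] := pselect (exists2 g', points (cio iR) G g' & H' (invmx (s i) *m jc g')).
    by exists g'.
  by exists 1%:M; split=> // /h.
exists (\matrix_i mxvec (sg i)), e0; split=> //; split; first by exists e.
split=> //; split; first by move=> i; rewrite rowK mxvecK; case: (sgP i).
move=> g Gg; have [i Hi] := cover (jc g) ((Gam_jc _ _ _).2 Gg).
have [Gs /(_ (ex_intro2 _ _ g Gg Hi)) Hs] := sgP i.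
exists i, (invmx (sg i) *m g); rewrite rowK mxvecK.
have us' : sg i \in unitmx := GU _ Gs.
split; first exact: (GM _ _ (GV _ Gs) Gg).
split; last by rewrite mulKVmx.
have [H'U _ H'M H'V] := H'g.
have : H' (invmx (invmx (s i) *m jc (sg i)) *m (invmx (s i) *m jc g)) by apply: H'M => //; apply: H'V.
have -> : invmx (invmx (s i) *m jc (sg i)) *m (invmx (s i) *m jc g) = jc (invmx (sg i) *m g).
  apply: (can_inj (mulKmx (H'U _ Hs))); rewrite mulKVmx ?(H'U _ Hs) //.
  by rewrite -mulmxA -jcM mulKVmx.
by move=> [h _]; rewrite jcK in h; apply: HO.
Qed.

End Real.

(** Over K, the stabiliser of the points where q vanishes nearby is Zariski closed and of finite
    index, hence all of G by connectedness. It contains g, and 1 is such a point, so q vanishes near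
    g and in particular at g. *)
Theorem density (R : realType) (iR : {rmorphism K -> R}) e : 0 < e ->
  (forall g, points (cio iR) G g -> nrm (jc (g - 1%:M)) < e -> mxeval (cio iR) q g = 0) ->
  forall (L : rcfType) (io : {rmorphism K -> L}) g,
    points (cio io) G g -> mxeval (cio io) q g = 0.
Proof.
move=> e_gt0 h.
have [N QN] : exists N, finite_stab N iR.
  have N2 : 0 < (n + n)%:R * (n + n)%:R + 1 :> R by rewrite ltr_wpDl // mulr_ge0.
  apply: (@finite_stab_real _ iR (e / ((n + n)%:R * (n + n)%:R + 1))); first by rewrite divr_gt0.
  move=> x Gx /nrm_cnear xn; rewrite mul1mx; apply: h => //.
  apply: le_lt_trans xn _; rewrite mulrCA gtr_pMr // ltr_pdivrMr // mul1r ltrDl //.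
have {}QN : finite_stab N (idfun : {rmorphism K -> K}) := @xfer _ _ (def_finite_stab N) _ _ iR idfun QN.
move=> L io.
have dQ : def (fun (L : rcfType) (io : {rmorphism K -> L}) (_ : nat -> L) =>
  forall g, points (cio io) G g -> mxeval (cio io) q g = 0).
  by rewrite /vsh /=; repeat first [exact: cdef_0 | def_step].
apply: (@xfer _ _ dQ K L idfun io) => g Gg.
have [S [e0 [e00 [[e2 [e20 B2]] [uni [SG cover]]]]]] := QN.
have B1 := uni _ _ e20 B2.
have grp := cgroup G_grp (idfun : {rmorphism K -> K}); have [GU G1 GM GV] := grp.
pose H (h : 'M[complex K]_n) := points (cio idfun) G h /\
  forall y, vnear idfun e0 y -> vnear idfun e0 (y *m h) /\ vnear idfun e0 (y *m invmx h).
have Hg : is_mxgroup H := stab_group _ grp.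
(* As the determinant is 1, the inverse is the adjugate: this makes the stabiliser a zero set of
   polynomials. *)
have adjE h' : points (cio idfun) G h' -> invmx h' = \adj h'.
  move=> Gh'; have d1 : \det h' = 1 by apply: G_det; rewrite geomE.
  by rewrite /invmx (GU _ Gh') d1 invr1 scale1r.
have Hcl : zclosed H.
  pose I := {yx : 'M[complex K]_n * 'M[complex K]_n |
     [/\ vnear idfun e0 yx.1, points (cio idfun) G yx.2 & cnear yx.2 e0]}.
  have c1 := zclosed_points (cio idfun : {rmorphism K -> complex K}) G.
  have c2 := @zclosed_palg _ n I (fun yx h => mxeval (cio idfun) q ((sval yx).1 *m h *m (sval yx).2)).
  have c3 := @zclosed_palg _ n I (fun yx h => mxeval (cio idfun) q ((sval yx).1 *m \adj h *m (sval yx).2)).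
  apply: zclosed_eq (zclosedI c1 (zclosedI (c2 _) (c3 _))).
  - move=> h'; split=> [[Gh' [h2 h3]]|[Gh' hh]].
      split; first exact: Gh'.
      move=> y By; split=> x Gx xn; first exact: (h2 (exist _ (y, x) (And3 By Gx xn))).
      by rewrite adjE //; exact: (h3 (exist _ (y, x) (And3 By Gx xn))).
    split=> //; split=> -[[y x] /= [By Gx xn]]; have [h1 h2] := hh _ By; first exact: h1.
    by rewrite -adjE //; apply: h2.
  - move=> i; apply: palg_mxeval; apply: mpalg_mul; last exact: mpalg_const.
    by apply: mpalg_mul; [exact: mpalg_const|exact: mpalg_id].
  - move=> i; apply: palg_mxeval; apply: mpalg_mul; last exact: mpalg_const.
    by apply: mpalg_mul; [exact: mpalg_const|apply: mpalg_adj; exact: mpalg_id].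
have HG := @zconnected_finite_index _ n (geom G) H N (fun i => vec_mx (row i S)) G_conn Hcl Hg.
have [||||_ Hgg] := HG _ _ _ g.
- by rewrite geomE.
- by move=> i; apply: GU.
- move=> g'; rewrite geomE => /cover[i [k [Gk [vk kE]]]]; exists i.
  rewrite -kE mulKmx; last exact: (GU _ (SG i)).
  split; first exact: Gk.
  move=> y By; have [h1 h2] := vk _ By; split; first exact: h1.
  by apply: h2; rewrite mulmxV // (GU _ Gk).
- by rewrite geomE.
have [/(_ _ G1)] := Hgg _ B1; rewrite mul1mx mulmx1 => E _; apply: E => i j.
by rewrite subrr mxE /= normr0.
Qed.

End Density.

(** * Uniqueness over R *)

Lemma minor_pol (K : fieldType) n p (P : 'M[K]_n) (f c : 'I_p -> 'I_n) :
  exists q : mxpol K n, forall (C : fieldType) (io : {rmorphism K -> C}) g,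
    mxeval io q g = \det (mxsub f c (map_mx io P *m g *m map_mx io (invmx P))).
Proof.
pose X : 'M[mpoly (n * n) K]_n := \matrix_(a, b) mpolyX _ (mnm1 (mxvec_index a b)).
pose cst (M : 'M[K]_n) : 'M[mpoly (n * n) K]_n := map_mx (@mpolyC (n * n) K) M.
exists (\det (mxsub f c (cst P *m X *m cst (invmx P)))) => C io g.
pose ev : {rmorphism mpoly (n * n) K -> C} := meval (fun k => mxvec g 0 k) \o map_mpoly io.
have evE q : mxeval io q g = ev q by [].
rewrite evE -det_map_mx; congr (\det _).
have evX : map_mx ev X = g.
  by apply/matrixP => a b; rewrite !mxE -evE mxevalX.
have evC M : map_mx ev (cst M) = map_mx io M.
  by apply/matrixP => a b; rewrite !mxE -evE mxevalC.
by rewrite map_mxsub !map_mxM evX !evC.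
Qed.

(** Differences of successive upper level sets isolate the sum of D over each level of mu, on which
    mu is a constant factor. *)
Lemma abel_sum (R : realDomainType) n (mu D : 'I_n -> R) :
  (forall c, \sum_(i | c <= mu i) D i = 0) -> \sum_i mu i * D i = 0.
Proof.
move=> h.
have gt c : \sum_(i | c < mu i) D i = 0.
  have [[i0 ci0]|no] := pselect (exists i, c < mu i); last first.
    by apply: big1 => i ci; case: no; exists i.
  have [i ci imin] := @arg_minP _ _ _ i0 (fun i => c < mu i) mu ci0.
  rewrite -[RHS](h (mu i)); apply: eq_bigl => j; apply/idP/idP => [/imin //|].
  exact: lt_le_trans ci.
have eqv c : \sum_(i | mu i == c) D i = 0.
  have := h c; rewrite (bigID (fun i => mu i == c)) /=.
  rewrite (eq_bigl (fun i => mu i == c)) => [|i]; last first.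
    by case: eqP => [->|]; rewrite ?lexx ?andbF.
  rewrite [X in _ + X](eq_bigl (fun i => c < mu i)) => [|i]; last first.
    by rewrite lt_neqAle andbC eq_sym.
  by rewrite gt addr0.
transitivity (\sum_(c <- undup [seq mu i | i <- enum 'I_n]) \sum_(i | mu i == c) mu i * D i).
  rewrite (exchange_big_dep xpredT) //=; apply: eq_bigr => i _.
  rewrite -big_filter (_ : [seq c <- _ | mu i == c] = [:: mu i]) ?big_seq1 //.
  rewrite (eq_filter (a2 := pred1 (mu i))) => [|c]; last by rewrite /= eq_sym.
  by rewrite filter_pred1_uniq ?undup_uniq // mem_undup map_f // mem_enum.
apply: big1 => c _; rewrite (eq_bigr (fun i => c * D i)) => [|i /eqP -> //].
by rewrite -big_distrr /= eqv mulr0.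
Qed.

Section Uniqueness.
Variables (R : realType) (n : nat) (K : rcfType) (iR : {rmorphism K -> R}) (G : seq (mxpol K n)).
Variables (A : set 'M[R]_n) (P0 : 'M[K]_n) (r : nat) (Delta : 'I_r -> {scalar 'M[R]_n}).
Hypothesis G_grp : is_mxgroup (geom G).
Hypothesis G_det : forall g, geom G g -> \det g = 1.
Hypothesis G_tr : forall g, geom G g -> geom G g^T.
Hypothesis G_conn : zconnected (geom G).
Local Notation P := (map_mx iR P0).
Hypothesis cd : cartan_data (points iR G) A P Delta.
Local Notation C := (complex R).
Local Notation toC := (map_mx (@real_complex R)).
Let uP := cd_uP cd.

Lemma minor_zero rho c p (f cJ : 'I_p -> 'I_n) H : strict A Delta rho ->
  p = #|[set i | c <= lam P i rho]| -> injective cJ -> (forall k, c <= lam P (cJ k) rho) ->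
  dominant A Delta H -> \sum_k lam P (cJ k) H < \sum_k lam P (f k) H ->
  forall g, points iR G g -> \det (mxsub f cJ (pc P g)) = 0.
Proof.
move=> sr pJ cinj cJJ dH lt g Gg.
have cJJ' k : cJ k \in [set i | c <= lam P i rho] by rewrite inE.
have [e e0 he] := minor_open_cell G_grp cd sr pJ cinj cJJ' dH lt.
have [q qE] := minor_pol P0 f cJ.
have cP M : map_mx (cio iR) M = toC (map_mx iR M) by rewrite -map_mx_comp.
have := @density K n G q G_grp G_det G_tr G_conn R iR e e0 _ R iR (toC g) ((points_real _ _ _).1 Gg).
rewrite qE !cP -!map_mxM => h.
have {h} : \det (mxsub f cJ (toC (P *m g *m map_mx iR (invmx P0)))) = 0.
  apply: h => g' Gg' g'e; rewrite qE !cP; have := he g' Gg' g'e.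
  by rewrite /pcC -(map_invmx iR).
have -> : mxsub f cJ (toC (P *m g *m map_mx iR (invmx P0))) = toC (mxsub f cJ (pc P g)).
  by apply/matrixP => a b; rewrite /pc -map_invmx !mxE.
by rewrite det_map_mx => /eqP; rewrite fmorph_eq0 => /eqP.
Qed.

(** The columns J of the invertible k have a nonzero minor, on rows f say, so by [minor_zero] the
    rows f have at H' a weight sum no larger than J. A nonzero term of its expansion matches f with
    J, and H' k = k H makes matched weights equal: the sum of f at H' is that of J at H. *)
Lemma top_sum_le rho c H H' k : strict A Delta rho -> dominant A Delta H -> dominant A Delta H' ->
  orthG (points iR G) k -> H' *m k = k *m H ->
  \sum_(i | c <= lam P i rho) lam P i H <= \sum_(i | c <= lam P i rho) lam P i H'.
Proof.
move=> sr dH dH' ok E; set J := [set i | c <= lam P i rho].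
pose cJ (a : 'I_#|J|) : 'I_n := enum_val a.
have cinj : injective cJ := enum_val_inj.
have cJJ a : cJ a \in J := enum_valP a.
have uk : k \in unitmx by case: ok => _ /mulmx1_unit[].
set k' := pc P k; have uk' : k' \in unitmx by rewrite /k' /pc !unitmx_mul uk uP unitmx_inv uP.
have full : row_full (colsub cJ k').
  apply/row_fullP; exists (rowsub cJ (invmx k')); apply/matrixP => a b.
  transitivity ((invmx k' *m k') (cJ a) (cJ b)).
    by rewrite !mxE; apply: eq_bigr => l _; rewrite !mxE.
  by rewrite mulVmx // !mxE (inj_eq cinj).
pose f := fullrankfun full.
have nz : \det (mxsub f cJ k') != 0.
  have := fullrowsub_unit full; rewrite unitmxE unitfE; congr (\det _ != 0).
  by apply/matrixP => a b; rewrite !mxE.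
have fle : \sum_a lam P (f a) H' <= \sum_a lam P (cJ a) H'.
  rewrite leNgt; apply/negP => lt; move/eqP: nz; apply.
  apply: (@minor_zero rho c _ f cJ H' sr) => //; last by case: ok.
  by move=> a; have := cJJ a; rewrite inE.
have kE i j : k' i j != 0 -> lam P i H' = lam P j H.
  have := congr1 (pc P) E; rewrite !pcM // (pdiagE (cd_Adiag cd dH.1)) (pdiagE (cd_Adiag cd dH'.1)) -/k'.
  rewrite mul_mx_diag mul_diag_mx => /matrixP/(_ i j); rewrite [LHS]mxE [RHS]mxE ![(\row_ _ _) _ _]mxE mulrC.
  by move=> h nz'; apply: (mulfI nz').
have [s sP] : exists s : 'S_#|J|, \prod_a k' (f a) (cJ (s a)) != 0.
  apply: contrapT => /forallNP h; move/eqP: nz; apply; apply: big1 => s _.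
  have := h s => /negP; rewrite negbK => /eqP E0.
  by under eq_bigr => a _ do rewrite mxE; rewrite E0 mulr0.
have fH : \sum_a lam P (f a) H' = \sum_a lam P (cJ a) H.
  rewrite [RHS](reindex_inj (@perm_inj _ s)) /=; apply: eq_bigr => a _; apply: kE.
  by move/prodf_neq0: sP => /(_ a isT).
have sJ F : \sum_(i | c <= lam P i rho) F i = \sum_a F (cJ a) :> R.
  rewrite (sum_inj_set F cinj cJJ erefl); by apply: eq_bigl => i; rewrite inE.
by rewrite !sJ -fH.
Qed.

Theorem cartan_unique H H' k l : dominant A Delta H -> dominant A Delta H' ->
  orthG (points iR G) k -> orthG (points iR G) l ->
  mxexp H' = k *m mxexp H *m l -> H = H'.
Proof.
move=> dH dH' ok ol E; have aH := dH.1; have aH' := dH'.1.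
have HE := cartan_conj cd aH aH' ok ol E; have [_ kk] := ok.
have e1 : H' *m k = k *m H by rewrite HE -mulmxA (orth_inv ok) mulmx1.
have e2 : H *m k^T = k^T *m H' by rewrite HE !mulmxA (orth_inv ok) mul1mx.
have eqs rho c : strict A Delta rho ->
    \sum_(i | c <= lam P i rho) (lam P i H - lam P i H') = 0.
  move=> sr; rewrite sumrB; apply/eqP; rewrite subr_eq0 eq_le.
  by rewrite (top_sum_le _ sr dH dH' ok e1) (top_sum_le _ sr dH' dH (orthG_tr cd ok) e2).
have aX : lie A (H - H') by apply: lieB => //; [exact: cd_Agrp cd|exact: cd_Acl cd].
have tr0 rho : strict A Delta rho -> \tr (rho *m (H - H')) = 0.
  move=> sr; rewrite (pdiag_tr uP (cd_Adiag cd sr.1) (cd_Adiag cd aX)).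
  rewrite -[RHS](@abel_sum _ _ (fun i => lam P i rho) (fun i => lam P i H - lam P i H')).
    by apply: eq_bigr => i _; congr (_ * _); rewrite /lam pcB !mxE.
  by move=> c; apply: eqs.
have [rho ar rho1] := exists_rho cd.
(* Strict dominance is an open condition: rho may be moved by a small multiple of H - H', the size
   of which is dictated by B. Subtracting the two trace identities leaves tr (H - H')^2 = 0. *)
pose B := \sum_i `|Delta i (H - H')|; have B0 : 0 < B + 1 by rewrite ltr_wpDl // sumr_ge0.
have s1 : strict A Delta rho by split=> // i; rewrite rho1.
have s2 : strict A Delta (rho + (B + 1)^-1 *: (H - H')).
  split; first by apply: lieD; [exact: cd_Agrp cd|exact: cd_Acl cd|by []|exact: lieZ].
  move=> i; rewrite linearD linearZ /= rho1.
  have : `|Delta i (H - H')| < B + 1.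
    apply: (@le_lt_trans _ _ B); last by rewrite ltrDl.
    by rewrite /B (bigD1 i) //= lerDl sumr_ge0.
  rewrite ltr_norml => /andP[h _]; rewrite -(ltr_pM2r B0) mul0r mulrDl mul1r mulrAC mulVf ?gt_eqF // mul1r.
  by rewrite -ltrBlDl sub0r.
have := tr0 _ s2; rewrite mulmxDl mxtraceD (tr0 _ s1) add0r -scalemxAl mxtraceZ => /eqP.
rewrite mulf_eq0 invr_eq0 gt_eqF //= => /eqP h.
apply/eqP; rewrite -subr_eq0; apply/eqP; apply: mxtrace_tr_gt0.
by rewrite (cd_Asym cd aX) h.
Qed.

End Uniqueness.

(** * The Cartan projection *)

(** X is the limit of (exp(tX) - 1)/t. *)
Lemma lie_linear (R : realType) n (V : 'M[R]_n -> Prop) X : nclosed V ->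
  (forall a Y, V Y -> V (a *: Y)) -> (forall t, V (mxexp (t *: X) - 1%:M)) -> V X.
Proof.
move=> Vc VZ h; apply: Vc => e e0.
have [d d0 hd] := fo_exp X (divr_gt0 e0 (ltr0n R 2)).
pose t := d / 2; have t0 : 0 < t by rewrite divr_gt0.
have td : t < d by rewrite ltr_pdivrMr // ltr_pMr // ltr1n.
exists (t^-1 *: (mxexp (t *: X) - 1%:M)); first exact: VZ.
have -> : t^-1 *: (mxexp (t *: X) - 1%:M) - X = t^-1 *: (mxexp (t *: X) - 1%:M - t *: X).
  by rewrite [in RHS]scalerBr scalerA mulVf ?scale1r // gt_eqF.
rewrite nrmZ gtr0_norm ?invr_gt0 // ltr_pdivrMl //; apply: le_lt_trans (hd t t0 td) _.
by rewrite mulrC ltr_pM2l // ltr_pdivrMr // ltr_pMr // ltr1n.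
Qed.

Lemma mxexp_comm (R : realType) n (X Y : 'M[R]_n) : X *m Y = Y *m X -> mxexp X *m Y = Y *m mxexp X.
Proof.
move=> XY; apply: (@exp_closed _ _ (fun z : 'M[R]_n => z *m Y = Y *m z)).
  by apply: nclosed_eqmx; apply: mpalg_mul; do ?[exact: mpalg_id|exact: mpalg_const].
move=> N; rewrite /eS mulmx_suml mulmx_sumr; apply: eq_bigr => k _.
rewrite -scalemxAl -scalemxAr; congr (_ *: _).
elim: k => [|k IH]; first by rewrite !expr0 mul1mx mulmx1.
by rewrite exprSr -[X ^+ k * X]/(X ^+ k *m X) -mulmxA XY !mulmxA IH.
Qed.

Section CartanData.
Variables (K : rcfType) (R : realType) (iR : {rmorphism K -> R}) (n : nat).
Variables (G S : seq (mxpol K n)) (P0 : 'M[K]_n).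
Variables (r : nat) (Delta : 'I_r -> {scalar 'M[R]_n}).
Hypothesis G_SL : subgroup_SL G.
Hypothesis G_tr : self_adjoint G.
Hypothesis S_max : maximal_split_torus G S.
Hypothesis S_sym : forall s, geom S s -> s^T = s.
Hypothesis uP : P0 \in unitmx.
Local Notation toC := (map_mx (@real_complex K)).
Hypothesis S_diag : forall s, geom S s -> is_diag_mx (toC P0 *m s *m toC (invmx P0)).
Local Notation P := (map_mx iR P0).
Local Notation A := (pos_torus iR S P0).
Local Notation ev x i := ((P *m x *m map_mx iR (invmx P0)) i i).

Let S_grp : is_mxgroup (geom S). Proof. by case: S_max => -[]. Qed.

Lemma nclosed_points (V : seq (mxpol K n)) : nclosed (points iR V).
Proof.
have c := @nclosed_palg R n {p | p \in V} (fun p x => mxeval iR (sval p) x).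
move=> x hx p pV; apply: (c _ x _ (exist _ p pV)).
  by move=> q; apply: palg_mxeval; exact: mpalg_id.
by move=> e /hx[z Vz zx]; exists z => // -[q qV] /=; apply: Vz.
Qed.

Lemma ev_mul x y i : points iR S x -> ev (x *m y) i = ev x i * ev y i.
Proof.
move=> Sx; have PP : map_mx iR (invmx P0) *m P = 1%:M by rewrite -map_mxM mulVmx // map_mx1.
have -> : P *m (x *m y) *m map_mx iR (invmx P0) =
    (P *m x *m map_mx iR (invmx P0)) *m (P *m y *m map_mx iR (invmx P0)).
  by rewrite !mulmxA -(mulmxA _ (map_mx iR (invmx P0)) P) PP mulmx1.
rewrite [LHS]mxE (bigD1 i) //= big1 ?addr0 // => j ji.
by rewrite (points_diag S_diag Sx) ?mul0r // eq_sym.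
Qed.

Lemma ev1 i : ev 1%:M i = 1.
Proof. by rewrite mulmx1 -map_mxM mulmxV // map_mx1 mxE eqxx. Qed.

Lemma ev_neq0 x i : points iR S x -> ev x i != 0.
Proof.
move=> Sx; have [U _ _ _] := rgroup S_grp iR.
have := ev_mul (invmx x) i Sx; rewrite mulmxV ?U // ev1 => /esym/eqP.
by apply: contraTneq => ->; rewrite mul0r eq_sym oner_eq0.
Qed.

Lemma pos_torus_group : is_mxgroup A.
Proof.
have [U U1 M V] := rgroup S_grp iR; split.
- by move=> x [/U].
- exact: pos_torus1.
- by move=> x y [Sx x0] [Sy y0]; split; [exact: M|move=> i; rewrite ev_mul // mulr_gt0].
move=> x [Sx x0]; split; first exact: V.
move=> i; have := ev_mul (invmx x) i Sx; rewrite mulmxV ?U // ev1 => E.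
by rewrite -(ltr_pM2l (x0 i)) mulr0 -E ltr01.
Qed.

(** A limit of positive eigenvalues is nonnegative, and it is nonzero since the limit is still in
    the group S. *)
Lemma pos_torus_closed : nclosed A.
Proof.
move=> x hx; have Sx : points iR S x.
  by apply: nclosed_points => e /hx[z [Sz _] zx]; exists z.
split=> // i; pose C := nrm P * nrm (map_mx iR (invmx P0)).
have C0 : 0 < C + 1 by rewrite ltr_wpDl // mulr_ge0 ?nrm_ge0.
have xi := ev_neq0 i Sx; have n0 : 0 < `|ev x i| by rewrite normr_gt0.
have [z [_ /(_ i) z0] zx] := hx _ (divr_gt0 n0 C0).
have le : `|ev z i - ev x i| <= C * nrm (z - x).
  have -> : ev z i - ev x i = ev (z - x) i.
    by rewrite mulmxBr mulmxBl [in RHS]mxE [X in _ = _ + X]mxE.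
  apply: le_trans (le_nrm _ _ _) _; apply: le_trans (nrmM _ _) _.
  by rewrite /C mulrAC ler_wpM2r ?nrm_ge0 // nrmM.
have lt : `|ev z i - ev x i| < `|ev x i|.
  apply: le_lt_trans le _; rewrite ltr_pdivlMr // in zx; apply: le_lt_trans zx.
  by rewrite mulrC ler_wpM2l ?nrm_ge0 // lerDl.
rewrite lt_def xi leNgt; apply/negP => x0; move: lt; rewrite (ltr0_norm x0) ltr_norml => /andP[_].
by rewrite ltrBlDr addNr => /(lt_trans z0); rewrite ltxx.
Qed.

Lemma lie_torus_sym H : lie A H -> H^T = H.
Proof.
move=> aH; apply: (@lie_linear R n (fun Y => Y^T = Y)).
- by apply: nclosed_eqmx; [apply: mpalg_tr; exact: mpalg_id|exact: mpalg_id].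
- by move=> a Y YE; rewrite linearZ /= YE.
by move=> t; rewrite linearB /= (points_sym S_sym (aH t).1) trmx1.
Qed.

Lemma lie_torus_diag H : lie A H -> pdiag P H.
Proof.
have pcE Y : pc P Y = P *m Y *m map_mx iR (invmx P0) by rewrite /pc map_invmx.
move=> aH i j ij; rewrite pcE.
apply: (@lie_linear R n (fun Y => (P *m Y *m map_mx iR (invmx P0)) i j = 0)).
- have c := @nclosed_palg R n unit (fun _ x => (P *m x *m map_mx iR (invmx P0)) i j).
  move=> x hx; apply: (c _ x _ tt).
    move=> _; apply: mpalg_mul; last exact: mpalg_const.
    by apply: mpalg_mul; [exact: mpalg_const|exact: mpalg_id].
  by move=> e /hx[z Vz zx]; exists z.
- by move=> a Y YE; rewrite -scalemxAr -scalemxAl mxE YE mulr0.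
move=> t; rewrite mulmxBr mulmxBl [LHS]mxE (points_diag S_diag (aH t).1 ij) add0r.
by rewrite mulmx1 -map_mxM mulmxV // map_mx1 !mxE (negbTE ij) oppr0.
Qed.

Lemma torus_log x : A x -> exists2 H, lie A H & x = mxexp H.
Proof.
move=> Ax; have [h [hx path]] := pos_torus_path S_grp uP S_diag (pos_torus1 S_grp uP iR) Ax.
exists (invmx P *m diag_mx h *m P); last by rewrite -hx mul1mx.
by move=> t; have := path t; rewrite mul1mx.
Qed.

Let dQ : def (fun (L : rcfType) (io : {rmorphism K -> L}) (_ : nat -> L) =>
  forall g : 'M[L]_n, points io G g -> g^T = g -> posdef g ->
    (forall a, pos_torus io S P0 a -> g *m a = a *m g) -> pos_torus io S P0 g).
Proof. by rewrite /pos_torus /posdef; definable. Qed.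

(** Maximality holds among tori over K, so the statement about symmetric positive definite elements
    is proved there and transferred; over R it is applied to all exp(tX). *)
Lemma torus_max X : lie (points iR G) X -> X^T = X ->
  (forall H, lie A H -> X *m H = H *m X) -> lie A X.
Proof.
move=> gX sX comm t.
have cen : forall g : 'M[K]_n, points idfun G g -> g^T = g -> posdef g ->
    (forall a, pos_torus idfun S P0 a -> g *m a = a *m g) -> pos_torus idfun S P0 g.
  exact: centraliser_sub_torus G_SL S_max uP S_diag.
apply: (@xfer _ _ dQ K R idfun iR cen); first exact: gX.
- by rewrite -mxexp_tr linearZ /= sX.
- pose Y := 2^-1 *: (t *: X); have sY : Y^T = Y by rewrite /Y linearZ /= linearZ /= sX.
  have -> : mxexp (t *: X) = (mxexp Y)^T *m mxexp Y.
    rewrite -mxexp_tr sY -[RHS]/(mxexp Y * mxexp Y) -expr2 -mxexp_mulrn //.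
    by rewrite /Y scalerA mulfV ?scale1r // pnatr_eq0.
  exact: posdef_tr (mxexp_unit _).
move=> a /torus_log[H aH ->]; apply: mxexp_comm.
apply/esym/mxexp_comm; rewrite -scalemxAl -scalemxAr; congr (_ *: _).
by rewrite comm.
Qed.

Lemma torus_cartan_data :
  root_basis (lie (points iR G)) (lie A) Delta -> cartan_data (points iR G) A P Delta.
Proof.
have [GS _] := G_SL; have [_ SG _] := S_max.
move=> rb; apply: CartanData.
- exact: rgroup.
- exact: nclosed_points.
- exact: points_tr.
- exact: points_powclosed.
- by rewrite map_unitmx.
- exact: pos_torus_group.
- exact: pos_torus_closed.
- by move=> x [Sx _]; apply: (points_sub SG).
- exact: lie_torus_sym.
- exact: lie_torus_diag.
- exact: torus_log.
- exact: torus_max.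
- exact: rb.
Qed.

End CartanData.

Section Facts.
Variables (K : rcfType) (n : nat) (G : seq (mxpol K n)) (A : saform K n).
Variables (r : nat) (chi : 'I_r -> mxpol K n).

Definition Kext (L : rcfType) (io : {rmorphism K -> L}) (k : 'M[L]_n) :=
  points io G k /\ (k *m k^T = 1%:M /\ \det k = 1).
Definition Chext (L : rcfType) (io : {rmorphism K -> L}) (a : 'M[L]_n) :=
  sa_ext io A a /\ forall i, 1 <= mxeval io (chi i) a.

Definition cartan_exists (L : rcfType) (io : {rmorphism K -> L}) :=
  forall g, points io G g -> exists k l a, Kext io k /\ (Kext io l /\ (Chext io a /\ g = k *m a *m l)).

Definition cartan_inj (L : rcfType) (io : {rmorphism K -> L}) :=
  forall k l a b, Kext io k -> Kext io l -> Chext io a -> Chext io b -> b = k *m a *m l -> a = b.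

(** Stated for all of A, since the inverse of a chamber element may leave the chamber. Normalising
    is expressed by two inclusions and inverses by transposes. *)
Definition cartan_weyl (L : rcfType) (io : {rmorphism K -> L}) :=
  forall k l a b, Kext io k -> Kext io l -> sa_ext io A a -> sa_ext io A b -> b = k *m a *m l ->
    exists w, Kext io w /\ ((forall x, sa_ext io A x -> sa_ext io A (w *m x *m w^T)) /\
      ((forall x, sa_ext io A x -> sa_ext io A (w^T *m x *m w)) /\ w *m a *m w^T = b)).

Lemma def_cartan_exists : def (fun (L : rcfType) (io : {rmorphism K -> L}) (_ : nat -> L) => cartan_exists io).
Proof. by rewrite /cartan_exists /Kext /Chext; definable. Qed.

Lemma def_cartan_inj : def (fun (L : rcfType) (io : {rmorphism K -> L}) (_ : nat -> L) => cartan_inj io).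
Proof. by rewrite /cartan_inj /Kext /Chext; definable. Qed.

Lemma def_cartan_weyl : def (fun (L : rcfType) (io : {rmorphism K -> L}) (_ : nat -> L) => cartan_weyl io).
Proof. by rewrite /cartan_weyl /Kext /Chext; definable. Qed.

(** The inverse of a Cartan projection has to lie in A before [cartan_weyl] can be applied to it. *)
Definition sa_inv (L : rcfType) (io : {rmorphism K -> L}) :=
  forall x, sa_ext io A x -> exists y, sa_ext io A y /\ x *m y = 1%:M.

Lemma def_sa_inv : def (fun (L : rcfType) (io : {rmorphism K -> L}) (_ : nat -> L) => sa_inv io).
Proof. by rewrite /sa_inv; definable. Qed.

End Facts.

Section RealFacts.
Variables (K : rcfType) (R : realType) (iR : {rmorphism K -> R}) (n : nat).
Variables (G S : seq (mxpol K n)) (A : saform K n) (r : nat).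
Variables (Delta : 'I_r -> {scalar 'M[R]_n}) (chi : 'I_r -> mxpol K n).
Hypothesis G_SL : subgroup_SL G.
Hypothesis G_connected : zconnected (geom G).
Hypothesis G_self_adjoint : self_adjoint G.
Hypothesis S_torus : maximal_split_torus G S.
Hypothesis S_sym : forall s, geom S s -> s^T = s.
Hypothesis A_component : sa_component (points idfun S) 1%:M A.
Hypothesis Delta_basis : root_basis (lie (points iR G)) (lie (sa_ext iR A)) Delta.
Hypothesis chi_character : forall i, root_character iR S (lie (sa_ext iR A)) (Delta i) (chi i).

Lemma component_cartan_data : exists P0 : 'M[K]_n,
  cartan_data (points iR G) (sa_ext iR A) (map_mx iR P0) Delta.
Proof.
have [[Sg _ [P0 uP Sd]] _ _] := S_torus; exists P0.
have AE : sa_ext iR A = pos_torus iR S P0.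
  by apply: funext => x; apply: propext; exact: (component_pos_torus Sg uP Sd A_component iR iR x).
have rb := Delta_basis; rewrite AE in rb *.
exact: (torus_cartan_data G_SL G_self_adjoint S_torus S_sym uP Sd rb).
Qed.

Lemma Kext_orthG k : Kext G iR k <-> orthG (points iR G) k.
Proof.
have [_ Gd] := G_SL; split=> [[Gk [kk _]]|[Gk kk]]; first by split; [exact: Gk|exact: kk].
by split; [exact: Gk|split; [exact: kk|exact: (points_det Gd Gk)]].
Qed.

Lemma chamber_exp H : lie (sa_ext iR A) H -> Chext A chi iR (mxexp H) <-> dominant (sa_ext iR A) Delta H.
Proof.
move=> aH; have E i : mxeval iR (chi i) (mxexp H) = expR (Delta i H).
  by case: (chi_character i) => _ _; apply.
split=> [[_ h]|[_ h]].
  by split; [exact: aH|move=> i; have := h i; rewrite E -[1]expR0 ler_expR].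
split; first by rewrite -[H]scale1r; exact: aH.
by move=> i; rewrite E -[1]expR0 ler_expR; apply: h.
Qed.

Lemma real_cartan_exists : cartan_exists G A chi iR.
Proof.
have [P0 cd] := component_cartan_data.
move=> g Gg; have [k [l [H [ok ol dH E]]]] := cartan_decomposition cd Gg.
exists k, l, (mxexp H); split; first exact/Kext_orthG.
split; first exact/Kext_orthG.
split; last exact: E.
by apply/chamber_exp => //; case: dH.
Qed.

Lemma real_cartan_inj : cartan_inj G A chi iR.
Proof.
have [P0 cd] := component_cartan_data; have [Gg Gd] := G_SL.
move=> k l a b /Kext_orthG ok /Kext_orthG ol ca cb.
have [H aH aE] := cd_Alog cd ca.1; have [H' bH bE] := cd_Alog cd cb.1.
rewrite aE bE in ca cb *; move=> E; congr (mxexp _).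
have dH := (chamber_exp aH).1 ca; have dH' := (chamber_exp bH).1 cb.
exact: (cartan_unique Gg Gd G_self_adjoint G_connected cd dH dH' ok ol E).
Qed.

Lemma real_cartan_weyl : cartan_weyl G A iR.
Proof.
have [P0 cd] := component_cartan_data.
move=> k l a b /Kext_orthG ok /Kext_orthG ol Aa Ab.
have [H aH aE] := cd_Alog cd Aa; have [H' bH bE] := cd_Alog cd Ab.
rewrite aE bE => E; have [w [ow w1 w2 wE]] := weyl_element cd aH bH ok ol E.
have uw : w \in unitmx by case: ow => _ /mulmx1_unit[].
have wV : w^T = invmx w by rewrite -[LHS](mulKmx uw) ow.2 mulmx1.
have expA Y : lie (sa_ext iR A) Y -> sa_ext iR A (mxexp Y).
  by move=> aY; rewrite -[Y]scale1r; exact: aY.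
exists w; split; first exact/Kext_orthG.
split; last split.
- move=> x Ax; have [Y aY ->] := cd_Alog cd Ax; have := expA _ (w1 _ aY).
  by rewrite wV mxexp_conj.
- move=> x Ax; have [Y aY ->] := cd_Alog cd Ax; have := expA _ (w2 _ aY).
  by rewrite wV -{2}(invmxK w) mxexp_conj ?unitmx_inv // invmxK.
by rewrite -wE wV mxexp_conj.
Qed.

Lemma real_sa_inv : sa_inv A iR.
Proof.
have [P0 cd] := component_cartan_data; have [U _ _ V] := cd_Agrp cd.
by move=> x Ax; exists (invmx x); split; [exact: V|rewrite mulmxV ?U].
Qed.

End RealFacts.

Section CartanProjection.
Variables (K F : rcfType) (iF : {rmorphism K -> F}) (n : nat).
Variables (G : seq (mxpol K n)) (A : saform K n) (r : nat) (chi : 'I_r -> mxpol K n).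
Hypothesis G_SL : subgroup_SL G.
Hypothesis G_self_adjoint : self_adjoint G.
Hypothesis ex : cartan_exists G A chi iF.
Hypothesis inj : cartan_inj G A chi iF.
Hypothesis wey : cartan_weyl G A iF.
Hypothesis inv : sa_inv A iF.
Local Notation GF := (points iF G).
Local Notation KF := (Kext G iF).
Local Notation AFp := (Chext A chi iF).

Lemma KextM k l : KF k -> KF l -> KF (k *m l).
Proof.
have [_ _ M _] := rgroup G_SL.1 iF.
move=> [Gk [kk dk]] [Gl [ll dl]]; split; first exact: M.
by rewrite trmx_mul mulmxA -(mulmxA k) ll mulmx1 kk det_mulmx dk dl mulr1.
Qed.

Lemma Kext_tr k : KF k -> KF k^T.
Proof.
move=> [Gk [kk dk]]; split; first exact: points_tr.
by rewrite trmxK det_tr dk; split=> //; apply: mulmx1C.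
Qed.

Lemma Kext_trK k : KF k -> k^T *m k = 1%:M.
Proof. by move=> [_ [kk _]]; apply: mulmx1C. Qed.

Lemma Kext_inv k : KF k -> invmx k = k^T.
Proof.
move=> Kk; have [u _] := mulmx1_unit Kk.2.1.
by rewrite -[RHS](mulKmx u) Kk.2.1 mulmx1.
Qed.

Lemma dcosetM a k l z : KF k -> KF l -> dcoset KF a z -> dcoset KF a (k *m z *m l).
Proof.
move=> Kk Kl [k' Kk' [l' Kl' <-]]; exists (k *m k'); first exact: KextM.
by exists (l' *m l); [exact: KextM|rewrite !mulmxA].
Qed.

Lemma dcoset_inj a b z : AFp a -> AFp b -> dcoset KF a z -> dcoset KF b z -> a = b.
Proof.
move=> ca cb [k Kk [l Kl <-]] [k' Kk' [l' Kl' E]].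
apply: (inj (KextM (Kext_tr Kk') Kk) (KextM Kl (Kext_tr Kl')) ca cb).
have -> : k'^T *m k *m a *m (l *m l'^T) = k'^T *m (k *m a *m l) *m l'^T by rewrite !mulmxA.
by rewrite -E !mulmxA Kext_trK // mul1mx -mulmxA Kl'.2.1 mulmx1.
Qed.

(** The equality g g^T = g' g'^T says exactly that g^-1 g' is orthogonal. *)
Lemma stabiliser g g' : GF g -> GF g' -> symact g 1%:M = symact g' 1%:M -> KF (invmx g *m g').
Proof.
have [U _ M V] := rgroup G_SL.1 iF; have [_ Gd] := G_SL.
move=> Gg Gg'; rewrite /symact !mulmx1 => E; have Gu := M _ _ (V _ Gg) Gg'.
split; first exact: Gu.
split; last exact: (points_det Gd Gu).
rewrite trmx_mul mulmxA -(mulmxA (invmx g)) -E mulmxA mulVmx ?U // mul1mx.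
by rewrite -trmx_mul mulVmx ?U // trmx1.
Qed.

Lemma dcoset_symact a g h g' h' : GF g -> GF h -> GF g' -> GF h' ->
  symact g 1%:M = symact g' 1%:M -> symact h 1%:M = symact h' 1%:M ->
  dcoset KF a (invmx g *m h) -> dcoset KF a (invmx g' *m h').
Proof.
have [U _ _ _] := rgroup G_SL.1 iF.
move=> Gg Gh Gg' Gh' Eg Eh D.
have -> : invmx g' *m h' = (invmx g' *m g) *m (invmx g *m h) *m (invmx h *m h').
  by rewrite !mulmxA !mulmxK ?U.
by apply: dcosetM => //; apply: stabiliser.
Qed.

Definition relpos (x y a : 'M[F]_n) := exists g h, [/\ GF g, GF h, symact g 1%:M = x,
  symact h 1%:M = y & AFp a /\ dcoset KF a (invmx g *m h)].

(** A choice among all admissible representatives and values; the default [1%:M] is returned only at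
    pairs without any relative position. *)
Definition cartan_projection (x y : 'M[F]_n) : 'M[F]_n := xget 1%:M [set a | relpos x y a]%classic.

Lemma cartan_projectionP g h a : GF g -> GF h ->
  cartan_projection (symact g 1%:M) (symact h 1%:M) = a <-> AFp a /\ dcoset KF a (invmx g *m h).
Proof.
have [_ _ M V] := rgroup G_SL.1 iF.
move=> Gg Gh; have [k [l [a0 [Kk [Kl [ca0 E]]]]]] := ex (M _ _ (V _ Gg) Gh).
have r0 : relpos (symact g 1%:M) (symact h 1%:M) a0.
  exists g, h; split; [exact: Gg|exact: Gh|by []|by []|split; first exact: ca0].
  by exists k => //; exists l.
have [g' [h' [Gg' Gh' Eg Eh [cd Dd]]]] : relpos (symact g 1%:M) (symact h 1%:M)
    (cartan_projection (symact g 1%:M) (symact h 1%:M)).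
  by rewrite /cartan_projection; case: xgetP => [b _ //|/(_ a0)].
have {}Dd := dcoset_symact Gg' Gh' Gg Gh Eg Eh Dd.
split=> [<-|[ca Da]]; first by split; [exact: cd|exact: Dd].
exact: dcoset_inj cd ca Dd Da.
Qed.

Lemma symactM g h x : symact g (symact h x) = symact (g *m h) x :> 'M[F]_n.
Proof. by rewrite /symact trmx_mul !mulmxA. Qed.

Lemma cartan_projection_invariant g x y : GF g -> symspace GF x -> symspace GF y ->
  cartan_projection (symact g x) (symact g y) = cartan_projection x y.
Proof.
have [U _ M _] := rgroup G_SL.1 iF.
move=> Gg [g1 Gg1 <-] [h1 Gh1 <-]; rewrite !symactM.
apply/(cartan_projectionP _ (M _ _ Gg Gg1) (M _ _ Gg Gh1)).
have -> : invmx (g *m g1) *m (g *m h1) = invmx g1 *m h1.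
  have ug : g *m g1 \in unitmx by apply/U/M.
  by apply: (can_inj (mulKmx ug)); rewrite mulKVmx // -!mulmxA mulKVmx ?U.
exact/(cartan_projectionP _ Gg1 Gh1).
Qed.

(** From g^-1 h = k a l follows h^-1 g = l^T a^-1 k^T, so the projection of (y, x) and a^-1 are
    elements of A in the same double coset of K. *)
Lemma cartan_projection_opp x y : symspace GF x -> symspace GF y ->
  weyl_orbit KF (sa_ext iF A) (invmx (cartan_projection x y)) (cartan_projection y x).
Proof.
have [U _ M _] := rgroup G_SL.1 iF.
move=> [g Gg <-] [h Gh <-].
have [ca [k Kk [l Kl E]]] := (cartan_projectionP _ Gg Gh).1 erefl.
have [cb [k' Kk' [l' Kl' E']]] := (cartan_projectionP _ Gh Gg).1 erefl.
set a := cartan_projection _ _ in ca E *; set b := cartan_projection _ _ in cb E' *.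
clearbody a b; have [a' [Aa' aa']] := inv ca.1; have [ua _] := mulmx1_unit aa'.
have aV : invmx a = a' by rewrite -[RHS](mulKmx ua) aa' mulmx1.
rewrite aV.
have bE : b = k'^T *m l^T *m a' *m (k^T *m l'^T).
  have inverse : (l^T *m a' *m k^T) *m (k *m a *m l) = 1%:M.
    rewrite !mulmxA -(mulmxA (l^T *m a')) Kext_trK // mulmx1 -(mulmxA l^T) (mulmx1C aa') mulmx1.
    exact: Kext_trK.
  have hg : invmx h *m g = l^T *m a' *m k^T.
    have [_ ui] := mulmx1_unit inverse.
    apply: (can_inj (mulmxK ui)); rewrite inverse E !mulmxA mulmxK ?U // mulVmx ?U //.
  have -> : k'^T *m l^T *m a' *m (k^T *m l'^T) = k'^T *m (l^T *m a' *m k^T) *m l'^T by rewrite !mulmxA.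
  by rewrite -hg -E' !mulmxA Kext_trK // mul1mx -mulmxA Kl'.2.1 mulmx1.
have [w [Kw [w1 [w2 wE]]]] := wey (KextM (Kext_tr Kk') (Kext_tr Kl)) (KextM (Kext_tr Kk) (Kext_tr Kl')) Aa' cb.1 bE.
have wV := Kext_inv Kw; exists w; last by rewrite wV.
split; first exact: Kw.
apply/seteqP; split=> [_ [z Ax <-]|z Ax]; first by rewrite wV; apply: w1.
exists (w^T *m z *m w); first exact: w2.
by rewrite wV !mulmxA Kw.2.1 mul1mx -mulmxA Kw.2.1 mulmx1.
Qed.

End CartanProjection.

Local Open Scope classical_set_scope.

Theorem lemma4p2
  (K F : rcfType) (R : realType)
  (iF : {rmorphism K -> F}) (iR : {rmorphism K -> R})
  (n : nat) (G S : seq (mxpol K n)) (A : saform K n)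
  (r : nat) (Delta : 'I_r -> {scalar 'M[R]_n}) (chi : 'I_r -> mxpol K n)
  (G_SL : subgroup_SL G)
  (G_connected : zconnected (geom G))
  (G_semisimple : semisimple (geom G))
  (G_self_adjoint : self_adjoint G)
  (S_torus : maximal_split_torus G S)
  (S_sym : forall s, geom S s -> s^T = s)
  (A_component : sa_component (points idfun S) 1%:M A)
  (Delta_basis : root_basis (lie (points iR G)) (lie (sa_ext iR A)) Delta)
  (chi_character : forall i,
     root_character iR S (lie (sa_ext iR A)) (Delta i) (chi i)) :
  let GF := points iF G in
  let AF := sa_ext iF A in
  let KF := GF `&` @SO F n in
  let AFp := chamber iF AF chi in
  let XF := symspace GF in
  exists delta : 'M[F]_n -> 'M[F]_n -> 'M[F]_n,
    [/\ forall g h a, GF g -> GF h ->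
          (delta (symact g 1%:M) (symact h 1%:M) = a <->
           AFp a /\ dcoset KF a (invmx g *m h)),
        forall g x y, GF g -> XF x -> XF y ->
          delta (symact g x) (symact g y) = delta x y
      & forall x y, XF x -> XF y ->
          weyl_orbit KF AF (invmx (delta x y)) (delta y x)].
Proof.
move=> GF AF KF AFp XF.
have [rex rinj] := (real_cartan_exists G_SL G_self_adjoint S_torus S_sym A_component Delta_basis chi_character,
  real_cartan_inj G_SL G_connected G_self_adjoint S_torus S_sym A_component Delta_basis chi_character).
have rwey := real_cartan_weyl G_SL G_self_adjoint S_torus S_sym A_component Delta_basis.
have rinv := real_sa_inv G_SL G_self_adjoint S_torus S_sym A_component Delta_basis.
(* The facts proved over R descend to K and are lifted to F; nothing else about F is used. *)
have ex := @xfer _ _ (def_cartan_exists G A chi) R F iR iF rex.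
have inj := @xfer _ _ (def_cartan_inj G A chi) R F iR iF rinj.
have wey := @xfer _ _ (def_cartan_weyl G A) R F iR iF rwey.
have inv := @xfer _ _ (def_sa_inv A) R F iR iF rinv.
exists (cartan_projection iF G A chi); split.
- move=> g h a Gg Gh; exact: (cartan_projectionP G_SL G_self_adjoint ex inj a Gg Gh).
- move=> g x y Gg Xx Xy; exact: (cartan_projection_invariant G_SL G_self_adjoint ex inj Gg Xx Xy).
- move=> x y Xx Xy; exact: (cartan_projection_opp G_SL G_self_adjoint ex inj wey inv Xx Xy).
Qed.
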